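(* Let $\Omega$ be a bounded open set in $\mathbb{R}^n$ of class $C^1$, and let $s\in(0,1)$, $\gamma>0$, $r>1$. Then there exists $\Lambda>0$ such that for all $\lambda\in(0,\Lambda)$ the problem $$-\Delta u+(-\Delta)^s u=\frac{\lambda}{u^{\gamma}}+u^r\ \text{ in }\Omega,\qquad u>0\ \text{ in }\Omega,\qquad u=0\ \text{ in }\mathbb{R}^n\setminus\Omega,$$ has a positive weak solution $u\in W^{1,2}_{\mathrm{loc}}(\Omega)\cap L^\infty(\Omega)$ (in the sense defined in the context) with $u\in W_0^{1,2}(\Omega)$ if $0<\gamma\le 1$, and $u^{\frac{\gamma+1}{2}}\in W_0^{1,2}(\Omega)$ if $\gamma>1$.
   Context: $W_0^{1,2}(\omega)$ is the closure of $C_c^\infty(\omega)$ in $W^{1,2}(\omega)$; functions on $\Omega$ (and test functions) are extended by zero to $\mathbb{R}^n$. $W^{1,2}_{\mathrm{loc}}(\Omega)$ is the set of $u$ with $u,|\nabla u|\in L^2(K)$ for every $K\subset\subset\Omega$. $(-\Delta)^s$ is the fractional Laplacian (its normalization constant is dropped in the weak formulation). Weak solution: a function $u\in W_{\mathrm{loc}}^{1,2}(\Omega)\cap L^\infty(\Omega)$, positive in $\Omega$, zero outside $\Omega$ (the boundary condition being understood as some suitable positive power of $u$ belonging to $W_0^{1,2}(\Omega)$), such that for every open $\omega\subset\subset\Omega$ and every $\phi\in W_0^{1,2}(\omega)$ one has $\frac{\phi}{u^\gamma}\in L^1(\Omega)$ and $$\int_\Omega\nabla u\cdot\nabla\phi\,dx+\int_{\mathbb{R}^n}\int_{\mathbb{R}^n}\frac{(u(x)-u(y))(\phi(x)-\phi(y))}{|x-y|^{n+2s}}\,dx\,dy=\lambda\int_\Omega\frac{\phi}{u^\gamma}\,dx+\int_\Omega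 u^r\phi\,dx.$$ *)

(* Defs.v *)
From HB Require Import structures.
From mathcomp Require Import all_boot all_order all_algebra.
From mathcomp Require Import all_classical all_reals all_analysis.
Set Implicit Arguments.
Unset Strict Implicit.
Unset Printing Implicit Defensive.
Import Order.TTheory GRing.Theory Num.Theory.
Import numFieldNormedType.Exports.
Local Open Scope classical_set_scope.
Local Open Scope ring_scope.

(* R^n is 'rV[R]_n with its product topology; its Borel sigma-algebra is the
   one generated by the coordinate maps. *)
Definition rV_display : measure_display.
Proof. exact: default_measure_display. Qed.

Section measurable_rV.
Context {R : realType} (n : nat).

Let coord (i : 'I_n) (x : 'rV[R]_n) : measurableTypeR R := x ord0 i.

Let rV_set0 : g_sigma_preimage coord set0.
Proof. exact: sigma_algebra0. Qed.

Let rV_setC A : g_sigma_preimage coord A -> g_sigma_preimage coord (~` A).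
Proof. exact: sigma_algebraC. Qed.

Let rV_bigcup (F : _^nat) : (forall i, g_sigma_preimage coord (F i)) ->
  g_sigma_preimage coord (\bigcup_i (F i)).
Proof. exact: sigma_algebra_bigcup. Qed.

HB.instance Definition _ := @isMeasurable.Build rV_display
  'rV[R]_n (g_sigma_preimage coord) rV_set0 rV_setC rV_bigcup.

Lemma measurable_coord (i : 'I_n) :
  measurable_fun [set: 'rV[R]_n] (fun x => x ord0 i : measurableTypeR R).
Proof.
move=> _ Y mY; rewrite setTI; apply: sub_sigma_algebra => /=.
rewrite -bigcup_seq/=; exists i => /=; first by rewrite mem_index_enum.
by exists Y => //; rewrite setTI.
Qed.

Lemma measurable_fun_coordP d (T : measurableType d) (f : T -> 'rV[R]_n) :
  (forall i, measurable_fun [set: T] (fun x => f x ord0 i : measurableTypeR R)) ->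
  measurable_fun [set: T] f.
Proof.
move=> mf _ A mA; rewrite setTI.
suff : g_sigma_preimage coord `<=` [set B | measurable (f @^-1` B)] by exact.
apply: smallest_sub.
  split => [|B mB|F mF]; rewrite /mkset.
  - by rewrite preimage_set0.
  - by rewrite setTD preimage_setC; exact: measurableC.
  - by rewrite preimage_bigcup; exact: bigcupT_measurable.
move=> B; rewrite -bigcup_seq => -[i _ [C mC <-]] /=.
by rewrite setTI; have := mf i measurableT C mC; rewrite setTI.
Qed.

End measurable_rV.

Section lebesgue_rV.
Context {R : realType}.

Section step.
Variables (n : nat) (m : {sigma_finite_measure set 'rV[R]_n -> \bar R}).

Definition cons_rV (p : measurableTypeR R * 'rV[R]_n) : 'rV[R]_n.+1 :=
  row_mx (p.1)%:M p.2.

Definition uncons_rV (x : 'rV[R]_n.+1) : measurableTypeR R * 'rV[R]_n :=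
  (x ord0 ord0, rsubmx (x : 'rV[R]_(1 + n))).

Lemma cons_rV0 p : cons_rV p ord0 ord0 = p.1.
Proof.
have -> : (ord0 : 'I_n.+1) = lshift n (ord0 : 'I_1) by exact/val_inj.
by apply: etrans (row_mxEl _ _ _ _) _; rewrite mxE.
Qed.

Lemma cons_rVS p (j : 'I_n) : cons_rV p ord0 (rshift 1 j) = p.2 ord0 j.
Proof. exact: row_mxEr. Qed.

Lemma cons_rVK : cancel cons_rV uncons_rV.
Proof.
move=> [t y]; rewrite /uncons_rV cons_rV0/=; congr pair.
exact: (row_mxKr (t%:M : 'M[R]_1) y).
Qed.

Lemma measurable_cons_rV : measurable_fun setT cons_rV.
Proof.
apply: measurable_fun_coordP => i.
case: (split_ordP (i : 'I_(1 + n))) => j ->.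
- have -> : lshift n j = ord0 by apply/val_inj; rewrite /= ord1.
  by under eq_fun do rewrite cons_rV0; exact: measurable_fst.
- under eq_fun do rewrite cons_rVS.
  exact: measurableT_comp (@measurable_coord R n j) measurable_snd.
Qed.

Lemma measurable_uncons_rV : measurable_fun setT uncons_rV.
Proof.
apply/measurable_fun_pairP; split => /=; first exact: measurable_coord.
apply: measurable_fun_coordP => j.
apply: (eq_measurable_fun (fun x : 'rV[R]_n.+1 =>
  x ord0 (rshift 1 j) : measurableTypeR R)); last exact: measurable_coord.
by move=> x _; rewrite /= mxE.
Qed.

Definition lebesgue_step : set 'rV[R]_n.+1 -> \bar R :=
  pushforward (@lebesgue_measure R \x m)%E cons_rV.

Let lebesgue_step0 : lebesgue_step set0 = 0%E.
Proof. by rewrite /lebesgue_step /pushforward preimage_set0 measure0. Qed.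

Let lebesgue_step_ge0 A : (0 <= lebesgue_step A)%E.
Proof. exact: (measure_ge0 (@lebesgue_measure R \x m)%E). Qed.

Let lebesgue_step_sigma_additive : semi_sigma_additive lebesgue_step.
Proof.
have mpre A : measurable A -> measurable (cons_rV @^-1` A).
  by move=> mA; rewrite -[X in measurable X]setTI; exact: measurable_cons_rV.
move=> F mF tF mUF; rewrite /lebesgue_step /pushforward preimage_bigcup.
apply: measure_semi_sigma_additive => [k||]; first exact: mpre.
- apply/trivIsetP => /= i j _ _ ij; rewrite -preimage_setI.
  by move/trivIsetP : tF => /(_ _ _ _ _ ij) ->//; rewrite preimage_set0.
- by rewrite -preimage_bigcup; exact: mpre.
Qed.

HB.instance Definition _ := isMeasure.Build _ _ _ lebesgue_step
  lebesgue_step0 lebesgue_step_ge0 lebesgue_step_sigma_additive.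

Let lebesgue_step_sigma_finite : sigma_finite setT lebesgue_step.
Proof.
have /sigma_finiteP[F [TF ndF Foo]] := sigma_finiteT (@lebesgue_measure R).
have /sigma_finiteP[G [TG ndG Goo]] := sigma_finiteT m.
exists (fun k => uncons_rV @^-1` (F k `*` G k)).
  rewrite -preimage_bigcup; apply/seteqP; split => // x _ /=.
  have [i _ Fi] : (\bigcup_k F k) (uncons_rV x).1 by rewrite -TF.
  have [j _ Gj] : (\bigcup_k G k) (uncons_rV x).2 by rewrite -TG.
  exists (maxn i j) => //; split.
  - by have /subsetPset := ndF _ _ (leq_maxl i j); exact.
  - by have /subsetPset := ndG _ _ (leq_maxr i j); exact.
move=> k; have [mF Fk] := Foo k; have [mG Gk] := Goo k; split.
  have := measurable_uncons_rV measurableT (measurableX mF mG).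
  by rewrite setTI.
rewrite /lebesgue_step /pushforward /= -comp_preimage.
rewrite (_ : uncons_rV \o cons_rV = id); last first.
  by apply/funext => p; exact: cons_rVK.
by rewrite preimage_id product_measure1E// lte_mul_pinfty// ge0_fin_numE.
Qed.

HB.instance Definition _ := Measure_isSigmaFinite.Build _ _ _ lebesgue_step
  lebesgue_step_sigma_finite.

End step.

(* Image of the iterated product of one-dimensional Lebesgue measures under the
   identification of R * R^n with R^(n+1). *)
Fixpoint lebesgue_rV (n : nat) : {sigma_finite_measure set 'rV[R]_n -> \bar R} :=
  match n with
  | 0 => dirac (0 : 'rV[R]_0)
  | n'.+1 => lebesgue_step (lebesgue_rV n')
  end.

End lebesgue_rV.

Section smooth.
Context {R : realType}.

(* The library norm on 'rV[R]_n is the sup norm. *)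
Definition enorm n (x : 'rV[R]_n) : R := Num.sqrt (\sum_i x ord0 i ^+ 2).

Definition partial n (i : 'I_n) (f : 'rV[R]_n -> R) : 'rV[R]_n -> R :=
  fun x => 'D_(delta_mx ord0 i) f x.

Fixpoint Ck (k n : nat) (f : 'rV[R]_n -> R) : Prop :=
  continuous f /\
  match k with
  | 0 => True
  | k'.+1 => forall i : 'I_n,
      (forall x, derivable f x (delta_mx ord0 i)) /\ Ck k' (partial i f)
  end.

(* Near each boundary point, Omega lies strictly above the graph of a C^1
   function of n-1 of the coordinates, the axes being relabelled (choice of i)
   and reoriented (choice of b). *)
Definition C1_boundary n (Omega : set 'rV[R]_n) : Prop :=
  forall x0, (closure Omega `\` Omega) x0 ->
  exists (i : 'I_n) (b : bool) (g : 'rV[R]_n.-1 -> R), Ck 1 g /\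
    \forall x \near x0, Omega x <-> g (col' i x) < (-1) ^+ b * x ord0 i.

End smooth.

Section sobolev.
Context {R : realType} {n : nat}.
Notation mu := (@lebesgue_rV R n).
Implicit Types (D w : set 'rV[R]_n) (u : 'rV[R]_n -> R).

Definition cpt_inside w D : Prop := compact (closure w) /\ closure w `<=` D.

(* C_c^oo(D), its elements being extended by zero to R^n *)
Definition Cc_smooth D : set ('rV[R]_n -> R) :=
  [set psi | (forall k, Ck k psi) /\ cpt_inside [set x | psi x != 0] D].

Definition L2 D : set ('rV[R]_n -> R) := [set f | f \_ D \in Lfun mu 2%:E].

Definition Loo D : set ('rV[R]_n -> R) := [set f | f \_ D \in Lfun mu +oo%E].

Definition L1 D : set ('rV[R]_n -> R) :=
  [set f | mu.-integrable D (EFin \o f)].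

Definition L1loc D : set ('rV[R]_n -> R) :=
  [set f | measurable_fun D f /\
    forall K, compact K -> K `<=` D -> L1 K f].

Definition is_wgrad D u (g : 'rV[R]_n -> 'rV[R]_n) : Prop :=
  L1loc D u /\
  forall i, L1loc D (fun x => g x ord0 i) /\
    forall psi, Cc_smooth D psi ->
      \int[mu]_(x in D) (u x * partial i psi x) =
      - \int[mu]_(x in D) (g x ord0 i * psi x).

Definition has_wgrad D u : Prop := exists g, is_wgrad D u g.

(* Only meaningful under has_wgrad D u; unique up to a null subset of D, and
   unspecified outside D. *)
Definition wgrad D u : 'rV[R]_n -> 'rV[R]_n := get (is_wgrad D u).

Definition W12 D : set ('rV[R]_n -> R) :=
  [set u | [/\ L2 D u, has_wgrad D u &
    forall i, L2 D (fun x => wgrad D u x ord0 i)]].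

Definition W12norm D u : \bar R :=
  ((\int[mu]_(x in D) (u x ^+ 2)%:E +
    \int[mu]_(x in D) (enorm (wgrad D u x) ^+ 2)%:E) `^ 2^-1)%E.

(* The elements of W_0^{1,2}(D) are extended by zero to R^n. *)
Definition W012 D : set ('rV[R]_n -> R) :=
  [set u | [/\ (forall x, ~ D x -> u x = 0), W12 D u &
    exists psi : nat -> 'rV[R]_n -> R, (forall k, Cc_smooth D (psi k)) /\
      (fun k => W12norm D (u \- psi k)) @ \oo --> 0%E]].

Definition W12loc D : set ('rV[R]_n -> R) :=
  [set u | has_wgrad D u /\
    forall w, open w -> cpt_inside w D ->
      L2 w u /\ forall i, L2 w (fun x => wgrad D u x ord0 i)].

End sobolev.

Section weak_solution.
Context {R : realType} {n : nat}.
Notation mu := (@lebesgue_rV R n).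

Definition dotr (x y : 'rV[R]_n) : R := \sum_i x ord0 i * y ord0 i.

Definition nonlocal_integrand (s : R) (u phi : 'rV[R]_n -> R)
    (z : 'rV[R]_n * 'rV[R]_n) : R :=
  (u z.1 - u z.2) * (phi z.1 - phi z.2) /
  enorm (z.1 - z.2) `^ (n%:R + 2 * s).

(* phi vanishes outside w, hence belongs to W_0^{1,2}(Omega), and
   [wgrad Omega phi] is its gradient on w extended by zero.  Besides
   phi / u^gamma, the other integrands are required to be integrable, since
   integrals of non-integrable functions have junk values. *)
Definition weak_equation (Omega : set 'rV[R]_n) (s gamma r lambda : R)
    (u phi : 'rV[R]_n -> R) : Prop :=
  [/\ L1 Omega (fun x => phi x / u x `^ gamma),
      L1 Omega (fun x => dotr (wgrad Omega u x) (wgrad Omega phi x)),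
      (mu \x mu)%E.-integrable setT (EFin \o nonlocal_integrand s u phi),
      L1 Omega (fun x => u x `^ r * phi x) &
      \int[mu]_(x in Omega) dotr (wgrad Omega u x) (wgrad Omega phi x) +
      \int[(mu \x mu)%E]_z nonlocal_integrand s u phi z =
      lambda * \int[mu]_(x in Omega) (phi x / u x `^ gamma) +
      \int[mu]_(x in Omega) (u x `^ r * phi x)].

Record weak_solution (Omega : set 'rV[R]_n) (s gamma r lambda : R)
    (u : 'rV[R]_n -> R) : Prop := WeakSolution {
  weak_solution_W12loc : W12loc Omega u;
  weak_solution_Loo : Loo Omega u;
  weak_solution_gt0 : forall x, Omega x -> 0 < u x;
  weak_solution_eq0 : forall x, ~ Omega x -> u x = 0;
  weak_solution_boundary :
    exists2 p : R, 0 < p & W012 Omega (fun x => u x `^ p);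
  weak_solution_equation : forall w phi, open w -> cpt_inside w Omega ->
    W012 w phi -> weak_equation Omega s gamma r lambda u phi
}.

End weak_solution.

(* Main.v *)
Require Import Defs.
From HB Require Import structures.
From mathcomp Require Import all_boot all_order all_algebra.
From mathcomp Require Import all_classical all_reals all_analysis.
From mathcomp Require Import measurable_realfun.
From mathcomp Require Import lra.
Set Implicit Arguments.
Unset Strict Implicit.
Unset Printing Implicit Defensive.
Import Order.TTheory GRing.Theory Num.Theory.
Import numFieldNormedType.Exports.
Local Open Scope classical_set_scope.
Local Open Scope ring_scope.

(* For small lambda a multiple q of a fixed smooth cut-off of a concave parabola satisfies
   M/2 <= q <= M on Omega and is a strict enough supersolution to dominate the right-hand side.
   Starting from 0, a Newton iteration solves, with f_k(t) = lambda (t + 1/(k+1))^(-gamma) + t^r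
   and N_k = lambda gamma (u_k + 1/(k+1))^(-gamma-1), the linear problems
     -Delta u_{k+1} + (-Delta)^s u_{k+1} + N_k u_{k+1} = f_k(u_k) + N_k u_k
   by minimization.  Convexity of t^(-gamma) and the comparison principle give
   u_k <= u_{k+1} <= q together with a positive lower bound on every compact subset of Omega.
   A Caccioppoli identity then makes chi u_k a Cauchy sequence in W_0^{1,2}(Omega) for every cut-off
   chi, so that the pointwise limit u solves the equation locally.  Testing the equation of u_k with
   u_k, respectively with u_k (u_k^2 + eps_k^2)^((gamma-1)/2), bounds u_k, respectively
   (u_k^2 + eps_k^2)^((gamma+1)/4), in W_0^{1,2}(Omega), which yields the boundary condition. *)

(** * Lebesgue measure on R^n *)

(** The singular term decreases in u, so an iteration that merely lags the right-hand side would not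
    be monotone. Linearizing lambda (t + eps)^(-gamma) alone keeps every step linear, symmetric and
    coercive, hence solvable by minimizing a quadratic functional. A convex function lies above its
    tangents and t^r increases, so each iterate is a subsolution of the next problem; this invariant
    drives the monotonicity. Monotonicity in turn replaces compactness: for j, k >= N the difference
    |u_j - u_k| is at most u - u_N, and dominated convergence yields strong local convergence of the
    gradients without any compact embedding. Interior positivity comes from comparing the first
    iterate, whose source is lambda - lambda gamma u, with small multiples of cut-offs, so that no
    strong maximum principle enters. Elements of W_0^{1,2} are handled as pairs of a function and
    its gradient, limits of test functions. In comparison arguments the positive part is replaced by
    a smooth nondecreasing function, for which the chain rule passes to the limit directly. *)

Section rV_borel.
Context {R : realType} {n : nat}.
Local Notation V := 'rV[R]_n.

Lemma coord_le_norm (x : V) i : `|x ord0 i| <= `|x|.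
Proof. by rewrite [leRHS]/Num.norm /= mx_normrE; apply/bigmax_geP; right => /=; exists (ord0, i). Qed.

Lemma norm_le_coord (x : V) (e : R) : 0 <= e -> (forall i, `|x ord0 i| <= e) -> `|x| <= e.
Proof.
move=> e0 h; rewrite [leLHS]/Num.norm /= mx_normrE; apply/bigmax_leP; split => // -[a b] _ /=.
by rewrite (ord1 a).
Qed.

Lemma measurable_ball_rV (x : V) e : measurable (ball x e).
Proof.
have [e0|e0] := ltP 0 e; last first.
  rewrite (_ : ball x e = set0) //; apply/seteqP; split => // y [e0' _].
  by move: e0; rewrite leNgt e0'.
rewrite (_ : ball x e = \bigcap_(i in [set: 'I_n]) (fun y : V => y ord0 i : measurableTypeR R) @^-1` (ball (x ord0 i) e)).
  apply: fin_bigcap_measurable => // i _.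
  rewrite -[X in measurable X]setTI; apply: (@measurable_coord R n i) => //.
  exact: measurable_ball.
apply/seteqP; split => y.
  by move=> [_ h] i _; exact: h.
by move=> h; split => // i j; rewrite (ord1 i); exact: h.
Qed.

(** Links the topology with the coordinate sigma-algebra: an open set is the countable union of
    those balls with rational centre and radius 1/(k+1) that it contains. *)
Lemma open_measurable_rV (U : set V) : open U -> measurable U.
Proof.
move=> oU.
pose c (q : 'rV[rat]_n * nat) : set V :=
  let B := ball (map_mx ratr q.1 : V) (q.2.+1%:R^-1) in if `[< B `<=` U >] then B else set0.
rewrite (_ : U = \bigcup_q c q).
  apply: countable_bigcupT_measurable => // q; rewrite /c /=.
  by case: ifP => // _; exact: measurable_ball_rV.
apply/seteqP; split => x; last first.
  by move=> [q _]; rewrite /c; case: asboolP => // h /h.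
move=> Ux; have /nbhs_ballP[e e0 he] : nbhs x U by exact: open_nbhs_nbhs.
(* The ball of radius 1/(k+1) around a rational point closer than 1/(k+1) to x stays within distance
   2/(k+1) < e of x. *)
have [k /andP[k0 ke]] : exists k, 0 < (k.+1%:R^-1 : R) < e / 2.
  have e2 : 0 < e / 2 by rewrite divr_gt0.
  near \oo => k; exists k; rewrite invr_gt0 ltr0n //=.
  near: k; exact: (near_infty_natSinv_lt (PosNum e2)).
have hq i : exists q : rat, `|x ord0 i - ratr q| < k.+1%:R^-1.
  move: k0; set dk := k.+1%:R^-1 => k0.
  have lt1 : x ord0 i - dk < x ord0 i + dk by lra.
  have [q] := rat_in_itvoo lt1.
  rewrite in_itv /= => /andP[q1 q2]; exists q; rewrite ltr_norml; apply/andP; split; lra.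
have [q hq'] : exists q : 'I_n -> rat, forall i, `|x ord0 i - ratr (q i)| < k.+1%:R^-1.
  by have [q hq'] := boolp.choice hq; exists q.
exists (\row_i q i, k) => //; rewrite /c /=.
case: asboolP => [_|[]].
  by split => // i j; rewrite /ball /= !mxE (ord1 i) distrC; exact: hq'.
move=> y [_ hy]; apply: he; split => // i j; rewrite (ord1 i).
have := hy ord0 j; rewrite /ball /= !mxE => h1.
have h2 := hq' j.
rewrite (_ : _ - _ = (x ord0 j - ratr (q j)) + (ratr (q j) - y ord0 j)); last lra.
apply: le_lt_trans (ler_normD _ _) _; move: ke h1 h2; set dk := k.+1%:R^-1; lra.
Unshelve. all: by end_near. Qed.

Lemma continuous_measurable_rV (f : V -> R) : continuous f -> measurable_fun setT f.
Proof.
move=> cf; apply: (measurability _ (RGenOpens.measurableE R)).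
move=> _ [_ [a [b ->] <-]]; rewrite setTI; apply: open_measurable_rV.
by move/continuousP: cf; apply; exact: interval_open.
Qed.

(** Open sets are stable under intersection, so with this description a Dynkin argument reduces
    statements on all measurable sets to open ones. *)
Lemma measurable_rV_generated :
  (@measurable _ V) = <<s [set U : set V | open U] >>.
Proof.
apply/seteqP; split; last first.
  by apply: smallest_sub; [exact: sigma_algebra_measurable | move=> U; exact: open_measurable_rV].
apply: smallest_sub; first exact: smallest_sigma_algebra.
move=> B; rewrite -bigcup_seq => -[i _ [C mC <-]] /=; rewrite setTI.
have : (@measurable _ (measurableTypeR R)) `<=` [set C | <<s [set U : set V | open U] >> ((fun x : V => x ord0 i) @^-1` C)].
  rewrite (RGenOpens.measurableE R); apply: smallest_sub.
    split => [|A hA|F mF]; rewrite /mkset.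
    - rewrite preimage_set0; exact: sigma_algebra0.
    - rewrite setTD preimage_setC -setTD; exact: sigma_algebraCD.
    - rewrite preimage_bigcup; exact: sigma_algebra_bigcup.
  move=> _ [a [b ->]]; apply: sub_sigma_algebra => /=.
  by move/continuousP: (@coord_continuous R 1 n ord0 i); apply; exact: interval_open.
exact.
Qed.

Lemma measurable_addr_rV (a : V) : measurable_fun setT (fun x : V => x + a).
Proof.
apply: measurable_fun_coordP => i; under eq_fun do rewrite mxE.
apply: measurable_funD => //; exact: measurable_coord.
Qed.

Lemma measurable_add_rV : measurable_fun setT (fun z : V * V => z.1 + z.2).
Proof.
apply: measurable_fun_coordP => i; under eq_fun do rewrite mxE.
apply: measurable_funD.
  exact: (measurableT_comp (@measurable_coord R n i) measurable_fst).
exact: (measurableT_comp (@measurable_coord R n i) measurable_snd).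
Qed.

Lemma measurable_sub_rV : measurable_fun setT (fun z : V * V => z.1 - z.2).
Proof.
apply: measurable_fun_coordP => i; under eq_fun do rewrite !mxE.
apply: measurable_funB.
  exact: (measurableT_comp (@measurable_coord R n i) measurable_fst).
exact: (measurableT_comp (@measurable_coord R n i) measurable_snd).
Qed.

End rV_borel.

(** * Integrals under measure-preserving maps *)

Section measure_preserving.
Local Open Scope ereal_scope.
Context d1 d2 (X : measurableType d1) (Y : measurableType d2) (R : realType).
Variables (phi : X -> Y) (mphi : measurable_fun setT phi).
Variables (mu : {measure set X -> \bar R}) (nu : {measure set Y -> \bar R}).
Hypothesis phiE : forall A, measurable A -> mu (phi @^-1` A) = nu A.

Lemma ge0_integral_preserving (f : Y -> \bar R) : measurable_fun setT f ->
  (forall y, 0 <= f y) -> \int[mu]_x f (phi x) = \int[nu]_y f y.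
Proof.
move=> mf f0.
have := @ge0_integral_pushforward _ _ _ _ _ phi mphi mu setT f measurableT mf (fun y _ => f0 y).
rewrite preimage_setT => <-.
by apply: eq_measure_integral => A mA _; exact: phiE.
Qed.

Lemma integrable_preserving (f : Y -> \bar R) :
  nu.-integrable setT f -> mu.-integrable setT (f \o phi).
Proof.
move=> /integrableP[mf fi]; apply/integrableP; split; first exact: measurableT_comp.
rewrite (ge0_integral_preserving (f := abse \o f)) //; first exact: measurableT_comp.
by move=> y; exact: abse_ge0.
Qed.

Lemma integral_preserving (f : Y -> \bar R) : measurable_fun setT f ->
  \int[mu]_x f (phi x) = \int[nu]_y f y.
Proof.
move=> mf; rewrite [LHS]integralE [RHS]integralE; congr (_ - _).
  have mp : measurable_fun setT f^\+ by apply: measurable_funepos.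
  transitivity (\int[mu]_x f^\+ (phi x)); first by apply: eq_integral => x _; rewrite unlock.
  by apply: ge0_integral_preserving => // y; exact: funepos_ge0.
have mn : measurable_fun setT f^\- by apply: measurable_funeneg.
transitivity (\int[mu]_x f^\- (phi x)); first by apply: eq_integral => x _; rewrite unlock.
by apply: ge0_integral_preserving => // y; exact: funeneg_ge0.
Qed.

End measure_preserving.

(** * Translation invariance and volumes of boxes *)

Section lebesgue_translation.
Context {R : realType}.

(** The push-forward under the shift agrees with Lebesgue measure on half-open intervals, and these
    determine it. *)
Lemma lebesgue_measure_shift (a : R) (A : set (measurableTypeR R)) : measurable A ->
  lebesgue_measure ((fun x => x + a) @^-1` A) = lebesgue_measure A.
Proof.
move=> mA.
have ma : measurable_fun setT (fun x : measurableTypeR R => (x + a : measurableTypeR R)) by exact: measurable_funD.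
pose ma_mixin := isMeasurableFun.Build _ _ _ _ _ ma.
pose phi : {mfun (measurableTypeR R) >-> (measurableTypeR R)} := HB.pack (fun x : measurableTypeR R => (x + a : measurableTypeR R)) ma_mixin.
apply/esym; rewrite -[RHS]/(pushforward (@lebesgue_measure R) phi A).
apply: (@lebesgue_measure_unique R) => //= _ [[p q]] _ <-.
rewrite /pushforward.
have -> : phi @^-1` `]p, q] = `]p - a, q - a]%classic.
  by apply/seteqP; split => x /=; rewrite !in_itv /= => /andP[h1 h2]; apply/andP; split; lra.
rewrite !lebesgue_measure_itv /= !lte_fin.
rewrite ltrD2r; case: ifP => // _; rewrite -!EFinD; congr EFin; lra.
Qed.

Lemma cons_rV_add n (t a : R) (y b : 'rV[R]_n) :
  cons_rV (t, y) + cons_rV (a, b) = cons_rV (t + a, y + b).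
Proof.
apply/rowP => i; rewrite mxE; case: (split_ordP (i : 'I_(1 + n))) => j ->.
- have -> : lshift n j = ord0 by apply/val_inj; rewrite /= ord1.
  by rewrite !cons_rV0.
- by rewrite !cons_rVS /= mxE.
Qed.

Lemma uncons_rVK n (x : 'rV[R]_n.+1) : cons_rV (uncons_rV x) = x.
Proof.
apply/rowP => i; rewrite /uncons_rV; case: (split_ordP (i : 'I_(1 + n))) => j ->.
- have -> : lshift n j = ord0 by apply/val_inj; rewrite /= ord1.
  by rewrite cons_rV0.
- by rewrite cons_rVS /= mxE.
Qed.

(** Induction on the dimension: after slicing along the first coordinate, the induction hypothesis
    shifts the slices and the one-dimensional case shifts the slicing variable. *)
Lemma lebesgue_rV_shift n (a : 'rV[R]_n) (A : set 'rV[R]_n) : measurable A ->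
  lebesgue_rV n ((fun x => x + a) @^-1` A) = lebesgue_rV n A.
Proof.
elim: n a A => [|n IH] a A mA.
  congr (lebesgue_rV 0 _); apply/seteqP; split => x /=; rewrite (_ : x + a = x) //; by apply/rowP => -[].
rewrite /= /lebesgue_step /pushforward /product_measure1 /=.
have mcA : measurable (@cons_rV R n @^-1` A).
  by rewrite -[X in measurable X]setTI; exact: measurable_cons_rV.
transitivity (\int[@lebesgue_measure R]_t (lebesgue_rV n (xsection (@cons_rV R n @^-1` A) ((t : R) + (uncons_rV a).1)%R)))%E.
  apply: eq_integral => t _ /=.
  rewrite -[RHS](IH (uncons_rV a).2); last exact: measurable_xsection.
  have E y : cons_rV (t, y) + a = cons_rV (t + a ord0 ord0, y + (uncons_rV a).2).
    by rewrite -cons_rV_add -/(uncons_rV a) uncons_rVK.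
  by congr (lebesgue_rV n _); apply/seteqP; split => y; rewrite /xsection /= !inE /= E.
rewrite (@ge0_integral_preserving _ _ _ _ _ _ _ _ lebesgue_measure (lebesgue_measure_shift _) (fun t => lebesgue_rV n (xsection (@cons_rV R n @^-1` A) t))) //.
- exact: measurable_funD.
- exact: measurable_fun_xsection.
Qed.

Definition rV_box n (rho : R) : set 'rV[R]_n :=
  [set x | forall i, - rho <= x ord0 i <= rho].

Lemma measurable_rV_box n (rho : R) : measurable (@rV_box n rho).
Proof.
rewrite (_ : @rV_box n rho = \bigcap_(i in [set: 'I_n]) (fun y : 'rV[R]_n => y ord0 i : measurableTypeR R) @^-1` `[- rho, rho]).
  apply: fin_bigcap_measurable => // i _.
  by rewrite -[X in measurable X]setTI; apply: (@measurable_coord R n i).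
by apply/seteqP; split => y h i; move: (h i); rewrite /= in_itv /=; [move=> h1 _|apply].
Qed.

(** The induction starts with the Dirac mass of dimension 0. Besides the finiteness of bounded sets,
    the explicit volume serves to evaluate the dyadic sums of [integrable_kmin]. *)
Lemma lebesgue_rV_box n (rho : R) : 0 <= rho ->
  lebesgue_rV n (@rV_box n rho) = ((2 * rho) ^+ n)%:E.
Proof.
move=> rho0; elim: n => [|n IH].
  by rewrite /= diracE mem_set ?expr0 // => -[].
rewrite /= /lebesgue_step /pushforward.
have -> : @cons_rV R n @^-1` (@rV_box n.+1 rho) = `[-rho, rho]%classic `*` (@rV_box n rho).
  apply/seteqP; split => -[t y] /=.
    move=> h; split; first by have := h ord0; rewrite cons_rV0 in_itv.
    by move=> i; have := h (rshift 1 i); rewrite cons_rVS.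
  rewrite in_itv /= => -[h1 h2] i.
  case: (split_ordP (i : 'I_(1 + n))) => j ->.
  - have -> : lshift n j = ord0 by apply/val_inj; rewrite /= ord1.
    by rewrite cons_rV0.
  - by rewrite cons_rVS; exact: h2.
rewrite product_measure1E //; last exact: measurable_rV_box.
have := @lebesgue_measure_itv R `[- rho, rho]; rewrite /= lte_fin => h.
rewrite [X in (_ * X)%E]IH [X in (X * _)%E]h.
case: ifPn => [_|h']; first by rewrite -EFinD -EFinM exprS; congr EFin; congr (_ * _); lra.
have -> : rho = 0 by lra.
by rewrite mulr0 exprS mul0r mul0e.
Qed.

End lebesgue_translation.

Section rV_integrals.
Context {R : realType} {n : nat}.
Local Notation V := 'rV[R]_n.
Local Notation mu := (@lebesgue_rV R n).

Lemma rV_shift_preserving (a : V) (A : set V) : measurable A ->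
  mu ((fun x => x + a) @^-1` A) = mu A.
Proof. exact: lebesgue_rV_shift. Qed.

(** The change of variables y = x + z: a double integral with a kernel in x - y becomes an integral
    over the displacement z of quantities to which translation estimates apply. *)
Lemma shear_preserving (A : set (V * V)) : measurable A ->
  (mu \x mu)%E ((fun z => (z.1, z.1 + z.2)) @^-1` A) = (mu \x mu)%E A.
Proof.
move=> mA; rewrite /product_measure1; apply: eq_integral => x _ /=.
rewrite -[RHS](lebesgue_rV_shift x); last exact: measurable_xsection.
by congr (lebesgue_rV n _); apply/seteqP; split => y; rewrite /xsection /= !inE /= addrC.
Qed.

Lemma measurable_shear : measurable_fun setT (fun z : V * V => (z.1, z.1 + z.2)).
Proof. by apply/measurable_fun_pairP; split => //=; [exact: measurable_fst|exact: measurable_add_rV]. Qed.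

Lemma bounded_set_finite_measure (A : set V) : measurable A -> bounded_set A -> (mu A < +oo)%E.
Proof.
move=> mA [M [_ bM]].
pose rho := `|M| + 1.
have rho0 : 0 <= rho by rewrite /rho addr_ge0.
apply: (@le_lt_trans _ _ (mu (@rV_box R n rho))).
  apply: le_measure; rewrite ?inE //; first exact: measurable_rV_box.
  move=> x Ax i; rewrite -ler_norml (le_trans (coord_le_norm x i)) //.
  apply: bM => //; rewrite /rho; apply: le_lt_trans (ler_norm M) _; lra.
by rewrite lebesgue_rV_box // ltry.
Qed.

End rV_integrals.

(** * Null sequences *)

Section real_sequences.
Context {R : realType}.
Implicit Types a b : nat -> R.

Lemma squeeze0 b a : (forall k, 0 <= a k <= b k) -> b @ \oo --> (0 : R) -> a @ \oo --> (0 : R).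
Proof.
move=> h hb; apply: (squeeze_cvgr _ (@cvg_cst _ _ _ _ _) hb); exact: nearW.
Qed.

Lemma sqr_cvg0 a : (fun k => a k ^+ 2) @ \oo --> (0 : R) -> a @ \oo --> (0 : R).
Proof.
move=> h; apply/norm_cvg0P.
have /(_ _) := continuous_cvg _ (@sqrt_continuous R 0) h.
by rewrite sqrtr0 /comp; under eq_fun do rewrite sqrtr_sqr; apply.
Qed.

Lemma cvg0_eps a : (forall e, 0 < e -> \forall k \near \oo, `|a k| <= e) -> a @ \oo --> (0 : R).
Proof. by move=> h; apply/cvgr0Pnorm_le. Qed.

Lemma cvg0_lin c1 c2 a b : a @ \oo --> (0 : R) -> b @ \oo --> (0 : R) ->
  (fun k => c1 * a k + c2 * b k) @ \oo --> (0 : R).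
Proof.
move=> ha hb; rewrite [X in _ --> X](_ : 0 = c1 * 0 + c2 * 0); last by rewrite !mulr0 addr0.
by apply: cvgD; apply: cvgMr.
Qed.

End real_sequences.

Lemma integralZl_T d (T : measurableType d) (R : realType) (mu : {measure set T -> \bar R})
    (f : T -> \bar R) (k : \bar R) : measurable_fun setT f -> (forall x, 0 <= f x)%E -> (0 <= k)%E ->
  (\int[mu]_x (k * f x) = k * \int[mu]_x f x)%E.
Proof. by move=> mf f0 k0; rewrite ge0_integralZl. Qed.

(** * Convergence in L^2 *)

Section L2_theory.
Context d (T : measurableType d) (R : realType) (mu : {measure set T -> \bar R}).
Implicit Types f g h : T -> R.

(** Genuine functions rather than classes, because pointwise values matter for the monotone limit
    and for the weak solution itself; [Lfun2_l2] makes the link with [Lfun]. *)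
Definition l2 f := measurable_fun setT f /\
  mu.-integrable setT (EFin \o (fun x => f x ^+ 2)).

Definition ip f g : R := \int[mu]_x (f x * g x).

(** Squared distances keep every estimate polynomial in inner products and free of roots. *)
Definition l2cvg (u : nat -> T -> R) f :=
  (fun k => ip (fun x => u k x - f x) (fun x => u k x - f x)) @ \oo --> (0 : R).

Lemma integrable_le f g : measurable_fun setT f -> (forall x, `|f x| <= g x) ->
  mu.-integrable setT (EFin \o g) -> mu.-integrable setT (EFin \o f).
Proof.
move=> mf fg ig; apply: le_integrable ig => //; first exact/measurable_EFinP.
by move=> x _ /=; rewrite lee_fin (le_trans (fg x)) // ler_norm.
Qed.

Lemma l2_le f g : measurable_fun setT f -> (forall x, `|f x| <= `|g x|) -> l2 g -> l2 f.
Proof.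
move=> mf fg [mg ig]; split => //; apply: integrable_le ig.
  exact: measurable_funX.
move=> x; rewrite normrX -[X in _ <= X]ger0_norm ?sqr_ge0 // normrX.
by rewrite lerXn2r ?nnegrE.
Qed.

Lemma l2D f g : l2 f -> l2 g -> l2 (fun x => f x + g x).
Proof.
move=> [mf If] [mg Ig]; have mfg := measurable_funD mf mg; split => //.
have /(integrable_le (f := fun x => (f x + g x) ^+ 2)) : mu.-integrable setT (EFin \o (fun x => 2 * f x ^+ 2 + 2 * g x ^+ 2)).
  have := integrableD measurableT (integrableZl measurableT 2 If) (integrableZl measurableT 2 Ig).
  by apply: eq_integrable => // x _ /=; rewrite -!EFinM -EFinD.
apply; first exact: measurable_funX.
move=> x; rewrite ger0_norm ?sqr_ge0 //.
have := sqr_ge0 (f x - g x); lra.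
Qed.

Lemma l2Z a f : l2 f -> l2 (fun x => a * f x).
Proof.
move=> [mf If]; split; first exact: measurable_funM.
have := integrableZl measurableT (a ^+ 2) If.
by apply: eq_integrable => // x _ /=; rewrite -EFinM exprMn.
Qed.

Lemma l2N f : l2 f -> l2 (fun x => - f x).
Proof. by move=> /(l2Z (-1)); under eq_fun do rewrite mulN1r. Qed.

Lemma l2B f g : l2 f -> l2 g -> l2 (fun x => f x - g x).
Proof. by move=> If /l2N; exact: l2D. Qed.

Lemma l20 : l2 (fun=> 0).
Proof.
split; first exact: measurable_cst.
have := @integrable0 _ _ _ mu setT.
by apply: eq_integrable => // x _ /=; rewrite expr0n.
Qed.

Lemma l2_bdM h C f : measurable_fun setT h -> (forall x, `|h x| <= C) -> l2 f ->
  l2 (fun x => h x * f x).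
Proof.
move=> mh hC lf; apply: (l2_le (g := fun x => C * f x)); last exact: l2Z.
  by apply: measurable_funM => //; case: lf.
move=> x; rewrite !normrM ler_wpM2r // (le_trans (hC x)) //; exact: ler_norm.
Qed.

Lemma l2_meas f : l2 f -> measurable_fun setT f. Proof. by case. Qed.

Lemma l2M_integrable f g : l2 f -> l2 g -> mu.-integrable setT (EFin \o (fun x => f x * g x)).
Proof.
move=> [mf If] [mg Ig].
have /(integrable_le (f := fun x => f x * g x)) : mu.-integrable setT (EFin \o (fun x => f x ^+ 2 + g x ^+ 2)).
  have := integrableD measurableT If Ig.
  by apply: eq_integrable => // x _ /=; rewrite -EFinD.
apply; first exact: measurable_funM.
move=> x; rewrite ler_norml; apply/andP; split.
  have := sqr_ge0 (f x + g x); have := sqr_ge0 (f x); have := sqr_ge0 (g x); lra.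
have := sqr_ge0 (f x - g x); have := sqr_ge0 (f x); have := sqr_ge0 (g x); lra.
Qed.

Lemma ipC f g : ip f g = ip g f.
Proof. by apply: eq_Rintegral => x _; rewrite mulrC. Qed.

Lemma ipDl f g h : l2 f -> l2 g -> l2 h ->
  ip (fun x => f x + g x) h = ip f h + ip g h.
Proof.
move=> lf lg lh; rewrite /ip -RintegralD //; try exact: l2M_integrable.
by apply: eq_Rintegral => x _; rewrite mulrDl.
Qed.

Lemma ipZl a f h : l2 f -> l2 h -> ip (fun x => a * f x) h = a * ip f h.
Proof.
move=> lf lh; rewrite /ip -RintegralZl //; try exact: l2M_integrable.
by apply: eq_Rintegral => x _; rewrite mulrA.
Qed.

Lemma ipNl f h : l2 f -> l2 h -> ip (fun x => - f x) h = - ip f h.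
Proof.
move=> lf lh; rewrite -mulN1r -ipZl //.
by apply: eq_Rintegral => x _; rewrite mulN1r.
Qed.

Lemma ipBl f g h : l2 f -> l2 g -> l2 h ->
  ip (fun x => f x - g x) h = ip f h - ip g h.
Proof. by move=> lf lg lh; rewrite (ipDl lf (l2N lg) lh) ipNl. Qed.

Lemma ipDr f g h : l2 f -> l2 g -> l2 h ->
  ip h (fun x => f x + g x) = ip h f + ip h g.
Proof. by move=> lf lg lh; rewrite ipC ipDl // !(ipC h). Qed.

Lemma ipBr f g h : l2 f -> l2 g -> l2 h ->
  ip h (fun x => f x - g x) = ip h f - ip h g.
Proof. by move=> lf lg lh; rewrite ipC ipBl // !(ipC h). Qed.

Lemma ipZr a f h : l2 f -> l2 h -> ip h (fun x => a * f x) = a * ip h f.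
Proof. by move=> lf lh; rewrite ipC ipZl // ipC. Qed.

Lemma ip_ge0 f : 0 <= ip f f.
Proof. by apply: Rintegral_ge0 => x _; rewrite -expr2 sqr_ge0. Qed.

Lemma ipE f : l2 f -> (\int[mu]_x (f x ^+ 2)%:E = (ip f f)%:E)%E.
Proof.
move=> [mf If]; rewrite /ip /Rintegral fineK; last exact: integrable_fin_num.
by apply: eq_integral => x _; rewrite expr2.
Qed.

Lemma ip_CS f g : l2 f -> l2 g -> ip f g ^+ 2 <= ip f f * ip g g.
Proof.
move=> lf lg.
have H a b : 0 <= a ^+ 2 * ip f f + 2 * a * b * ip f g + b ^+ 2 * ip g g.
  have := ip_ge0 (fun x => a * f x + b * g x).
  have laf := l2Z a lf; have lbg := l2Z b lg.
  rewrite ipDl //; last exact: l2D.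
  rewrite !ipDr // !ipZl // !ipZr // (ipC g f); lra.
have [z|nz] := eqVneq (ip g g) 0.
  (* When g has norm zero, these coefficients give the quadratic form the value minus the square of
     [ip f g]. *)
  have := H (- (ip f g)) ((ip f f + 1)/2); have := H (ip f g) (- (ip f f + 1)/2).
  have := ip_ge0 f; rewrite z mulr0 => h0 h1 h2.
  rewrite real_leNgt ?num_real //; apply/negP => h3.
  nra.
have := H (ip g g) (- ip f g); have := ip_ge0 g.
rewrite le_eqVlt eq_sym (negbTE nz) /= => gp h.
have : 0 <= ip g g * (ip f f * ip g g - ip f g ^+ 2) by lra.
by rewrite pmulr_rge0 // subr_ge0.
Qed.

Lemma ipD_le f g : l2 f -> l2 g ->
  ip (fun x => f x + g x) (fun x => f x + g x) <= 2 * ip f f + 2 * ip g g.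
Proof.
move=> lf lg; have := ip_ge0 (fun x => f x - g x).
have lB := l2B lf lg; have lD := l2D lf lg.
rewrite (ipBl lf lg lB) (ipDl lf lg lD) !(ipBr lf lg) // !(ipDr lf lg) // (ipC g f); lra.
Qed.

Lemma ip_le f g : l2 g -> measurable_fun setT f -> (forall x, `|f x| <= `|g x|) -> ip f f <= ip g g.
Proof.
move=> lg mf h; have lf := l2_le mf h lg.
apply: le_Rintegral => //; try exact: l2M_integrable.
by move=> x _; rewrite -!expr2 -(real_normK (num_real (f x))) -(real_normK (num_real (g x))) lerXn2r ?nnegrE.
Qed.

Lemma ae_eq_l2 f g : measurable_fun setT g -> {ae mu, forall x, f x = g x} -> l2 f -> l2 g.
Proof.
move=> mg fg [mf If]; split => //; apply/integrableP; split.
  by apply/measurable_EFinP; exact: measurable_funX.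
have /integrableP[_] := If; apply: le_lt_trans.
rewrite (@ge0_ae_eq_integral _ _ _ mu setT (abse \o (EFin \o (fun x : T => g x ^+ 2))) (abse \o (EFin \o (fun x : T => f x ^+ 2)))) //.
- by apply: measurableT_comp => //; apply/measurable_EFinP; exact: measurable_funX.
- by apply: measurableT_comp => //; apply/measurable_EFinP; exact: measurable_funX.
- by move=> x _; exact: abse_ge0.
- by move=> x _; exact: abse_ge0.
- by apply: filterS fg => x /= ->.
Qed.

Lemma ae_eq_Rint f g : measurable_fun setT f -> measurable_fun setT g ->
  {ae mu, forall x, f x = g x} -> \int[mu]_x f x = \int[mu]_x g x.
Proof.
move=> mf mg fg; congr fine; apply: ae_eq_integral => //; try exact/measurable_EFinP.
by apply: filterS fg => x /= ->.
Qed.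

(** Replacing g by the maximum of f and g, equal to g almost everywhere, makes the inequality
    pointwise. *)
Lemma ae_le_Rint f g : mu.-integrable setT (EFin \o f) -> mu.-integrable setT (EFin \o g) ->
  {ae mu, forall x, f x <= g x} -> \int[mu]_x f x <= \int[mu]_x g x.
Proof.
move=> If Ig fg.
have mf : measurable_fun setT f by apply/measurable_EFinP; case/integrableP: If.
have mg : measurable_fun setT g by apply/measurable_EFinP; case/integrableP: Ig.
have Imax : mu.-integrable setT (EFin \o (fun x => Num.max (f x) (g x))).
  have /(integrable_le (f := fun x => Num.max (f x) (g x))) : mu.-integrable setT (EFin \o (fun x => `|f x| + `|g x|)).
    have := integrableD measurableT (integrable_norm If) (integrable_norm Ig).
    by apply: eq_integrable => // x _ /=; rewrite -EFinD.
  apply; first exact: measurable_maxr.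
  move=> x; rewrite /Num.max; case: ifP => _; [rewrite -[leLHS]add0r|rewrite -[leLHS]addr0]; exact: lerD.
rewrite (@ae_eq_Rint g (fun x => Num.max (f x) (g x))) //.
- by apply: le_Rintegral => // x _; rewrite le_max lexx.
- exact: measurable_maxr.
- by apply: filterS fg => x h; rewrite max_r.
Qed.

Lemma ip_eq0 f : l2 f -> ip f f = 0 -> {ae mu, forall x, f x = 0}.
Proof.
move=> lf h; have [mf If] := lf.
have : (\int[mu]_x `|(f x ^+ 2)%:E| = 0)%E.
  transitivity (\int[mu]_x (f x ^+ 2)%:E)%E; last by rewrite ipE // h.
  by apply: eq_integral => x _; rewrite gee0_abs // lee_fin sqr_ge0.
have mf2 : measurable_fun setT (fun x => (f x ^+ 2)%:E) by apply/measurable_EFinP; exact: measurable_funX.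
move/(ae_eq_integral_abs mu measurableT mf2); apply: filterS => x /(_ I) /= [] /eqP.
by rewrite sqrf_eq0 => /eqP.
Qed.

(** By monotone convergence the sum of the series has a finite integral, hence is finite almost
    everywhere. *)
Lemma ae_summable (g : nat -> T -> R) C :
  (forall k, measurable_fun setT (g k)) -> (forall k x, 0 <= g k x) ->
  (forall k, mu.-integrable setT (EFin \o g k)) ->
  (forall N, \sum_(0 <= k < N) \int[mu]_x g k x <= C) ->
  {ae mu, forall x, cvgn (series (fun k => g k x))}.
Proof.
move=> mg g0 Ig hC.
pose S x := (\sum_(0 <= k <oo) (g k x)%:E)%E.
have mS : measurable_fun setT S.
  by apply: ge0_emeasurable_sum => [k x _ _|k _]; [rewrite lee_fin|exact/measurable_EFinP].
have S0 x : (0 <= S x)%E by apply: nneseries_ge0 => k _ _; rewrite lee_fin.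
have SI : (\int[mu]_x S x <= C%:E)%E.
  rewrite integral_nneseries //; last 2 first.
  - by move=> k; apply/measurable_EFinP.
  - by move=> k x _; rewrite lee_fin.
  apply: lime_le.
    apply: is_cvg_nneseries => k _ _; apply: integral_ge0 => x _; by rewrite lee_fin.
  apply: nearW => N.
  rewrite (eq_bigr (fun k => (\int[mu]_x g k x)%:E)); first last.
    by move=> k _; rewrite /Rintegral fineK //; exact: (integrable_fin_num measurableT (Ig k)).
  by rewrite sumEFin lee_fin.
have IS : mu.-integrable setT S.
  apply/integrableP; split => //.
  under eq_integral => x _ do rewrite gee0_abs //.
  exact: le_lt_trans SI (ltry _).
have := integrable_ae measurableT IS; apply: filterS => x /(_ I) Sx.
have Sx' : (S x < +oo)%E by rewrite ltey_eq Sx.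
apply: nondecreasing_is_cvgn.
  by apply: nondecreasing_series => k _ _.
exists (fine (S x)) => _ [N _ <-].
rewrite -lee_fin fineK // seriesEnat /= -sumEFin.
by apply: nneseries_lim_ge => k _ _; rewrite lee_fin.
Qed.

Lemma dominated_Rint (u : nat -> T -> R) f g :
  (forall k, measurable_fun setT (u k)) -> measurable_fun setT f ->
  {ae mu, forall x, (fun k => u k x) @ \oo --> f x} ->
  mu.-integrable setT (EFin \o g) ->
  (forall k x, `|u k x| <= g x) ->
  mu.-integrable setT (EFin \o f) /\
  (fun k => \int[mu]_x u k x) @ \oo --> \int[mu]_x f x.
Proof.
move=> mu_ mf uf Ig ug.
have [|||||If _ cf] := @dominated_convergence _ _ _ mu setT measurableT (fun k => EFin \o u k) (EFin \o f) (EFin \o g) => //.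
- by move=> k; exact/measurable_EFinP.
- exact/measurable_EFinP.
- by apply: filterS uf => x h _; apply: cvg_EFin => //; exact: nearW.
- by apply: nearW => x k _ /=; rewrite lee_fin.
split => //.
rewrite /Rintegral; apply: fine_cvg; rewrite fineK //; exact: integrable_fin_num.
Qed.

(** Fatou's lemma for the squares, off the null set where convergence may fail. Square integrability
    of the limit is obtained, not assumed, which is what completeness needs. *)
Lemma l2_fatou (u : nat -> T -> R) f C :
  (forall k, l2 (u k)) -> measurable_fun setT f ->
  {ae mu, forall x, (fun k => u k x) @ \oo --> f x} ->
  (\forall k \near \oo, ip (u k) (u k) <= C) -> l2 f /\ ip f f <= C.
Proof.
move=> lu mf uf [N _ hC].
have H : (\int[mu]_x (f x ^+ 2)%:E <= C%:E)%E.
  have mF k : measurable_fun setT (fun x => (u k x ^+ 2)%:E).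
    by apply/measurable_EFinP/measurable_funX; case: (lu k).
  have F0 (k : nat) x : (0 <= (u k x ^+ 2)%:E)%E by rewrite lee_fin sqr_ge0.
  have mf2 : measurable_fun setT (fun x => (f x ^+ 2)%:E) by apply/measurable_EFinP/measurable_funX.
  case: uf => B [mB B0 subB].
  rewrite (ge0_negligible_integral mB measurableT mf2 _ B0); last by move=> x _; rewrite lee_fin sqr_ge0.
  have mD : measurable (setT `\` B) by exact: measurableD.
  rewrite (eq_integral (fun x => limn_einf (fun k => (u k x ^+ 2)%:E))); last first.
    move=> x; rewrite inE => -[_ nBx].
    have h : (fun k => u k x) @ \oo --> f x by apply: contrapT => h; apply: nBx; exact: subB.
    have h2 : (fun k => (u k x ^+ 2)%:E) @ \oo --> (f x ^+ 2)%:E.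
      apply: cvg_EFin; first exact: nearW.
      rewrite [X in X @ _](_ : _ = (fun k => u k x * u k x)); last by apply/funext => k /=; rewrite expr2.
      by rewrite expr2; exact: cvgM.
    by rewrite (cvg_limn_einf_sup h2).1.
  have mFD k : measurable_fun (setT `\` B) (fun x => (u k x ^+ 2)%:E) by exact: measurable_funTS.
  apply: le_trans (fatou mu mD mFD (fun k x _ => F0 k x)) _.
  rewrite limn_einf_lim; apply: lime_le; first exact: is_cvg_einfs.
  (* The bound holds from [N] on only, so the infimum over the indices beyond [k] is tested at
     [maxn k N]. *)
  apply: nearW => k; apply: (@le_trans _ _ (\int[mu]_(x in setT `\` B) (u (maxn k N) x ^+ 2)%:E)%E).
    by apply: ereal_inf_lbound; exists (maxn k N) => //=; exact: leq_maxl.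
  apply: (@le_trans _ _ (\int[mu]_x (u (maxn k N) x ^+ 2)%:E)%E).
    by apply: ge0_subset_integral.
  rewrite ipE // lee_fin; apply: hC; exact: leq_maxr.
have lf : l2 f.
  split => //; apply/integrableP; split; first by apply/measurable_EFinP/measurable_funX.
  under eq_integral => x _ do rewrite /= ger0_norm ?sqr_ge0 //.
  exact: le_lt_trans H (ltry _).
by split => //; rewrite -lee_fin -ipE.
Qed.

(** Indices at which the squared distance is at most 2^-k make the squares summable. They need not
    increase: [k <= phi k] is enough to preserve limits. *)
Lemma l2cvg_ae (u : nat -> T -> R) f : (forall k, l2 (u k)) -> l2 f -> l2cvg u f ->
  exists phi : nat -> nat, (forall k, (k <= phi k)%N) /\
    {ae mu, forall x, (fun k => u (phi k) x) @ \oo --> f x}.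
Proof.
move=> lu lf uf.
have h k : exists m : nat, (k <= m)%N /\
    ip (fun x => u m x - f x) (fun x => u m x - f x) <= 2^-1 ^+ k.
  have e0 : 0 < 2^-1 ^+ k :> R by rewrite exprn_gt0.
  have /cvgrPdist_le/(_ _ e0)[N _ hN] := uf.
  exists (maxn k N); split; first exact: leq_maxl.
  have := hN (maxn k N) (leq_maxr _ _); rewrite sub0r normrN ger0_norm //; exact: ip_ge0.
have [phi hphi] := boolp.choice h.
exists phi; split; first by move=> k; case: (hphi k).
have l2d k : l2 (fun x => u (phi k) x - f x) by exact: l2B.
have : {ae mu, forall x, cvgn (series (fun k => (u (phi k) x - f x) ^+ 2))}.
  apply: (@ae_summable (fun k x => (u (phi k) x - f x) ^+ 2) 2).
  - by move=> k; apply: measurable_funX; case: (l2d k).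
  - by move=> k x; rewrite sqr_ge0.
  - by move=> k; case: (l2d k).
  - move=> N; apply: (@le_trans _ _ (\sum_(0 <= k < N) 2^-1 ^+ k)).
      by apply: ler_sum => k _; under eq_Rintegral do rewrite expr2; case: (hphi k).
    have : series (geometric 1 (2^-1 : R)) N <= 1 * (1 - 2^-1)^-1.
      by apply: geometric_le_lim; rewrite ?ger0_norm //; lra.
    rewrite seriesEnat /=; under eq_bigr do rewrite mul1r.
    by have -> : 1 * (1 - 2^-1)^-1 = 2 :> R by rewrite mul1r (_ : 1 - 2^-1 = 2^-1) ?invrK //; lra.
apply: filterS => x /cvg_series_cvg_0 h0.
by apply/subr_cvg0; exact: sqr_cvg0.
Qed.

Lemma l2cvg_ip (u v : nat -> T -> R) f g : (forall k, l2 (u k)) -> (forall k, l2 (v k)) -> l2 f -> l2 g ->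
  l2cvg u f -> l2cvg v g -> (fun k => ip (u k) (v k)) @ \oo --> ip f g.
Proof.
move=> lu lv lf lg uf vg.
have H (w : nat -> T -> R) p q : (forall k, l2 (w k)) -> l2 p -> l2 q -> l2cvg w p ->
    (fun k => ip (fun x => w k x - p x) q) @ \oo --> (0 : R).
  move=> lw lp lq wp; apply: sqr_cvg0.
  apply: (@squeeze0 _ (fun k => ip (fun x => w k x - p x) (fun x => w k x - p x) * ip q q)).
    by move=> k; rewrite sqr_ge0 /=; apply: ip_CS => //; exact: l2B.
  by rewrite -[X in _ --> X](mul0r (ip q q)); apply: cvgMl.
have H2 : (fun k => ip (fun x => u k x - f x) (fun x => v k x - g x)) @ \oo --> (0 : R).
  apply: sqr_cvg0.
  apply: (@squeeze0 _ (fun k => ip (fun x => u k x - f x) (fun x => u k x - f x) * ip (fun x => v k x - g x) (fun x => v k x - g x))).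
    by move=> k; rewrite sqr_ge0 /=; apply: ip_CS => //; exact: l2B.
  by rewrite -[X in _ --> X](mul0r 0); apply: cvgM.
have := cvgD (cvgD H2 (H u f g lu lf lg uf)) (H v g f lv lg lf vg).
move=> /(_ _ _); rewrite !addr0 => h; apply/subr_cvg0; apply: cvg_trans h; apply: near_eq_cvg; apply: nearW => k /=.
have luf := l2B (lu k) lf; have lvg := l2B (lv k) lg.
rewrite !fctE !(ipBl (lu k) lf) // !(ipBl (lv k) lg) // !(ipBr (lv k) lg) // (ipC g f) (ipC f g) (ipC (v k) f).
rewrite (ipC g f); lra.
Qed.

(** Completeness of L^2: a subsequence with squared increments at most 4^-k converges almost
    everywhere, and Fatou's lemma turns the Cauchy condition into convergence to that limit. *)
Lemma l2cvg_cauchy (u : nat -> T -> R) : (forall k, l2 (u k)) ->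
  (forall e, 0 < e -> exists N, forall j k, (N <= j)%N -> (N <= k)%N ->
     ip (fun x => u j x - u k x) (fun x => u j x - u k x) <= e) ->
  exists f, l2 f /\ l2cvg u f.
Proof.
move=> lu hu.
have h k : exists m : nat, forall i j, (m <= i)%N -> (m <= j)%N ->
    ip (fun x => u i x - u j x) (fun x => u i x - u j x) <= 4^-1 ^+ k.
  by apply: hu; rewrite exprn_gt0.
have [psi hpsi] := boolp.choice h.
(* The running maximum makes the indices nondecreasing and at least [k]. *)
pose phi := fix phi k := if k is k'.+1 then maxn (phi k') (maxn k (psi k)) else psi 0%N.
have psiphi k : (psi k <= phi k)%N by case: k => //= k; rewrite !leq_max leqnn !orbT.
have phi_le k : (phi k <= phi k.+1)%N by exact: leq_maxl.
pose dd k x := u (phi k.+1) x - u (phi k) x.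
have ld k : l2 (dd k) by exact: l2B.
have hd k : ip (dd k) (dd k) <= 4^-1 ^+ k.
  by apply: (hpsi k); [exact: leq_trans (phi_le k)|exact: psiphi].
have S1 : {ae mu, forall x, cvgn (series (fun k => 2 ^+ k * dd k x ^+ 2))}.
  apply: (@ae_summable (fun k x => 2 ^+ k * dd k x ^+ 2) 2).
  - by move=> k; apply: measurable_funM => //; apply: measurable_funX; case: (ld k).
  - by move=> k x; rewrite mulr_ge0 ?sqr_ge0 // exprn_ge0.
  - move=> k; have [_ Id] := ld k; have := integrableZl measurableT (2 ^+ k) Id.
    by apply: eq_integrable => // x _ /=; rewrite -EFinM.
  - move=> N; apply: (@le_trans _ _ (\sum_(0 <= k < N) 2^-1 ^+ k)).
      apply: ler_sum => k _; rewrite RintegralZl //; last by case: (ld k).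
      under eq_Rintegral do rewrite expr2.
      apply: (@le_trans _ _ (2 ^+ k * 4^-1 ^+ k)); first by rewrite ler_wpM2l ?exprn_ge0 //; exact: hd.
      by rewrite -exprMn (_ : 2 * 4^-1 = 2^-1) //; lra.
    have : series (geometric 1 (2^-1 : R)) N <= 1 * (1 - 2^-1)^-1.
      by apply: geometric_le_lim; rewrite ?ger0_norm //; lra.
    rewrite seriesEnat /=; under eq_bigr do rewrite mul1r.
    by have -> : 1 * (1 - 2^-1)^-1 = 2 :> R by rewrite mul1r (_ : 1 - 2^-1 = 2^-1) ?invrK //; lra.
have S2 : {ae mu, forall x, cvgn (fun k => u (phi k) x)}.
  apply: filterS S1 => x S1.
  (* Since |d| <= 2^k d^2 + 2^-k, adding a geometric series turns the weighted square summability
     into absolute summability of the increments. *)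
  have S3 : cvgn (series (fun k => 2 ^+ k * dd k x ^+ 2 + 2^-1 ^+ k)).
    have hg : cvgn (series (geometric 1 (2^-1 : R))).
      by apply: is_cvg_geometric_series; rewrite ger0_norm //; lra.
    have := is_cvg_seriesD S1 hg; rewrite [X in series X](_ : _ = (fun k => 2 ^+ k * dd k x ^+ 2 + 2^-1 ^+ k)) //.
    by apply/funext => k; rewrite fctE /= mul1r.
  have S4 : cvgn [normed series (fun k => dd k x)].
    apply: series_le_cvg S3 => k /=; first exact: normr_ge0.
      by rewrite addr_ge0 // ?exprn_ge0 // mulr_ge0 ?sqr_ge0 ?exprn_ge0.
    have a0 : 0 < 2 ^+ k :> R by rewrite exprn_gt0.
    have b0 : 0 < 2^-1 ^+ k :> R by rewrite exprn_gt0.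
    have ab : 2 ^+ k * 2^-1 ^+ k = 1 :> R by rewrite -exprMn mulfV ?expr1n.
    move: a0 b0 ab; set a := 2 ^+ k; set b := 2^-1 ^+ k => a0 b0 ab.
    rewrite -(real_normK (num_real (dd k x))); set t := `|dd k x|.
    have t0 : 0 <= t by exact: normr_ge0.
    have : 0 <= a * (t - b) ^+ 2 by rewrite mulr_ge0 ?sqr_ge0 // ltW.
    have e1 : a * (b * t) = t by rewrite mulrA ab mul1r.
    have e2 : a * (b * b) = b by rewrite mulrA ab mul1r.
    rewrite (_ : a * (t - b) ^+ 2 = a * t ^+ 2 - 2 * (a * (b * t)) + a * (b * b)); last lra.
    rewrite e1 e2; lra.
  have := normed_cvg S4.
  have -> : series (fun k => dd k x) = (fun k => u (phi k) x - u (phi 0%N) x).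
    apply/funext => N; rewrite seriesEnat /= /dd.
    by rewrite telescope_sumr.
  move=> /cvg_ex[l hl]; apply/cvg_ex; exists (l + u (phi 0%N) x).
  rewrite (_ : (fun k => u (phi k) x) = (fun k => (u (phi k) x - u (phi 0%N) x) + u (phi 0%N) x)); last by apply/funext => k; rewrite subrK.
  by apply: cvgD => //; exact: cvg_cst.
(* An upper limit is measurable on the whole space and equals the limit wherever that exists. *)
pose f x := limn_esup (fun k => (u (phi k) x)%:E).
have mf : measurable_fun setT (fine \o f).
  apply: measurableT_comp => //; apply: measurable_fun_limn_esup => k.
  by apply/measurable_EFinP; case: (lu (phi k)).
have cf : {ae mu, forall x, (fun k => u (phi k) x) @ \oo --> fine (f x)}.
  apply: filterS S2 => x /cvg_ex[l hl].
  have hl' : (fun k => (u (phi k) x)%:E) @ \oo --> l%:E by apply: cvg_EFin => //; exact: nearW.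
  by rewrite /f (cvg_limn_einf_sup hl').2.
have key e N : (forall j k, (N <= j)%N -> (N <= k)%N ->
     ip (fun x => u j x - u k x) (fun x => u j x - u k x) <= e) -> forall j, (N <= j)%N ->
   l2 (fun x => u j x - fine (f x)) /\ ip (fun x => u j x - fine (f x)) (fun x => u j x - fine (f x)) <= e.
  move=> hN j Nj.
  apply: (@l2_fatou (fun k x => u j x - u (phi k) x)).
  - by move=> k; exact: l2B.
  - by apply: measurable_funB => //; case: (lu j).
  - by apply: filterS cf => x hx; apply: cvgB => //; exact: cvg_cst.
  - exists N => // k Nk; apply: hN => //; apply: leq_trans Nk _.
    by case: k => //= k; rewrite !leq_max leqnn !orbT.
exists (fine \o f).
have lf : l2 (fine \o f).
  have [N hN] := hu 1 ltr01; have [h1 _] := key 1 N hN N (leqnn N).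
  have := l2B (lu N) h1; congr l2; apply/funext => x /=; lra.
split => //; apply: cvg0_eps => e e0; have [N hN] := hu e e0.
exists N => // k Nk; rewrite ger0_norm ?ip_ge0 //.
by have [_] := key e N hN k Nk.
Qed.

Lemma l2cvgD (u v : nat -> T -> R) f g : (forall k, l2 (u k)) -> (forall k, l2 (v k)) -> l2 f -> l2 g ->
  l2cvg u f -> l2cvg v g -> l2cvg (fun k x => u k x + v k x) (fun x => f x + g x).
Proof.
move=> lu lv lf lg uf vg.
apply: (@squeeze0 _ (fun k => 2 * ip (fun x => u k x - f x) (fun x => u k x - f x) + 2 * ip (fun x => v k x - g x) (fun x => v k x - g x))).
  move=> k; rewrite ip_ge0 /=.
  apply: le_trans (ipD_le (l2B (lu k) lf) (l2B (lv k) lg)).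
  by rewrite le_eqVlt; apply/orP; left; apply/eqP; apply: eq_Rintegral => x _; congr (_ * _); lra.
exact: cvg0_lin.
Qed.

Lemma l2cvg_bdM h C (u : nat -> T -> R) f : measurable_fun setT h -> (forall x, `|h x| <= C) ->
  (forall k, l2 (u k)) -> l2 f -> l2cvg u f -> l2cvg (fun k x => h x * u k x) (fun x => h x * f x).
Proof.
move=> mh hC lu lf uf.
apply: (@squeeze0 _ (fun k => C ^+ 2 * ip (fun x => u k x - f x) (fun x => u k x - f x))).
  move=> k; rewrite ip_ge0 /=; have ld := l2B (lu k) lf.
  rewrite expr2 -mulrA -ipZl // -?ipZr //; try exact: l2Z.
  have -> : (fun x => h x * u k x - h x * f x) = (fun x => h x * (u k x - f x)).
    by apply/funext => x; rewrite mulrBr.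
  apply: ip_le; first exact: l2Z.
    by apply: measurable_funM => //; case: ld.
  move=> x; rewrite !normrM ler_wpM2r // (le_trans (hC x)) //; exact: ler_norm.
by rewrite -[X in _ --> X](mulr0 (C ^+ 2)); apply: cvgMr.
Qed.

Lemma l2cvg_unique (u : nat -> T -> R) f g : (forall k, l2 (u k)) -> l2 f -> l2 g ->
  l2cvg u f -> l2cvg u g -> {ae mu, forall x, f x = g x}.
Proof.
move=> lu lf lg uf ug.
suff h : ip (fun x => f x - g x) (fun x => f x - g x) = 0.
  have := ip_eq0 (l2B lf lg) h; apply: filterS => x /eqP; rewrite subr_eq0 => /eqP //.
apply/eqP; rewrite eq_le ip_ge0 andbT.
have c : (fun k : nat => ip (fun x => f x - g x) (fun x => f x - g x)) @ \oo --> (0 : R).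
  apply: (@squeeze0 _ (fun k => 2 * ip (fun x => u k x - f x) (fun x => u k x - f x) + 2 * ip (fun x => u k x - g x) (fun x => u k x - g x))); last exact: cvg0_lin.
  move=> k; rewrite ip_ge0 /=.
  have := ipD_le (l2N (l2B (lu k) lf)) (l2B (lu k) lg).
  rewrite [X in _ <= _ * X + _](_ : _ = ip (fun x => u k x - f x) (fun x => u k x - f x)); last first.
    by apply: eq_Rintegral => x _; rewrite mulrNN.
  apply: le_trans; rewrite le_eqVlt; apply/orP; left; apply/eqP; apply: eq_Rintegral => x _; congr (_ * _); lra.
have cc : (fun k : nat => ip (fun x => f x - g x) (fun x => f x - g x)) @ \oo --> ip (fun x => f x - g x) (fun x => f x - g x) by exact: cvg_cst.
have -> // : ip (fun x => f x - g x) (fun x => f x - g x) = 0 by exact: cvg_unique cc c.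
Qed.

Lemma l2cvg_ae_limit (u : nat -> T -> R) f g : (forall k, l2 (u k)) -> l2 f -> l2cvg u f ->
  {ae mu, forall x, (fun k => u k x) @ \oo --> g x} -> {ae mu, forall x, f x = g x}.
Proof.
move=> lu lf uf ug; have [phi [phik h]] := l2cvg_ae lu lf uf.
apply: filterS2 h ug => x h1 h2.
have phioo : phi @ \oo --> \oo.
  by move=> A [N _ hN]; exists N => // k /= Nk; apply: hN; apply: leq_trans (phik k).
have h3 : (fun k => u (phi k) x) @ \oo --> g x by exact: cvg_comp phioo h2.
exact: cvg_unique h1 h3.
Qed.

Lemma l2cvg_dominated (u : nat -> T -> R) f g : l2 g ->
  (forall k, measurable_fun setT (u k)) -> measurable_fun setT f ->
  {ae mu, forall x, (fun k => u k x) @ \oo --> f x} ->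
  (forall k x, `|u k x| <= g x) -> (forall x, `|f x| <= g x) -> l2cvg u f.
Proof.
move=> lg mu_ mf uf ug fg.
have mk k : measurable_fun setT (fun x => u k x - f x) by exact: measurable_funB.
have [||||| _] := @dominated_Rint (fun k x => (u k x - f x) * (u k x - f x)) (fun=> 0) (fun x => 4 * g x ^+ 2).
- by move=> k; exact: measurable_funM.
- exact: measurable_cst.
- apply: filterS uf => x h; rewrite -[X in _ --> X](mulr0 0).
  by apply: cvgM; exact/subr_cvg0.
- have [_ Ig] := lg; have := integrableZl measurableT 4 Ig.
  by apply: eq_integrable => // x _ /=; rewrite -EFinM.
- move=> k x; have := ug k x; have := fg x; rewrite -expr2 [X in _ -> _ -> X <= _]ger0_norm ?sqr_ge0 //.
  rewrite !ler_norml => /andP[h1 h2] /andP[h3 h4].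
  have : 0 <= (2 * g x - (u k x - f x)) * (2 * g x + (u k x - f x)) by apply: mulr_ge0; lra.
  lra.
have -> : \int[mu]_x (fun=> (0:R)) x = 0 by rewrite Rintegral_cst // mul0r.
by [].
Qed.

End L2_theory.

(** * Smooth functions *)

Section smooth_real.
Context {R : realType}.
Implicit Types F G : R -> R.

Fixpoint Ck1 (k : nat) F : Prop :=
  continuous F /\
  match k with
  | 0 => True
  | k'.+1 => (forall x, derivable F x (1:R)) /\ Ck1 k' (derive1 F)
  end.

Definition smooth1 F := forall k, Ck1 k F.

Lemma is_derive_continuous F F' : (forall x, is_derive x (1:R) F (F' x)) -> continuous F.
Proof.
move=> h x; apply: differentiable_continuous; apply/derivable1_diffP; exact: ex_derive.
Qed.

Lemma Ck1_intro k F F' : (forall x, is_derive x (1:R) F (F' x)) -> Ck1 k F' -> Ck1 k.+1 F.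
Proof.
move=> h hF'; split; first exact: is_derive_continuous h.
split; first by move=> x; exact: ex_derive.
suff -> : derive1 F = F' by [].
by apply/funext => x; rewrite derive1E; exact: derive_val.
Qed.

Lemma Ck1_cont k F : Ck1 k F -> continuous F.
Proof. by case: k => [|k] []. Qed.

Lemma Ck1_mono k F : Ck1 k.+1 F -> Ck1 k F.
Proof.
elim: k F => [|k IH] F; first by case.
by move=> [cF [dF hF]]; split => //; split => //; exact: IH.
Qed.

Lemma Ck1S k F : Ck1 k.+1 F -> (forall x, is_derive x (1:R) F (derive1 F x)) /\ Ck1 k (derive1 F).
Proof.
by move=> [_ [dF hF]]; split => // x; rewrite derive1E; exact/derivableP.
Qed.

Lemma Ck1_cst k (c : R) : Ck1 k (fun=> c).
Proof.
elim: k c => [|k IH] c; first by split => //; exact: cst_continuous.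
exact: (Ck1_intro (fun x => is_derive_cst c x (1:R)) (IH 0)).
Qed.

Lemma Ck1_id k : Ck1 k (fun x => x).
Proof.
case: k => [|k]; first by split => // x; exact: cvg_id.
exact: (Ck1_intro (fun x => is_derive_id x (1:R)) (Ck1_cst k 1)).
Qed.

Lemma Ck1D k F G : Ck1 k F -> Ck1 k G -> Ck1 k (fun x => F x + G x).
Proof.
elim: k F G => [|k IH] F G; first by move=> [cF _] [cG _]; split => // x; exact: cvgD (cF x) (cG x).
move=> /Ck1S[dF hF] /Ck1S[dG hG].
exact: (Ck1_intro (fun x => is_deriveD (dF x) (dG x)) (IH _ _ hF hG)).
Qed.

Lemma Ck1M k F G : Ck1 k F -> Ck1 k G -> Ck1 k (fun x => F x * G x).
Proof.
elim: k F G => [|k IH] F G; first by move=> [cF _] [cG _]; split => // x; exact: cvgM (cF x) (cG x).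
move=> hF hG; have /Ck1S[dF hF'] := hF; have /Ck1S[dG hG'] := hG.
apply: (Ck1_intro (fun x => is_deriveM (dF x) (dG x))).
by apply: Ck1D; apply: IH => //; exact: Ck1_mono.
Qed.

Lemma Ck1Z k (a : R) F : Ck1 k F -> Ck1 k (fun x => a * F x).
Proof. by move=> h; exact: Ck1M (Ck1_cst k a) h. Qed.

Lemma Ck1_comp k F G : Ck1 k F -> Ck1 k G -> Ck1 k (fun x => F (G x)).
Proof.
elim: k F G => [|k IH] F G.
  by move=> [cF _] [cG _]; split => // x; apply: continuous_comp (cG x) (cF _).
move=> hF hG; have /Ck1S[dF hF'] := hF; have /Ck1S[dG hG'] := hG.
apply: (Ck1_intro (fun x => is_derive1_comp (dF (G x)) (dG x))).
apply: Ck1M hG'; apply: IH => //; exact: Ck1_mono.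
Qed.

Lemma Ck1V k F : (forall x, F x != 0) -> Ck1 k F -> Ck1 k (fun x => (F x)^-1).
Proof.
move=> F0; elim: k => [|k IH].
  by move=> [cF _]; split => // x; apply: cvgV => //; exact: cF.
move=> hF; have /Ck1S[dF hF'] := hF.
have dV x : is_derive x (1:R) (fun x => (F x)^-1) (- ((F x)^-1 * (F x)^-1 * derive1 F x)).
  have := is_deriveV (F0 x) (dF x).
  by move/is_derive_eq; apply; rewrite /GRing.scale /= expr2 invfM mulNr.
apply: (Ck1_intro dV).
have hV := IH (Ck1_mono hF).
rewrite (_ : (fun _ => _) = (fun x => (-1) * ((F x)^-1 * (F x)^-1 * derive1 F x))).
  by apply: Ck1Z; apply: Ck1M => //; exact: Ck1M.
by apply/funext => x; rewrite mulN1r.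
Qed.

Lemma is_derive_sqpowR (a d t : R) : 0 < d ->
  is_derive t (1:R) (fun t => (t ^+ 2 + d) `^ a) (2 * a * t * (t ^+ 2 + d) `^ (a - 1)).
Proof.
move=> d0; have pos : 0 < t ^+ 2 + d :> R by rewrite ltr_wpDl ?sqr_ge0.
have h : is_derive t (1:R) (fun t => t ^+ 2 + d) (2 * t).
  have := @is_deriveD _ _ _ _ _ t (1:R) _ _ (@is_deriveM _ _ _ _ t (1:R) _ _ (is_derive_id t 1) (is_derive_id t 1)) (is_derive_cst d t 1).
  by move/is_derive_eq; apply; rewrite /GRing.scale /= addr0 mulr1; lra.
have := @is_derive1_comp R (fun x => x `^ a) (fun t => t ^+ 2 + d) t _ _ (is_derive1_powR a pos) h.
by move/is_derive_eq; apply; lra.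
Qed.

Lemma Ck1_powR k (d a : R) : 0 < d -> Ck1 k (fun t => (t ^+ 2 + d) `^ a).
Proof.
move=> d0; have dd a' t := is_derive_sqpowR a' t d0; elim: k a => [|k IH] a.
  by split => //; exact: (is_derive_continuous (dd a)).
apply: (Ck1_intro (dd a)); apply: Ck1M (IH _).
by apply: Ck1Z; exact: Ck1_id.
Qed.

(* p(1/t) e^(-1/t), extended by 0 to t <= 0: a class of functions stable
   under differentiation. *)
Definition flat (p : {poly R}) (t : R) : R :=
  if 0 < t then p.[t^-1] * expR (- t^-1) else 0.

(** With y = 1/t, the bound y^(i+1) <= (i+1)! e^y absorbs each monomial of p and leaves a factor t
    to spare, which gives both continuity and the derivative at 0. *)
Lemma flat_bound p : exists2 K, 0 <= K & forall t, `|flat p t| <= K * `|t|.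
Proof.
exists (\sum_(i < size p) `|p`_i| * i.+1`!%:R).
  by apply: sumr_ge0 => i _; rewrite mulr_ge0.
move=> t; rewrite /flat; case: ifPn => t0; last first.
  by rewrite normr0 mulr_ge0 //; apply: sumr_ge0 => i _; rewrite mulr_ge0.
have y0 : 0 < t^-1 by rewrite invr_gt0.
rewrite (gtr0_norm t0) -ler_pdivrMr //.
rewrite normrM (gtr0_norm (expR_gt0 _)) -mulrA horner_coef.
apply: (@le_trans _ _ ((\sum_(i < size p) `|p`_i| * t^-1 ^+ i) * (expR (- t^-1) * t^-1))).
  apply: ler_wpM2r; first by rewrite mulr_ge0 ?expR_ge0 // ltW.
  apply: le_trans (ler_norm_sum _ _ _) _; apply: ler_sum => i _.
  by rewrite normrM normrX (gtr0_norm y0).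
rewrite mulr_suml; apply: ler_sum => i _; rewrite -mulrA ler_wpM2l //.
rewrite mulrCA -exprSr expRN mulrC ler_pdivrMr ?expR_gt0 //.
have f0 : 0 < i.+1`!%:R :> R by rewrite ltr0n fact_gt0.
rewrite mulrC -ler_pdivrMr //; apply: le_trans (expR_ge1Dxn i (ltW y0)).
by rewrite lerDr.
Qed.

Lemma flat_cvg0 p : flat p @ (0:R)^' --> (0:R).
Proof.
have [K K0 hK] := flat_bound p; apply/norm_cvg0P.
apply: (@squeeze_cvgr _ _ _ _ (fun=> 0) (fun t => K * `|t|)).
- by apply: nearW => t; rewrite normr_ge0 hK.
- exact: cvg_cst.
- rewrite -[X in _ --> X](mulr0 K); apply: cvgMr; rewrite -[X in _ --> X](normr0 R).
  by apply: cvg_within_filter; apply: norm_continuous.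
Qed.

(** With y = 1/t, the derivative of p(y) e^(-y) in t is y^2 (p(y) - p'(y)) e^(-y). *)
Definition flatD (p : {poly R}) : {poly R} := 'X^2 * (p - p^`()).

Lemma flat_derive p t : is_derive t (1:R) (flat p) (flat (flatD p) t).
Proof.
have [t0|t0|->] := ltgtP t 0.
- have -> : flat (flatD p) t = 0 by rewrite /flat ltNge (ltW t0).
  apply: near_eq_is_derive (is_derive_cst (0:R) t (1:R)).
  near=> z; rewrite /flat ltNge (_ : z <= 0) //; apply: ltW.
  by near: z; exact: lt_nbhsl.
- have -> : flat (flatD p) t = (p.[t^-1] * (expR (- t^-1) * t ^- 2) + expR (- t^-1) * (p^`().[t^-1] * - t^-2)).
    rewrite /flat t0 /flatD hornerM hornerXn hornerD hornerN exprVn; lra.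
  have dV : is_derive t (1:R) (fun t => t^-1) (- t^-2).
    have := @is_deriveV R id t 1 1 (lt0r_neq0 t0) (is_derive_id t (1:R)).
    by move/is_derive_eq; apply; rewrite /GRing.scale /= mulr1.
  have dP : is_derive t (1:R) (fun t => p.[t^-1]) (p^`().[t^-1] * - t^-2).
    have h : is_derive t^-1 (1:R) (horner p) (p^`().[t^-1]).
      by rewrite -[p^`().[_]]/(horner p^`() t^-1) derivE derive1E; apply/derivableP; exact: derivable_horner.
    exact: (is_derive1_comp h dV).
  have dE : is_derive t (1:R) (fun t => expR (- t^-1)) (expR (- t^-1) * t^-2).
    have := @is_derive1_comp R expR (fun t => - t^-1) t _ _ (is_derive_expR (- t^-1)) (is_deriveN dV).
    by move/is_derive_eq; apply; rewrite opprK.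
  apply: near_eq_is_derive (is_deriveM dP dE).
  near=> z; rewrite /flat (_ : 0 < z) //.
  by near: z; exact: lt_nbhsr.
(* At 0 the difference quotient belongs to the same class, namely [flat ('X * p)], and so tends to
   0. *)
- rewrite {2}/flat ltxx.
  have h : (fun h : R => h^-1 *: ((flat p \o shift 0) (h *: (1:R)) - flat p 0)) @ (0:R)^' --> (0:R).
    apply: cvg_trans (flat_cvg0 ('X * p)); apply: near_eq_cvg; near=> h.
    rewrite /flat /= !ltxx addr0 subr0 [h *: _]mulr1; case: ifPn => h0; last by rewrite scaler0.
    by rewrite !hornerE /GRing.scale /= mulrA.
  apply: DeriveDef; first by apply/cvg_ex; exists 0.
  exact: cvg_lim h.
Unshelve. all: by end_near. Qed.

Lemma smooth_flat p : smooth1 (flat p).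
Proof.
move=> k; elim: k p => [|k IH] p.
  by split => //; exact: is_derive_continuous (flat_derive p).
exact: (Ck1_intro (flat_derive p) (IH _)).
Qed.

(** Smooth substitute for the positive part: nondecreasing, positive exactly on t > 0, with a
    bounded derivative. It also builds the cut-offs. *)
Definition bump0 : R -> R := flat 1.

Lemma bump0E t : bump0 t = if 0 < t then expR (- t^-1) else 0.
Proof. by rewrite /bump0 /flat; case: ifP => // _; rewrite hornerC mul1r. Qed.

Lemma bump0_ge0 t : 0 <= bump0 t.
Proof. by rewrite bump0E; case: ifP => // _; exact: expR_ge0. Qed.

Lemma bump0_gt0 t : (0 < bump0 t) = (0 < t).
Proof. by rewrite bump0E; case: ifP => h; rewrite ?expR_gt0 ?ltxx. Qed.

Lemma bump0_le0 t : t <= 0 -> bump0 t = 0.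
Proof. by move=> h; rewrite bump0E ltNge h. Qed.

Lemma bump0_derive t : derive1 bump0 t = flat 'X^2 t.
Proof.
rewrite derive1E (derive_val (is_derive := flat_derive 1 t)) /flatD derivC subr0 mulr1 //.
Qed.

(** With y = 1/t the derivative is y^2 e^(-y), and e^y >= 1 + y^2/2. *)
Lemma bump0_derive_bound t : 0 <= derive1 bump0 t <= 2.
Proof.
rewrite bump0_derive /flat; case: ifPn => t0; last by rewrite lexx ler0n.
rewrite hornerXn mulr_ge0 ?exprn_ge0 ?invr_ge0 ?expR_ge0 ?(ltW t0) //=.
have y0 : 0 <= t^-1 by rewrite invr_ge0 ltW.
have := expR_ge1Dxn 1 y0; rewrite expRN ler_pdivrMr ?expR_gt0 // (_ : 2`!%:R = 2) //.
lra.
Qed.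

Lemma bump0_mono : {homo bump0 : x y / x <= y}.
Proof.
move=> x y xy; rewrite !bump0E; case: ifPn => x0; last by case: ifP => // _; exact: expR_ge0.
rewrite (lt_le_trans x0 xy) ler_expR lerN2 lef_pV2 ?posrE //; exact: lt_le_trans xy.
Qed.

Definition sstep (t : R) : R := bump0 t / (bump0 t + bump0 (1 - t)).

Lemma sstep_den t : 0 < bump0 t + bump0 (1 - t).
Proof.
have [t0|t0] := ltP 0 t; first by rewrite ltr_pwDl ?bump0_gt0 ?bump0_ge0.
by rewrite ltr_wpDl ?bump0_ge0 // bump0_gt0; lra.
Qed.

Lemma smooth_sstep : smooth1 sstep.
Proof.
move=> k; apply: Ck1M; first exact: smooth_flat.
apply: Ck1V; first by move=> x; rewrite gt_eqF // sstep_den.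
apply: Ck1D; first exact: smooth_flat.
apply: Ck1_comp; first exact: smooth_flat.
apply: Ck1D; first exact: Ck1_cst.
rewrite (_ : -%R = (fun x => (-1) * x)); last by apply/funext => x; rewrite mulN1r.
by apply: Ck1Z; exact: Ck1_id.
Qed.

Lemma sstep_le0 t : t <= 0 -> sstep t = 0.
Proof. by move=> t0; rewrite /sstep bump0_le0 // mul0r. Qed.

Lemma sstep_ge1 t : 1 <= t -> sstep t = 1.
Proof.
move=> t1; rewrite /sstep (@bump0_le0 (1 - t)); last lra.
by rewrite addr0 mulfV // gt_eqF // bump0_gt0; lra.
Qed.

Lemma sstep_01 t : 0 <= sstep t <= 1.
Proof.
rewrite /sstep divr_ge0 ?bump0_ge0 ?(ltW (sstep_den t)) //=.
by rewrite ler_pdivrMr ?sstep_den // mul1r lerDl bump0_ge0.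
Qed.

(** Equal to t on [-M, M] and of compact support. A smooth F with F(0) = 0 composed with it also has
    compact support, hence a bounded derivative. *)
Definition sclamp (M t : R) : R := t * (sstep (M + 1 + t) * sstep (M + 1 - t)).

Lemma smooth_sclamp M : smooth1 (sclamp M).
Proof.
move=> k; apply: Ck1M; first exact: Ck1_id.
have idk := Ck1_id k; have ck := Ck1_cst k (M + 1).
have h : Ck1 k (fun t => M + 1 - t).
  rewrite (_ : (fun t => _) = (fun t => M + 1 + (-1) * t)); last by apply/funext => t; rewrite mulN1r.
  by apply: Ck1D => //; exact: Ck1Z.
apply: Ck1M; apply: Ck1_comp; [exact: smooth_sstep|exact: Ck1D|exact: smooth_sstep|exact: h].
Qed.

Lemma sclamp_id M t : - M <= t <= M -> sclamp M t = t.
Proof. by move=> /andP[h1 h2]; rewrite /sclamp !sstep_ge1 ?mulr1 //; lra. Qed.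

Lemma sclamp_out M t : M + 1 <= `|t| -> sclamp M t = 0.
Proof.
rewrite ler_normr => /orP[h|h]; rewrite /sclamp.
  by rewrite (@sstep_le0 (M + 1 - t)) ?mulr0 //; lra.
by rewrite (@sstep_le0 (M + 1 + t)) ?mul0r ?mulr0 //; lra.
Qed.

Lemma smooth_derive_bounded (F : R -> R) a : smooth1 F -> (forall t, a <= `|t| -> F t = 0) ->
  exists2 C, 0 <= C & forall t, `|derive1 F t| <= C.
Proof.
move=> sF F0; have [_ hF'] := Ck1S (sF 1%N); have cF' := Ck1_cont hF'.
have [c _ hc] : exists2 c, c \in `[- (`|a| + 1), `|a| + 1] & forall t, t \in `[- (`|a| + 1), `|a| + 1] -> `|derive1 F t| <= `|derive1 F c|.
  apply: (@EVT_max R (fun t => `|derive1 F t|)).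
    by have := normr_ge0 a; lra.
  apply: continuous_subspaceT => x; apply: continuous_comp; [exact: cF'|exact: norm_continuous].
exists `|derive1 F c| => // t.
have [h|h] := leP `|t| (`|a| + 1); first by apply: hc; rewrite in_itv /= -ler_norml.
suff -> : derive1 F t = 0 by rewrite normr0.
rewrite derive1E; have -> : 'D_1 F t = 'D_1 (fun=> 0) t; last by rewrite derive_cst.
apply: near_eq_derive; near=> z; apply: F0.
have h2 : `|t - z| < 1 by near: z; exact: (@nbhsx_ballx _ R t 1 ltr01).
have := ler_norm a; have := ler_normD (t - z) z; rewrite subrK; lra.
Unshelve. all: by end_near. Qed.

End smooth_real.

(** * Smooth functions of several variables *)

Section smooth_rV.
Context {R : realType} {n : nat}.
Local Notation V := 'rV[R]_n.
Local Notation e_ i := (delta_mx ord0 i : V).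
Implicit Types f g : V -> R.

Definition smooth f := forall k, Ck k f.

Lemma is_derive_line f (x v : V) (t : R) : derivable f (x + t *: v) v ->
  is_derive t (1:R) (fun t => f (x + t *: v)) ('D_v f (x + t *: v)).
Proof.
move=> df.
have E : (fun h : R => h^-1 *: (((fun t : R => f (x + t *: v)) \o shift t) (h *: (1:R)) - f (x + t *: v)))
   = (fun h => h^-1 *: ((f \o shift (x + t *: v)) (h *: v) - f (x + t *: v))).
  apply/funext => h /=; rewrite [h *: (1:R)]mulr1; congr (_ *: (f _ - _)).
  by rewrite scalerDl addrCA.
apply: DeriveDef; first by rewrite /derivable /= E.
by rewrite /derive /= E.
Qed.

(** The inner function is only known to be derivable in the direction v, so the one-variable chain
    rule is applied along the line x + t v. *)
Lemma derivable_comp1 (F : R -> R) f (x v : V) : derivable f x v -> derivable F (f x) (1:R) ->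
  derivable (fun y => F (f y)) x v /\ 'D_v (fun y => F (f y)) x = derive1 F (f x) * 'D_v f x.
Proof.
move=> df dF.
have df' : derivable f (x + 0 *: v) v by rewrite scale0r addr0.
have h1 := is_derive_line df'.
have h2 : is_derive (f (x + 0 *: v)) (1:R) F (derive1 F (f x)).
  by rewrite scale0r addr0 derive1E; exact/derivableP.
have h3 := is_derive1_comp h2 h1.
have E : (fun h : R => h^-1 *: (((fun t : R => F (f (x + t *: v))) \o shift 0) (h *: (1:R)) - F (f (x + 0 *: v))))
   = (fun h => h^-1 *: (((fun y => F (f y)) \o shift x) (h *: v) - F (f x))).
  apply/funext => h /=; rewrite [h%:A]mulr1 addr0 scale0r addr0; congr (_ *: (F (f _) - _)).
  exact: addrC.
split.
  by have := ex_derive (is_derive := h3); rewrite /derivable /= E.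
transitivity (derive1 F (f x) * 'D_v f (x + 0 *: v)); last by rewrite scale0r addr0.
by rewrite -(derive_val (is_derive := h3)) /derive /= E.
Qed.

Lemma Ck_cont k f : Ck k f -> continuous f.
Proof. by case: k => [|k] []. Qed.

Lemma Ck_mono k f : Ck k.+1 f -> Ck k f.
Proof.
elim: k f => [|k IH] f; first by case.
by move=> [cf h]; split => // i; have [dfi hi] := h i; split => //; exact: IH.
Qed.

Lemma Ck_der k f i : Ck k.+1 f -> (forall x, derivable f x (e_ i)) /\ Ck k (partial i f).
Proof. by move=> [_ /(_ i)]. Qed.

Lemma Ck_intro k f (f' : 'I_n -> V -> R) : continuous f ->
  (forall i x, derivable f x (e_ i) /\ partial i f x = f' i x) ->
  (forall i, Ck k (f' i)) -> Ck k.+1 f.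
Proof.
move=> cf df hf'; split => // i; split; first by move=> x; case: (df i x).
suff -> : partial i f = f' i by [].
by apply/funext => x; case: (df i x).
Qed.

Lemma partial_cst (c : R) (i : 'I_n) (x : V) : partial i (fun=> c) x = 0.
Proof. by rewrite /partial derive_cst. Qed.

Lemma Ck_cst k (c : R) : Ck k (fun _ : V => c).
Proof.
elim: k c => [|k IH] c; first by split => //; exact: cst_continuous.
apply: (Ck_intro (f' := fun _ _ => 0)) => //; first exact: cst_continuous.
by move=> i x; split; [exact: derivable_cst|exact: partial_cst].
Qed.

Lemma partialD f g i x : derivable f x (e_ i) -> derivable g x (e_ i) ->
  partial i (fun x => f x + g x) x = partial i f x + partial i g x.
Proof. exact: deriveD. Qed.

Lemma partialM f g i x : derivable f x (e_ i) -> derivable g x (e_ i) ->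
  partial i (fun x => f x * g x) x = f x * partial i g x + g x * partial i f x.
Proof. exact: deriveM. Qed.

Lemma CkD k f g : Ck k f -> Ck k g -> Ck k (fun x => f x + g x).
Proof.
elim: k f g => [|k IH] f g; first by move=> [cf _] [cg _]; split => // x; exact: cvgD (cf x) (cg x).
move=> hf hg; apply: (Ck_intro (f' := fun i x => partial i f x + partial i g x)).
- have cf := Ck_cont hf; have cg := Ck_cont hg; by move=> x; exact: cvgD (cf x) (cg x).
- move=> i x; have [dfi _] := Ck_der i hf; have [dgi _] := Ck_der i hg.
  by split; [exact: derivableD|exact: partialD].
- by move=> i; apply: IH; [case: (Ck_der i hf)|case: (Ck_der i hg)].
Qed.

Lemma CkM k f g : Ck k f -> Ck k g -> Ck k (fun x => f x * g x).
Proof.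
elim: k f g => [|k IH] f g; first by move=> [cf _] [cg _]; split => // x; exact: cvgM (cf x) (cg x).
move=> hf hg; apply: (Ck_intro (f' := fun i x => f x * partial i g x + g x * partial i f x)).
- have cf := Ck_cont hf; have cg := Ck_cont hg; by move=> x; exact: cvgM (cf x) (cg x).
- move=> i x; have [dfi _] := Ck_der i hf; have [dgi _] := Ck_der i hg.
  by split; [exact: derivableM|exact: partialM].
- move=> i; have [_ dfi] := Ck_der i hf; have [_ dgi] := Ck_der i hg.
  by apply: CkD; apply: IH => //; exact: Ck_mono.
Qed.

Lemma Ck_comp1 k (F : R -> R) f : Ck1 k F -> Ck k f -> Ck k (fun x => F (f x)).
Proof.
elim: k F f => [|k IH] F f.
  by move=> [cF _] [cf _]; split => // x; apply: continuous_comp (cf x) (cF _).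
move=> hF hf; have /Ck1S[dF hF'] := hF.
apply: (Ck_intro (f' := fun i x => derive1 F (f x) * partial i f x)).
- by move=> x; apply: continuous_comp; [exact: (Ck_cont hf)|exact: (Ck1_cont hF)].
- move=> i x; have [dfi _] := Ck_der i hf.
  by apply: derivable_comp1 => //; exact: (ex_derive (is_derive := dF _)).
- move=> i; have [_ dfi] := Ck_der i hf.
  by apply: CkM => //; apply: IH => //; exact: Ck_mono.
Qed.

Lemma partial_comp1 (F : R -> R) f i x : Ck1 1 F -> Ck 1 f ->
  partial i (fun x => F (f x)) x = derive1 F (f x) * partial i f x.
Proof.
move=> /Ck1S[dF _] hf; have [dfi _] := Ck_der i hf.
by apply: (proj2 (derivable_comp1 (dfi x) _)); exact: (ex_derive (is_derive := dF _)).
Qed.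

Lemma derive_coord (j : 'I_n) (x v : V) : is_derive x v (fun y : V => y ord0 j) (v ord0 j).
Proof.
have E : (fun h : R => h^-1 *: (((fun y : V => y ord0 j) \o shift x) (h *: v) - x ord0 j)) @ (0:R)^' --> v ord0 j.
  apply: (@cvg_trans _ ((fun=> v ord0 j) @ (0:R)^')); last exact: cvg_cst.
  apply: near_eq_cvg; near=> h; rewrite /= !mxE addrK /GRing.scale /= mulrA mulVf ?mul1r //.
  by near: h; exact: nbhs_dnbhs_neq.
by apply: DeriveDef; [apply/cvg_ex; exists (v ord0 j)|exact: cvg_lim E].
Unshelve. all: by end_near. Qed.

Lemma Ck_coord k (j : 'I_n) : Ck k (fun x : V => x ord0 j).
Proof.
case: k => [|k]; first by split => //; exact: coord_continuous.
apply: (Ck_intro (f' := fun i _ => (e_ i) ord0 j)); first exact: coord_continuous.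
  move=> i x; have h := derive_coord j x (e_ i).
  by split; [exact: (ex_derive (is_derive := h))|exact: (derive_val (is_derive := h))].
by move=> i; exact: Ck_cst.
Qed.

Lemma CkZ k (a : R) f : Ck k f -> Ck k (fun x => a * f x).
Proof. by move=> h; exact: CkM (Ck_cst k a) h. Qed.

Lemma Ck_sum k (I : Type) (r : seq I) (F : I -> V -> R) : (forall i, Ck k (F i)) ->
  Ck k (fun x => \sum_(i <- r) F i x).
Proof.
move=> h; elim: r => [|a r IH].
  by under eq_fun do rewrite big_nil; exact: Ck_cst.
by under eq_fun do rewrite big_cons; exact: CkD.
Qed.

Lemma Ck_prod k (I : Type) (r : seq I) (F : I -> V -> R) : (forall i, Ck k (F i)) ->
  Ck k (fun x => \prod_(i <- r) F i x).
Proof.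
move=> h; elim: r => [|a r IH].
  by under eq_fun do rewrite big_nil; exact: Ck_cst.
by under eq_fun do rewrite big_cons; exact: CkM.
Qed.

End smooth_rV.

Lemma measurable_gt0 d (T : measurableType d) (R : realType) (f : T -> R) :
  measurable_fun setT f -> measurable [set x | 0 < f x].
Proof.
move=> mf; have := mf measurableT `]0, +oo[%classic (measurable_itv _); rewrite setTI.
by congr measurable; apply/seteqP; split => x /=; rewrite in_itv /= andbT.
Qed.

(** * Test functions and cut-offs *)

Section test_functions.
Context {R : realType} {n : nat}.
Local Notation V := 'rV[R]_n.
Local Notation mu := (@lebesgue_rV R n).
Local Notation e_ i := (delta_mx ord0 i : V).
Implicit Types (f g psi : V -> R) (D U : set V).

Definition supp f : set V := [set x | f x != 0].

Lemma closure_min (A B : set V) : A `<=` B -> closed B -> closure A `<=` B.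
Proof. by move=> AB /closure_id ->; exact: closureS. Qed.

Lemma closed_norm_le (rho : R) : closed [set x : V | `|x| <= rho].
Proof.
have -> : [set x : V | `|x| <= rho] = (fun x : V => `|x|) @^-1` [set t | t <= rho] by [].
apply: closed_comp; last exact: closed_le.
by move=> x _; exact: norm_continuous.
Qed.

Lemma compact_norm_le (rho : R) : compact [set x : V | `|x| <= rho].
Proof.
apply: bounded_closed_compact; last exact: closed_norm_le.
exists rho; split; first exact: num_real.
by move=> M rM x /= h; rewrite (le_trans h) // ltW.
Qed.

Lemma closure_norm_le (A : set V) (rho : R) : (forall x, A x -> `|x| <= rho) ->
  closure A `<=` [set x | `|x| <= rho].
Proof. by move=> h; apply: closure_min => //; exact: closed_norm_le. Qed.

Lemma compact_closure_bounded (A : set V) (rho : R) : (forall x, A x -> `|x| <= rho) -> compact (closure A).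
Proof.
move=> h; apply: (@subclosed_compact _ _ [set x | `|x| <= rho]); first exact: closed_closure.
  exact: compact_norm_le.
exact: closure_norm_le.
Qed.

Lemma bounded_normP (A : set V) : bounded_set A -> exists2 rho : R, 0 < rho & forall x, A x -> `|x| <= rho.
Proof.
move=> [M [_ bM]]; exists (`|M| + 1); first by rewrite ltr_wpDl.
by move=> x Ax; apply: bM => //; have := ler_norm M; lra.
Qed.

Lemma compact_closure_normP (A : set V) : compact (closure A) -> exists2 rho : R, 0 < rho & forall x, A x -> `|x| <= rho.
Proof.
move=> /compact_bounded /bounded_normP[rho r0 h]; exists rho => // x Ax; apply: h.
exact: subset_closure.
Qed.

Lemma cpt_inside_sub (A B D : set V) : A `<=` B -> cpt_inside B D -> cpt_inside A D.
Proof.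
move=> AB [cB BD]; split.
  by apply: subclosed_compact cB _; [exact: closed_closure|exact: closureS].
by apply: subset_trans BD; exact: closureS.
Qed.

Lemma cpt_insideU (A B D : set V) : cpt_inside A D -> cpt_inside B D -> cpt_inside (A `|` B) D.
Proof.
move=> [cA AD] [cB BD].
have [rA _ hA] := compact_closure_normP cA; have [rB _ hB] := compact_closure_normP cB.
split; last by rewrite closureU => x [/AD|/BD].
apply: (@compact_closure_bounded _ (Num.max rA rB)) => x [/hA|/hB] h; by rewrite le_max h ?orbT.
Qed.

Lemma Cc_sub D psi f : Cc_smooth D psi -> smooth f -> (forall x, psi x = 0 -> f x = 0) -> Cc_smooth D f.
Proof.
move=> [_ cp] sf h; split => //; apply: cpt_inside_sub cp => x /= fx.
by apply: contra_neq fx => /h.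
Qed.

Lemma CcD D f g : Cc_smooth D f -> Cc_smooth D g -> Cc_smooth D (fun x => f x + g x).
Proof.
move=> [sf cf] [sg cg]; split; first by move=> k; exact: CkD.
apply: cpt_inside_sub (cpt_insideU cf cg) => x /=.
have [->|] := eqVneq (f x) 0; last by left.
by rewrite add0r; right.
Qed.

Lemma CcM D f g : smooth f -> Cc_smooth D g -> Cc_smooth D (fun x => f x * g x).
Proof.
move=> sf hg; apply: (Cc_sub hg); last by move=> x ->; rewrite mulr0.
by move=> k; apply: CkM => //; case: hg.
Qed.

Lemma CcZ D (a : R) f : Cc_smooth D f -> Cc_smooth D (fun x => a * f x).
Proof. by apply: CcM => k; exact: Ck_cst. Qed.

Lemma CcB D f g : Cc_smooth D f -> Cc_smooth D g -> Cc_smooth D (fun x => f x - g x).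
Proof.
move=> hf /(CcZ (-1)) hg; have := CcD hf hg; congr Cc_smooth; apply/funext => x; by rewrite mulN1r.
Qed.

Lemma Cc0 D : Cc_smooth D (fun=> 0).
Proof.
split; first by move=> k; exact: Ck_cst.
have -> : [set x : V | (0:R) != 0] = set0 by apply/seteqP; split => // x /=; rewrite eqxx.
by rewrite /cpt_inside closure0; split => //; exact: compact0.
Qed.

Lemma Cc_mono D U : D `<=` U -> Cc_smooth D `<=` Cc_smooth U.
Proof. by move=> DU f [sf [c h]]; split => //; split => //; exact: subset_trans DU. Qed.

Lemma Cc_out D f x : Cc_smooth D f -> ~ D x -> f x = 0.
Proof.
move=> [_ [_ h]] Dx; apply/eqP; rewrite -[_ == _]negbK; apply/negP => fx; apply: Dx; apply: h.
exact: subset_closure.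
Qed.

Lemma smooth_partial f i : smooth f -> smooth (partial i f).
Proof. by move=> sf k; case: (Ck_der i (sf k.+1)). Qed.

Lemma smooth_derivable f i x : smooth f -> derivable f x (e_ i).
Proof. by move=> sf; case: (Ck_der i (sf 1%N)). Qed.

Lemma smooth_cont f : smooth f -> continuous f.
Proof. by move=> sf; exact: (Ck_cont (sf 0%N)). Qed.

Lemma smooth_meas f : smooth f -> measurable_fun setT f.
Proof. by move=> sf; apply: continuous_measurable_rV; exact: smooth_cont. Qed.

Lemma partial_out f i x : ~ closure (supp f) x -> partial i f x = 0.
Proof.
move=> h; rewrite -(@partial_cst R n 0 i x); apply: near_eq_derive.
have : nbhs x (~` closure (supp f)) by apply: open_nbhs_nbhs; split => //; apply: closed_openC; exact: closed_closure.
apply: filterS => y hy; apply/eqP; rewrite -[_ == _]negbK; apply/negP => fy; apply: hy.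
exact: subset_closure.
Qed.

Lemma Cc_partial D f i : Cc_smooth D f -> Cc_smooth D (partial i f).
Proof.
move=> [sf [cf hf]]; split; first exact: smooth_partial.
have h : supp (partial i f) `<=` closure (supp f).
  by move=> x /=; apply: contra_neqP => /(partial_out i).
have hc : closure (supp (partial i f)) `<=` closure (supp f).
  by apply: closure_min => //; exact: closed_closure.
split; first by apply: subclosed_compact cf hc; exact: closed_closure.
exact: subset_trans hf.
Qed.

Lemma Cc_smoothE D f : Cc_smooth D f -> smooth f. Proof. by case. Qed.

Lemma Cc_meas D f : Cc_smooth D f -> measurable_fun setT f.
Proof. by move=> [sf _]; exact: smooth_meas. Qed.

Lemma Cc_box D f : Cc_smooth D f -> exists2 rho : R, 0 < rho & forall x, rho < `|x| -> f x = 0.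
Proof.
move=> [_ [cf _]]; have [rho r0 h] := compact_closure_normP cf; exists rho => // x hx.
by apply: contraTeq hx => fx; rewrite -leNgt; exact: h.
Qed.

Lemma cont_cpt_bounded f (rho : R) : continuous f -> exists2 C : R, 0 <= C & forall x, `|x| <= rho -> `|f x| <= C.
Proof.
move=> cf; have [[x0 hx0]|h] := pselect (exists x : V, `|x| <= rho); last first.
  by exists 0 => // x hx; exfalso; apply: h; exists x.
have [|||c _ hc] := @compact_EVT_max V R (fun x => `|f x|) [set x | `|x| <= rho].
- by exists x0.
- exact: compact_norm_le.
- apply: continuous_subspaceT => x; apply: continuous_comp; [exact: cf|exact: norm_continuous].
by exists `|f c| => // x hx; apply: hc; rewrite inE.
Qed.

Lemma Cc_bounded D f : Cc_smooth D f -> exists2 C : R, 0 <= C & forall x, `|f x| <= C.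
Proof.
move=> hf; have [rho r0 h] := Cc_box hf.
have [C C0 hC] := cont_cpt_bounded rho (smooth_cont (Cc_smoothE hf)).
exists C => // x; have [/hC//|/h ->] := leP `|x| rho; by rewrite normr0.
Qed.

Lemma mu_norm_le (rho : R) : (mu [set x : V | (`|x| <= rho)%R] < +oo)%E.
Proof.
apply: bounded_set_finite_measure.
  rewrite -(setCK [set x : V | _]); apply: measurableC; apply: open_measurable_rV.
  by apply: closed_openC; exact: closed_norm_le.
by apply: compact_bounded; exact: compact_norm_le.
Qed.

Lemma measurable_norm_le (rho : R) : measurable [set x : V | `|x| <= rho].
Proof.
rewrite -(setCK [set x : V | _]); apply: measurableC; apply: open_measurable_rV.
by apply: closed_openC; exact: closed_norm_le.
Qed.

Lemma bounded_box_integrable f (rho C : R) : measurable_fun setT f -> (forall x, `|f x| <= C) ->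
  (forall x, rho < `|x| -> f x = 0) -> mu.-integrable setT (EFin \o f).
Proof.
move=> mf hC h.
apply: (@integrable_le _ _ _ mu f (fun x => C * \1_[set x : V | `|x| <= rho] x)) => //.
  move=> x; rewrite indicE; have [hx|hx] := leP `|x| rho.
    by rewrite mem_set // mulr1.
  by rewrite (h x hx) normr0 mulr_ge0 //; exact: le_trans (hC x).
have C0 : 0 <= C by exact: le_trans (hC 0).
have mi : measurable_fun setT (EFin \o (\1_[set x : V | `|x| <= rho] : V -> R)).
  by apply/measurable_EFinP; apply: measurable_indic; exact: measurable_norm_le.
apply: (@eq_integrable _ _ _ mu setT measurableT (fun x => C%:E * (EFin \o (\1_[set x : V | (`|x| <= rho)%R] : V -> R)) x)%E) => //.
apply: integrableZl => //; apply/integrableP; split => //.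
under eq_integral => x _ do rewrite /= ger0_norm //.
rewrite integral_indic //; last exact: measurable_norm_le.
by rewrite setIT; exact: mu_norm_le.
Qed.

Lemma bounded_box_l2 f (rho C : R) : measurable_fun setT f -> (forall x, `|f x| <= C) ->
  (forall x, rho < `|x| -> f x = 0) -> l2 mu f.
Proof.
move=> mf hC h; split => //; apply: (@bounded_box_integrable _ rho (C ^+ 2)).
- exact: measurable_funX.
- by move=> x; rewrite normrX lerXn2r ?nnegrE //; exact: le_trans (hC x).
- by move=> x /h ->; rewrite expr0n.
Qed.

Lemma Cc_l2 D f : Cc_smooth D f -> l2 mu f.
Proof.
move=> hf; have [C _ hC] := Cc_bounded hf; have [rho _ h] := Cc_box hf.
exact: bounded_box_l2 (Cc_meas hf) hC h.
Qed.

Lemma Cc_integrable D f : Cc_smooth D f -> mu.-integrable setT (EFin \o f).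
Proof.
move=> hf; have [C _ hC] := Cc_bounded hf; have [rho _ h] := Cc_box hf.
exact: bounded_box_integrable (Cc_meas hf) hC h.
Qed.

Lemma Cc_partial_l2 D f i : Cc_smooth D f -> l2 mu (partial i f).
Proof. by move=> hf; apply: (@Cc_l2 D); exact: Cc_partial. Qed.

(** For the sup norm balls are cubes, so a product of one-dimensional bumps is positive exactly on
    the ball. *)
Lemma bump_ball (x : V) (r : R) : 0 < r -> exists b : V -> R,
  [/\ smooth b, forall y, 0 <= b y, forall y, ball x r y -> 0 < b y & forall y, ~ ball x r y -> b y = 0].
Proof.
move=> r0; pose b (y : V) := \prod_(i < n) bump0 (r ^+ 2 - (y ord0 i - x ord0 i) ^+ 2).
exists b; split.
- move=> k; apply: Ck_prod => i; apply: Ck_comp1; first exact: smooth_flat.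
  have hc : Ck k (fun y : V => y ord0 i - x ord0 i) by apply: CkD; [exact: Ck_coord|exact: Ck_cst].
  have -> : (fun y : V => r ^+ 2 - (y ord0 i - x ord0 i) ^+ 2) = (fun y : V => r ^+ 2 + (-1) * ((y ord0 i - x ord0 i) * (y ord0 i - x ord0 i))).
    by apply/funext => y; rewrite mulN1r -expr2.
  by apply: CkD; [exact: Ck_cst|apply: CkZ; exact: CkM].
- by move=> y; apply: prodr_ge0 => i _; exact: bump0_ge0.
- move=> y [_ h]; apply: prodr_gt0 => i _; rewrite bump0_gt0 subr_gt0.
  have := h ord0 i; rewrite /ball /= distrC => h1.
  by rewrite -(real_normK (num_real (_ - _))) ltrXn2r ?nnegrE // ltW.
- move=> y h; have [i hi] : exists i, r <= `|y ord0 i - x ord0 i|.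
    apply: contrapT => /forallNP h2; apply: h; split => // j i; rewrite (ord1 j) /ball /= distrC.
    by rewrite ltNge; apply/negP; exact: h2.
  rewrite /b (bigD1 i) //= bump0_le0 ?mul0r // subr_le0 -(real_normK (num_real (_ - _))) lerXn2r ?nnegrE //; exact: ltW.
Qed.

(** A sum of bumps over a finite cover of K has a positive minimum on K; it is rescaled and sent
    through [sstep]. The value 1 is reached on a neighbourhood of K and not on K alone, so that
    derivatives of the cut-off vanish there. *)
Lemma urysohn_Cc (K U : set V) : compact K -> open U -> K `<=` U ->
  exists eta : V -> R, [/\ Cc_smooth U eta, forall x, 0 <= eta x <= 1 &
    exists W, [/\ open W, K `<=` W & forall x, W x -> eta x = 1]].
Proof.
move=> cK oU KU.
have [[x0 Kx0]|K0] := pselect (K !=set0); last first.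
  exists (fun=> 0); split; [exact: Cc0|by move=> x; rewrite lexx ler01|].
  exists (set0 : set V); split; [exact: (@open0 V)| |by []].
  by move=> x Kx; exfalso; apply: K0; exists x.
have hr (x : V) : exists r : R, 0 < r /\ (U x -> [set y | `|x - y| <= r] `<=` U).
  have [Ux|nUx] := pselect (U x); last by exists 1.
  have /nbhs_ballP[e /= e0 he] : nbhs x U by exact: open_nbhs_nbhs.
  exists (e / 2); split; first by rewrite divr_gt0.
  move=> _ y hy; apply: he; rewrite mx_norm_ball /ball_ /= (le_lt_trans hy) //.
  by move: (e0 : 0 < e); lra.
have [r hr'] := boolp.choice hr.
have hb (x : V) : exists b : V -> R, [/\ smooth b, forall y, 0 <= b y, forall y, ball x (r x) y -> 0 < b y & forall y, ~ ball x (r x) y -> b y = 0].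
  by apply: bump_ball; case: (hr' x).
have [b hb'] := boolp.choice hb.
have := cK; rewrite compact_cover => /(_ V K (fun x => ball x (r x))).
case.
- by move=> x Kx; exact: ball_open.
- by move=> x Kx; exists x => //; apply: ballxx; case: (hr' x).
move=> F FK Kcov.
pose s x := \sum_(z <- finmap.enum_fset F) b z x.
have s_ge0 x : 0 <= s x by apply: sumr_ge0 => z _; case: (hb' z).
have ss : smooth s by move=> k; apply: Ck_sum => z; case: (hb' z).
have s_gt0 x : K x -> 0 < s x.
  move=> /Kcov[z /= zF xz]; rewrite /s (big_rem z) //=.
  by case: (hb' z) => _ _ /(_ x xz) h _; rewrite ltr_pwDl //; apply: sumr_ge0 => w _; case: (hb' w).
have [|||c cK' hc] := @compact_EVT_min V R s K.
- by exists x0.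
- by [].
- by apply: continuous_subspaceT; exact: smooth_cont.
rewrite inE in cK'; have c0 := s_gt0 c cK'.
have bCc z : K z -> Cc_smooth U (b z).
  move=> Kz; case: (hb' z) => sb _ _ b0; split => //.
  have hsub : [set x | b z x != 0] `<=` [set x | `|z - x| <= r z].
    move=> x /=; apply: contra_neqT; rewrite -ltNge => h; apply: b0.
    by rewrite mx_norm_ball /ball_ /= => h2; move: h; rewrite ltNge ltW.
  split.
    apply: (@compact_closure_bounded _ (r z + `|z|)) => x /hsub /= h.
    by rewrite -(subKr z x) (le_trans (ler_normB _ _)) // addrC lerD2r.
  apply: subset_trans (closure_min hsub _) _; last exact: (hr' z).2 (KU z Kz).
  apply: (@closed_comp V R (fun x => `|z - x|) [set t | t <= r z]); last exact: closed_le.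
  move=> x _; apply: continuous_comp; last exact: norm_continuous.
  exact: (@continuousB R V V (fun=> z) id _ (@cst_continuous _ _ _ _) (fun A h => h)).
have sCc : Cc_smooth U s.
  have : {subset finmap.enum_fset F <= K} by move=> z; exact: FK.
  rewrite /s; elim: (finmap.enum_fset F) => [|z l IH] lK.
    by under eq_fun do rewrite big_nil; exact: Cc0.
  under eq_fun do rewrite big_cons.
  apply: CcD; last by apply: IH => w wl; apply: lK; rewrite inE wl orbT.
  by apply: bCc; have := lK z (mem_head _ _); rewrite inE.
(* The argument of [sstep] exceeds 1 as soon as [s x] exceeds half of its minimum [s c] over K, an
   open condition that holds on K. *)
exists (fun x => sstep (2 / s c * s x)); split.
- apply: (Cc_sub sCc) => [k|x ->]; last by rewrite mulr0 sstep_le0.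
  by apply: Ck_comp1; [exact: smooth_sstep|exact: CkZ].
- by move=> x; exact: sstep_01.
exists [set x | s c / 2 < s x]; split.
- apply: (@open_comp V R s [set t | s c / 2 < t]); last exact: open_gt.
  by move=> x _; exact: (smooth_cont ss).
- by move=> x Kx /=; have := hc x; rewrite inE => /(_ Kx); lra.
- move=> x /= h; apply: sstep_ge1.
  by rewrite mulrAC ler_pdivlMr // mul1r; lra.
Qed.

(** The distance to the complement is phrased through balls, so that an empty complement needs no
    separate case. *)
Definition exhaust U (k : nat) : set V :=
  [set x | `|x| <= k%:R /\ forall y, `|x - y| < k.+1%:R^-1 -> U y].

Lemma compact_exhaust U k : compact (exhaust U k).
Proof.
apply: bounded_closed_compact.
  exists k%:R; split; first exact: num_real.
  by move=> M kM x /= [h _]; rewrite (le_trans h) // ltW.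
have -> : exhaust U k = [set x | `|x| <= k%:R] `&` \bigcap_(y in ~` U) [set x | k.+1%:R^-1 <= `|x - y|].
  apply/seteqP; split => x.
    by move=> [h1 h2]; split => // y nUy /=; rewrite leNgt; apply/negP => /h2.
  move=> [h1 h2]; split => // y hy; apply: contrapT => nUy.
  by have := h2 y nUy; rewrite /= leNgt hy.
apply: closedI; first exact: closed_norm_le.
apply: closed_bigI => y _.
apply: (@closed_comp V R (fun x => `|x - y|) [set t | k.+1%:R^-1 <= t]); last exact: closed_ge.
move=> x _; apply: continuous_comp; last exact: norm_continuous.
exact: (@continuousB R V V id (fun=> y) _ (fun A h => h) (@cst_continuous _ _ _ _)).
Qed.

Lemma exhaust_sub U k : exhaust U k `<=` U.
Proof. by move=> x [_]; apply; rewrite subrr normr0. Qed.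

Lemma exhaust_near U x : open U -> U x -> \forall k \near \oo, exhaust U k x.
Proof.
move=> oU Ux; have /nbhs_ballP[e /= e0 he] : nbhs x U by exact: open_nbhs_nbhs.
near=> k; split; first by near: k; exact: nbhs_infty_ger.
move=> y hy; apply: he; rewrite mx_norm_ball /ball_ /= (lt_trans hy) //.
by near: k; exact: (near_infty_natSinv_lt (PosNum e0)).
Unshelve. all: by end_near. Qed.

Lemma open_approx U : open U -> exists eta : nat -> V -> R,
  [/\ forall k, Cc_smooth U (eta k), forall k x, 0 <= eta k x <= 1,
      forall k x, exhaust U k x -> eta k x = 1 &
      forall x, (fun k => eta k x) @ \oo --> (\1_U x : R)].
Proof.
move=> oU; have h k : exists eta : V -> R, [/\ Cc_smooth U eta, forall x, 0 <= eta x <= 1 &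
    forall x, exhaust U k x -> eta x = 1].
  have [eta [h1 h2 [W [_ KW h3]]]] := urysohn_Cc (compact_exhaust (U := U) (k := k)) oU (@exhaust_sub U k).
  by exists eta; split => // x /KW /h3.
have [eta heta] := boolp.choice h.
exists eta; split.
- by move=> k; case: (heta k).
- by move=> k; case: (heta k).
- by move=> k; case: (heta k).
move=> x; have [Ux|nUx] := pselect (U x).
  rewrite indicE mem_set //; apply: cvg_near_cst.
  have := exhaust_near oU Ux; apply: filterS => k hk; by case: (heta k) => _ _; apply.
rewrite indicE memNset //.
have -> : (fun k => eta k x) = (fun=> 0) by apply/funext => k; apply: (Cc_out _ nUx); case: (heta k).
exact: cvg_cst.
Qed.

(** The sets on which f has integral 0 form a Dynkin system containing the open sets, hence all
    measurable ones; the sets where f > 0 and where f < 0 are then null. *)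
Lemma ae_eq0_open (f : V -> R) : mu.-integrable setT (EFin \o f) ->
  (forall U, open U -> \int[mu]_(x in U) f x = 0) -> {ae mu, forall x, f x = 0}.
Proof.
move=> If hU; have mf : measurable_fun setT f by apply/measurable_EFinP; case/integrableP: If.
have hUe U : open U -> (\int[mu]_(x in U) (f x)%:E = 0)%E.
  move=> oU; have mU := open_measurable_rV oU.
  have IU : mu.-integrable U (EFin \o f) by exact: integrableS If.
  by rewrite -[LHS]fineK ?(integrable_fin_num mU IU) // -[fine _]/(\int[mu]_(x in U) f x) hU.
pose G : set (set V) := [set A | measurable A /\ (\int[mu]_(x in A) (f x)%:E = 0)%E].
have dG : dynkin G.
  split.
  - by split => //; apply: hUe; exact: openT.
  - move=> A [mA hA]; split; first exact: measurableC.
    have := hUe setT openT; rewrite -(setUv A) integral_setU //; last 3 first.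
    + exact: measurableC.
    + exact: measurable_funTS (measurableT_comp _ mf).
    + by apply/disj_setPS => x [].
    by rewrite hA add0e.
  - move=> F tF GF; have mF k : measurable (F k) by case: (GF k).
    split; first exact: bigcupT_measurable.
    rewrite integral_bigcup //; last by apply: integrableS If => //; exact: bigcupT_measurable.
    by apply: eseries0 => k _ _; case: (GF k).
have GU : [set U : set V | open U] `<=` G by move=> U oU; split; [exact: open_measurable_rV|exact: hUe].
have GA A : measurable A -> G A.
  have sI : setI_closed [set U : set V | open U] by move=> A1 B1; exact: openI.
  rewrite measurable_rV_generated -(setI_closed_g_dynkin_g_sigma_algebra sI).
  by move=> h; apply: h; split.
have pos (h : V -> R) : measurable_fun setT h -> (forall A, measurable A -> (\int[mu]_(x in A) (h x)%:E = 0)%E) ->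
   {ae mu, forall x, h x <= 0}.
  move=> mh hA; have mP : measurable [set x | 0 < h x].
    exact: measurable_gt0.
  have mhE : measurable_fun [set x | 0 < h x] (EFin \o h) by apply/measurable_EFinP; exact: measurable_funTS.
  have : (\int[mu]_(x in [set x | (0 < h x)%R]) `|(h x)%:E| = 0)%E.
    rewrite -[RHS](hA _ mP); apply: eq_integral => x; rewrite inE /= => hx.
    by rewrite gtr0_norm.
  move/(ae_eq_integral_abs mu mP mhE); apply: filterS => x /= hx.
  by rewrite leNgt; apply/negP => h0; have [] := hx h0; move=> h1; rewrite h1 ltxx in h0.
have p1 := pos f mf (fun A mA => (GA A mA).2).
have p2 : {ae mu, forall x, - f x <= 0}.
  apply: (pos (fun x => - f x)); first exact: measurableT_comp.
  move=> A mA; have := (GA A mA).2 => h.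
  transitivity (\int[mu]_(x in A) ((-1)%:E * (f x)%:E))%E; first by apply: eq_integral => x _; rewrite -EFinM mulN1r.
  rewrite integralZl ?h ?mule0 //; exact: (integrableS measurableT mA (@subsetT _ _) If).
by apply: filterS2 p1 p2 => x h1 h2; apply/eqP; rewrite eq_le h1 /=; lra.
Qed.

End test_functions.

(** * Translation estimates and weak gradients *)

Section translations.
Context {R : realType} {n : nat}.
Local Notation V := 'rV[R]_n.
Local Notation mu := (@lebesgue_rV R n).
Local Notation leb := (@lebesgue_measure R).
Local Notation e_ i := (delta_mx ord0 i : V).
Implicit Types (f g psi : V -> R) (D U : set V).

Lemma measurable_shift f (v : V) : measurable_fun setT f -> measurable_fun setT (fun x : V => f (x + v)).
Proof. by move=> mf; exact: measurableT_comp mf (measurable_addr_rV v). Qed.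

Lemma Rintegral_shift f (v : V) : measurable_fun setT f -> \int[mu]_x f (x + v) = \int[mu]_x f x.
Proof.
move=> mf; congr fine; have mfE : measurable_fun setT (EFin \o f) by exact/measurable_EFinP.
exact: (integral_preserving (measurable_addr_rV v) (@rV_shift_preserving R n v) mfE).
Qed.

Lemma integrable_shift f (v : V) : mu.-integrable setT (EFin \o f) ->
  mu.-integrable setT (EFin \o (fun x => f (x + v))).
Proof. exact: (integrable_preserving (measurable_addr_rV v) (@rV_shift_preserving R n v)). Qed.

Lemma l2_shift f (v : V) : l2 mu f -> l2 mu (fun x => f (x + v)).
Proof. by move=> [mf If]; split; [exact: measurable_shift|exact: (integrable_shift v If)]. Qed.

Lemma ip_shift f g (v : V) : measurable_fun setT f -> measurable_fun setT g ->
  ip mu (fun x => f (x + v)) (fun x => g (x + v)) = ip mu f g.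
Proof.
move=> mf mg; rewrite /ip; apply: (@Rintegral_shift (fun x => f x * g x)).
exact: measurable_funM.
Qed.

Lemma ipE_shift f (v : V) : l2 mu f ->
  (\int[mu]_x (f (x + v) ^+ 2)%:E = (ip mu f f)%:E)%E.
Proof.
move=> lf; have [mf _] := lf; rewrite -(ip_shift v mf mf); exact: (ipE (l2_shift v lf)).
Qed.

Lemma ge0_integral_shift (f : V -> \bar R) (v : V) : measurable_fun setT f -> (forall x, 0 <= f x)%E ->
  (\int[mu]_x f (x + v)%R = \int[mu]_x f x)%E.
Proof. exact: (ge0_integral_preserving (measurable_addr_rV v) (@rV_shift_preserving R n v)). Qed.

Lemma line_continuous f (x v : V) : continuous f -> continuous (fun t : R => f (x + t *: v)).
Proof.
move=> cf t; apply: continuous_comp; last exact: cf.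
apply: (@continuousD _ _ _ (fun=> x) (fun t : R => t *: v)); first exact: cst_continuous.
exact: scalel_continuous.
Qed.

Lemma FTC_line f i (x : V) (h : R) : smooth f -> 0 < h ->
  f (x + h *: e_ i) - f x = \int[leb]_(t in `[0, h]) partial i f (x + t *: e_ i).
Proof.
move=> sf h0.
have dline t : is_derive t (1:R) (fun t : R => f (x + t *: e_ i)) (partial i f (x + t *: e_ i)).
  by apply: is_derive_line; exact: smooth_derivable.
have cl : continuous (fun t : R => f (x + t *: e_ i)) by apply: line_continuous; exact: smooth_cont.
rewrite /Rintegral (@continuous_FTC2 R (fun t => partial i f (x + t *: e_ i)) (fun t => f (x + t *: e_ i)) 0 h) //.
- by rewrite scale0r addr0.
- apply: continuous_subspaceT; apply: line_continuous; apply: smooth_cont; exact: smooth_partial.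
- split.
  + by move=> t _; exact: (ex_derive (is_derive := dline t)).
  + by apply: cvg_at_right_filter; exact: cl.
  + by apply: cvg_at_left_filter; exact: cl.
- by move=> t _; rewrite derive1E; exact: (derive_val (is_derive := dline t)).
Qed.

Lemma measurable_line f i : measurable_fun setT f ->
  measurable_fun setT (fun z : V * measurableTypeR R => f (z.1 + (z.2 : R) *: e_ i)).
Proof.
move=> mf; apply: (measurableT_comp mf).
apply: measurable_fun_coordP => j; under eq_fun do rewrite !mxE.
apply: measurable_funD; first exact: (measurableT_comp (@measurable_coord R n j) measurable_fst).
by apply: measurable_funM => //; exact: measurable_snd.
Qed.

Lemma l2_indic_itv (h : R) : l2 leb (\1_`[0, h] : measurableTypeR R -> R).
Proof.
have mI : measurable_fun setT (\1_`[0, h] : measurableTypeR R -> R) by apply: measurable_indic; exact: measurable_itv.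
split => //; have := @integrable_indic_itv R 0 h true false.
by apply: eq_integrable => // x _ /=; rewrite indicE; case: (_ \in _); rewrite ?expr1n ?expr0n.
Qed.

(** The fundamental theorem of calculus followed by Cauchy-Schwarz against the indicator of
    [0, h]. *)
Lemma line_sq D f i (x : V) (h : R) : Cc_smooth D f -> 0 < h ->
  (f (x + h *: e_ i) - f x) ^+ 2 <=
    h * \int[leb]_t ((partial i f (x + t *: e_ i)) ^+ 2 * \1_`[0, h] t).
Proof.
move=> hf h0; have lI := l2_indic_itv h; have [mI _] := lI.
have hp := Cc_partial i hf; have [C C0 hC] := Cc_bounded hp.
pose F : measurableTypeR R -> R := fun t => partial i f (x + t *: e_ i).
have mF : measurable_fun setT F.
  exact: (measurableT_comp (measurable_line i (Cc_meas hp)) (pair1_measurable x)).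
have lF := l2_bdM mF (fun t => hC _) lI.
have := ip_CS lF lI.
have -> : ip leb (fun t => F t * \1_`[0, h] t) (\1_`[0, h] : measurableTypeR R -> R) = f (x + h *: e_ i) - f x.
  rewrite (FTC_line _ _ (Cc_smoothE hf) h0) Rintegral_mkcond /ip; apply: eq_Rintegral => t _.
  by rewrite patchE indicE; case: (_ \in _); rewrite ?mulr1 ?mulr0.
have -> : ip leb (\1_`[0, h] : measurableTypeR R -> R) (\1_`[0, h] : measurableTypeR R -> R) = h.
  transitivity (\int[leb]_(t in `[0, h]) 1).
    rewrite Rintegral_mkcond /ip; apply: eq_Rintegral => t _.
    by rewrite patchE indicE; case: (_ \in _); rewrite ?mulr1 ?mulr0.
  rewrite Rintegral_cst // mul1r.
  have := @lebesgue_measure_itv R `[0, h]; rewrite /= lte_fin h0 => E.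
  by rewrite -[lebesgue_measure]/(@lebesgue_measure R) E /= subr0.
rewrite mulrC => H; apply: (le_trans H); rewrite ler_pM2l // le_eqVlt; apply/orP; left; apply/eqP.
apply: eq_Rintegral => t _; rewrite indicE expr2 /F; case: (_ \in _); rewrite ?mulr1 ?mulr0 //.
Qed.

(** [line_sq] is integrated in x. After Tonelli each inner integral is the norm of a translate of
    the derivative, independent of t, and the length of the segment supplies the second factor h. *)
Lemma transl_axis_pos D f i (h : R) : Cc_smooth D f -> 0 < h ->
  ip mu (fun x => f (x + h *: e_ i) - f x) (fun x => f (x + h *: e_ i) - f x) <=
    h ^+ 2 * ip mu (partial i f) (partial i f).
Proof.
move=> hf h0; have lf := Cc_l2 hf; have hp := Cc_partial i hf; have lp := Cc_l2 hp.
have ld := l2B (l2_shift (h *: e_ i) lf) lf.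
have mI : measurable_fun setT (\1_`[0, h] : measurableTypeR R -> R) by case: (l2_indic_itv h).
pose G (z : V * measurableTypeR R) : \bar R := ((partial i f (z.1 + (z.2 : R) *: e_ i)) ^+ 2 * \1_`[0, h] z.2)%:E.
have mG : measurable_fun setT G.
  apply/measurable_EFinP; apply: measurable_funM.
    by apply: measurable_funX; apply: measurable_line; exact: Cc_meas hp.
  exact: (measurableT_comp mI measurable_snd).
have G0 z : (0 <= G z)%E by rewrite lee_fin mulr_ge0 ?sqr_ge0 // indicE.
have [C C0 hC] := Cc_bounded hp.
have mFG : measurable_fun setT (fun x : V => \int[leb]_t G (x, t))%E  by exact: measurable_fun_fubini_tonelli_F.
rewrite -lee_fin -(ipE ld).
apply: (@le_trans _ _ (\int[mu]_x (h%:E * \int[leb]_t G (x, t)))%E).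
  apply: ge0_le_integral => //.
  - by move=> x _; rewrite lee_fin sqr_ge0.
  - by apply/measurable_EFinP; apply: measurable_funX; case: ld.
  - by apply: emeasurable_funM.
  move=> x _; have H := line_sq i x hf h0.
  have I1 : leb.-integrable setT (EFin \o (fun t : measurableTypeR R => (partial i f (x + t *: e_ i)) ^+ 2 * \1_`[0, h] t)).
    have := l2_bdM (measurableT_comp (measurable_line i (Cc_meas hp)) (pair1_measurable x)) (fun t => hC _) (l2_indic_itv h).
    move=> [_]; apply: eq_integrable => // t _ /=; rewrite exprMn indicE; case: (_ \in _); by rewrite ?expr1n ?expr0n.
  have E : (\int[leb]_t G (x, t) = (\int[leb]_t ((partial i f (x + t *: e_ i)) ^+ 2 * \1_`[0, h] t))%:E)%E.
    by rewrite /Rintegral fineK //; exact: (integrable_fin_num measurableT I1).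
  by rewrite E -EFinM lee_fin.
rewrite (integralZl_T _ mFG) ?lee_fin ?(ltW h0) //; last by move=> x; exact: integral_ge0.
rewrite (@fubini_tonelli _ _ _ _ _ mu leb G mG G0) expr2 -mulrA EFinM lee_pmul2l //.
rewrite (eq_integral (fun t : measurableTypeR R => ((ip mu (partial i f) (partial i f))%:E * (\1_`[0, h] t)%:E)%E)); last first.
  move=> t _; rewrite /G /=.
  transitivity (\int[mu]_x ((\1_`[0, h] t)%:E * ((partial i f (x + (t : R) *: e_ i)) ^+ 2)%:E))%E.
    by apply: eq_integral => x _; rewrite -EFinM mulrC.
  rewrite integralZl_T; [|apply/measurable_EFinP; apply: measurable_funX; apply: measurable_shift; exact: Cc_meas hp
    |by move=> x; rewrite lee_fin sqr_ge0|by rewrite lee_fin indicE].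
  by rewrite (ipE_shift ((t : R) *: e_ i) lp) muleC.
rewrite integralZl_T; [|exact/measurable_EFinP|by move=> t; rewrite lee_fin indicE|by rewrite lee_fin ip_ge0].
rewrite integral_indic //.
have := @lebesgue_measure_itv R `[0, h]; rewrite /= lte_fin h0 => E.
by rewrite setIT E /= sube0 muleC.
Qed.

Lemma transl_axis D f i (h : R) : Cc_smooth D f ->
  ip mu (fun x => f (x + h *: e_ i) - f x) (fun x => f (x + h *: e_ i) - f x) <=
    h ^+ 2 * ip mu (partial i f) (partial i f).
Proof.
move=> hf; have [h0|h0|->] := ltgtP h 0; [|exact: transl_axis_pos hf h0|]; last first.
- under [X in ip mu X _]eq_fun do rewrite scale0r addr0 subrr.
  by rewrite /ip; under eq_Rintegral do rewrite mul0r; rewrite Rintegral_cst // mul0r mulr_ge0 ?ip_ge0 ?sqr_ge0.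
have mf := Cc_meas hf.
have := @transl_axis_pos D f i (- h) hf _; rewrite oppr_gt0 => /(_ h0); rewrite sqrrN; apply: le_trans.
have md : measurable_fun setT (fun x : V => f (x + h *: e_ i) - f x).
  by apply: measurable_funB => //; exact: measurable_shift.
rewrite -(ip_shift (- h *: e_ i) md md) le_eqVlt; apply/orP; left; apply/eqP.
apply: eq_Rintegral => x _; rewrite -addrA -scalerDl addNr scale0r addr0 -opprB mulrNN.
by [].
Qed.

Lemma sum_sq (I : finType) (F : I -> R) : (\sum_i F i) ^+ 2 <= #|I|%:R * \sum_i F i ^+ 2.
Proof.
have : 0 <= \sum_i \sum_j (F i - F j) ^+ 2 by apply: sumr_ge0 => i _; apply: sumr_ge0 => j _; exact: sqr_ge0.
have -> : \sum_i \sum_j (F i - F j) ^+ 2 = 2 * (#|I|%:R * \sum_i F i ^+ 2) - 2 * (\sum_i F i) ^+ 2.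
  transitivity (\sum_i (#|I|%:R * F i ^+ 2 + \sum_j F j ^+ 2 - 2 * F i * \sum_j F j)).
    apply: eq_bigr => i _; rewrite mulr_sumr -(sumr_const I) mulr_suml.
    rewrite (eq_bigr (fun j => 1 * F i ^+ 2 + F j ^+ 2 - 2 * F i * F j)); last by move=> j _; lra.
    by rewrite sumrB big_split.
  rewrite sumrB big_split /= -mulr_sumr sumr_const -mulr_natl -!mulr_suml -mulr_sumr; lra.
lra.
Qed.

(** Vertices of the path from 0 to z that follows one coordinate axis after another. *)
Definition prefix_row (z : V) (k : nat) : V := \row_j (if (j < k)%N then z ord0 j else 0).

Lemma prefix_rowS z (i : 'I_n) : prefix_row z i.+1 = prefix_row z i + z ord0 i *: e_ i.
Proof.
apply/rowP => j; rewrite !mxE eqxx /= ltnS leq_eqVlt.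
case: (eqVneq (j : nat) i) => [/val_inj ->|h]; first by rewrite ltnn eqxx add0r mulr1.
by rewrite (_ : (j == i) = false) ?mulr0 ?addr0 //; apply/negbTE; apply: contra h => /eqP ->.
Qed.

(** The increment is split along the axis path; squaring the sum of the n pieces costs the factor
    n. *)
Lemma transl_est D f (z : V) : Cc_smooth D f ->
  ip mu (fun x => f (x + z) - f x) (fun x => f (x + z) - f x) <=
    n%:R * `|z| ^+ 2 * \sum_i ip mu (partial i f) (partial i f).
Proof.
move=> hf; have lf := Cc_l2 hf; have mf := Cc_meas hf.
pose d (i : 'I_n) x := f (x + prefix_row z i + z ord0 i *: e_ i) - f (x + prefix_row z i).
have ld i : l2 mu (d i).
  by apply: (l2_shift (f := fun x => f (x + z ord0 i *: e_ i) - f x)); apply: l2B => //; exact: l2_shift.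
have hd i : ip mu (d i) (d i) <= `|z| ^+ 2 * ip mu (partial i f) (partial i f).
  have md : measurable_fun setT (fun x : V => f (x + z ord0 i *: e_ i) - f x).
    by apply: measurable_funB => //; exact: measurable_shift.
  rewrite (ip_shift (prefix_row z i) md md); apply: le_trans (transl_axis i (z ord0 i) hf) _.
  rewrite ler_wpM2r ?ip_ge0 // -(real_normK (num_real (z ord0 i))) lerXn2r ?nnegrE //.
  exact: coord_le_norm.
have E x : f (x + z) - f x = \sum_i d i x.
  have -> : \sum_i d i x = \sum_(0 <= k < n) (f (x + prefix_row z k.+1) - f (x + prefix_row z k)).
    rewrite big_mkord; apply: eq_bigr => i _; by rewrite prefix_rowS addrA.
  rewrite telescope_sumr //; congr (f _ - f _); last first.
    by rewrite (_ : prefix_row z 0 = 0) ?addr0 //; apply/rowP => j; rewrite !mxE.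
  by congr (_ + _); apply/rowP => j; rewrite !mxE ltn_ord.
apply: (@le_trans _ _ (\int[mu]_x (n%:R * \sum_i d i x ^+ 2))).
  apply: le_Rintegral => //.
  - by apply: l2M_integrable; apply: l2B => //; exact: l2_shift.
  - have := @integrable_sum _ _ _ mu setT measurableT _ (index_enum 'I_n) xpredT (fun i => EFin \o (fun x => d i x ^+ 2)) (fun i _ => (ld i).2).
    move=> /(integrableZl measurableT n%:R); apply: eq_integrable => // x _ /=.
    by rewrite EFinM sumEFin.
  - by move=> x _; rewrite -expr2 E -[X in X%:R](card_ord n); exact: sum_sq.
rewrite RintegralZl //; last first.
  have := @integrable_sum _ _ _ mu setT measurableT _ (index_enum 'I_n) xpredT (fun i => EFin \o (fun x => d i x ^+ 2)) (fun i _ => (ld i).2).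
  by apply: eq_integrable => // x _ /=; rewrite sumEFin.
rewrite -mulrA ler_wpM2l //.
have -> : \int[mu]_x (\sum_i d i x ^+ 2) = \sum_i ip mu (d i) (d i).
  rewrite /Rintegral; under eq_integral do rewrite -sumEFin.
  rewrite integral_sum //; last by move=> i; exact: (ld i).2.
  by under eq_bigr do rewrite (ipE (ld _)); rewrite sumEFin.
by rewrite mulr_sumr; apply: ler_sum => i _.
Qed.

(** A shift by more than the width of the support makes f and its translate disjoint, so the
    difference has twice the squared norm of f, and the translation estimate bounds it by the
    derivative. *)
Lemma poincare_Cc D f (rho : R) (i : 'I_n) : (forall x, D x -> `|x| <= rho) -> 0 < rho -> Cc_smooth D f ->
  ip mu f f <= (2 * rho + 1) ^+ 2 * ip mu (partial i f) (partial i f).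
Proof.
move=> hD r0 hf; have lf := Cc_l2 hf; have mf := Cc_meas hf.
pose v := (2 * rho + 1) *: e_ i.
have := transl_axis i (2 * rho + 1) hf; rewrite -/v.
have -> : ip mu (fun x => f (x + v) - f x) (fun x => f (x + v) - f x) = ip mu f f + ip mu f f.
  rewrite -{1}(ip_shift v mf mf) /ip -RintegralD //; try by apply: l2M_integrable => //; exact: l2_shift.
  apply: eq_Rintegral => x _.
  suff : f (x + v) * f x = 0 by lra.
  have [|h] := eqVneq (f x) 0; first by move=> ->; rewrite mulr0.
  have [|h'] := eqVneq (f (x + v)) 0; first by move=> ->; rewrite mul0r.
  have Dx : D x by apply: contrapT => nD; rewrite (Cc_out hf nD) eqxx in h.
  have Dxv : D (x + v) by apply: contrapT => nD; rewrite (Cc_out hf nD) eqxx in h'.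
  have := le_trans (coord_le_norm x i) (hD _ Dx).
  have := le_trans (coord_le_norm (x + v) i) (hD _ Dxv).
  rewrite !mxE !eqxx mulr1 !ler_norml => /andP[a1 a2] /andP[b1 b2]; lra.
have := ip_ge0 mu f; lra.
Qed.

(** The derivative integrated along unit segments gives f(x + e_i) - f(x), of integral 0 by
    translation invariance; by Fubini the same double integral is that of the derivative. *)
Lemma Rintegral_partial0 D f i : Cc_smooth D f -> \int[mu]_x partial i f x = 0.
Proof.
move=> hf; have hp := Cc_partial i hf; have Ip := Cc_integrable hp; have If := Cc_integrable hf.
have mp := Cc_meas hp; have mf := Cc_meas hf.
have mI : measurable_fun setT (\1_`[0, (1:R)] : measurableTypeR R -> R) by case: (l2_indic_itv 1).
pose G (z : V * measurableTypeR R) : \bar R := (partial i f (z.1 + (z.2 : R) *: e_ i) * \1_`[0, 1] z.2)%:E.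
have mG : measurable_fun setT G.
  apply/measurable_EFinP; apply: measurable_funM; first exact: measurable_line.
  exact: (measurableT_comp mI measurable_snd).
have int1 : (\int[leb]_t (\1_`[0, (1:R)] t)%:E = 1)%E.
  rewrite integral_indic //.
  have := @lebesgue_measure_itv R `[0, 1]; rewrite /= lte_fin ltr01 => E.
  by rewrite setIT E /= sube0.
have IG : (mu \x leb)%E.-integrable setT G.
  apply/(integrable21ltyP mu leb mG).
  rewrite (eq_integral (fun t : measurableTypeR R => (\int[mu]_x `|(partial i f x)%:E|) * (\1_`[0, 1] t)%:E)%E); last first.
    move=> t _; rewrite /G /=.
    transitivity (\int[mu]_x ((\1_`[0, (1:R)] t)%:E * `|(partial i f (x + (t : R) *: e_ i))%:E|))%E.
      by apply: eq_integral => x _; rewrite normrM EFinM muleC indicE; case: (_ \in _); rewrite ?normr1 ?normr0.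
    rewrite integralZl_T; [|by apply: measurableT_comp => //; apply/measurable_EFinP; exact: measurable_shift
      |by move=> x; exact: abse_ge0|by rewrite lee_fin indicE].
    have mN : measurable_fun setT (fun x : V => `|(partial i f x)%:E|)%E.
      by apply: measurableT_comp => //; exact/measurable_EFinP.
    by rewrite (ge0_integral_shift ((t : R) *: e_ i) mN) // muleC.
  rewrite integralZl_T; [|exact/measurable_EFinP|by move=> t; rewrite lee_fin indicE|exact: integral_ge0].
  by rewrite int1 mule1; case/integrableP: Ip.
have Ex (x : V) : (\int[leb]_t G (x, t) = (f (x + e_ i) - f x)%:E)%E.
  have := FTC_line i x (Cc_smoothE hf) ltr01; rewrite scale1r => ->.
  have I1 : leb.-integrable setT (EFin \o (fun t : measurableTypeR R => partial i f (x + t *: e_ i) * \1_`[0, 1] t)).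
    have [C C0 hC] := Cc_bounded hp.
    apply: (@integrable_le _ _ _ leb _ (fun t => C * \1_`[0, 1] t)).
    - apply: measurable_funM => //.
      exact: (measurableT_comp (measurable_line i mp) (pair1_measurable x)).
    - by move=> t; rewrite normrM [X in _ * X]ger0_norm ?indicE // ler_wpM2r.
    - have := integrableZl measurableT C (@integrable_indic_itv R 0 1 true false).
      by apply: eq_integrable => // t _ /=; rewrite -EFinM.
  have -> : \int[leb]_(t in `[0, 1]) partial i f (x + t *: e_ i) = \int[leb]_t (partial i f (x + t *: e_ i) * \1_`[0, 1] t).
    rewrite Rintegral_mkcond; apply: eq_Rintegral => t _.
    by rewrite patchE indicE; case: (_ \in _); rewrite ?mulr1 ?mulr0.
  by rewrite /Rintegral fineK //; exact: (integrable_fin_num measurableT I1).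
have Et (t : measurableTypeR R) : (\int[mu]_x G (x, t) = (\1_`[0, (1:R)] t)%:E * (\int[mu]_x partial i f x)%:E)%E.
  transitivity (\int[mu]_x ((\1_`[0, (1:R)] t)%:E * (partial i f (x + (t : R) *: e_ i))%:E))%E.
    by apply: eq_integral => x _; rewrite -EFinM mulrC.
  rewrite integralZl //; last exact: (integrable_shift ((t : R) *: e_ i) Ip).
  rewrite -(Rintegral_shift ((t : R) *: e_ i) mp) /Rintegral fineK //.
  exact: (integrable_fin_num measurableT (integrable_shift ((t : R) *: e_ i) Ip)).
have : (\int[mu]_x (f (x + e_ i) - f x)%:E = \int[leb]_t ((\int[mu]_x partial i f x)%:E * (\1_`[0, (1:R)] t)%:E))%E.
  transitivity (\int[mu]_x \int[leb]_t G (x, t))%E; first by apply: eq_integral => x _; rewrite Ex.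
  by rewrite (Fubini IG); apply: eq_integral => t _; rewrite Et muleC.
rewrite integralZl //; last exact: (@integrable_indic_itv R 0 1 true false).
rewrite int1 mule1 => E.
have := congr1 fine E => /= <-.
have := RintegralB measurableT (integrable_shift (e_ i) If) If.
by rewrite (Rintegral_shift (e_ i) mf) subrr.
Qed.

Lemma integral_by_parts D f psi i : smooth f -> Cc_smooth D psi ->
  \int[mu]_x (f x * partial i psi x) = - \int[mu]_x (partial i f x * psi x).
Proof.
move=> sf hpsi; have hfp := CcM sf hpsi.
have := Rintegral_partial0 i hfp.
have h1 : Cc_smooth D (fun x => f x * partial i psi x) by apply: CcM => //; exact: Cc_partial.
have h2 : Cc_smooth D (fun x => partial i f x * psi x) by apply: CcM => //; exact: smooth_partial.
have E x : partial i (fun y => f y * psi y) x = f x * partial i psi x + partial i f x * psi x.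
  by rewrite partialM ?(mulrC (psi x)) //; apply: smooth_derivable => //; exact: Cc_smoothE hpsi.
under eq_Rintegral do rewrite E.
rewrite (RintegralD measurableT (Cc_integrable h1) (Cc_integrable h2)) => /eqP.
by rewrite addr_eq0 => /eqP.
Qed.

Lemma L1loc_mul D (f : V -> R) psi : open D -> L1loc D f -> Cc_smooth D psi ->
  mu.-integrable setT (EFin \o (fun x => (f \_ D) x * psi x)).
Proof.
move=> oD [mf hf] hpsi; have [_ [cK KD]] := hpsi.
have mD := open_measurable_rV oD.
set K := closure [set x | psi x != 0] in cK KD.
have cK' : closed K by exact: closed_closure.
have mK : measurable K by rewrite -(setCK K); apply: measurableC; apply: open_measurable_rV; exact: closed_openC.
have IK : mu.-integrable setT (EFin \o (f \_ K)).
  have := (integrable_mkcond (EFin \o f) mK).1 (hf K cK KD).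
  by apply: eq_integrable => // x _ /=; rewrite !patchE; case: ifP.
have [C C0 hC] := Cc_bounded hpsi.
apply: (@integrable_le _ _ _ mu _ (fun x => C * `|(f \_ K) x|)).
- apply: measurable_funM; last exact: Cc_meas hpsi.
  exact: (measurable_restrictT f mD).1.
- move=> x; rewrite normrM mulrC; have [->|px] := eqVneq (psi x) 0; first by rewrite normr0 mul0r mulr_ge0.
  have Kx : K x by exact: subset_closure.
  rewrite !patchE !mem_set //; last exact: KD.
  by rewrite ler_wpM2r.
- have := integrableZl measurableT C (integrable_norm IK).
  by apply: eq_integrable => // x _ /=; rewrite -EFinM.
Qed.

(** Fundamental lemma of the calculus of variations: times a cut-off f is integrable, and
    approximating the indicator of an open set by cut-offs shows that its integral over every open
    set is 0. *)
Lemma L1loc_ae_eq0 D (f : V -> R) : open D -> L1loc D f ->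
  (forall psi, Cc_smooth D psi -> \int[mu]_(x in D) (f x * psi x) = 0) ->
  {ae mu, forall x, D x -> f x = 0}.
Proof.
move=> oD lf h; have mD := open_measurable_rV oD.
have [eta [etaC eta01 etaK _]] := open_approx oD.
have mfD : measurable_fun setT (f \_ D) by apply: (measurable_restrictT f mD).1; case: lf.
have hk k : {ae mu, forall x, (f \_ D) x * eta k x = 0}.
  have IF := L1loc_mul oD lf (etaC k).
  apply: ae_eq0_open => // U oU; have mU := open_measurable_rV oU.
  have [chi [chiC chi01 _ chicvg]] := open_approx oU.
  have c0 j : \int[mu]_x ((f \_ D) x * eta k x * chi j x) = 0.
    have := h (fun x => eta k x * chi j x) _.
    rewrite Rintegral_mkcond => <-; last first.
      by have := CcM (Cc_smoothE (chiC j)) (etaC k); congr Cc_smooth; apply/funext => x; rewrite mulrC.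
    by apply: eq_Rintegral => x _; rewrite !patchE; case: ifP => _; rewrite ?mul0r // mulrA.
  have [||||| _ cv] := @dominated_Rint _ _ _ mu (fun j x => (f \_ D) x * eta k x * chi j x) (fun x => (f \_ D) x * eta k x * \1_U x) (fun x => `|(f \_ D) x * eta k x|).
  - by move=> j; apply: measurable_funM; [apply: measurable_funM => //; exact: Cc_meas (etaC k)|exact: Cc_meas (chiC j)].
  - by apply: measurable_funM; [apply: measurable_funM => //; exact: Cc_meas (etaC k)|exact: measurable_indic].
  - by apply: nearW => x; apply: cvgMr; exact: chicvg.
  - exact: integrable_norm.
  - move=> j x; rewrite normrM -[X in _ <= X]mulr1 ler_wpM2l //.
    by have /andP[c1 c2] := chi01 j x; rewrite ger0_norm.
  have cv0 : (fun j : nat => \int[mu]_x ((f \_ D) x * eta k x * chi j x)) @ \oo --> (0:R).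
    rewrite (_ : (fun _ => _) = (fun=> 0)); first exact: cvg_cst.
    by apply/funext => j; exact: c0.
  transitivity (\int[mu]_x ((f \_ D) x * eta k x * \1_U x)); last by exact: cvg_unique cv cv0.
  rewrite Rintegral_mkcond; apply: eq_Rintegral => x _.
  by rewrite patchE indicE; case: (_ \in _); rewrite ?mulr1 ?mulr0.
have : {ae mu, forall x, forall k, (f \_ D) x * eta k x = 0} by apply/ae_foralln.
apply: filterS => x hx Dx; have [k _ hk'] := exhaust_near oD Dx.
have := hx k; rewrite (etaK k x (hk' k (leqnn k))) mulr1 patchE mem_set //.
Qed.

Lemma wgrad_unique D u (g g' : V -> V) : open D -> is_wgrad D u g -> is_wgrad D u g' ->
  forall i, {ae mu, forall x, D x -> g x ord0 i = g' x ord0 i}.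
Proof.
move=> oD [_ h] [_ h'] i; have [lg hg] := h i; have [lg' hg'] := h' i.
have mD := open_measurable_rV oD.
have : {ae mu, forall x, D x -> g x ord0 i - g' x ord0 i = 0}.
  apply: L1loc_ae_eq0 => //.
    split; first by apply: measurable_funB; [case: lg|case: lg'].
    move=> K cK KD; have mK : measurable K.
      rewrite -(setCK K); apply: measurableC; apply: open_measurable_rV; apply: closed_openC.
      exact: compact_closed.
    have := integrableB mK (proj2 lg K cK KD) (proj2 lg' K cK KD).
    by apply: eq_integrable => // x _ /=; rewrite EFinB.
  move=> psi hpsi.
  have I1 := L1loc_mul oD lg hpsi; have I2 := L1loc_mul oD lg' hpsi.
  have := hg psi hpsi; rewrite (hg' psi hpsi) => /oppr_inj E.
  rewrite [LHS]Rintegral_mkcond; rewrite [LHS]Rintegral_mkcond [RHS]Rintegral_mkcond in E.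
  transitivity (\int[mu]_x (((fun x => g x ord0 i) \_ D) x * psi x) - \int[mu]_x (((fun x => g' x ord0 i) \_ D) x * psi x)).
    rewrite -(RintegralB measurableT I1 I2); apply: eq_Rintegral => x _.
    by rewrite !patchE; case: ifP; rewrite ?mul0r ?subrr // mulrBl.
  apply/eqP; rewrite subr_eq0; apply/eqP.
  transitivity (\int[mu]_x ((fun x => g x ord0 i * psi x) \_ D) x).
    by apply: eq_Rintegral => x _; rewrite !patchE; case: ifP; rewrite ?mul0r.
  rewrite -E; apply: eq_Rintegral => x _; rewrite !patchE; case: ifP; rewrite ?mul0r //.
by apply: filterS => x hx /hx /eqP; rewrite subr_eq0 => /eqP.
Qed.

End translations.

(** * The fractional kernel *)

Section kernel.
Context {R : realType} {n : nat}.
Local Notation V := 'rV[R]_n.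
Local Notation mu := (@lebesgue_rV R n).
Variables (s : R) (s_gt0 : 0 < s) (s_lt1 : s < 1).
Implicit Types (u v psi : V -> R).

Definition kern (z : V) : R := (enorm z `^ (n%:R + 2 * s))^-1.

Lemma kern_ge0 z : 0 <= kern z.
Proof. by rewrite invr_ge0 powR_ge0. Qed.

Lemma enormN (z : V) : enorm (- z) = enorm z.
Proof. by rewrite /enorm; congr Num.sqrt; apply: eq_bigr => i _; rewrite mxE sqrrN. Qed.

Lemma kernN z : kern (- z) = kern z.
Proof. by rewrite /kern enormN. Qed.

Lemma norm_le_enorm (z : V) : `|z| <= enorm z.
Proof.
apply: norm_le_coord; first exact: sqrtr_ge0.
move=> i; rewrite -sqrtr_sqr; apply: ler_wsqrtr.
by rewrite (bigD1 i) //= lerDl; apply: sumr_ge0 => j _; exact: sqr_ge0.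
Qed.

Lemma enorm0 : enorm (0 : V) = 0.
Proof. by rewrite /enorm big1 ?sqrtr0 // => i _; rewrite mxE expr0n. Qed.

(** A default value: the inverse of 0 is 0, so the diagonal satisfies pointwise bounds without
    exception. *)
Lemma kern0 : kern 0 = 0.
Proof.
rewrite /kern enorm0 powR0 ?invr0 // gt_eqF //.
by apply: ltr_wpDl => //; rewrite mulr_gt0.
Qed.

Lemma exponent_gt0 : 0 < n%:R + 2 * s.
Proof. by apply: ltr_wpDl => //; rewrite mulr_gt0. Qed.

Lemma kern_le (z : V) (t : R) : 0 < t -> t <= `|z| -> kern z <= (t `^ (n%:R + 2 * s))^-1.
Proof.
move=> t0 tz; rewrite lef_pV2 ?posrE ?powR_gt0 //; last first.
  by apply: lt_le_trans (norm_le_enorm z); exact: lt_le_trans tz.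
apply: ge0_ler_powR; rewrite ?nnegrE ?(ltW t0) ?sqrtr_ge0 //; first exact: ltW exponent_gt0.
exact: le_trans (norm_le_enorm z).
Qed.

Lemma measurable_kern : measurable_fun setT kern.
Proof.
apply: measurable_funTS; have -> : kern = (fun t : R => (t `^ (n%:R + 2 * s))^-1) \o @enorm R n by [].
have me : measurable_fun setT (@enorm R n).
  apply: continuous_measurable_rV => x; apply: continuous_comp; last exact: sqrt_continuous.
  have h : Ck 0 (fun x : V => \sum_i x ord0 i * x ord0 i) by apply: Ck_sum => i; apply: CkM; exact: Ck_coord.
  have E : (fun x : V => \sum_i x ord0 i ^+ 2) = (fun x : V => \sum_i x ord0 i * x ord0 i).
    by apply/funext => y; apply: eq_bigr => i _; rewrite expr2.
  by rewrite E; exact: (Ck_cont h).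
apply: measurableT_comp => //.
have -> : (fun t : R => (t `^ (n%:R + 2 * s))^-1) = (fun t => t `^ (- (n%:R + 2 * s))) by apply/funext => t; rewrite powRN.
exact: measurable_powR.
Qed.

(** Its integrability is the Lévy condition of the kernel: the quadratic factor tames the
    singularity when s < 1, the constant one keeps the tail, integrable when s > 0. *)
Definition kmin (z : V) : R := kern z * Num.min 1 (`|z| ^+ 2).

Lemma kmin_ge0 z : 0 <= kmin z.
Proof. by rewrite mulr_ge0 ?kern_ge0 // le_min ler01 sqr_ge0. Qed.

Lemma measurable_norm_rV : measurable_fun setT (fun z : V => `|z|).
Proof. by apply: continuous_measurable_rV => z; exact: norm_continuous. Qed.

Lemma measurable_kmin : measurable_fun setT kmin.
Proof.
apply: measurable_funM; first exact: measurable_kern.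
apply: measurable_minr; first exact: measurable_cst.
by apply: measurable_funX; exact: measurable_norm_rV.
Qed.

Lemma dyadic (t : R) : 0 < t -> t <= 1 -> exists k : nat, 2^-1 ^+ k.+1 < t <= 2^-1 ^+ k.
Proof.
move=> t0 t1.
have ex : exists k : nat, 2^-1 ^+ k < t.
  have h : (fun k => (2^-1 : R) ^+ k) @ \oo --> (0:R).
    have := @cvg_geometric R 1 2^-1; rewrite ger0_norm // => /(_ _); rewrite /geometric.
    by under [X in X @ _ --> _]eq_fun do rewrite mul1r; apply; lra.
  have /cvgrPdist_lt/(_ t t0)[N _ hN] := h; exists N.
  by have := hN N (leqnn N); rewrite sub0r normrN ger0_norm ?exprn_ge0.
have := ex_minnP ex; case=> m hm mmin; case: m hm mmin => [|m] hm mmin.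
  by move: hm; rewrite expr0 ltNge t1.
exists m; rewrite hm /= leNgt; apply/negP => h.
by have := mmin m h; rewrite ltnn.
Qed.

Lemma box_of_norm (z : V) (t : R) : `|z| <= t -> @rV_box R n t z.
Proof. by move=> h i; rewrite -ler_norml (le_trans (coord_le_norm z i)). Qed.

(** Dyadic majorant of [kmin], with [cs] near the origin and [cl] near infinity. Full boxes replace
    shells: their volumes are explicit, and the overlap still leaves convergent geometric series. *)
Let a := n%:R + 2 * s.
Let cs (k : nat) : R := ((2^-1 ^+ k.+1) `^ a)^-1 * (2^-1 ^+ k) ^+ 2.
Let cl (k : nat) : R := ((2 ^+ k) `^ a)^-1.
Let dom (k : nat) (z : V) : R :=
  cs k * \1_(@rV_box R n (2^-1 ^+ k)) z + cl k * \1_(@rV_box R n (2 ^+ k.+1)) z.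

Let cs_ge0 k : 0 <= cs k.
Proof. by rewrite mulr_ge0 ?invr_ge0 ?powR_ge0 ?sqr_ge0. Qed.
Let cl_ge0 k : 0 <= cl k.
Proof. by rewrite invr_ge0 powR_ge0. Qed.

Let kmin_dom z : exists k, kmin z <= dom k z.
Proof.
have [->|z0] := eqVneq z 0.
  by exists 0%N; rewrite /kmin kern0 mul0r addr_ge0 // mulr_ge0 // indicE.
have nz : 0 < `|z| by rewrite normr_gt0.
have [z1|z1] := leP `|z| 1.
  have [k /andP[h1 h2]] := dyadic nz z1; exists k.
  rewrite /dom (_ : \1_(@rV_box R n (2^-1 ^+ k)) z = 1); last by rewrite indicE mem_set //; exact: box_of_norm.
  rewrite mulr1 -[X in X <= _]addr0; apply: lerD; last by rewrite mulr_ge0 // indicE.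
  apply: ler_pM; rewrite ?kern_ge0 ?le_min ?ler01 ?sqr_ge0 //.
    by apply: kern_le; [rewrite exprn_gt0|exact: ltW].
  by rewrite ge_min lerXn2r ?nnegrE ?exprn_ge0 ?h2 ?orbT.
have nz1 : 0 < `|z|^-1 by rewrite invr_gt0.
have nz2 : `|z|^-1 <= 1 by rewrite invf_le1 // ltW.
have [k /andP[h1 h2]] := dyadic nz1 nz2.
exists k; have e2 : (2^-1 : R) ^+ k.+1 = (2 ^+ k.+1)^-1 by rewrite exprVn.
have e1 : (2^-1 : R) ^+ k = (2 ^+ k)^-1 by rewrite exprVn.
rewrite e2 ltf_pV2 ?posrE ?exprn_gt0 // in h1; rewrite e1 lef_pV2 ?posrE ?exprn_gt0 // in h2.
rewrite /dom (_ : \1_(@rV_box R n (2 ^+ k.+1)) z = 1); last by rewrite indicE mem_set //; apply: box_of_norm; exact: ltW.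
rewrite mulr1 -[X in X <= _]add0r; apply: lerD; first by rewrite mulr_ge0 // indicE.
rewrite -[X in _ <= X]mulr1; apply: ler_pM; rewrite ?kern_ge0 ?le_min ?ler01 ?sqr_ge0 //.
  by apply: kern_le => //; rewrite exprn_gt0.
Qed.

Let powR_exprn (b c : R) k : 0 < b -> (b ^+ k) `^ c = (b `^ c) ^+ k.
Proof.
move=> b0; elim: k => [|k IH]; first by rewrite !expr0 powR1.
by rewrite !exprS powRM ?exprn_ge0 ?(ltW b0) // IH.
Qed.

(** The ratios of the two geometric series, below 1 because s < 1 and s > 0 respectively. *)
Let rs : R := 2^-1 `^ (2 - 2 * s).
Let rl : R := 2 `^ (- (2 * s)).

Let csE k : cs k * (2 * 2^-1 ^+ k) ^+ n = (2 ^+ n * (2^-1 `^ a)^-1) * rs ^+ k.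
Proof.
have b0 : 0 < 2^-1 `^ a :> R by rewrite powR_gt0.
rewrite /cs powR_exprn // exprMn exprSr invfM.
have -> : rs = (2^-1 `^ a)^-1 * (2^-1 ^+ 2 * 2^-1 ^+ n).
  rewrite /rs /a -exprD -powR_mulrn // -powRN -powRD; last by rewrite invr_eq0 pnatr_eq0 implybT.
  by congr (_ `^ _); rewrite natrD; lra.
rewrite (exprMn k) (exprMn k) (exprAC 2^-1 2 k) (exprAC 2^-1 n k) -(exprVn (2^-1 `^ a) k).
move: ((2^-1 `^ a)^-1 ^+ k) ((2^-1 ^+ k) ^+ 2) ((2^-1 ^+ k) ^+ n) => A1 A2 A3; lra.
Qed.

Let clE k : cl k * (2 * 2 ^+ k.+1) ^+ n = 4 ^+ n * rl ^+ k.
Proof.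
rewrite /cl powR_exprn //.
have -> : rl = (2 `^ a)^-1 * 2 ^+ n.
  rewrite /rl /a -powRN -powR_mulrn // -powRD; last by rewrite pnatr_eq0 implybT.
  by congr (_ `^ _); lra.
have -> : (2 * 2 ^+ k.+1 : R) = 4 * 2 ^+ k by rewrite exprS; lra.
rewrite (exprMn n) (exprMn k) (exprAC 2 n k) -(exprVn (2 `^ a) k).
move: ((2 `^ a)^-1 ^+ k) ((2 ^+ k) ^+ n) => A1 A2; lra.
Qed.

Lemma integrable_kmin : mu.-integrable setT (EFin \o kmin).
Proof.
have md k : measurable_fun setT (dom k).
  by apply: measurable_funD; apply: measurable_funM => //; apply: measurable_indic; exact: measurable_rV_box.
have d0 k z : 0 <= dom k z by rewrite addr_ge0 // mulr_ge0 // indicE.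
apply/integrableP; split; first by apply/measurable_EFinP; exact: measurable_kmin.
apply: (@le_lt_trans _ _ (\int[mu]_z (\sum_(0 <= k <oo) (dom k z)%:E))%E).
  apply: ge0_le_integral => //.
  - by apply: measurableT_comp => //; apply/measurable_EFinP; exact: measurable_kmin.
  - by apply: ge0_emeasurable_sum => [k x _ _|k _]; [rewrite lee_fin|exact/measurable_EFinP].
  move=> z _ /=; have [k hk] := kmin_dom z.
  rewrite ger0_norm ?kmin_ge0 //; apply: (@le_trans _ _ (dom k z)%:E); first by rewrite lee_fin.
  apply: le_trans (nneseries_lim_ge k.+1 _); last by move=> j _ _; rewrite lee_fin.
  rewrite big_nat_recr //= leeDr //; apply: sume_ge0 => j _; by rewrite lee_fin.
rewrite integral_nneseries //; last 2 first.
- by move=> k; exact/measurable_EFinP.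
- by move=> k x _; rewrite lee_fin.
have Id k : (\int[mu]_z (dom k z)%:E = (2 ^+ n * (2^-1 `^ a)^-1 * rs ^+ k + 4 ^+ n * rl ^+ k)%:E)%E.
  have b (rho c : R) : 0 <= rho -> 0 <= c -> (\int[mu]_z (c * \1_(@rV_box R n rho) z)%:E = (c * (2 * rho) ^+ n)%:E)%E.
    move=> r0 c0; under eq_integral do rewrite EFinM.
    rewrite integralZl_T; [|by apply/measurable_EFinP; apply: measurable_indic; exact: measurable_rV_box|by move=> z; rewrite lee_fin indicE|by rewrite lee_fin].
    rewrite integral_indic ?setIT //; last exact: measurable_rV_box.
    by rewrite EFinM; congr (_ * _)%E; exact: lebesgue_rV_box.
  rewrite /dom; under eq_integral do rewrite EFinD.
  rewrite ge0_integralD //; last 4 first.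
  - by move=> z _; rewrite lee_fin mulr_ge0 // indicE.
  - by apply/measurable_EFinP; apply: measurable_funM => //; apply: measurable_indic; exact: measurable_rV_box.
  - by move=> z _; rewrite lee_fin mulr_ge0 // indicE.
  - by apply/measurable_EFinP; apply: measurable_funM => //; apply: measurable_indic; exact: measurable_rV_box.
  by rewrite !b ?exprn_ge0 // csE clE -EFinD.
under eq_eseriesr do rewrite Id.
have rs1 : 0 < rs < 1.
  rewrite powR_gt0 //=; have -> : 1 = 2^-1 `^ 0 :> R by rewrite powRr0.
  have l2 : 0 < ln (2:R) by apply: ln_gt0; lra.
  have l3 : 0 < (2 - 2 * s) * ln 2 by apply: mulr_gt0 => //; rewrite subr_gt0 -[X in _ < X]mulr1 ltr_pM2l.
  rewrite /rs /powR invr_eq0 pnatr_eq0 /= ltr_expR lnV ?posrE // mul0r mulrN oppr_lt0; exact: l3.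
have rl1 : 0 < rl < 1.
  rewrite powR_gt0 //=; have -> : 1 = 2 `^ 0 :> R by rewrite powRr0.
  have l2 : 0 < ln (2:R) by apply: ln_gt0; lra.
  have l3 : 0 < (2 * s) * ln 2 by apply: mulr_gt0 => //; rewrite mulr_gt0.
  rewrite /rl /powR pnatr_eq0 /= ltr_expR mul0r mulNr oppr_lt0; exact: l3.
have A0 : 0 <= 2 ^+ n * (2^-1 `^ a)^-1 :> R by rewrite mulr_ge0 ?exprn_ge0 ?invr_ge0 ?powR_ge0.
have B0 : 0 <= 4 ^+ n :> R by rewrite exprn_ge0.
move: rs1 rl1 => /andP[p1 p2] /andP[p3 p4].
apply: (@le_lt_trans _ _ ((2 ^+ n * (2^-1 `^ a)^-1) * (1 - rs)^-1 + 4 ^+ n * (1 - rl)^-1)%:E); last exact: ltry.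
apply: lime_le.
  apply: is_cvg_nneseries => k _ _; rewrite lee_fin; apply: addr_ge0; apply: mulr_ge0 => //; rewrite exprn_ge0 // ltW //.
apply: nearW => N; rewrite sumEFin lee_fin big_split /=; apply: lerD.
  have := @geometric_le_lim R N _ rs A0 p1; rewrite gtr0_norm // => /(_ p2); by rewrite seriesEnat.
by have := @geometric_le_lim R N _ rl B0 p3; rewrite gtr0_norm // => /(_ p4); rewrite seriesEnat.
Qed.

Local Notation m2 := (@product_measure1 _ _ V V R mu mu).

Lemma measurable_kern2 : measurable_fun setT (fun z : V * V => kern (z.1 - z.2)).
Proof. exact: measurableT_comp measurable_kern measurable_sub_rV. Qed.

(** Sharing the kernel as a square root between the two factors makes the nonlocal form an L^2 inner
    product on the product space, so the L^2 theory applies to it unchanged. *)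
Definition ndiff u (z : V * V) : R := (u z.1 - u z.2) * Num.sqrt (kern (z.1 - z.2)).

Lemma nonlocalE u v z : nonlocal_integrand s u v z = ndiff u z * ndiff v z.
Proof.
rewrite /nonlocal_integrand /ndiff -[(enorm _ `^ _)^-1]/(kern (z.1 - z.2)).
rewrite -{1}(sqr_sqrtr (kern_ge0 (z.1 - z.2))); lra.
Qed.

Lemma ndiff_sq u z : ndiff u z ^+ 2 = (u z.1 - u z.2) ^+ 2 * kern (z.1 - z.2).
Proof. by rewrite exprMn sqr_sqrtr ?kern_ge0. Qed.

Lemma measurable_ndiff u : measurable_fun setT u -> measurable_fun setT (ndiff u).
Proof.
move=> mu_; apply: measurable_funM.
  by apply: measurable_funB; [exact: measurableT_comp mu_ measurable_fst|exact: measurableT_comp mu_ measurable_snd].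
apply: measurableT_comp measurable_kern2.
exact: (continuous_measurable_fun (@sqrt_continuous R)).
Qed.

Lemma ndiffB u v z : ndiff (fun x => u x - v x) z = ndiff u z - ndiff v z.
Proof. by rewrite /ndiff; lra. Qed.
Lemma ndiffZ (c : R) u z : ndiff (fun x => c * u x) z = c * ndiff u z.
Proof. by rewrite /ndiff; lra. Qed.

Lemma ge0_integral_shear (G : V * V -> \bar R) : measurable_fun setT G -> (forall z, 0 <= G z)%E ->
  (\int[m2]_z G z = \int[mu]_z \int[mu]_x G (x, (x + z)%R))%E.
Proof.
move=> mG G0; rewrite -(ge0_integral_preserving (@measurable_shear R n) (@shear_preserving R n)) //.
apply: (@fubini_tonelli2 _ _ _ _ _ mu mu (fun z : V * V => G (z.1, z.1 + z.2)) _ _) => //.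
exact: measurableT_comp mG (@measurable_shear R n).
Qed.

Lemma integral_shear (G : V * V -> \bar R) : m2.-integrable setT G ->
  (\int[m2]_z G z = \int[mu]_z \int[mu]_x G (x, (x + z)%R))%E.
Proof.
move=> IG; have mG : measurable_fun setT G by case/integrableP: IG.
rewrite -(integral_preserving (@measurable_shear R n) (@shear_preserving R n)) //.
have I2 := integrable_preserving (@measurable_shear R n) (@shear_preserving R n) IG.
by rewrite -(integral21_prod_meas1 I2).
Qed.

Definition CK : R := \int[mu]_z kmin z.

Lemma CK_ge0 : 0 <= CK.
Proof. by apply: Rintegral_ge0 => z _; exact: kmin_ge0. Qed.

(** By Tonelli in the displacement z, the inner integral is [kern s z] times a squared L^2
    increment. One hypothesis is good for small z, the other for large z; together they leave the
    integrable [kmin]. *)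
Lemma ndiff_bound u A B : l2 mu u -> 0 <= A -> 0 <= B ->
  (forall z : V, ip mu (fun x => u (x + z) - u x) (fun x => u (x + z) - u x) <= A * `|z| ^+ 2) ->
  (forall z : V, ip mu (fun x => u (x + z) - u x) (fun x => u (x + z) - u x) <= B) ->
  l2 m2 (ndiff u) /\ ip m2 (ndiff u) (ndiff u) <= CK * (A + B).
Proof.
move=> lu A0 B0 hA hB; have [mu_ _] := lu; have mN := measurable_ndiff mu_.
have mN2 : measurable_fun setT (fun z => (ndiff u z ^+ 2)%:E) by apply/measurable_EFinP; exact: measurable_funX.
have ld z : l2 mu (fun x => u (x + z) - u x) by apply: l2B => //; exact: l2_shift.
have H : (\int[m2]_z (ndiff u z ^+ 2)%:E <= (CK * (A + B))%:E)%E.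
  rewrite ge0_integral_shear //; last by move=> z; rewrite lee_fin sqr_ge0.
  have E (z : V) : (\int[mu]_x (ndiff u (x, (x + z)%R) ^+ 2)%:E =
     (kern z * ip mu (fun x => u (x + z) - u x) (fun x => u (x + z) - u x))%:E)%E.
    transitivity (\int[mu]_x ((kern z)%:E * ((u (x + z) - u x) ^+ 2)%:E))%E.
      apply: eq_integral => x _; rewrite -EFinM ndiff_sq /= opprD addrA subrr sub0r kernN; congr EFin; lra.
    rewrite integralZl_T; [|by apply/measurable_EFinP; apply: measurable_funX; case: (ld z)|by move=> x; rewrite lee_fin sqr_ge0|by rewrite lee_fin kern_ge0].
    by rewrite (ipE (ld z)).
  under eq_integral do rewrite E.
  apply: (@le_trans _ _ (\int[mu]_z ((A + B)%:E * (kmin z)%:E))%E).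
    apply: ge0_le_integral => //.
    - by move=> z _; rewrite lee_fin mulr_ge0 ?kern_ge0 ?ip_ge0.
    - have m3 : measurable_fun setT (fun z : V * V => (ndiff u (z.1, z.1 + z.2) ^+ 2)%:E) := measurableT_comp mN2 (@measurable_shear R n).
      have p3 (z : V * V) : (0 <= (ndiff u (z.1, z.1 + z.2) ^+ 2)%:E)%E by rewrite lee_fin sqr_ge0.
      have := @measurable_fun_fubini_tonelli_G _ _ _ _ _ mu _ m3 p3.
      by apply: eq_measurable_fun => z _; rewrite /fubini_G /= E.
    - by apply: measurable_funeM; apply/measurable_EFinP; exact: measurable_kmin.
    move=> z _; rewrite -EFinM lee_fin /kmin mulrCA ler_wpM2l ?kern_ge0 //.
    rewrite /Num.min; case: ifP => _; first by rewrite mulr1 (le_trans (hB z)) // lerDr.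
    by rewrite (le_trans (hA z)) // ler_wpM2r ?sqr_ge0 // lerDl.
  rewrite integralZl_T; [|by apply/measurable_EFinP; exact: measurable_kmin|by move=> z; rewrite lee_fin kmin_ge0|by rewrite lee_fin addr_ge0].
  rewrite mulrC EFinM lee_wpmul2l ?lee_fin ?addr_ge0 // /CK /Rintegral fineK //.
  exact: (integrable_fin_num measurableT integrable_kmin).
have lN : l2 m2 (ndiff u).
  split => //; apply/integrableP; split; first by apply/measurable_EFinP; exact: measurable_funX.
  under eq_integral => x _ do rewrite /= ger0_norm ?sqr_ge0 //.
  exact: le_lt_trans H (ltry _).
by split => //; rewrite -lee_fin -ipE.
Qed.

(** The 4 comes from bounding an increment by the function and its translate, the n from
    [transl_est]. *)
Definition CN : R := CK * (4 + n%:R).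

Lemma CN_ge0 : 0 <= CN.
Proof. by rewrite mulr_ge0 ?CK_ge0 // addr_ge0. Qed.

Lemma ndiff_Cc D psi : Cc_smooth D psi -> l2 m2 (ndiff psi) /\
  ip m2 (ndiff psi) (ndiff psi) <= CN * (ip mu psi psi + \sum_i ip mu (partial i psi) (partial i psi)).
Proof.
move=> hpsi; have lp := Cc_l2 hpsi; have [mp _] := lp.
set S := \sum_i _; have S0 : 0 <= S by apply: sumr_ge0 => i _; exact: ip_ge0.
have p0 := ip_ge0 mu psi.
have [||||lN hN] := @ndiff_bound psi (n%:R * S) (4 * ip mu psi psi) lp.
- by rewrite mulr_ge0.
- by rewrite mulr_ge0.
- by move=> z; have := transl_est z hpsi; rewrite -/S; lra.
- move=> z; have := ipD_le (l2_shift z lp) (l2N lp).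
  rewrite (ip_shift z mp mp) (_ : ip mu (fun x => - psi x) (fun x => - psi x) = ip mu psi psi); first lra.
  by apply: eq_Rintegral => x _; rewrite mulrNN.
split => //; apply: le_trans hN _; rewrite /CN -mulrA ler_wpM2l ?CK_ge0 //.
have n0 : 0 <= n%:R :> R by [].
have := mulr_ge0 n0 p0; lra.
Qed.

Lemma ae_prod (P : V -> Prop) : {ae mu, forall x, P x} -> {ae m2, forall z, P z.1 /\ P z.2}.
Proof.
move=> [A [mA A0 hA]]; exists (A `*` setT `|` setT `*` A); split.
- by apply: measurableU; exact: measurableX.
- apply/eqP; rewrite -measure_le0; apply: le_trans (measureU2 _ _ _) _; try exact: measurableX.
  have h1 : m2 (A `*` setT) = 0%E.
    by apply: etrans (product_measure1E _ _ mA measurableT) _; exact: etrans (congr1 (fun t => t * _)%E A0) (mul0e _).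
  have h2 : m2 (setT `*` A) = 0%E.
    by apply: etrans (product_measure1E _ _ measurableT mA) _; exact: etrans (congr1 (fun t => _ * t)%E A0) (mule0 _).
  by move: h1 h2 => /= -> ->; rewrite adde0.
- move=> z /= /not_andP[h|h]; [left|right]; split => //=; exact: hA.
Qed.

End kernel.

(** * Limits of test functions *)

Section Hspace.
Context {R : realType} {n : nat}.
Local Notation V := 'rV[R]_n.
Local Notation mu := (@lebesgue_rV R n).
Local Notation m2 := (@product_measure1 _ _ V V R mu mu).
Local Notation VF := (V -> R).
Local Notation GF := ('I_n -> V -> R).
Implicit Types (u v : VF) (g h : GF) (D : set V).

Definition dir g h : R := \sum_i ip mu (g i) (h i).

Definition nrm u g : R := ip mu u u + dir g g.

Definition l2H u g := l2 mu u /\ forall i, l2 mu (g i).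

Definition cvgH (u : nat -> VF) (g : nat -> GF) u0 g0 :=
  l2cvg mu u u0 /\ forall i, l2cvg mu (fun k => g k i) (g0 i).

(* [u] lies in W_0^{1,2}(D), seen on R^n, and [g] is its gradient; carrying [g] along avoids [wgrad]. *)
Definition inH D u g := l2H u g /\ exists psi : nat -> VF,
  (forall k, Cc_smooth D (psi k)) /\ cvgH psi (fun k i => partial i (psi k)) u g.

Lemma l2cvg_cst d (T : measurableType d) (m : {measure set T -> \bar R}) f : l2cvg m (fun=> f) f.
Proof.
have E : ip m (fun x => f x - f x) (fun x => f x - f x) = 0.
  by rewrite /ip /Rintegral integral0_eq // => x _; rewrite subrr mul0r.
by rewrite /l2cvg E; exact: cvg_cst.
Qed.

Lemma dir_ge0 g : 0 <= dir g g.
Proof. by apply: sumr_ge0 => i _; exact: ip_ge0. Qed.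

Lemma nrm_ge0 u g : 0 <= nrm u g.
Proof. by rewrite addr_ge0 ?ip_ge0 ?dir_ge0. Qed.

Lemma ip_le_dir g i : ip mu (g i) (g i) <= dir g g.
Proof. by rewrite /dir (bigD1 i) //= lerDl; apply: sumr_ge0 => j _; exact: ip_ge0. Qed.

Lemma l2H_lin (a b : R) u g v h : l2H u g -> l2H v h ->
  l2H (fun x => a * u x + b * v x) (fun i x => a * g i x + b * h i x).
Proof. by move=> [lu lg] [lv lh]; split => [|i]; apply: l2D; exact: l2Z. Qed.

Lemma l2HB u g v h : l2H u g -> l2H v h -> l2H (fun x => u x - v x) (fun i x => g i x - h i x).
Proof. by move=> [lu lg] [lv lh]; split => [|i]; exact: l2B. Qed.

Lemma nrmD_le u g v h : l2H u g -> l2H v h ->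
  nrm (fun x => u x + v x) (fun i x => g i x + h i x) <= 2 * nrm u g + 2 * nrm v h.
Proof.
move=> [lu lg] [lv lh]; have h1 := ipD_le lu lv.
have : dir (fun i x => g i x + h i x) (fun i x => g i x + h i x) <= 2 * dir g g + 2 * dir h h.
  by rewrite /dir !mulr_sumr -big_split /=; apply: ler_sum => i _; exact: ipD_le.
rewrite /nrm; lra.
Qed.

Lemma cvgH_nrm (u : nat -> VF) (g : nat -> GF) u0 g0 : cvgH u g u0 g0 <->
  (fun k => nrm (fun x => u k x - u0 x) (fun i x => g k i x - g0 i x)) @ \oo --> (0 : R).
Proof.
split.
  move=> [h1 h2]; rewrite [X in _ --> X](_ : 0 = 0 + \sum_(i < n) 0); last by rewrite big1 // addr0.
    apply: cvgD => //; rewrite /dir; elim: (index_enum _) => [|a l IH].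
    by under eq_fun do rewrite big_nil; rewrite big_nil; exact: cvg_cst.
  by under eq_fun do rewrite big_cons; rewrite big_cons; exact: cvgD (h2 a) IH.
move=> h; split.
  by apply: squeeze0 h => k; rewrite ip_ge0 /= lerDl dir_ge0.
move=> i; apply: squeeze0 h => k; rewrite ip_ge0 /=.
apply: le_trans (ip_le_dir (fun i x => g k i x - g0 i x) i) _; rewrite lerDr; exact: ip_ge0.
Qed.

Lemma cvgH_lin (a b : R) (u v : nat -> VF) (g h : nat -> GF) u0 g0 v0 h0 :
  (forall k, l2H (u k) (g k)) -> (forall k, l2H (v k) (h k)) -> l2H u0 g0 -> l2H v0 h0 ->
  cvgH u g u0 g0 -> cvgH v h v0 h0 ->
  cvgH (fun k x => a * u k x + b * v k x) (fun k i x => a * g k i x + b * h k i x)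
       (fun x => a * u0 x + b * v0 x) (fun i x => a * g0 i x + b * h0 i x).
Proof.
have bd (c : R) (w : nat -> VF) w0 : (forall k, l2 mu (w k)) -> l2 mu w0 -> l2cvg mu w w0 -> l2cvg mu (fun k x => c * w k x) (fun x => c * w0 x).
  by move=> lw lw0; apply: (@l2cvg_bdM _ _ _ mu (fun=> c) `|c|) => //.
move=> lu lv [lu0 lg0] [lv0 lh0] [hu hg] [hv hh]; split => [|i].
  apply: l2cvgD; try (by move=> k; apply: l2Z; case: (lu k)) || (by move=> k; apply: l2Z; case: (lv k)); try exact: l2Z.
    by apply: bd => // k; case: (lu k).
  by apply: bd => // k; case: (lv k).
apply: l2cvgD; try (by move=> k; apply: l2Z; case: (lu k)) || (by move=> k; apply: l2Z; case: (lv k)); try exact: l2Z.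
  by apply: bd => // k; case: (lu k).
by apply: bd => // k; case: (lv k).
Qed.

Lemma Cc_l2H D psi : Cc_smooth D psi -> l2H psi (fun i => partial i psi).
Proof. by move=> h; split => [|i]; [exact: Cc_l2 h|exact: Cc_partial_l2 h]. Qed.

Lemma Cc_inH D psi : Cc_smooth D psi -> inH D psi (fun i => partial i psi).
Proof.
move=> h; split; first exact: Cc_l2H h.
by exists (fun=> psi); split => //; split => [|i]; exact: l2cvg_cst.
Qed.

Lemma inH_mono D U u g : D `<=` U -> inH D u g -> inH U u g.
Proof.
by move=> DU [lu [psi [hp hc]]]; split => //; exists psi; split => // k; apply: Cc_mono (hp k).
Qed.

Lemma partial_lin (a b : R) (f f' : VF) i x : smooth f -> smooth f' ->
  partial i (fun x => a * f x + b * f' x) x = a * partial i f x + b * partial i f' x.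
Proof.
move=> sf sf'; have d (c : R) (k : VF) : smooth k -> derivable (fun x => c * k x) x (delta_mx ord0 i).
  by move=> sk; have [] := Ck_der i (CkZ c (sk 1%N)).
have Z (c : R) (k : VF) : smooth k -> partial i (fun x => c * k x) x = c * partial i k x.
  by move=> sk; rewrite partialM ?partial_cst ?mulr0 ?addr0 //; exact: smooth_derivable.
by rewrite partialD ?Z //; exact: d.
Qed.

Lemma inH_lin D (a b : R) u g v h : inH D u g -> inH D v h ->
  inH D (fun x => a * u x + b * v x) (fun i x => a * g i x + b * h i x).
Proof.
move=> [lu [p [hp cp]]] [lv [q [hq cq]]]; split; first exact: l2H_lin.
exists (fun k x => a * p k x + b * q k x); split.
  by move=> k; apply: CcD; exact: CcZ.
have := cvgH_lin a b (fun k => Cc_l2H (hp k)) (fun k => Cc_l2H (hq k)) lu lv cp cq.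
rewrite /cvgH => -[h1 h2]; split => // i; suff <- : (fun k x => a * partial i (p k) x + b * partial i (q k) x) = (fun k => partial i (fun x => a * p k x + b * q k x)) by exact: h2.
by apply/funext => k; apply/funext => x; rewrite partial_lin //; [exact: Cc_smoothE (hp k)|exact: Cc_smoothE (hq k)].
Qed.

Lemma inH_Z D a u g : inH D u g -> inH D (fun x => a * u x) (fun i x => a * g i x).
Proof.
move=> hu; have := inH_lin a 0 hu hu; congr (inH D).
  by apply/funext => x; rewrite mul0r addr0.
by apply/funext => i; apply/funext => x; rewrite mul0r addr0.
Qed.

Lemma inH_B D u g v h : inH D u g -> inH D v h -> inH D (fun x => u x - v x) (fun i x => g i x - h i x).
Proof.
move=> hu hv; have := inH_lin 1 (-1) hu hv; congr (inH D).
  by apply/funext => x; rewrite mul1r mulN1r.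
by apply/funext => i; apply/funext => x; rewrite mul1r mulN1r.
Qed.

Lemma inH_0 D : inH D (fun=> 0) (fun _ _ => 0).
Proof.
have := Cc_inH (Cc0 D); congr (inH D); apply/funext => i; apply/funext => x; exact: partial_cst.
Qed.

Lemma l2cvg_ae_eq d (T : measurableType d) (m : {measure set T -> \bar R}) (u : nat -> T -> R) f f' :
  (forall k, measurable_fun setT (u k)) -> measurable_fun setT f -> measurable_fun setT f' ->
  {ae m, forall x, f x = f' x} -> l2cvg m u f -> l2cvg m u f'.
Proof.
move=> mu_ mf mf' ff'; rewrite /l2cvg.
suff -> : (fun k => ip m (fun x => u k x - f x) (fun x => u k x - f x)) = (fun k => ip m (fun x => u k x - f' x) (fun x => u k x - f' x)) by [].
apply/funext => k; by apply: ae_eq_Rint; try (by apply: measurable_funM; exact: measurable_funB); apply: filterS ff' => x ->.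
Qed.

Lemma l2cvg_sub d (T : measurableType d) (m : {measure set T -> \bar R}) (u : nat -> T -> R) f phi :
  (forall k, (k <= phi k)%N) -> l2cvg m u f -> l2cvg m (fun k => u (phi k)) f.
Proof.
move=> hphi; apply: cvg_comp => A [N _ hN]; exists N => // k /= Nk; apply: hN; exact: leq_trans (hphi k).
Qed.

Lemma inH_ae D u g u' g' : inH D u g -> measurable_fun setT u' -> (forall i, measurable_fun setT (g' i)) ->
  {ae mu, forall x, u x = u' x} -> (forall i, {ae mu, forall x, g i x = g' i x}) -> inH D u' g'.
Proof.
move=> [[lu lg] [psi [hp [c1 c2]]]] mu' mg' uu' gg'.
split; first by split => [|i]; [exact: ae_eq_l2 uu' lu|exact: ae_eq_l2 (gg' i) (lg i)].
exists psi; split => //; split => [|i].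
  by apply: l2cvg_ae_eq c1 => //; [move=> k; exact: Cc_meas (hp k)|case: lu].
by apply: l2cvg_ae_eq (c2 i) => //; [move=> k; exact: Cc_meas (Cc_partial i (hp k))|case: (lg i)].
Qed.

(** Diagonal choice: a test function whose squared distance to the k-th term is at most 1/(k+1). *)
Lemma inH_closed D (u : nat -> VF) (g : nat -> GF) u0 g0 :
  (forall k, inH D (u k) (g k)) -> l2H u0 g0 -> cvgH u g u0 g0 -> inH D u0 g0.
Proof.
move=> hu l0 c0; split => //.
have h k : exists psi, Cc_smooth D psi /\ nrm (fun x => psi x - u k x) (fun i x => partial i psi x - g k i x) <= k.+1%:R^-1.
  have [_ [psi [hp /cvgH_nrm cp]]] := hu k.
  have k0 : 0 < k.+1%:R^-1 :> R by rewrite invr_gt0.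
  have /cvgrPdist_le/(_ _ k0)[N _ hN] := cp; exists (psi N); split => //.
  by have := hN N (leqnn N); rewrite sub0r normrN ger0_norm ?nrm_ge0.
have [psi hpsi] := boolp.choice h; exists psi; split; first by move=> k; case: (hpsi k).
apply/cvgH_nrm; move/cvgH_nrm: c0 => c0.
apply: (@squeeze0 _ (fun k => 2 * k.+1%:R^-1 + 2 * nrm (fun x => u k x - u0 x) (fun i x => g k i x - g0 i x))); last first.
  by apply: cvg0_lin c0; exact: cvg_harmonic.
move=> k; rewrite nrm_ge0 /=; have [hp hk] := hpsi k; have [lk _] := hu k.
have := nrmD_le (l2HB (Cc_l2H hp) lk) (l2HB lk l0).
have -> : (fun x => psi k x - u k x + (u k x - u0 x)) = (fun x => psi k x - u0 x) by apply/funext => x; rewrite addrA subrK.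
have -> : (fun i x => partial i (psi k) x - g k i x + (g k i x - g0 i x)) = (fun i x => partial i (psi k) x - g0 i x).
  by apply/funext => i; apply/funext => x; rewrite addrA subrK.
by move: hk; set a := k.+1%:R^-1; lra.
Qed.

Lemma inH_cauchy D (u : nat -> VF) (g : nat -> GF) : (forall k, inH D (u k) (g k)) ->
  (forall e, 0 < e -> exists N, forall j k, (N <= j)%N -> (N <= k)%N ->
     nrm (fun x => u j x - u k x) (fun i x => g j i x - g k i x) <= e) ->
  exists u0 g0, inH D u0 g0 /\ cvgH u g u0 g0.
Proof.
move=> hu hc.
have [|u0 [lu0 c0]] := @l2cvg_cauchy _ _ _ mu u (fun k => proj1 (proj1 (hu k))).
  move=> e /hc[N hN]; exists N => j k Nj Nk; apply: le_trans (hN j k Nj Nk).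
  by rewrite lerDl dir_ge0.
have h i : exists gi, l2 mu gi /\ l2cvg mu (fun k => g k i) gi.
  apply: (l2cvg_cauchy (fun k => proj2 (proj1 (hu k)) i)).
  move=> e /hc[N hN]; exists N => j k Nj Nk; apply: le_trans (hN j k Nj Nk).
  by apply: le_trans (ip_le_dir (fun i x => g j i x - g k i x) i) _; rewrite lerDr ip_ge0.
have [g0 hg0] := boolp.choice h; exists u0, g0.
have c : cvgH u g u0 g0 by split => // i; case: (hg0 i).
by split => //; apply: inH_closed hu _ c; split => // i; case: (hg0 i).
Qed.

Lemma inH_poincare D (rho : R) (i : 'I_n) u g : (forall x, D x -> `|x| <= rho) -> 0 < rho -> inH D u g ->
  ip mu u u <= (2 * rho + 1) ^+ 2 * dir g g.
Proof.
move=> hD r0 [[lu lg] [psi [hp [c1 c2]]]].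
have lp k := Cc_l2 (hp k); have lpp k i := Cc_partial_l2 i (hp k).
apply: (@le_trans _ _ ((2 * rho + 1) ^+ 2 * ip mu (g i) (g i))); last first.
  by rewrite ler_wpM2l ?sqr_ge0 // ip_le_dir.
apply: ler_cvg_to (l2cvg_ip lp lp lu lu c1 c1) (cvgMr (l2cvg_ip (fun k => lpp k i) (fun k => lpp k i) (lg i) (lg i) (c2 i) (c2 i))) _.
by apply: nearW => k; exact: poincare_Cc hD r0 (hp k).
Qed.

(** Off D the approximating test functions and their derivatives vanish identically, and
    subsequences converge almost everywhere; D is an arbitrary set. *)
Lemma inH_out D u g : inH D u g -> {ae mu, forall x, ~ D x -> u x = 0 /\ forall i, g i x = 0}.
Proof.
move=> [[lu lg] [psi [hp [c1 c2]]]].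
have [f1 [_ h1]] := l2cvg_ae (fun k => Cc_l2 (hp k)) lu c1.
have h2 i : {ae mu, forall x, ~ D x -> g i x = 0}.
  have [f2 [_ h]] := l2cvg_ae (fun k => Cc_partial_l2 i (hp k)) (lg i) (c2 i).
  apply: filterS h => x hx Dx.
  have E : (fun k => partial i (psi (f2 k)) x) = (fun=> 0) by apply/funext => k; exact: Cc_out (Cc_partial i (hp _)) Dx.
  by rewrite E in hx; exact: cvg_unique hx (cvg_cst _).
have h2' : {ae mu, forall x, forall i, ~ D x -> g i x = 0}.
  exact: filter_forall h2.
apply: filterS2 h1 h2' => x hx hg Dx; split => [|i]; last exact: hg.
have E : (fun k => psi (f1 k) x) = (fun=> 0) by apply/funext => k; exact: Cc_out (hp _) Dx.
by rewrite E in hx; exact: cvg_unique hx (cvg_cst _).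
Qed.

(** [psi] need not be supported in D: extension by zero keeps the weak gradient, itself extended by
    zero. *)
Lemma inH_ibp D u g i psi : inH D u g -> Cc_smooth setT psi ->
  \int[mu]_x (u x * partial i psi x) = - \int[mu]_x (g i x * psi x).
Proof.
move=> [[lu lg] [p [hp [c1 c2]]]] hpsi.
have lp k := Cc_l2 (hp k); have lpp k := Cc_partial_l2 i (hp k).
have l1 := Cc_l2 hpsi; have l1' := Cc_partial_l2 i hpsi.
have h1 := l2cvg_ip lp (fun=> l1') lu l1' c1 (@l2cvg_cst _ _ mu _).
have h2 := cvgN (l2cvg_ip lpp (fun=> l1) (lg i) l1 (c2 i) (@l2cvg_cst _ _ mu _)).
suff E : (fun k => ip mu (p k) (partial i psi)) = (fun k => - ip mu (partial i (p k)) psi).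
  by move: h2; rewrite E in h1; move=> /(_ _) h2; exact: cvg_unique h1 h2.
by apply/funext => k; rewrite /ip (integral_by_parts i (Cc_smoothE (hp k)) hpsi).
Qed.

End Hspace.

(** * The nonlocal form, the chain rule and a comparison estimate *)

Section nonlocal.
Context {R : realType} {n : nat}.
Local Notation V := 'rV[R]_n.
Local Notation mu := (@lebesgue_rV R n).
Local Notation m2 := (@product_measure1 _ _ V V R mu mu).
Local Notation VF := (V -> R).
Local Notation GF := ('I_n -> V -> R).
Implicit Types (u v : VF) (g h : GF) (D : set V).

Lemma cont_cvg_seq (F : R -> R) (a : nat -> R) l : continuous F -> a @ \oo --> l ->
  (fun k => F (a k)) @ \oo --> F l.
Proof. by move=> cF ha; have /(_ _) := continuous_cvg _ (cF l) ha; apply. Qed.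

Lemma cvg0Z (c : R) (a : nat -> R) : a @ \oo --> (0 : R) -> (fun k => c * a k) @ \oo --> (0 : R).
Proof. by move=> h; rewrite -[X in _ --> X](mulr0 c); exact: cvgMr. Qed.

Lemma cvgH_nrm_to (u : nat -> VF) (g : nat -> GF) u0 g0 : (forall k, l2H (u k) (g k)) -> l2H u0 g0 ->
  cvgH u g u0 g0 -> (fun k => nrm (u k) (g k)) @ \oo --> nrm u0 g0.
Proof.
move=> lu [lu0 lg0] [c1 c2]; apply: cvgD.
  exact: (l2cvg_ip (fun k => proj1 (lu k)) (fun k => proj1 (lu k)) lu0 lu0 c1 c1).
rewrite /dir; elim: (index_enum _) => [|i l IH].
  by under eq_fun do rewrite big_nil; rewrite big_nil; exact: cvg_cst.
under eq_fun do rewrite big_cons; rewrite big_cons; apply: cvgD IH.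
exact: (l2cvg_ip (fun k => proj2 (lu k) i) (fun k => proj2 (lu k) i) (lg0 i) (lg0 i) (c2 i) (c2 i)).
Qed.

Lemma cvgH_is_cauchy (u : nat -> VF) (g : nat -> GF) u0 g0 : (forall k, l2H (u k) (g k)) -> l2H u0 g0 ->
  cvgH u g u0 g0 -> forall e, 0 < e -> exists N, forall j k, (N <= j)%N -> (N <= k)%N ->
    nrm (fun x => u j x - u k x) (fun i x => g j i x - g k i x) <= e.
Proof.
move=> lu l0 /cvgH_nrm c e e0; have e4 : 0 < e / 4 by lra.
have /cvgrPdist_le/(_ _ e4)[N _ hN] := c; exists N => j k Nj Nk.
have hj := hN j Nj; have hk := hN k Nk; rewrite sub0r normrN ger0_norm ?nrm_ge0 // in hj.
rewrite sub0r normrN ger0_norm ?nrm_ge0 // in hk.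
have := nrmD_le (l2HB (lu j) l0) (l2HB l0 (lu k)).
have -> : nrm (fun x => u0 x - u k x) (fun i x => g0 i x - g k i x) = nrm (fun x => u k x - u0 x) (fun i x => g k i x - g0 i x).
  have E (a b : VF) : ip mu (fun x => a x - b x) (fun x => a x - b x) = ip mu (fun x => b x - a x) (fun x => b x - a x).
    by apply: eq_Rintegral => x _; rewrite -(opprB (b x)) mulrNN.
  by rewrite /nrm E; congr (_ + _); apply: eq_bigr => i _; exact: E.
have -> : (fun x => u j x - u0 x + (u0 x - u k x)) = (fun x => u j x - u k x) by apply/funext => x; rewrite addrA subrK.
have -> : (fun i x => g j i x - g0 i x + (g0 i x - g k i x)) = (fun i x => g j i x - g k i x).
  by apply/funext => i; apply/funext => x; rewrite addrA subrK.
lra.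
Qed.

Lemma partialB (f f' : VF) i x : smooth f -> smooth f' ->
  partial i (fun x => f x - f' x) x = partial i f x - partial i f' x.
Proof.
move=> sf sf'; have := partial_lin 1 (-1) i x sf sf'.
rewrite mul1r mulN1r => <-; congr (partial i _ x); apply/funext => y; by rewrite mul1r mulN1r.
Qed.

Variables (s : R) (s_gt0 : 0 < s) (s_lt1 : s < 1).

Definition nl u v : R := ip m2 (ndiff s u) (ndiff s v).

(** By [ndiff_Cc] the weighted differences of the test functions form a Cauchy sequence; an almost
    everywhere convergent subsequence identifies its limit with that of u. *)
Lemma cvgH_ndiff_Cc (psi : nat -> VF) u g : (forall k, Cc_smooth setT (psi k)) -> l2H u g ->
  cvgH psi (fun k i => partial i (psi k)) u g ->
  l2 m2 (ndiff s u) /\ l2cvg m2 (fun k => ndiff s (psi k)) (ndiff s u).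
Proof.
move=> hp lu c; have [lu0 _] := lu.
have lN k : l2 m2 (ndiff s (psi k)) by case: (ndiff_Cc s_gt0 s_lt1 (hp k)).
have [|f [lf cf]] := l2cvg_cauchy lN.
  move=> e e0; have C1 : 0 < CN (n := n) s + 1 by rewrite ltr_wpDl ?CN_ge0.
  have e'0 : 0 < e / (CN (n := n) s + 1) by rewrite divr_gt0.
  have [N h] := cvgH_is_cauchy (fun k => Cc_l2H (hp k)) lu c e'0.
  exists N => j k Nj Nk; have hd := CcB (hp j) (hp k).
  have [_] := ndiff_Cc s_gt0 s_lt1 hd.
  have -> : ndiff s (fun x => psi j x - psi k x) = (fun z => ndiff s (psi j) z - ndiff s (psi k) z).
    by apply/funext => z; exact: ndiffB.
  move=> H0; apply: le_trans H0 _; have := h j k Nj Nk.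
  have -> : (fun i x => partial i (psi j) x - partial i (psi k) x) = (fun i => partial i (fun x => psi j x - psi k x)).
    by apply/funext => i; apply/funext => x; rewrite partialB //; [exact: Cc_smoothE (hp j)|exact: Cc_smoothE (hp k)].
  rewrite -[X in CN s * X]/(nrm (fun x => psi j x - psi k x) (fun i => partial i (fun x => psi j x - psi k x))).
  move=> H; apply: (@le_trans _ _ (CN (n := n) s * (e / (CN (n := n) s + 1)))).
    by apply: ler_wpM2l => //; exact: CN_ge0.
  by rewrite mulrA ler_pdivrMr // mulrC ler_pM2l // lerDl.
have [phi [hphi ae1]] := l2cvg_ae (fun k => Cc_l2 (hp k)) lu0 (proj1 c).
have ae2 : {ae m2, forall z, (fun k => ndiff s (psi (phi k)) z) @ \oo --> ndiff s u z}.
  by apply: filterS (ae_prod ae1) => z [h1 h2]; rewrite /ndiff; apply: cvgMl; exact: cvgB.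
have E := l2cvg_ae_limit (fun k => lN (phi k)) lf (l2cvg_sub hphi cf) ae2.
have mN := measurable_ndiff s (l2_meas lu0).
split; first exact: ae_eq_l2 E lf.
by apply: l2cvg_ae_eq cf => //; [move=> k; exact: l2_meas (lN k)|exact: l2_meas lf].
Qed.

Lemma inH_ndiff D u g : inH D u g -> l2 m2 (ndiff s u) /\ nl u u <= CN (n := n) s * nrm u g.
Proof.
move=> /(inH_mono (@subsetT _ D))[lu [psi [hp c]]].
have [lN cN] := cvgH_ndiff_Cc hp lu c; split => //.
have lNk k : l2 m2 (ndiff s (psi k)) by case: (ndiff_Cc s_gt0 s_lt1 (hp k)).
have h1 := l2cvg_ip lNk lNk lN lN cN cN.
have h2 : (fun k => CN (n := n) s * nrm (psi k) (fun i => partial i (psi k))) @ \oo --> CN (n := n) s * nrm u g.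
  apply: cvgMr; exact: cvgH_nrm_to (fun k => Cc_l2H (hp k)) lu c.
apply: ler_cvg_to h1 h2 _; apply: nearW => k; by case: (ndiff_Cc s_gt0 s_lt1 (hp k)).
Qed.

Lemma inH_l2 D u g : inH D u g -> l2 mu u. Proof. by move=> [[]]. Qed.
Lemma inH_l2g D u g i : inH D u g -> l2 mu (g i). Proof. by move=> [[_ h]]. Qed.
Lemma inH_l2n D u g : inH D u g -> l2 m2 (ndiff s u). Proof. by move=> /inH_ndiff[]. Qed.

Lemma cvgH_ndiff D (u : nat -> VF) (g : nat -> GF) u0 g0 : (forall k, inH D (u k) (g k)) -> inH D u0 g0 ->
  cvgH u g u0 g0 -> l2cvg m2 (fun k => ndiff s (u k)) (ndiff s u0).
Proof.
move=> hu h0 /cvgH_nrm c.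
apply: (@squeeze0 _ (fun k => CN (n := n) s * nrm (fun x => u k x - u0 x) (fun i x => g k i x - g0 i x))).
  move=> k; rewrite ip_ge0 /=.
  have [_] := inH_ndiff (inH_B (hu k) h0).
  rewrite /nl; congr (_ <= _); congr ip; apply/funext => z; exact: ndiffB.
exact: cvg0Z.
Qed.

Lemma inH_mul D eta u g : Cc_smooth setT eta -> inH D u g ->
  inH D (fun x => eta x * u x) (fun i x => eta x * g i x + u x * partial i eta x).
Proof.
move=> he [[lu lg] [psi [hp [c1 c2]]]]; have [C _ hC] := Cc_bounded he.
have me := Cc_meas he; have se := Cc_smoothE he.
have lp k := Cc_l2 (hp k); have lpp k i := Cc_partial_l2 i (hp k).
have mpe i := Cc_meas (Cc_partial i he).
have Eg (f : VF) i : (fun x => f x * partial i eta x) = (fun x => partial i eta x * f x) by apply/funext => x; exact: mulrC.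
have lpe (f : VF) i : l2 mu f -> l2 mu (fun x => f x * partial i eta x).
  by move=> lf; have [C' _ hC'] := Cc_bounded (Cc_partial i he); rewrite Eg; exact: l2_bdM hC' lf.
split.
  split => [|i]; first exact: l2_bdM hC lu.
  by apply: l2D; [exact: l2_bdM hC (lg i)|exact: lpe].
exists (fun k x => eta x * psi k x); split; first by move=> k; exact: CcM.
split; first exact: l2cvg_bdM me hC lp lu c1.
move=> i; have -> : (fun k => partial i (fun x => eta x * psi k x)) = (fun k x => eta x * partial i (psi k) x + psi k x * partial i eta x).
  by apply/funext => k; apply/funext => x; apply: partialM; apply: smooth_derivable => //; exact: Cc_smoothE (hp k).
apply: l2cvgD.
- by move=> k; exact: l2_bdM hC (lpp k i).
- by move=> k; apply: lpe.
- exact: l2_bdM hC (lg i).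
- exact: lpe.
- exact: l2cvg_bdM hC _ (lg i) (c2 i).
have [C' _ hC'] := Cc_bounded (Cc_partial i he).
rewrite Eg; have -> : (fun k x => psi k x * partial i eta x) = (fun k x => partial i eta x * psi k x).
  by apply/funext => k; exact: Eg.
exact: l2cvg_bdM hC' lp lu c1.
Qed.

Lemma inH_approx D u g : inH D u g -> exists psi : nat -> VF, [/\ forall k, Cc_smooth D (psi k),
  cvgH psi (fun k i => partial i (psi k)) u g & {ae mu, forall x, (fun k => psi k x) @ \oo --> u x}].
Proof.
move=> [[lu lg] [psi [hp [c1 c2]]]].
have [phi [hphi ae1]] := l2cvg_ae (fun k => Cc_l2 (hp k)) lu c1.
exists (fun k => psi (phi k)); split; [by move=> k; exact: hp| |exact: ae1].
split; first exact: (l2cvg_sub hphi c1).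
move=> i; exact: (l2cvg_sub hphi (c2 i)).
Qed.

Lemma smooth1_lip (F : R -> R) C : smooth1 F -> (forall t, `|derive1 F t| <= C) ->
  forall a b, `|F a - F b| <= C * `|a - b|.
Proof.
move=> sF hC.
have C0 : 0 <= C by apply: le_trans (hC 0).
have [dF _] := Ck1S (sF 1%N); have cF := Ck1_cont (sF 0%N).
have H a b : a < b -> `|F a - F b| <= C * `|a - b|.
  move=> ab; have [c _ hc] := @MVT R F (derive1 F) a b ab (fun x _ => dF x) (continuous_subspaceT cF).
  by rewrite distrC hc normrM (distrC a) ler_wpM2r.
move=> a b; have [ab|ab|->] := ltgtP a b; first exact: H.
  by rewrite distrC (distrC a); exact: H.
by rewrite !subrr normr0 mulr0.
Qed.

(** The shift by q prepares the test function of the comparison principle. The condition on F at -q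
    keeps F(psi - q) supported where the test function psi is. *)
Lemma inH_comp D u g q F C : inH D u g -> Cc_smooth setT q -> smooth1 F ->
  (forall t, `|derive1 F t| <= C) -> (forall x, F (- q x) = 0) ->
  inH D (fun x => F (u x - q x)) (fun i x => derive1 F (u x - q x) * (g i x - partial i q x)).
Proof.
move=> hu hq sF hC F0; have [[lu lg] _] := hu.
have [psi [hp [c1 c2] ae1]] := inH_approx hu.
have lip := smooth1_lip sF hC.
have [_ sF'] := Ck1S (sF 1%N); have cF := Ck1_cont (sF 0%N); have cF' := Ck1_cont sF'.
have mF : measurable_fun setT F := continuous_measurable_fun cF.
have mF' : measurable_fun setT (derive1 F) := continuous_measurable_fun cF'.
have mq := Cc_meas hq; have sq := Cc_smoothE hq; have lq i := Cc_partial_l2 i hq.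
have lp k := Cc_l2 (hp k); have lpp k i := Cc_partial_l2 i (hp k).
have m1 (f : VF) : measurable_fun setT f -> measurable_fun setT (fun x => F (f x - q x)).
  by move=> mf; apply: measurableT_comp mF _; exact: measurable_funB.
have m1' (f : VF) : measurable_fun setT f -> measurable_fun setT (fun x => derive1 F (f x - q x)).
  by move=> mf; apply: measurableT_comp mF' _; exact: measurable_funB.
have mu0 := l2_meas lu; have mpk k := l2_meas (lp k).
have lgq i : l2 mu (fun x => g i x - partial i q x) by exact: l2B.
split.
  split => [|i].
    apply: (l2_le (g := fun x => C * u x)); [exact: m1| |exact: l2Z].
    move=> x; have := lip (u x - q x) (- q x); rewrite F0 subr0 opprK subrK => h.

    by rewrite normrM (le_trans h) // ler_wpM2r // ler_norm.
  by apply: l2_bdM (lgq i); [exact: m1'|move=> x; exact: hC].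
exists (fun k x => F (psi k x - q x)).
have sk k : smooth (fun x => psi k x - q x).
  have sq' : smooth (fun x => (-1) * q x) by move=> j; exact: CkZ.
  have -> : (fun x => psi k x - q x) = (fun x => psi k x + (-1) * q x) by apply/funext => x; rewrite mulN1r.
  by move=> j; apply: CkD => //; exact: Cc_smoothE (hp k) j.
have hF k : Cc_smooth D (fun x => F (psi k x - q x)).
  apply: (Cc_sub (hp k)); first by move=> j; apply: Ck_comp1; [exact: sF|exact: sk].
  by move=> x ->; rewrite sub0r F0.
split => //; split.
  apply: (@squeeze0 _ (fun k => C ^+ 2 * ip mu (fun x => psi k x - u x) (fun x => psi k x - u x))).
    move=> k; rewrite ip_ge0 /=; have ld := l2B (lp k) lu.
    have -> : C ^+ 2 * ip mu (fun x => psi k x - u x) (fun x => psi k x - u x) = ip mu (fun x => C * (psi k x - u x)) (fun x => C * (psi k x - u x)).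
      by rewrite ipZl ?ipZr //; [lra|exact: l2Z].
    apply: ip_le; first exact: l2Z.
      by apply: measurable_funB; exact: m1.
    move=> x; have := lip (psi k x - q x) (u x - q x).
    have -> : psi k x - q x - (u x - q x) = psi k x - u x by lra.
    by move=> h; rewrite normrM (le_trans h) // ler_wpM2r // ler_norm.
  exact: cvg0Z.
move=> i; have pE k : partial i (fun x => F (psi k x - q x)) = (fun x => derive1 F (psi k x - q x) * (partial i (psi k) x - partial i q x)).
  apply/funext => x; rewrite partial_comp1; [|exact: sF|exact: sk].
  by rewrite partialB //; exact: Cc_smoothE (hp k).
(* The first summand tends to 0 because F' is bounded; the second has a fixed square integrable
   factor, so dominated convergence applies to it. *)
have -> : (fun k => partial i (fun x => F (psi k x - q x))) =
    (fun k x => derive1 F (psi k x - q x) * (partial i (psi k) x - g i x) + derive1 F (psi k x - q x) * (g i x - partial i q x)).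
  by apply/funext => k; rewrite pE; apply/funext => x; lra.
have E : (fun x => derive1 F (u x - q x) * (g i x - partial i q x)) =
    (fun x => 0 + derive1 F (u x - q x) * (g i x - partial i q x)) by apply/funext => x; rewrite add0r.
rewrite E; have ldp k := l2B (lpp k i) (lg i).
apply: l2cvgD.
- by move=> k; apply: l2_bdM (ldp k); [exact: m1'|move=> x; exact: hC].
- by move=> k; apply: l2_bdM (lgq i); [exact: m1'|move=> x; exact: hC].
- exact: l20.
- by apply: l2_bdM (lgq i); [exact: m1'|move=> x; exact: hC].
- apply: (@squeeze0 _ (fun k => C ^+ 2 * ip mu (fun x => partial i (psi k) x - g i x) (fun x => partial i (psi k) x - g i x))); last exact: cvg0Z (c2 i).
  move=> k; rewrite ip_ge0 /=.
  have -> : C ^+ 2 * ip mu (fun x => partial i (psi k) x - g i x) (fun x => partial i (psi k) x - g i x) = ip mu (fun x => C * (partial i (psi k) x - g i x)) (fun x => C * (partial i (psi k) x - g i x)).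
    by rewrite ipZl ?ipZr //; [lra|exact: l2Z].
  apply: ip_le; first exact: l2Z.
    apply: measurable_funB => //; apply: measurable_funM; first exact: m1'.
    exact: l2_meas (ldp k).
  by move=> x; rewrite subr0 !normrM ler_wpM2r // (le_trans (hC _)) // ler_norm.
apply: (@l2cvg_dominated _ _ _ mu _ _ (fun x => C * `|g i x - partial i q x|)).
- apply: l2Z; apply: l2_le (lgq i).
    by apply: measurableT_comp => //; exact: l2_meas (lgq i).
  by move=> x; rewrite normr_id.
- by move=> k; apply: measurable_funM; [exact: m1'|exact: l2_meas (lgq i)].
- by apply: measurable_funM; [exact: m1'|exact: l2_meas (lgq i)].
- apply: filterS ae1 => x hx; apply: cvgMl.
  have hx' : (fun k => psi k x - q x) @ \oo --> u x - q x by exact: cvgB hx (cvg_cst _).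
  exact: (cont_cvg_seq cF' hx').
- by move=> k x; rewrite normrM ler_wpM2r.
- by move=> x; rewrite normrM ler_wpM2r.
Qed.

(** Monotonicity of b = [bump0] makes the nonlocal term nonnegative. As 0 <= b' <= 2, the square of
    b' is at most 2 b', so the gradient of b(w) vanishes and the Poincaré inequality gives b(w) =
    0. *)
Lemma bump0_comparison D (rho : R) (i0 : 'I_n) w gw : (forall x, D x -> `|x| <= rho) -> 0 < rho ->
  l2H w gw -> l2 m2 (ndiff s w) ->
  inH D (fun x => bump0 (w x)) (fun i x => derive1 bump0 (w x) * gw i x) ->
  dir gw (fun i x => derive1 bump0 (w x) * gw i x) + nl w (fun x => bump0 (w x)) <= 0 ->
  {ae mu, forall x, w x <= 0}.
Proof.
move=> hD r0 [lw lgw] lnw hF h.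
have lF := inH_l2 hF; have lgF i := inH_l2g i hF; have lnF := inH_l2n hF.
have N0 : 0 <= nl w (fun x => bump0 (w x)).
  apply: Rintegral_ge0 => z _; rewrite -nonlocalE /nonlocal_integrand.
  apply: mulr_ge0; last by rewrite invr_ge0 powR_ge0.
  have [hz|/ltW hz] := leP (w z.1) (w z.2).
    by rewrite -mulrNN mulr_ge0 // oppr_ge0 subr_le0 // bump0_mono.
  by rewrite mulr_ge0 // subr_ge0 // bump0_mono.
have D0 : dir (fun i x => derive1 bump0 (w x) * gw i x) (fun i x => derive1 bump0 (w x) * gw i x) <= 2 * dir gw (fun i x => derive1 bump0 (w x) * gw i x).
  rewrite /dir mulr_sumr; apply: ler_sum => i _; rewrite -ipZl //.
  apply: le_Rintegral => //; [exact: l2M_integrable|by apply: l2M_integrable => //; exact: l2Z|].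
  move=> x _; have /andP[b0 b2] := bump0_derive_bound (w x).
  move: (derive1 bump0 (w x)) (gw i x) b0 b2 => b t b0 b2.
  have -> : 2 * t * (b * t) = (2 * b) * t ^+ 2 by lra.
  have -> : b * t * (b * t) = (b * b) * t ^+ 2 by lra.
  by rewrite ler_wpM2r ?sqr_ge0 // ler_wpM2r.
have P := inH_poincare i0 hD r0 hF.
have ip0 : ip mu (fun x => bump0 (w x)) (fun x => bump0 (w x)) = 0.
  apply/eqP; rewrite eq_le ip_ge0 andbT; apply: le_trans P _.
  by rewrite mulr_ge0_le0 ?sqr_ge0 //; lra.
apply: filterS (ip_eq0 lF ip0) => x /eqP hx.
by rewrite leNgt; apply/negP => hw; move: hx; rewrite gt_eqF // bump0_gt0.
Qed.

End nonlocal.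

(** * Linear problems *)

(* Near-minimizers over nested convex sets form a Cauchy sequence, by the parallelogram law. *)
Lemma near_minimizers (R : realType) (E : Type) (C : nat -> E -> Prop) (J : E -> R) (d : E -> E -> R) (b B : R) :
  (forall k x, C k x -> b <= J x) -> (forall k, exists x, C k x /\ J x <= B) ->
  (forall j k x, (j <= k)%N -> C k x -> C j x) ->
  (forall k x y, C k x -> C k y -> exists2 z, C k z & d x y <= 2 * J x + 2 * J y - 4 * J z) ->
  exists z : nat -> E, [/\ forall k, C k (z k), forall k x, C k x -> J (z k) <= J x + k.+1%:R^-1 &
    forall e, 0 < e -> exists N, forall j k, (N <= j)%N -> (N <= k)%N -> d (z j) (z k) <= e].
Proof.
move=> hb hB hC hd; pose S k := [set J x | x in C k]; pose m k := inf (S k).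
have iS k : has_inf (S k).
  split; first by have [x [Cx _]] := hB k; exists (J x); exists x.
  by exists b => _ [x Cx <-]; exact: hb Cx.
have mle k x : C k x -> m k <= J x by move=> Cx; apply: ge_inf; [case: (iS k)|exists x].
have mB k : m k <= B by have [x [Cx xB]] := hB k; exact: le_trans (mle _ _ Cx) xB.
have mmono : nondecreasing_seq m.
  move=> j k jk; apply: lb_le_inf; first by case: (iS k).
  by move=> _ [x Cx <-]; apply: mle; exact: hC Cx.
have cm : cvgn m by apply: nondecreasing_is_cvgn => //; exists B => _ [k _ <-].
have hz k : exists x, C k x /\ J x <= m k + k.+1%:R^-1.
  have k0 : 0 < k.+1%:R^-1 :> R by rewrite invr_gt0.
  by have [_ [x Cx <-] /ltW h] := inf_adherent k0 (iS k); exists x.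
have [z {}hz] := boolp.choice hz.
exists z; split => [k|k x Cx|e e0]; first by case: (hz k).
  by have [_ h] := hz k; apply: le_trans h _; rewrite lerD2r; exact: mle.
have e8 : 0 < e / 12 by lra.
pose l : R := limn m.
have /cvgrPdist_le/(_ _ e8)[N1 _ h1] : m @ \oo --> l by exact: cm.
have /cvgrPdist_le/(_ _ e8)[N2 _ h2] := @cvg_harmonic R.
exists (maxn N1 N2) => j k; rewrite !geq_max => /andP[j1 j2] /andP[k1 k2].
have [Cj Jj] := hz j; have [Ck Jk] := hz k.
(* Both points lie in the larger of the two nested sets, so the intermediate point is compared with
   the infimum over that set. *)
have l1 : (N1 <= minn j k)%N by rewrite leq_min j1 k1.
have [w Cw hw] := hd (minn j k) (z j) (z k) (hC _ _ _ (geq_minl _ _) Cj) (hC _ _ _ (geq_minr _ _) Ck).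
have hw' := mle _ _ Cw; apply: le_trans hw _.
have := h1 j j1; have := h1 k k1; have := h1 _ l1; have := h2 j j2; have := h2 k k2.
rewrite /harmonic !sub0r !normrN !(@ger0_norm _ (_%:R^-1)) ?invr_ge0 // !ler_norml.
move=> b1 b2 /andP[a1 a2] /andP[a3 a4] /andP[a5 a6].
by move: (j.+1%:R^-1) (k.+1%:R^-1) (m j) (m k) (m _) Jj Jk hw' b1 b2 a1 a2 a3 a4 a5 a6 => x y mj mk ml *; lra.
Qed.

Lemma quad_ge0_lin (R : realType) (q c : R) : 0 <= q -> (forall t, 0 <= t ^+ 2 * q + 2 * t * c) -> c = 0.
Proof.
move=> q0 h; apply/eqP; rewrite -[_ == _]negbK; apply/negP => c0.
have q1 : 0 < q + 1 by lra.
(* The optimal t would be -c/q; the added 1 covers q = 0, and the value stays negative unless c =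
   0. *)
have := h (- c / (q + 1)).
have -> : (- c / (q + 1)) ^+ 2 * q + 2 * (- c / (q + 1)) * c = - (c ^+ 2 * ((q + 2) / (q + 1) ^+ 2)).
  rewrite -(exprVn (q + 1) 2); move: (divff (lt0r_neq0 q1)); move: (q + 1)^-1 => r' hr.
  have E : r' * q = 1 - r' by lra.
  have -> : (- c * r') ^+ 2 * q + 2 * (- c * r') * c = c ^+ 2 * r' * (r' * q) - 2 * c ^+ 2 * r' by lra.
  have -> : c ^+ 2 * ((q + 2) * r' ^+ 2) = c ^+ 2 * r' * (r' * q) + 2 * c ^+ 2 * r' ^+ 2 by lra.
  by rewrite E; lra.
have P : 0 < c ^+ 2 * ((q + 2) / (q + 1) ^+ 2).
  by apply: mulr_gt0; [rewrite exprn_even_gt0|apply: divr_gt0; [lra|exact: exprn_gt0]].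
by rewrite oppr_ge0 leNgt P.
Qed.

Section linear.
Context {R : realType} {n : nat}.
Local Notation V := 'rV[R]_n.
Local Notation mu := (@lebesgue_rV R n).
Local Notation m2 := (@product_measure1 _ _ V V R mu mu).
Local Notation VF := (V -> R).
Local Notation GF := ('I_n -> V -> R).
Implicit Types (u v : VF) (g h : GF) (D : set V).

Lemma dirC g h : dir g h = dir h g.
Proof. by apply: eq_bigr => i _; exact: ipC. Qed.

Lemma dir_lin (a b : R) g h k : (forall i, l2 mu (g i)) -> (forall i, l2 mu (h i)) -> (forall i, l2 mu (k i)) ->
  dir (fun i x => a * g i x + b * h i x) k = a * dir g k + b * dir h k.
Proof.
move=> lg lh lk; rewrite /dir !mulr_sumr -big_split /=; apply: eq_bigr => i _.
by rewrite ipDl ?ipZl //; exact: l2Z.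
Qed.

Lemma nrm_poincare D (rho : R) (i : 'I_n) u g : (forall x, D x -> `|x| <= rho) -> 0 < rho -> inH D u g ->
  nrm u g <= ((2 * rho + 1) ^+ 2 + 1) * dir g g.
Proof. by move=> hD r0 hu; have := inH_poincare i hD r0 hu; rewrite /nrm; lra. Qed.

(** Stands in for weak compactness: among the elements within squared distance 1/(k+1) of v0, a
    convex set, near-minimizers of the Dirichlet energy converge strongly, and their limit is v0. *)
Lemma inH_weak_closed D (rho : R) (i0 : 'I_n) (v : nat -> VF) (g : nat -> GF) v0 B :
  (forall x, D x -> `|x| <= rho) -> 0 < rho ->
  (forall k, inH D (v k) (g k)) -> (forall k, dir (g k) (g k) <= B) -> l2 mu v0 -> l2cvg mu v v0 ->
  exists g0, inH D v0 g0.
Proof.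
move=> hD r0 hv hB l0 c.
pose C (k : nat) (x : VF * GF) := inH D x.1 x.2 /\ ip mu (fun y => x.1 y - v0 y) (fun y => x.1 y - v0 y) <= k.+1%:R^-1.
pose J (x : VF * GF) := dir x.2 x.2.
pose d (x y : VF * GF) := dir (fun i t => x.2 i t - y.2 i t) (fun i t => x.2 i t - y.2 i t).
have [||||z [Cz _ zc]] := @near_minimizers R _ C J d 0 B.
- by move=> k x _; exact: dir_ge0.
- move=> k; have k0 : 0 < k.+1%:R^-1 :> R by rewrite invr_gt0.
  have /cvgrPdist_le/(_ _ k0)[N _ hN] := c; exists (v N, g N); split; last exact: hB.
  split; first exact: hv.
  by have := hN N (leqnn N); rewrite sub0r normrN ger0_norm ?ip_ge0.
- move=> j k x jk [hx hk]; split => //; apply: le_trans hk _.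
  by rewrite lef_pV2 ?posrE // ler_nat.
- move=> k [x gx] [y gy] [hx hkx] [hy hky]; rewrite /= in hx hkx hy hky.
  exists ((fun t => 2^-1 * x t + 2^-1 * y t), (fun i t => 2^-1 * gx i t + 2^-1 * gy i t)).
    split => /=; first exact: inH_lin.
    have lx := inH_l2 hx; have ly := inH_l2 hy.
    have := ipD_le (l2Z 2^-1 (l2B lx l0)) (l2Z 2^-1 (l2B ly l0)).
    have -> : (fun t => 2^-1 * (x t - v0 t) + 2^-1 * (y t - v0 t)) = (fun t => 2^-1 * x t + 2^-1 * y t - v0 t).
      by apply/funext => t; lra.
    have lxd := l2B lx l0; have lyd := l2B ly l0.
    rewrite !(ipZl _ lxd (l2Z _ lxd)) !(ipZl _ lyd (l2Z _ lyd)) !ipZr //.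
    by move: (k.+1%:R^-1) hkx hky => e; lra.
  have lgx i := inH_l2g i hx; have lgy i := inH_l2g i hy.
  rewrite /d /J /=.
  have -> : (fun i t => gx i t - gy i t) = (fun i t => 1 * gx i t + (-1) * gy i t).
    by apply/funext => i; apply/funext => t; lra.
  rewrite !dir_lin //; try (by move=> i; apply: l2D; exact: l2Z).
  rewrite !(dirC _ (fun i t => _ + _)) !dir_lin // (dirC gy gx); lra.
have [||u0 [g0 [h0 [c1 c2]]]] := @inH_cauchy R n D (fun k => (z k).1) (fun k => (z k).2).
- by move=> k; case: (Cz k).
- move=> e e0; have P0 : 0 < (2 * rho + 1) ^+ 2 + 1 by rewrite ltr_wpDl ?sqr_ge0.
  have [N hN] := zc (e / ((2 * rho + 1) ^+ 2 + 1)) (divr_gt0 e0 P0).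
  exists N => j k Nj Nk.
  have [hj _] := Cz j; have [hk _] := Cz k.
  apply: le_trans (nrm_poincare i0 hD r0 (inH_B hj hk)) _.
  by have := hN j k Nj Nk; rewrite ler_pdivlMr // mulrC.
have lz k : l2 mu (z k).1 by case: (Cz k) => /inH_l2.
have cz : l2cvg mu (fun k => (z k).1) v0.
  apply: squeeze0 (@cvg_harmonic R) => k; rewrite ip_ge0 /=; by case: (Cz k).
have E := l2cvg_unique lz (inH_l2 h0) l0 c1 cz.
have mg0 i := l2_meas (inH_l2g i h0).
exists g0; apply: (inH_ae h0 _ _ E) => //; first exact: l2_meas l0.
by move=> i; exact: (filterS (fun x _ => erefl) E).
Qed.

Variables (s : R) (s_gt0 : 0 < s) (s_lt1 : s < 1).
Local Notation nl := (nl s).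

Definition energy (N : VF) u g v h : R := dir g h + nl u v + ip mu (fun x => N x * u x) v.

Lemma energyC N u g v h : energy N u g v h = energy N v h u g.
Proof.
rewrite /energy dirC [nl u v]ipC; congr (_ + _); apply: eq_Rintegral => x _; lra.
Qed.

Lemma nl_lin D (a b : R) u g v h w k : inH D u g -> inH D v h -> inH D w k ->
  nl (fun x => a * u x + b * v x) w = a * nl u w + b * nl v w.
Proof.
move=> hu hv hw; have lu := inH_l2n s_gt0 s_lt1 hu; have lv := inH_l2n s_gt0 s_lt1 hv.
have lw := inH_l2n s_gt0 s_lt1 hw.
have E : ndiff s (fun x => a * u x + b * v x) = (fun z => a * ndiff s u z + b * ndiff s v z).
  by apply/funext => z; rewrite /ndiff; lra.
by rewrite /nl E ipDl ?ipZl //; exact: l2Z.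
Qed.

Section solve.
Variables (N : VF) (CNb : R).
Hypotheses (mN : measurable_fun setT N) (N_bd : forall x, 0 <= N x <= CNb).

Let N_norm x : `|N x| <= CNb.
Proof. by have /andP[h1 h2] := N_bd x; rewrite ger0_norm. Qed.

Lemma energy_lin D (a b : R) u g v h w k : inH D u g -> inH D v h -> inH D w k ->
  energy N (fun x => a * u x + b * v x) (fun i x => a * g i x + b * h i x) w k =
  a * energy N u g w k + b * energy N v h w k.
Proof.
move=> hu hv hw; rewrite /energy (nl_lin a b hu hv hw) dir_lin; [|by move=> i; exact: inH_l2g hu|by move=> i; exact: inH_l2g hv|by move=> i; exact: inH_l2g hw].
have lu := inH_l2 hu; have lv := inH_l2 hv; have lw := inH_l2 hw.
have -> : (fun x => N x * (a * u x + b * v x)) = (fun x => a * (N x * u x) + b * (N x * v x)) by apply/funext => x; lra.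
have lNu : l2 mu (fun x => N x * u x) := l2_bdM mN N_norm lu.
have lNv : l2 mu (fun x => N x * v x) := l2_bdM mN N_norm lv.
rewrite ipDl ?ipZl //; try exact: l2Z; lra.
Qed.

Lemma energy_ge_dir u g : dir g g <= energy N u g u g.
Proof.
rewrite /energy -addrA lerDl addr_ge0 //; first exact: ip_ge0.
by apply: Rintegral_ge0 => x _; have /andP[h1 _] := N_bd x; rewrite -mulrA mulr_ge0 // -expr2 sqr_ge0.
Qed.

(** The form is symmetric, so the solution minimizes energy minus twice the linear term;
    [near_minimizers] is used with a constant family of convex sets. *)
Lemma linear_solve D (rho : R) (i0 : 'I_n) (f : VF) : (forall x, D x -> `|x| <= rho) -> 0 < rho -> l2 mu f ->
  exists u g, inH D u g /\ forall v h, inH D v h -> energy N u g v h = ip mu f v.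
Proof.
move=> hD r0 lf; pose CP := (2 * rho + 1) ^+ 2.
have CP0 : 0 < CP by rewrite exprn_gt0 //; lra.
pose C (k : nat) (x : VF * GF) := inH D x.1 x.2.
pose J (x : VF * GF) := energy N x.1 x.2 x.1 x.2 - 2 * ip mu f x.1.
pose d (x y : VF * GF) := dir (fun i t => x.2 i t - y.2 i t) (fun i t => x.2 i t - y.2 i t).
have Jexp (a b : R) u g v h : inH D u g -> inH D v h ->
    J ((fun x => a * u x + b * v x), (fun i x => a * g i x + b * h i x)) =
    a ^+ 2 * energy N u g u g + 2 * a * b * energy N u g v h + b ^+ 2 * energy N v h v h - 2 * a * ip mu f u - 2 * b * ip mu f v.
  move=> hu hv; have hw := inH_lin a b hu hv; rewrite /J /=.
  rewrite (energy_lin a b hu hv hw) !(energyC N _ _ (fun x => a * u x + b * v x)) !(energy_lin a b hu hv) //.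
  rewrite (energyC N v h u g) ipDr ?ipZr //; try exact: l2Z; try exact: (inH_l2 hu); try exact: (inH_l2 hv).
    lra.
  - by apply: l2Z; exact: inH_l2 hu.
  - by apply: l2Z; exact: inH_l2 hv.
have [||||z [Cz zmin zc]] := @near_minimizers R _ C J d (- (CP * ip mu f f)) 0.
- move=> k0 [u g] hu; rewrite /C /= in hu; rewrite /J /=.
  have lu := inH_l2 hu; have P : ip mu u u <= CP * dir g g := inH_poincare i0 hD r0 hu.
  have E := energy_ge_dir u g; have lcf := l2Z CP lf.
  (* Completing the square with the Poincaré constant bounds [J] from below by -CP times the squared
     norm of f. *)
  have := ip_ge0 mu (fun x => CP * f x - u x); have lB := l2B lcf lu.
  rewrite ipBl // !ipBr // !ipZl // ?ipZr // (ipC mu u f) => h.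
  have h' : 0 <= CP * (CP * ip mu f f - 2 * ip mu f u + dir g g) by move: h P; lra.
  by rewrite pmulr_rge0 // in h'; move: h' E; lra.
- move=> k0; exists ((fun=> 0), (fun _ _ => 0)); split; first exact: inH_0.
  have := Jexp 0 0 _ _ _ _ (inH_0 D) (inH_0 D).
  have -> : ((fun x : V => 0 * 0 + 0 * 0 : R), (fun (i : 'I_n) (x : V) => 0 * 0 + 0 * 0 : R)) = ((fun=> 0), (fun _ _ => 0)).
    by congr pair; [apply/funext => x; lra|apply/funext => i; apply/funext => x; lra].
  by move=> ->; lra.
- by [].
- move=> k0 [x gx] [y gy] hx hy; rewrite /C /= in hx hy.
  exists ((fun t => 2^-1 * x t + 2^-1 * y t), (fun i t => 2^-1 * gx i t + 2^-1 * gy i t)); first exact: inH_lin.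
  rewrite Jexp // /d /J /=.
  have hxy := inH_lin 1 (-1) hx hy.
  have E := energy_ge_dir (fun t => 1 * x t + (-1) * y t) (fun i t => 1 * gx i t + (-1) * gy i t).
  rewrite (energy_lin 1 (-1) hx hy hxy) !(energyC N _ _ (fun t => 1 * x t + _)) !(energy_lin 1 (-1) hx hy) // (energyC N y gy x gx) in E.
  have -> : (fun i t => gx i t - gy i t) = (fun i t => 1 * gx i t + (-1) * gy i t).
    by apply/funext => i; apply/funext => t; lra.
  by apply: le_trans E _; lra.
have [||u0 [g0 [h0 [c1 c2]]]] := @inH_cauchy R n D (fun k => (z k).1) (fun k => (z k).2).
- by move=> k; exact: (Cz k).
- move=> e e0; have P0 : 0 < (2 * rho + 1) ^+ 2 + 1 by rewrite ltr_wpDl ?sqr_ge0.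
  have [N' hN] := zc (e / ((2 * rho + 1) ^+ 2 + 1)) (divr_gt0 e0 P0).
  exists N' => j k Nj Nk.
  apply: le_trans (nrm_poincare i0 hD r0 (inH_B (Cz j) (Cz k))) _.
  by have := hN j k Nj Nk; rewrite ler_pdivlMr // mulrC.
have lz k : l2 mu (z k).1 := inH_l2 (Cz k).
have lu0 := inH_l2 h0.
have cJ : (fun k => J (z k)) @ \oo --> J (u0, g0).
  apply: cvgB; last first.
    by apply: cvgMr; exact: (l2cvg_ip (fun=> lf) lz lf lu0 (@l2cvg_cst _ _ _ mu f) c1).
  apply: cvgD.
    apply: cvgD.
      rewrite /dir /=; elim: (index_enum _) => [|i l IH].
        by under eq_fun do rewrite big_nil; rewrite big_nil; exact: cvg_cst.
      under eq_fun do rewrite big_cons; rewrite big_cons; apply: cvgD IH.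
      have li k := inH_l2g i (Cz k); have li0 := inH_l2g i h0.
      exact: (l2cvg_ip li li li0 li0 (c2 i) (c2 i)).
    have ln k := inH_l2n s_gt0 s_lt1 (Cz k); have ln0 := inH_l2n s_gt0 s_lt1 h0.
    have cn := cvgH_ndiff s_gt0 s_lt1 Cz h0 (conj c1 c2).
    exact: (l2cvg_ip ln ln ln0 ln0 cn cn).
  have lN (w : VF) : l2 mu w -> l2 mu (fun x => N x * w x) by move=> lw; exact: l2_bdM N_norm lw.
  exact: (l2cvg_ip (fun k => lN _ (lz k)) lz (lN _ lu0) lu0 (l2cvg_bdM mN N_norm lz lu0 c1) c1).
have umin x : inH D x.1 x.2 -> J (u0, g0) <= J x.
  move=> hx; apply: ler_cvg_to cJ (_ : (fun k => J x + k.+1%:R^-1) @ \oo --> J x) _.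
    by rewrite -[X in _ --> X]addr0; apply: cvgD; [exact: cvg_cst|exact: cvg_harmonic].
  by apply: nearW => k; exact: zmin.
exists u0, g0; split => // v h hv; apply/eqP; rewrite -subr_eq0; apply/eqP.
apply: (@quad_ge0_lin _ (energy N v h v h)); first exact: le_trans (dir_ge0 h) (energy_ge_dir v h).
move=> t; have := umin (_, _) (inH_lin 1 t h0 hv).
by rewrite Jexp // /J /= expr1n; lra.
Qed.

End solve.
End linear.

(** * Barriers *)

Section barriers.
Context {R : realType} {n : nat}.
Local Notation V := 'rV[R]_n.
Local Notation mu := (@lebesgue_rV R n).
Local Notation m2 := (@product_measure1 _ _ V V R mu mu).
Local Notation VF := (V -> R).
Local Notation GF := ('I_n -> V -> R).
Local Notation e_ i := (delta_mx ord0 i : V).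
Implicit Types (u v b phi : VF) (g h : GF) (D : set V).

Lemma partial_near (f f' : VF) (W : set V) i x : open W -> W x -> (forall y, W y -> f y = f' y) ->
  partial i f x = partial i f' x.
Proof.
move=> oW Wx h; apply: near_eq_derive; have : nbhs x W by exact: open_nbhs_nbhs.
by apply: filterS => y /h.
Qed.

Lemma partialZ (c : R) (f : VF) i x : smooth f -> partial i (fun x => c * f x) x = c * partial i f x.
Proof.
move=> sf; have E := @partialM R n (fun=> c) f i x (derivable_cst _ _ _) (smooth_derivable sf).
by rewrite E partial_cst mulr0 addr0.
Qed.

Lemma smooth_axis_mvt (f : VF) i x (t : R) : smooth f ->
  exists2 c : R, `|c| <= `|t| & f (x + t *: e_ i) - f x = t * partial i f (x + c *: e_ i).
Proof.
move=> sf; pose F (r : R) := f (x + r *: e_ i).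
have dF r : is_derive r (1:R) F (partial i f (x + r *: e_ i)) by apply: is_derive_line; exact: smooth_derivable.
have cF : continuous F by apply: line_continuous; exact: smooth_cont.
have E0 : f x = F 0 by rewrite /F scale0r addr0.
rewrite E0 -[f (x + t *: e_ i)]/(F t); have [t0|t0] := leP 0 t.
  have [c hc ->] := MVT_segment t0 (fun r _ => dF r) (continuous_subspaceT cF).
  rewrite in_itv /= in hc; case/andP: hc => c0 ct.
  by exists c; [rewrite !ger0_norm|rewrite subr0 mulrC].
have [c hc E] := MVT_segment (ltW t0) (fun r _ => dF r) (continuous_subspaceT cF).
rewrite in_itv /= in hc; case/andP: hc => c0 ct.
by exists c; [rewrite ler0_norm // ltr0_norm // lerN2|move: E; rewrite sub0r; lra].
Qed.

Lemma prefix_telescope (f : VF) (x z : V) :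
  f (x + z) - f x = \sum_(i < n) (f (x + prefix_row z i + z ord0 i *: e_ i) - f (x + prefix_row z i)).
Proof.
have -> : \sum_(i < n) (f (x + prefix_row z i + z ord0 i *: e_ i) - f (x + prefix_row z i)) =
    \sum_(0 <= k < n) (f (x + prefix_row z k.+1) - f (x + prefix_row z k)).
  rewrite big_mkord; apply: eq_bigr => i _; by rewrite prefix_rowS addrA.
rewrite telescope_sumr //; congr (f _ - f _); last first.
  by rewrite (_ : prefix_row z 0 = 0) ?addr0 //; apply/rowP => j; rewrite !mxE.
by congr (_ + _); apply/rowP => j; rewrite !mxE ltn_ord.
Qed.

Lemma prefix_row_le (z : V) k : `|prefix_row z k| <= `|z|.
Proof.
apply: norm_le_coord => // j; rewrite !mxE; case: ifP => _; last by rewrite normr0.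
exact: coord_le_norm.
Qed.

Lemma Cc_lip D (f : VF) : Cc_smooth D f -> exists2 L : R, 0 <= L & forall x y, `|f x - f y| <= L * `|x - y|.
Proof.
move=> hf; have sf := Cc_smoothE hf.
have h i : exists C : R, 0 <= C /\ forall x, `|partial i f x| <= C.
  by have [C C0 hC] := Cc_bounded (Cc_partial i hf); exists C.
have [C hC] := boolp.choice h.
exists (\sum_i C i); first by apply: sumr_ge0 => i _; case: (hC i).
suff H y z : `|f (y + z) - f y| <= (\sum_i C i) * `|z| by move=> x y; have := H y (x - y); rewrite (addrC y) subrK.
rewrite prefix_telescope mulr_suml.
apply: le_trans (ler_norm_sum _ _ _) _; apply: ler_sum => i _.
have [c _ ->] := smooth_axis_mvt i (y + prefix_row z i) (z ord0 i) sf.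
rewrite normrM mulrC; apply: ler_pM => //; last exact: coord_le_norm.
by case: (hC i).
Qed.

(** Increments along the axis paths of z and of -z are paired. The mean value theorem leaves the
    difference of one partial derivative at two points at most 4|z| apart, and that derivative is
    Lipschitz. *)
Lemma Cc_second_diff D (f : VF) : Cc_smooth D f -> exists2 L : R, 0 <= L &
  forall x z, `|2 * f x - f (x + z) - f (x - z)| <= L * Num.min 1 (`|z| ^+ 2).
Proof.
move=> hf; have sf := Cc_smoothE hf; have [B B0 hB] := Cc_bounded hf.
have h i : exists L : R, 0 <= L /\ forall x y, `|partial i f x - partial i f y| <= L * `|x - y|.
  by have [L L0 hL] := Cc_lip (Cc_partial i hf); exists L.
have [L hL] := boolp.choice h.
have SL0 : 0 <= \sum_i L i by apply: sumr_ge0 => i _; case: (hL i).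
exists (4 * B + 4 * \sum_i L i); first by lra.
move=> x z; rewrite /Num.min; case: ifP => _.
  have := hB x; have := hB (x + z); have := hB (x - z); rewrite mulr1 !ler_norml.
  move=> /andP[? ?] /andP[? ?] /andP[? ?]; lra.
have E : 2 * f x - f (x + z) - f (x - z) = - ((f (x + z) - f x) + (f (x + - z) - f x)) by lra.
rewrite E normrN !prefix_telescope -big_split /=.
have H (i : 'I_n) : `|f (x + prefix_row z i + z ord0 i *: e_ i) - f (x + prefix_row z i) +
   (f (x + prefix_row (- z) i + (- z) ord0 i *: e_ i) - f (x + prefix_row (- z) i))| <= 4 * L i * `|z| ^+ 2.
  have [c1 h1 ->] := smooth_axis_mvt i (x + prefix_row z i) (z ord0 i) sf.
  have [c2 h2 ->] := smooth_axis_mvt i (x + prefix_row (- z) i) ((- z) ord0 i) sf.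
  rewrite mxE mulNr -mulrBr normrM; have [L0 hLi] := hL i.
  rewrite mxE normrN in h2.
  have zi := coord_le_norm z i; rewrite mulrC expr2 mulrA; apply: ler_pM => //.
  apply: le_trans (hLi _ _) _; rewrite mulrC mulrAC; apply: ler_pM => //.
  have -> : x + prefix_row z i + c1 *: e_ i - (x + prefix_row (- z) i + c2 *: e_ i) =
     (prefix_row z i - prefix_row (- z) i) + (c1 - c2) *: e_ i.
    by rewrite scalerBl; apply/rowP => j; rewrite !mxE; lra.
  apply: le_trans (ler_normD _ _) _.
  have d1 : `|(c1 - c2) *: e_ i| <= 2 * `|z|.
    rewrite normrZ -[X in _ <= X]mulr1; apply: ler_pM => //.
      by apply: le_trans (ler_normB _ _) _; lra.
    by apply: norm_le_coord => // j; rewrite !mxE eqxx /=; case: (_ == _); rewrite ?normr1 ?normr0.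
  have := ler_normB (prefix_row z i) (prefix_row (- z) i).
  have := prefix_row_le z i; have := prefix_row_le (- z) i; rewrite normrN; lra.
apply: le_trans (ler_norm_sum _ _ _) _.
apply: (@le_trans _ _ (\sum_i 4 * L i * `|z| ^+ 2)); first exact: ler_sum.
rewrite -mulr_suml -mulr_sumr ler_wpM2r ?sqr_ge0 //; lra.
Qed.

Variables (s : R) (s_gt0 : 0 < s) (s_lt1 : s < 1).
Local Notation nl := (nl s).

(* Symmetrizing in [z] moves both differences onto the smooth factor. *)
Lemma ip_second_diff b phi (z : V) : l2 mu b -> l2 mu phi ->
  ip mu (fun x => b x - b (x + z)) (fun x => phi x - phi (x + z)) =
  ip mu phi (fun x => 2 * b x - b (x + z) - b (x - z)).
Proof.
move=> lb lp; have lbz := l2_shift z lb; have lpz := l2_shift z lp; have lbz' := l2_shift (- z) lb.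
have mb := l2_meas lb; have mp := l2_meas lp.
have E : ip mu b (fun x => phi (x + z)) = ip mu (fun x => b (x - z)) phi.
  rewrite -(ip_shift (f := fun x => b (x - z)) z (l2_meas lbz') mp).
  by apply: eq_Rintegral => x _; rewrite addrK.
have l2b := l2Z 2 lb; have l2bz := l2B l2b lbz.
have ld := l2B lp lpz.
rewrite (ipBl lb lbz ld) (ipBr lp lpz lb) (ipBr lp lpz lbz) (ip_shift z mb mp) E.
rewrite (ipBr l2bz lbz' lp) (ipBr l2b lbz lp) (ipZr 2 lb lp) !(ipC mu phi); lra.
Qed.

(** Fubini in the displacement variable. Measurability of the inner integral is part of the
    conclusion because the estimates below integrate bounds on it. *)
Lemma nl_second_diff b phi : l2 mu b -> l2 mu phi -> l2 m2 (ndiff s b) -> l2 m2 (ndiff s phi) ->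
  let I z := kern s z * ip mu phi (fun x => 2 * b x - b (x + z) - b (x - z)) in
  measurable_fun setT I /\ ((nl b phi)%:E = \int[mu]_z (I z)%:E)%E.
Proof.
move=> lb lp lnb lnp I.
have IG := l2M_integrable lnb lnp.
have Ish := integrable_preserving (@measurable_shear R n) (@shear_preserving R n) IG.
have E (z : V) : (\int[mu]_x ((EFin \o (fun z => (ndiff s b z * ndiff s phi z)%R)) (x, (x + z)%R)) = (I z)%:E)%E.
  have ld1 := l2B lb (l2_shift z lb); have ld2 := l2B lp (l2_shift z lp).
  rewrite /I -ip_second_diff // /ip -RintegralZl //; last exact: l2M_integrable.
  rewrite /Rintegral fineK; last first.
    apply: (integrable_fin_num measurableT).
    exact: (integrableZl measurableT (kern s z) (l2M_integrable ld1 ld2)).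
  apply: eq_integral => x _ /=; congr EFin.
  by rewrite -nonlocalE /nonlocal_integrand /= opprD addrA subrr sub0r enormN /kern; lra.
split.
  apply/measurable_EFinP; have := measurable_fubini_G Ish.
  by apply: eq_measurable_fun => z _; rewrite /fubini_G /= -E.
rewrite /nl /ip /Rintegral fineK; last exact: integrable_fin_num IG.
by rewrite (integral_shear IG); apply: eq_integral => z _; exact: E.
Qed.

(** The sign of the second differences is required at base points in D only, since phi vanishes
    elsewhere; the shifted points are free. *)
Lemma nl_ge0_second_diff D b phi g : l2 mu b -> l2 m2 (ndiff s b) -> inH D phi g -> (forall x, 0 <= phi x) ->
  (forall x z, D x -> 0 <= 2 * b x - b (x + z) - b (x - z)) -> 0 <= nl b phi.
Proof.
move=> lb lnb hp p0 hS; have lp := inH_l2 hp.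
have [mI E] := nl_second_diff lb lp lnb (inH_l2n s_gt0 s_lt1 hp).
rewrite -lee_fin E; apply: integral_ge0 => z _; rewrite lee_fin mulr_ge0 ?kern_ge0 //.
have lS : l2 mu (fun x => 2 * b x - b (x + z) - b (x - z)).
  by apply: l2B; [apply: l2B; [exact: l2Z|exact: l2_shift]|exact: l2_shift].
have := @ae_le_Rint _ _ _ mu (fun=> 0) (fun x => phi x * (2 * b x - b (x + z) - b (x - z))).
rewrite [X in X <= _](_ : _ = 0); last by rewrite /Rintegral integral0_eq.
apply; [exact: integrable0|exact: l2M_integrable|].
apply: filterS (inH_out hp) => x hx; have [Dx|nDx] := pselect (D x).
  by rewrite mulr_ge0 //; exact: hS.
by have [-> _] := hx nDx; rewrite mul0r.
Qed.

Lemma nl_le_second_diff D b phi g (L : R) : l2 mu b -> l2 m2 (ndiff s b) -> inH D phi g -> (forall x, 0 <= phi x) ->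
  mu.-integrable setT (EFin \o phi) -> 0 <= L ->
  (forall x z, `|2 * b x - b (x + z) - b (x - z)| <= L * Num.min 1 (`|z| ^+ 2)) ->
  nl b phi <= L * CK (n := n) s * \int[mu]_x phi x.
Proof.
move=> lb lnb hp p0 Ip L0 hS; have lp := inH_l2 hp.
have [mI E] := nl_second_diff lb lp lnb (inH_l2n s_gt0 s_lt1 hp).
have P0 : 0 <= \int[mu]_x phi x by apply: Rintegral_ge0 => x _.
apply: le_trans (ler_norm _) _; rewrite -lee_fin -abse_EFin E.
apply: le_trans (le_abse_integral _ _ _) _ => //; first exact/measurable_EFinP.
apply: (@le_trans _ _ (\int[mu]_z ((L * \int[mu]_x phi x)%:E * (kmin s z)%:E))%E).
  apply: ge0_le_integral => //.
  - by apply: measurableT_comp => //; exact/measurable_EFinP.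
  - by apply: measurable_funeM; apply/measurable_EFinP; exact: measurable_kmin.
  move=> z _; rewrite -EFinM lee_fin normrM ger0_norm ?kern_ge0 // /kmin mulrCA ler_wpM2l ?kern_ge0 //.
  have lS : l2 mu (fun x => 2 * b x - b (x + z) - b (x - z)).
    by apply: l2B; [apply: l2B; [exact: l2Z|exact: l2_shift]|exact: l2_shift].
  have m0 : 0 <= Num.min 1 (`|z| ^+ 2) by rewrite le_min ler01 sqr_ge0.
  have Ic : mu.-integrable setT (EFin \o (fun x => L * Num.min 1 (`|z| ^+ 2) * phi x)) := integrableZl measurableT _ Ip.
  have IS := l2M_integrable lp lS.
  have -> : L * \int[mu]_x phi x * Num.min 1 (`|z| ^+ 2) = \int[mu]_x (L * Num.min 1 (`|z| ^+ 2) * phi x).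
    by rewrite RintegralZl //; lra.
  apply: le_trans (le_normr_Rintegral _ _) _ => //.
  apply: le_Rintegral => //; first exact: integrable_norm.
  by move=> x _; rewrite normrM ger0_norm // mulrC ler_wpM2r.
rewrite integralZl_T; [|by apply/measurable_EFinP; exact: measurable_kmin|by move=> z; rewrite lee_fin kmin_ge0|by rewrite lee_fin mulr_ge0].
rewrite le_eqVlt; apply/orP; left; apply/eqP.
have -> : (\int[mu]_z (kmin s z)%:E = (CK (n := n) s)%:E)%E.
  by rewrite /CK /Rintegral fineK //; exact: (integrable_fin_num measurableT (integrable_kmin s_gt0 s_lt1)).
by rewrite -EFinM; congr EFin; lra.
Qed.

Lemma dir_partial D b phi g : Cc_smooth setT b -> inH D phi g ->
  dir (fun i => partial i b) g = \sum_i ip mu (fun x => - partial i (partial i b) x) phi.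
Proof.
move=> hb hp; apply: eq_bigr => i _; have h : ip mu phi (partial i (partial i b)) = - ip mu (g i) (partial i b) := inH_ibp i hp (Cc_partial i hb).
by rewrite ipNl; [rewrite ipC -[LHS]opprK -h ipC|exact: Cc_partial_l2 (Cc_partial i hb)|exact: inH_l2 hp].
Qed.

(* [q = (1/C) eta (C - x_i^2)]: its second differences are nonnegative on the ball, where it
   coincides with a concave parabola lying above it wherever that parabola is nonnegative. *)
Lemma supersolution (rho : R) (i0 : 'I_n) : 0 < rho -> exists q c, [/\ Cc_smooth setT q, 0 < c,
  forall x, 0 <= q x, forall x, `|x| <= rho -> 2^-1 <= q x <= 1 &
  forall D phi g, (forall x, D x -> `|x| <= rho) -> inH D phi g -> (forall x, 0 <= phi x) ->
    mu.-integrable setT (EFin \o phi) ->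
    c * \int[mu]_x phi x <= dir (fun i => partial i q) g + nl q phi].
Proof.
(* With this C the parabola stays between C/2 and C on the ball, hence between 1/2 and 1 after
   division by C. *)
move=> r0; pose C := 2 * rho ^+ 2; have C0 : 0 < C by rewrite mulr_gt0 // exprn_gt0.
pose p0 (x : V) := C + (-1) * (x ord0 i0 * x ord0 i0).
have sp0 : smooth p0.
  by move=> k; apply: CkD; [exact: Ck_cst|apply: CkZ; apply: CkM; exact: Ck_coord].
have hK x : `|x| <= rho -> C / 2 <= p0 x <= C.
  move=> hx; have : x ord0 i0 ^+ 2 <= rho ^+ 2.
    rewrite -(real_normK (num_real (x ord0 i0))) lerXn2r ?nnegrE ?(ltW r0) //.
    exact: le_trans (coord_le_norm x i0) hx.
  have := sqr_ge0 (x ord0 i0); rewrite /p0 /C !expr2; lra.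
pose U := [set x : V | 0 < p0 x].
have oU : open U.
  by apply: (@open_comp V R p0 [set t | 0 < t]); [move=> x _; exact: (smooth_cont sp0)|exact: open_gt].
have KU : [set x : V | `|x| <= rho] `<=` U.
  by move=> x /= /hK /andP[h _]; apply: lt_le_trans h; rewrite divr_gt0.
have [eta [he e01 [W [oW KW eW]]]] := urysohn_Cc (@compact_norm_le R n rho) oU KU.
pose q (x : V) := C^-1 * (p0 x * eta x).
have hq : Cc_smooth setT q by apply: CcZ; apply: CcM => //; exact: Cc_mono (@subsetT _ _) _ he.
have q0 x : 0 <= q x.
  rewrite mulr_ge0 ?invr_ge0 ?(ltW C0) //; have [e0 _] := andP (e01 x).
  have [Ux|nUx] := pselect (U x); first by rewrite mulr_ge0 // ltW.
  by rewrite (Cc_out he nUx) mulr0.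
have qle x : C * q x <= Num.max 0 (p0 x).
  rewrite /q mulrA mulfV ?gt_eqF // mul1r; have [e0 e1] := andP (e01 x).
  have [Ux|nUx] := pselect (U x).
    by apply: (@le_trans _ _ (p0 x)); [rewrite ger_pMr|rewrite le_max lexx orbT].
  by rewrite (Cc_out he nUx) mulr0 le_max lexx.
have qE x : W x -> C * q x = p0 x.
  by move=> Wx; rewrite /q (eW x Wx) mulr1 mulrA mulfV ?gt_eqF // mul1r.
have sx : smooth (fun y : V => y ord0 i0) by move=> k; exact: Ck_coord.
have sxx : smooth (fun y : V => y ord0 i0 * y ord0 i0) by move=> k; apply: CkM; exact: Ck_coord.
have dc i x : partial i (fun y : V => y ord0 i0) x = e_ i ord0 i0 := derive_val (is_derive := derive_coord i0 x (e_ i)).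
have pd1 i x : partial i p0 x = (-1) * (x ord0 i0 * e_ i ord0 i0 + x ord0 i0 * e_ i ord0 i0).
  have sZ : smooth (fun y : V => (-1) * (y ord0 i0 * y ord0 i0)) by move=> k; exact: CkZ.
  have E := @partialD R n (fun=> C) _ i x (derivable_cst _ _ _) (smooth_derivable sZ).
  rewrite /p0 E partial_cst add0r partialZ //.
  have E2 := @partialM R n _ _ i x (smooth_derivable sx) (smooth_derivable sx).
  by rewrite E2 dc.
have pd2 i x : partial i (partial i p0) x = (-2) * (e_ i ord0 i0 * e_ i ord0 i0).
  have -> : partial i p0 = (fun y => ((-2) * e_ i ord0 i0) * y ord0 i0) by apply/funext => y; rewrite pd1; lra.
  by rewrite partialZ // dc; lra.
(* Minus the second derivative of the normalized parabola; the nonlocal term only adds a nonnegative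
   amount. *)
exists q, (2 / C); split => //; first by rewrite divr_gt0.
  move=> x hx; have := hK x hx; rewrite -(qE x (KW _ hx)) => /andP[h1 h2].
  by rewrite -(ler_pM2l C0) -(ler_pM2l C0 (q x)) h1 mulr1 h2.
move=> D phi g hD hp p0' Ip; rewrite -[X in X <= _]addr0; apply: lerD; last first.
  apply: (nl_ge0_second_diff (Cc_l2 hq) (inH_l2n s_gt0 s_lt1 (Cc_inH hq)) hp p0').
  move=> x z Dx; rewrite -(pmulr_rge0 _ C0).
  have := qle (x + z); have := qle (x - z); have := hK x (hD x Dx); have := q0 (x - z); have := q0 (x + z).
  have -> : C * (2 * q x - q (x + z) - q (x - z)) = 2 * p0 x - C * q (x + z) - C * q (x - z).
    by rewrite -(qE x (KW _ (hD x Dx))); lra.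
  have E : p0 (x + z) + p0 (x - z) <= 2 * p0 x.
    by rewrite /p0 !mxE; have := sqr_ge0 (z ord0 i0); lra.
  (* If the parabola is negative at one shifted point, the bound there is 0 and concavity is of no
     use; but the other value is at most C, and [2 * p0 x] is at least C on the ball. *)
  have U1 : p0 (x + z) <= C by rewrite /p0; have := sqr_ge0 ((x + z) ord0 i0); rewrite expr2; lra.
  have U2 : p0 (x - z) <= C by rewrite /p0; have := sqr_ge0 ((x - z) ord0 i0); rewrite expr2; lra.
  move=> _ _ /andP[a1 a2]; rewrite /Num.max.
  by case: ifP => h1; case: ifP => h2; lra.
rewrite (dir_partial hq hp).
have lpp i : l2 mu (fun x => - partial i (partial i q) x) := l2N (Cc_partial_l2 i (Cc_partial i hq)).
rewrite (bigD1 i0) //= -[X in X <= _]addr0.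
have aeD i (c : R) : (forall x, D x -> c <= - partial i (partial i q) x) -> c * \int[mu]_x phi x <= ip mu (fun x => - partial i (partial i q) x) phi.
  move=> h; rewrite -RintegralZl //; apply: ae_le_Rint; first exact: (integrableZl measurableT c Ip).
    by apply: l2M_integrable => //; exact: inH_l2 hp.
  apply: filterS (inH_out hp) => x hx; have [Dx|nDx] := pselect (D x); first by rewrite ler_wpM2r //; exact: h.
  by have [-> _] := hx nDx; rewrite !mulr0.
have qpp i x : D x -> - partial i (partial i q) x = 2 / C * (e_ i ord0 i0 * e_ i ord0 i0).
  move=> Dx; have Wx := KW _ (hD x Dx).
  pose q' (y : V) := C^-1 * p0 y.
  have sq' : smooth q' by move=> k; exact: CkZ.
  have d1 y : partial i q' y = C^-1 * partial i p0 y by exact: partialZ.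
  have -> : partial i (partial i q) x = partial i (partial i q') x.
    apply: (partial_near (W := W)) => // y Wy; apply: (partial_near (W := W)) => // w Ww.
    by rewrite /q' -(qE w Ww) mulrA mulVf ?gt_eqF // mul1r.
  have -> : partial i q' = (fun y => C^-1 * partial i p0 y) by apply/funext => y; exact: d1.
  by rewrite partialZ ?pd2; [lra|exact: smooth_partial].
apply: lerD.
  by apply: aeD => x Dx; rewrite qpp // mxE !eqxx /= !mulr1.
apply: sumr_ge0 => i _; apply: le_trans (aeD i 0 _); first by rewrite mul0r.
move=> x Dx; rewrite qpp // mulr_ge0 //; last by rewrite -expr2 sqr_ge0.
by rewrite divr_ge0 // ltW.
Qed.

(** Prepares the barrier from below in [newton_start]: a small multiple of a cut-off has a small
    image under the operator. *)
Lemma Cc_operator_bound U eta : Cc_smooth U eta -> exists2 L : R, 0 <= L &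
  forall D phi g, inH D phi g -> (forall x, 0 <= phi x) -> mu.-integrable setT (EFin \o phi) ->
    dir (fun i => partial i eta) g + nl eta phi <= L * \int[mu]_x phi x.
Proof.
move=> /(Cc_mono (@subsetT _ U)) he; have [L L0 hL] := Cc_second_diff he.
have h i : exists C : R, 0 <= C /\ forall x, `|partial i (partial i eta) x| <= C.
  by have [C C0 hC] := Cc_bounded (Cc_partial i (Cc_partial i he)); exists C.
have [C hC] := boolp.choice h.
have SC : 0 <= \sum_i C i by apply: sumr_ge0 => i _; case: (hC i).
exists (\sum_i C i + L * CK (n := n) s); first by rewrite addr_ge0 // mulr_ge0 // CK_ge0.
move=> D phi g hp p0 Ip; rewrite mulrDl; apply: lerD; last first.
  exact: nl_le_second_diff (Cc_l2 he) (inH_l2n s_gt0 s_lt1 (Cc_inH he)) hp p0 Ip L0 hL.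
rewrite (dir_partial he hp) mulr_suml; apply: ler_sum => i _.
have lpp : l2 mu (fun x => - partial i (partial i eta) x) := l2N (Cc_partial_l2 i (Cc_partial i he)).
rewrite -RintegralZl //; apply: le_Rintegral => //.
- by apply: l2M_integrable => //; exact: inH_l2 hp.
- exact: (integrableZl measurableT (C i) Ip).
move=> x _; rewrite ler_wpM2r // (le_trans (ler_norm _)) // normrN; by case: (hC i).
Qed.

End barriers.

(** * Comparison principle and Newton iteration *)

Lemma powR_mono (R : realType) (a b p : R) : 0 <= p -> 0 <= a -> a <= b -> a `^ p <= b `^ p.
Proof. by move=> p0 a0 ab; apply: ge0_ler_powR; rewrite ?nnegrE //; exact: le_trans ab. Qed.

Lemma powRN_anti (R : realType) (a b p : R) : 0 <= p -> 0 < a -> a <= b -> b `^ (- p) <= a `^ (- p).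
Proof.
move=> p0 a0 ab; have b0 := lt_le_trans a0 ab.
by rewrite !powRN lef_pV2 ?posrE ?powR_gt0 //; apply: powR_mono => //; exact: ltW.
Qed.

(** Convexity of t^(-gamma), from e^x >= 1 + x and ln y <= y - 1 with y = b/a. *)
Lemma powRN_tangent (R : realType) (a b gamma : R) : 0 < a -> 0 < b -> 0 < gamma ->
  a `^ (- gamma) - gamma * a `^ (- gamma - 1) * (b - a) <= b `^ (- gamma).
Proof.
move=> a0 b0 g0.
have E : b `^ (- gamma) = a `^ (- gamma) * expR (- gamma * ln (b / a)).
  rewrite -[X in _ * expR X]/(- gamma * ln (b / a)).
  have -> : expR (- gamma * ln (b / a)) = (b / a) `^ (- gamma) by rewrite /powR gt_eqF // divr_gt0.
  by rewrite -powRM ?divr_ge0 ?ltW // mulrC divfK // gt_eqF.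
have E1 : a `^ (- gamma - 1) = a `^ (- gamma) * a^-1.
  by rewrite powRB ?powRr1 ?(ltW a0) //; rewrite (gt_eqF a0) implybT.
rewrite E E1.
have h1 := expR_ge1Dx (- gamma * ln (b / a)).
have h2 : ln (b / a) <= b / a - 1.
  have := @le_ln1Dx R (b / a - 1); rewrite (addrC 1) subrK; apply.
  by rewrite ltrBrDl addrN divr_gt0.
have -> : a `^ (- gamma) - gamma * (a `^ (- gamma) / a) * (b - a) = a `^ (- gamma) * (1 - gamma * (b / a - 1)).
  have -> : b - a = a * (b / a - 1) by rewrite mulrBr mulr1 mulrC divfK // gt_eqF.
  move: (b / a - 1) => y; have := divff (lt0r_neq0 a0); move: (a^-1) => r hr.
  have -> : gamma * (a `^ (- gamma) * r) * (a * y) = (a * r) * (gamma * a `^ (- gamma) * y) by lra.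
  by rewrite hr; lra.
rewrite ler_wpM2l ?powR_ge0 //.
have := ler_wpM2l (ltW g0) h2; lra.
Qed.

Lemma ae_eq_integrable d (T : measurableType d) (R : realType) (m : {measure set T -> \bar R}) (f g : T -> R) :
  measurable_fun setT g -> {ae m, forall x, f x = g x} -> m.-integrable setT (EFin \o f) -> m.-integrable setT (EFin \o g).
Proof.
move=> mg fg If; have mf : measurable_fun setT f by apply/measurable_EFinP; case/integrableP: If.
case/integrableP: If => _ If; apply/integrableP; split; first exact/measurable_EFinP.
apply: le_lt_trans If.
rewrite (@ge0_ae_eq_integral _ _ _ m setT (abse \o (EFin \o g)) (abse \o (EFin \o f))) //.
- by apply: measurableT_comp => //; exact/measurable_EFinP.
- by apply: measurableT_comp => //; exact/measurable_EFinP.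
- by move=> x _; exact: abse_ge0.
- by move=> x _; exact: abse_ge0.
- by apply: filterS fg => x /= ->.
Qed.

Section newton.
Context {R : realType} {n : nat}.
Local Notation V := 'rV[R]_n.
Local Notation mu := (@lebesgue_rV R n).
Local Notation m2 := (@product_measure1 _ _ V V R mu mu).
Local Notation VF := (V -> R).
Local Notation GF := ('I_n -> V -> R).
Implicit Types (u v F : VF) (g h : GF) (D : set V).
Variables (s : R) (s_gt0 : 0 < s) (s_lt1 : s < 1).
Local Notation nl := (nl s).

(** D may fail to be measurable, so the function is multiplied by the indicator of a ball containing
    D. *)
Lemma inH_integrable D (rho : R) u g : (forall x, D x -> `|x| <= rho) -> inH D u g -> mu.-integrable setT (EFin \o u).
Proof.
move=> hD hu; have lu := inH_l2 hu.
have mI : measurable_fun setT (\1_[set x : V | `|x| <= rho] : V -> R).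
  by apply: measurable_indic; exact: measurable_norm_le.
have lI : l2 mu (\1_[set x : V | `|x| <= rho] : V -> R).
  apply: (bounded_box_l2 (rho := rho) (C := 1)) => //.
    by move=> x; rewrite indicE; case: (_ \in _); rewrite ?normr1 ?normr0.
  by move=> x hx; rewrite indicE memNset //= => h; move: hx; rewrite ltNge h.
apply: (ae_eq_integrable _ _ (l2M_integrable lI lu)); first exact: l2_meas lu.
apply: filterS (inH_out hu) => x hx; rewrite indicE.
have [h|h] := boolP (x \in _); first by rewrite mul1r.
have nDx : ~ D x by move=> Dx; move: h; rewrite mem_set //; exact: hD.
by have [-> _] := hx nDx; rewrite mulr0.
Qed.

Lemma nl_ae u u' v : measurable_fun setT u -> measurable_fun setT u' -> measurable_fun setT v ->
  {ae mu, forall x, u x = u' x} -> nl u v = nl u' v.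
Proof.
move=> mu_ mu_' mv h; apply: ae_eq_Rint.
- by apply: measurable_funM; exact: measurable_ndiff.
- by apply: measurable_funM; exact: measurable_ndiff.
- by apply: filterS (ae_prod h) => z [h1 h2]; rewrite /ndiff h1 h2.
Qed.

Lemma dirB g h k : (forall i, l2 mu (g i)) -> (forall i, l2 mu (h i)) -> (forall i, l2 mu (k i)) ->
  dir (fun i x => g i x - h i x) k = dir g k - dir h k.
Proof. by move=> lg lh lk; rewrite /dir -sumrB; apply: eq_bigr => i _; rewrite ipBl. Qed.

Lemma nlB D D' D'' u g v h w k : inH D u g -> inH D' v h -> inH D'' w k ->
  nl (fun x => u x - v x) w = nl u w - nl v w.
Proof.
move=> hu hv hw; rewrite /nl -ipBl; [|exact: (inH_l2n s_gt0 s_lt1 hu)|exact: (inH_l2n s_gt0 s_lt1 hv)|exact: (inH_l2n s_gt0 s_lt1 hw)].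
by congr ip; apply/funext => z; exact: ndiffB.
Qed.

Lemma bump0_derive_norm (t : R) : `|derive1 bump0 t| <= 2.
Proof. by have /andP[h1 h2] := bump0_derive_bound t; rewrite ger0_norm. Qed.

Variables (Omega : set V) (rho : R) (i0 : 'I_n).
Hypotheses (rho_gt0 : 0 < rho) (Omega_rho : forall x, Omega x -> `|x| <= rho) (mOmega : measurable Omega).

Lemma ip_le0_inH (H : VF) phi k : l2 mu H -> inH Omega phi k ->
  (forall x, Omega x -> H x * phi x <= 0) -> ip mu H phi <= 0.
Proof.
move=> lH hp hH; have lp := inH_l2 hp.
have := @ae_le_Rint _ _ _ mu (fun x => H x * phi x) (fun=> 0) (l2M_integrable lH lp) (integrable0 _ _).
rewrite [X in _ <= X](_ : _ = 0); last by rewrite /Rintegral integral0_eq.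
apply; apply: filterS (inH_out hp) => x hx; have [Ox|nOx] := pselect (Omega x); first exact: hH.
by have [-> _] := hx nOx; rewrite mulr0.
Qed.

(** The right-hand side is a function of its own: the linear theory never sees the nonlinearity, and
    F in L^2 allows every element of W_0^{1,2} as a test. *)
Definition solves u g F := [/\ inH Omega u g, l2 mu F &
  forall v h, inH Omega v h -> dir g h + nl u v = ip mu F v].

(** Permits a change of representative, so that bounds obtained almost everywhere can be imposed at
    every point. *)
Lemma solves_ae u g F u' F' : solves u g F -> measurable_fun setT u' -> measurable_fun setT F' ->
  {ae mu, forall x, u x = u' x} -> {ae mu, forall x, F x = F' x} -> solves u' g F'.
Proof.
move=> [hu lF hs] mu' mF' uu' FF'; have [[lu lg] _] := hu; split.
- by apply: (inH_ae hu mu' (fun i => l2_meas (lg i)) uu') => i; exact: (filterS (fun x _ => erefl) uu').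
- exact: ae_eq_l2 FF' lF.
move=> v h hv; have lv := inH_l2 hv.
rewrite -(nl_ae (l2_meas lu) mu' (l2_meas lv) uu') (hs _ _ hv); apply: ae_eq_Rint.
- by apply: measurable_funM; [exact: l2_meas lF|exact: l2_meas lv].
- by apply: measurable_funM; [|exact: l2_meas lv].
by apply: filterS FF' => x ->.
Qed.

(** The proof tests with [bump0] of u - q, so the differential inequality is required only for phi
    supported where u > q. This is where the sign of u - q can be used in the source. *)
Lemma comparison u g q : inH Omega u g -> Cc_smooth setT q -> (forall x, 0 <= q x) ->
  (forall phi h, inH Omega phi h -> (forall x, 0 <= phi x) -> (forall x, phi x != 0 -> q x < u x) ->
     mu.-integrable setT (EFin \o phi) ->
     dir (fun i x => g i x - partial i q x) h + nl (fun x => u x - q x) phi <= 0) ->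
  {ae mu, forall x, u x <= q x}.
Proof.
move=> hu hq q0 h.
have b0 x : bump0 (- q x) = 0 by apply: bump0_le0; rewrite oppr_le0.
have hF := inH_comp hu hq (smooth_flat 1) bump0_derive_norm b0.
have hq' := Cc_inH hq; have [lu lg] := proj1 hu; have [lq lgq] := proj1 hq'.
have lw : l2H (fun x => u x - q x) (fun i x => g i x - partial i q x) by apply: l2HB; split.
have lnw : l2 m2 (ndiff s (fun x => u x - q x)).
  have -> : ndiff s (fun x => u x - q x) = (fun z => ndiff s u z - ndiff s q z) by apply/funext => z; exact: ndiffB.
  by apply: l2B; [exact: (inH_l2n s_gt0 s_lt1 hu)|exact: (inH_l2n s_gt0 s_lt1 hq')].
have [|] := bump0_comparison s_gt0 s_lt1 i0 Omega_rho rho_gt0 lw lnw hF; last first.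
  by move=> A [mA A0 hA]; exists A; split => // x hx; apply: hA => /=; move: hx; rewrite /= subr_le0.
apply: (h _ _ hF) => //; last exact: (inH_integrable Omega_rho hF).
  by move=> x; exact: bump0_ge0.
by move=> x hx; rewrite -subr_gt0 -bump0_gt0 lt0r hx bump0_ge0.
Qed.

Lemma comparison0 w g : inH Omega w g ->
  (forall phi h, inH Omega phi h -> (forall x, 0 <= phi x) -> (forall x, phi x != 0 -> 0 < w x) ->
     mu.-integrable setT (EFin \o phi) -> dir g h + nl w phi <= 0) ->
  {ae mu, forall x, w x <= 0}.
Proof.
move=> hw h; apply: (comparison hw (Cc0 setT)) => // phi k hp p0 pw Ip.
have -> : (fun i x => g i x - partial i (fun=> 0) x) = g.
  by apply/funext => i; apply/funext => x; rewrite partial_cst subr0.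
have -> : (fun x => w x - 0) = w by apply/funext => x; rewrite subr0.
exact: h.
Qed.

Variables (gamma r lambda M c : R) (q : VF).
Hypotheses (gamma_gt0 : 0 < gamma) (r_gt1 : 1 < r) (lambda_gt0 : 0 < lambda) (M_gt0 : 0 < M).
Hypotheses (q_Cc : Cc_smooth setT q) (q_ge0 : forall x, 0 <= q x) (q_le : forall x, Omega x -> M / 2 <= q x <= M).
Hypothesis q_super : forall phi h, inH Omega phi h -> (forall x, 0 <= phi x) -> mu.-integrable setT (EFin \o phi) ->
  c * \int[mu]_x phi x <= dir (fun i => partial i q) h + nl q phi.
Hypothesis c_large : lambda * (M / 2) `^ (- gamma) + M `^ r <= c.

Let r_ge0 : 0 <= r. Proof. exact: le_trans ler01 (ltW r_gt1). Qed.
Let gamma_ge0 : 0 <= gamma. Proof. exact: ltW gamma_gt0. Qed.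
Let gamma1_ge0 : 0 <= gamma + 1. Proof. by rewrite addr_ge0. Qed.

Definition rhs (eps t : R) : R := lambda * (t + eps) `^ (- gamma) + t `^ r.
(** Minus the derivative of the singular part of [rhs]; the increasing power t^r is not
    linearized. *)
Definition slope (eps t : R) : R := lambda * (gamma * (t + eps) `^ (- gamma - 1)).

(** The last clause, that u is a subsolution of the eps-problem, is the invariant that makes the
    next iterate larger. The bounds are imposed at every point of [Omega]. *)
Definition admissible (eps : R) u g F := [/\ solves u g F, forall x, ~ Omega x -> u x = 0,
  forall x, Omega x -> 0 <= u x <= q x & forall x, Omega x -> F x <= rhs eps (u x)].

(** The tangent lies below the graph for the singular part, and t^r only grows; hence a larger
    Newton iterate is again a subsolution. *)
Lemma rhs_tangent (eps t t' : R) : 0 < eps -> 0 <= t -> t <= t' -> rhs eps t - slope eps t * (t' - t) <= rhs eps t'.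
Proof.
move=> e0 t0 tt'; have t1 : 0 < t + eps by lra.
have t1' : 0 < t' + eps by lra.
have := powRN_tangent t1 t1' gamma_gt0; rewrite (_ : t' + eps - (t + eps) = t' - t); last by lra.
have h : t `^ r <= t' `^ r by apply: powR_mono => //; lra.
move=> /(ler_wpM2l (ltW lambda_gt0)); rewrite /rhs /slope; lra.
Qed.

Lemma measurable_rhs eps : measurable_fun setT (rhs eps).
Proof.
apply: measurable_funD; last exact: measurable_powR.
apply: measurable_funM => //; apply: measurableT_comp (measurable_powR _) _; exact: measurable_funD.
Qed.

Lemma measurable_slope eps : measurable_fun setT (slope eps).
Proof.
apply: measurable_funM => //; apply: measurable_funM => //.
apply: measurableT_comp (measurable_powR _) _; exact: measurable_funD.
Qed.

Lemma slope_bound (eps t : R) : 0 < eps -> 0 <= t -> 0 <= slope eps t <= slope eps 0.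
Proof.
move=> e0 t0; rewrite /slope; apply/andP; split.
  by rewrite mulr_ge0 ?(ltW lambda_gt0) // mulr_ge0 ?(ltW gamma_gt0) // powR_ge0.
apply: ler_wpM2l; first exact: ltW; apply: ler_wpM2l; first exact: ltW.
by rewrite -opprD; apply: powRN_anti => //; lra.
Qed.

Lemma rhs_bound (eps t : R) : 0 < eps -> 0 <= t <= M -> 0 <= rhs eps t <= lambda * eps `^ (- gamma) + M `^ r.
Proof.
move=> e0 /andP[t0 tM]; rewrite /rhs addr_ge0 ?powR_ge0 // ?mulr_ge0 ?powR_ge0 ?(ltW lambda_gt0) //=.
apply: lerD; last by apply: powR_mono => //; lra.
apply: ler_wpM2l; first exact: ltW.
by apply: powRN_anti => //; lra.
Qed.

Lemma bounded_Omega_l2 (f : VF) B : measurable_fun setT f -> (forall x, Omega x -> `|f x| <= B) ->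
  (forall x, ~ Omega x -> f x = 0) -> l2 mu f.
Proof.
move=> mf hB h0; have [[x0 Ox0]|hO] := pselect (exists x, Omega x); last first.
  have -> : f = (fun=> 0) by apply/funext => x; apply: h0 => Ox; apply: hO; exists x.
  exact: l20.
have B0 : 0 <= B by apply: le_trans (hB _ Ox0).
apply: (bounded_box_l2 (rho := rho) (C := B) mf).
  by move=> x; have [/hB//|/h0 ->] := pselect (Omega x); rewrite normr0.
by move=> x hx; apply: h0 => /Omega_rho; rewrite leNgt hx.
Qed.

Lemma indicT x : Omega x -> \1_Omega x = 1 :> R. Proof. by move=> Ox; rewrite indicE mem_set. Qed.
Lemma indicF x : ~ Omega x -> \1_Omega x = 0 :> R. Proof. by move=> Ox; rewrite indicE memNset. Qed.

Lemma newton_step (eps eps' : R) u g F : 0 < eps' -> eps' <= eps -> admissible eps u g F ->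
  exists u' g' F', [/\ admissible eps' u' g' F', forall x, u x <= u' x &
    forall x, Omega x -> F' x = rhs eps (u x) - slope eps (u x) * (u' x - u x)].
Proof.
move=> e'0 e'e [[hu lF hsol] u_out u_bd F_le].
have e0 : 0 < eps := lt_le_trans e'0 e'e.
have lu := inH_l2 hu; have mu_ := l2_meas lu; have mq := Cc_meas q_Cc.
have mO : measurable_fun setT (\1_Omega : V -> R) by exact: measurable_indic.
have uM x : Omega x -> 0 <= u x <= M.
  by move=> Ox; have /andP[h1 h2] := u_bd x Ox; have /andP[_ h3] := q_le Ox; rewrite h1 (le_trans h2).
pose N x := \1_Omega x * slope eps (u x); pose NB := slope eps 0.
have mN : measurable_fun setT N by apply: measurable_funM => //; exact: measurableT_comp (measurable_slope eps) mu_.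
have N_bd x : 0 <= N x <= NB.
  rewrite /N; have [Ox|nOx] := pselect (Omega x).
    by rewrite indicT // mul1r; apply: slope_bound => //; case/andP: (u_bd x Ox).
  rewrite indicF // mul0r lexx /=; by have /andP[] := slope_bound e0 (lexx 0).
pose f x := \1_Omega x * (rhs eps (u x) + slope eps (u x) * u x).
have mf : measurable_fun setT f.
  apply: measurable_funM => //; apply: measurable_funD; first exact: measurableT_comp (measurable_rhs eps) mu_.
  by apply: measurable_funM => //; exact: measurableT_comp (measurable_slope eps) mu_.
have lf : l2 mu f.
  apply: (@bounded_Omega_l2 f (lambda * eps `^ (- gamma) + M `^ r + NB * M)) => //; last first.
    by move=> x nOx; rewrite /f indicF // mul0r.
  move=> x Ox; rewrite /f indicT // mul1r; have := rhs_bound e0 (uM x Ox).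
  have /andP[u0 uM'] := uM x Ox; have := slope_bound e0 u0; rewrite -/NB.
  move=> /andP[s0 s1] /andP[r0 r1]; rewrite ger0_norm; last by rewrite addr_ge0 // mulr_ge0.
  by apply: lerD => //; exact: ler_pM.
have [ut [gt [hut hE]]] := linear_solve s_gt0 s_lt1 mN N_bd i0 Omega_rho rho_gt0 lf.
have lut := inH_l2 hut; have mut := l2_meas lut.
have lNut : l2 mu (fun x => N x * ut x).
  by apply: (l2_bdM mN _ lut (C := NB)) => x; have /andP[h1 h2] := N_bd x; rewrite ger0_norm.
have hE' v h : inH Omega v h -> dir gt h + nl ut v = ip mu (fun x => f x - N x * ut x) v.
  by move=> hv; have lv := inH_l2 hv; rewrite (ipBl lf lNut lv) -(hE v h hv) /energy; lra.
have lG : l2 mu (fun x => f x - N x * ut x) := l2B lf lNut.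
(* The source of ut is [rhs eps u + slope eps u * (u - ut)], which is at least F wherever u > ut. *)
have ge_u : {ae mu, forall x, u x - ut x <= 0}.
  apply: (comparison0 (inH_B hu hut)) => phi k hp p0 hw Ip.
  have lp := inH_l2 hp.
  have -> : dir (fun i x => g i x - gt i x) k + nl (fun x => u x - ut x) phi = ip mu (fun x => F x - (f x - N x * ut x)) phi.
    rewrite (ipBl lF lG lp) -(hsol _ _ hp) -(hE' _ _ hp).
    rewrite dirB; [|by move=> i; exact: (inH_l2g i hu)|by move=> i; exact: (inH_l2g i hut)|by move=> i; exact: (inH_l2g i hp)].
    rewrite (nlB hu hut hp).
    lra.
  apply: (ip_le0_inH _ hp); first exact: l2B.
  move=> x Ox; have [->|px] := eqVneq (phi x) 0; first by rewrite mulr0.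
  apply: mulr_le0_ge0 => //; have wx := hw x px; have Fx := F_le x Ox.
  rewrite /f /N indicT // !mul1r; have /andP[u0 _] := uM x Ox; have /andP[s0 _] := slope_bound e0 u0.
  have := mulr_ge0 s0 (ltW wx); lra.
(* Where ut > q the tangent value at ut is at most the one at q, hence at most [rhs eps (q x)],
   which [c_large] bounds by c because M/2 <= q <= M. *)
have le_q : {ae mu, forall x, ut x <= q x}.
  apply: (comparison hut q_Cc q_ge0) => phi k hp p0 hw Ip.
  have lp := inH_l2 hp; have hq := Cc_inH q_Cc.
  have -> : dir (fun i x => gt i x - partial i q x) k + nl (fun x => ut x - q x) phi =
      ip mu (fun x => f x - N x * ut x) phi - (dir (fun i => partial i q) k + nl q phi).
    rewrite -(hE' _ _ hp).
    rewrite dirB; [|by move=> i; exact: (inH_l2g i hut)|by move=> i; exact: (inH_l2g i hq)|by move=> i; exact: (inH_l2g i hp)].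
    rewrite (nlB hut hq hp).
    lra.
  rewrite subr_le0; apply: le_trans (q_super hp p0 Ip).
  rewrite -RintegralZl //; apply: ae_le_Rint; first exact: l2M_integrable.
    exact: (integrableZl measurableT c Ip).
  apply: filterS (inH_out hp) => x hx; have [Ox|nOx] := pselect (Omega x); last first.
    by have [-> _] := hx nOx; rewrite !mulr0.
  have [->|px] := eqVneq (phi x) 0; first by rewrite !mulr0.
  apply: ler_wpM2r => //; rewrite /f /N indicT // !mul1r; have wx := hw x px.
  have /andP[u0 uq] := u_bd x Ox; have /andP[q2 qM] := q_le Ox.
  have := rhs_tangent e0 u0 uq; have /andP[s0 _] := slope_bound e0 u0.
  have h1 : rhs eps (q x) <= c.
    apply: le_trans c_large; rewrite /rhs; apply: lerD; last by apply: powR_mono => //; move: M_gt0; lra.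
    apply: ler_wpM2l; first exact: ltW.
    by apply: powRN_anti => //; move: M_gt0; lra.
  have := ler_wpM2l s0 (ltW wx); lra.
(* The representative of ut clamped between u and q, so that the order holds everywhere. *)
pose u' : VF := fun x => \1_Omega x * Num.max (u x) (Num.min (ut x) (q x)).
have mu' : measurable_fun setT u'.
  by apply: measurable_funM => //; apply: measurable_maxr => //; exact: measurable_minr.
have uu' : {ae mu, forall x, ut x = u' x}.
  apply: filterS3 ge_u le_q (inH_out hut) => x h1 h2 h3.
  rewrite /u'; have [Ox|nOx] := pselect (Omega x).
    rewrite indicT // mul1r /Num.min /Num.max.
    have [h|h] := ltP (ut x) (q x).
      by case: ifP => // /negbT; rewrite -leNgt => h'; lra.
    by case: ifP => [h'|/negbT]; [|rewrite -leNgt => h']; lra.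
  by have [-> _] := h3 nOx; rewrite indicF // mul0r.
have u'1 x : Omega x -> u x <= u' x <= q x.
  move=> Ox; rewrite /u' indicT // mul1r le_max lexx /= ge_max; case/andP: (u_bd x Ox) => _ ->.
  by rewrite ge_min lexx orbT.
pose F' x := f x - N x * u' x.
exists u', gt, F'; split; last 2 first.
- move=> x; have [Ox|nOx] := pselect (Omega x); first by case/andP: (u'1 x Ox).
  by rewrite u_out // /u' indicF // mul0r.
- by move=> x Ox; rewrite /F' /f /N indicT // !mul1r; lra.
split.
- apply: (@solves_ae ut gt (fun x => f x - N x * ut x)) => //.
    by apply: measurable_funB => //; exact: measurable_funM.
  by apply: filterS uu' => x hx; rewrite /F' hx.
- by move=> x nOx; rewrite /u' indicF // mul0r.
- move=> x Ox; have /andP[h1 ->] := u'1 x Ox; rewrite andbT; apply: le_trans h1.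
  by case/andP: (u_bd x Ox).
move=> x Ox; have /andP[h1 h2] := u'1 x Ox; have /andP[u0 _] := u_bd x Ox.
have -> : F' x = rhs eps (u x) - slope eps (u x) * (u' x - u x).
  by rewrite /F' /f /N indicT // !mul1r; lra.
(* Lowering eps to eps' only raises the singular term, so the subsolution property survives. *)
apply: le_trans (rhs_tangent e0 u0 h1) _; rewrite /rhs lerD2r; apply: ler_wpM2l; first exact: ltW.
by apply: powRN_anti => //; move: M_gt0; lra.
Qed.

Lemma admissible0 : admissible 1 (fun=> 0) (fun _ _ => 0) (fun=> 0).
Proof.
have ip0 d (T : measurableType d) (m : {measure set T -> \bar R}) (f : T -> R) : ip m (fun=> 0) f = 0.
  by rewrite /ip /Rintegral integral0_eq // => x _; rewrite mul0r.
split => //.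
- split; [exact: inH_0|exact: l20|] => v h hv.
  rewrite ip0 /dir big1 ?add0r; last by move=> i _; exact: ip0.
  have -> : nl (fun=> 0) v = ip m2 (fun=> 0) (ndiff s v).
    by congr ip; apply/funext => z; rewrite /ndiff subrr mul0r.
  exact: ip0.
- by move=> x Ox; rewrite lexx q_ge0.
- move=> x Ox; have : 0 <= (0:R) <= M by rewrite lexx ltW.
  by case/(rhs_bound ltr01)/andP.
Qed.

(** A step from 0 with eps = 1 has the source lambda - lambda gamma u. Small multiples of cut-offs
    are subsolutions of that linear problem, which yields positive lower bounds on compact sets,
    inherited by all later iterates. *)
Lemma newton_start (eta : nat -> VF) : (forall k, Cc_smooth Omega (eta k)) -> (forall k x, 0 <= eta k x <= 1) ->
  exists b : nat -> R, (forall k, 0 < b k) /\ exists u g F, admissible 1 u g F /\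
    forall k x, Omega x -> b k * eta k x <= u x.
Proof.
move=> heta eta01.
have [u [g [F [[hs u_out u_bd F_le] u_ge FE]]]] := newton_step ltr01 (lexx 1) admissible0.
have [hu lF hsol] := hs; have lu := inH_l2 hu; have mu_ := l2_meas lu; have mq := Cc_meas q_Cc.
have FE' x : Omega x -> F x = lambda - lambda * gamma * u x.
  move=> Ox; rewrite FE // /rhs /slope add0r !powR1 powR0 ?gt_eqF ?(lt_trans ltr01) //.
  by move: (u x) => t; lra.
have hb k : exists b : R, 0 < b <= M / 2 /\ {ae mu, forall x, b * eta k x - u x <= 0}.
  have [L L0 hL] := Cc_operator_bound s_gt0 s_lt1 (heta k).
  have lg0 : 0 < lambda * gamma by rewrite mulr_gt0.
  have D0 : 0 < L + lambda * gamma by lra.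
  (* Where b eta > u one has u <= b, so the second bound gives b L <= lambda - lambda gamma u. The
     first keeps b eta below q, needed where u is replaced by q. *)
  pose b := Num.min (M / 2) (lambda / (L + lambda * gamma)).
  have b0 : 0 < b by rewrite lt_min !divr_gt0.
  have bM : b <= M / 2 by rewrite ge_min lexx.
  have bL : b * (L + lambda * gamma) <= lambda by rewrite -ler_pdivlMr // ge_min lexx orbT.
  exists b; rewrite b0 bM; split => //.
  have hbe := inH_Z b (Cc_inH (heta k)).
  apply: (comparison0 (inH_B hbe hu)) => phi h hp p0 hw Ip; have lp := inH_l2 hp.
  rewrite dirB; [|by move=> i; exact: (inH_l2g i hbe)|by move=> i; exact: (inH_l2g i hu)|by move=> i; exact: (inH_l2g i hp)].
  rewrite (nlB hbe hu hp).
  have E1 : dir (fun i x => b * partial i (eta k) x) h + nl (fun x => b * eta k x) phi = b * (dir (fun i => partial i (eta k)) h + nl (eta k) phi).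
    rewrite mulrDr; congr (_ + _).
      rewrite /dir mulr_sumr; apply: eq_bigr => i _; rewrite ipZl //; [exact: Cc_partial_l2 (heta k)|exact: inH_l2g hp].
    rewrite /nl -ipZl; [|exact: (inH_l2n s_gt0 s_lt1 (Cc_inH (heta k)))|exact: (inH_l2n s_gt0 s_lt1 hp)].
    by congr ip; apply/funext => z; rewrite /ndiff; lra.
  have H1 := hL _ _ _ hp p0 Ip; have H2 := hsol _ _ hp.
  suff : b * L * \int[mu]_x phi x <= ip mu F phi.
    have := ler_wpM2l (ltW b0) H1; move: E1 H2; lra.
  rewrite -RintegralZl //; apply: ae_le_Rint; [exact: (integrableZl measurableT _ Ip)|exact: l2M_integrable|].
  apply: filterS (inH_out hp) => x hx; have [Ox|nOx] := pselect (Omega x); last first.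
    by have [-> _] := hx nOx; rewrite !mulr0.
  have [->|px] := eqVneq (phi x) 0; first by rewrite !mulr0.
  apply: ler_wpM2r => //; rewrite FE' //; have := hw x px; have /andP[e0 e1] := eta01 k x.
  have : b * eta k x <= b by rewrite ger_pMr.
  move=> h1 h2; have h3 : u x <= b by lra.
  have := ler_wpM2l (ltW lg0) h3; lra.
have [b {}hb] := boolp.choice hb; exists b; split; first by move=> k; have [/andP[]] := hb k.
have /ae_foralln[A [mA A0 hA]] : forall k, {ae mu, forall x, b k * eta k x - u x <= 0} by move=> k; case: (hb k).
have aeA : {ae mu, forall x, ~ A x} by exists A; split => // x /= /contrapT.
have mIA : measurable_fun setT (\1_A : V -> R) by exact: measurable_indic.
have mO : measurable_fun setT (\1_Omega : V -> R) by exact: measurable_indic.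
(* On the common null set A of the countably many lower bounds, u is set to q inside [Omega] and F
   to 0; this keeps the pair admissible. *)
pose u' x := u x + \1_Omega x * \1_A x * (q x - u x).
pose F' x := F x * (1 - \1_A x).
exists u', g, F'; split; last first.
  move=> k x Ox; rewrite /u' indicT // mul1r indicE; have [Ax|nAx] := boolP (x \in A).
    rewrite mul1r addrC subrK; have [/andP[b0 bM] _] := hb k; have /andP[q2 _] := q_le Ox.
    have /andP[e0 e1] := eta01 k x; apply: le_trans q2; apply: le_trans bM; by rewrite ger_pMr.
  rewrite mul0r addr0 -subr_le0; apply: contrapT => h; move: nAx; rewrite mem_set //.
  by apply: hA => /= /(_ k).
split.
- apply: (solves_ae hs).
  + by apply: measurable_funD => //; apply: measurable_funM; [exact: measurable_funM|exact: measurable_funB].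
  + by apply: measurable_funM; [exact: l2_meas lF|exact: measurable_funB].
  + by apply: filterS aeA => x nAx; rewrite /u' [\1_A x]indicE memNset // mulr0 mul0r addr0.
  + by apply: filterS aeA => x nAx; rewrite /F' indicE memNset // subr0 mulr1.
- by move=> x nOx; rewrite /u' indicF // !mul0r addr0 u_out.
- move=> x Ox; rewrite /u' indicT // mul1r indicE; case: (x \in A); last by rewrite mul0r addr0 u_bd.
  by rewrite mul1r addrC subrK lexx q_ge0.
move=> x Ox; rewrite /F' /u' indicT // mul1r indicE; case: (x \in A).
  rewrite subrr mulr0 mul1r addrC subrK; have /andP[q2 qM] := q_le Ox.
  have : 0 <= q x <= M by rewrite q_ge0.
  by case/(rhs_bound ltr01)/andP.
by rewrite subr0 mulr1 mul0r addr0 F_le.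
Qed.

Definition newton_eps (k : nat) : R := k.+1%:R^-1.

Lemma newton_sequence (eta : nat -> VF) : (forall k, Cc_smooth Omega (eta k)) -> (forall k x, 0 <= eta k x <= 1) ->
  exists (b : nat -> R) (u : nat -> VF) (g : nat -> GF) (F : nat -> VF), [/\ forall k, 0 < b k,
    forall k, admissible (newton_eps k) (u k) (g k) (F k),
    forall k x, u k x <= u k.+1 x,
    forall k x, Omega x -> F k.+1 x = rhs (newton_eps k) (u k x) - slope (newton_eps k) (u k x) * (u k.+1 x - u k x) &
    forall j k x, Omega x -> b j * eta j x <= u k x].
Proof.
move=> heta eta01; have [b [b0 [u0 [g0 [F0 [h0 hb]]]]]] := newton_start heta eta01.
pose S := {k : nat & {p : VF * GF * VF | admissible (newton_eps k) p.1.1 p.1.2 p.2}}.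
pose step (k : nat) (p p' : VF * GF * VF) := [/\ admissible (newton_eps k.+1) p'.1.1 p'.1.2 p'.2,
  forall x, p.1.1 x <= p'.1.1 x & forall x, Omega x -> p'.2 x = rhs (newton_eps k) (p.1.1 x) - slope (newton_eps k) (p.1.1 x) * (p'.1.1 x - p.1.1 x)].
(* As an implication the step is a total relation, so that choice yields a function to iterate. *)
have ex (k : nat) (p : VF * GF * VF) : exists p', admissible (newton_eps k) p.1.1 p.1.2 p.2 -> step k p p'.
  have [hp|hp] := pselect (admissible (newton_eps k) p.1.1 p.1.2 p.2); last by exists p.
  have e1 : 0 < newton_eps k.+1 by rewrite invr_gt0.
  have e2 : newton_eps k.+1 <= newton_eps k by rewrite lef_pV2 ?posrE // ler_nat.
  by have [u' [g' [F' [h1 h2 h3]]]] := newton_step e1 e2 hp; exists (u', g', F').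
have ex' (z : nat * (VF * GF * VF)) : exists p', admissible (newton_eps z.1) z.2.1.1 z.2.1.2 z.2.2 -> step z.1 z.2 p' by exact: ex.
have [nx hnx] := boolp.choice ex'.
pose fix z k : VF * GF * VF := if k is k'.+1 then nx (k', z k') else (u0, g0, F0).
have hz k : admissible (newton_eps k) (z k).1.1 (z k).1.2 (z k).2.
  elim: k => [|k IH]; first by rewrite /newton_eps invr1.
  by have [] := hnx (k, z k) IH.
exists b, (fun k => (z k).1.1), (fun k => (z k).1.2), (fun k => (z k).2); split => //.
- by move=> k x; have [_ h _] := hnx (k, z k) (hz k); exact: h.
- by move=> k x Ox; have [_ _ h] := hnx (k, z k) (hz k); exact: h.
move=> j k x Ox; elim: k => [|k IH]; first exact: hb.
by apply: le_trans IH _; have [_ h _] := hnx (k, z k) (hz k); exact: h.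
Qed.

End newton.

(** * Sobolev spaces *)

Section conversions.
Context {R : realType} {n : nat}.
Local Notation V := 'rV[R]_n.
Local Notation mu := (@lebesgue_rV R n).
Local Notation VF := (V -> R).
Local Notation GF := ('I_n -> V -> R).
Implicit Types (u v phi psi : VF) (g h : GF) (D w : set V).

Lemma Lfun2_l2 (f : VF) : f \in Lfun mu 2%:E <-> l2 mu f.
Proof.
split.
  move=> hf; split; last exact: Lfun2_integrable_sqr.
  by move: hf; rewrite inE => /andP[]; rewrite inE.
move=> [mf If]; rewrite inE; apply/andP; split; rewrite inE //= /finite_norm unlock.
apply: poweR_lty; have /integrableP[_] := If; apply: le_lt_trans.
rewrite le_eqVlt; apply/orP; left; apply/eqP; apply: eq_integral => x _ /=.
by rewrite powR_mulrn // normrX.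
Qed.

Lemma Loo_bounded D u C : measurable D -> measurable_fun setT u -> (forall x, `|u x| <= C) -> Loo D u.
Proof.
move=> mD mu_ hC; rewrite /Loo /= inE; apply/andP; split; rewrite inE /=.
  by apply: (measurable_restrictT _ mD).1; exact: measurable_funTS.
rewrite /finite_norm unlock; case: ifP => // m0; apply: le_lt_trans (ltry C).
apply/ess_sup_inf.ess_supP; apply: nearW => x /=; rewrite lee_fin patchE; case: ifP => // _.
by rewrite normr0; apply: le_trans (hC x).
Qed.

Lemma integral_outside D (f : V -> \bar R) : (forall x, ~ D x -> f x = 0%E) ->
  (\int[mu]_(x in D) f x = \int[mu]_x f x)%E.
Proof.
move=> h; rewrite integral_mkcond; apply: eq_integral => x _; rewrite patchE.
by have [//|/negP hx] := boolP (x \in D); rewrite h // => Dx; apply: hx; rewrite mem_set.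
Qed.

Lemma Rintegral_outside D (f : VF) : (forall x, ~ D x -> f x = 0) -> \int[mu]_(x in D) f x = \int[mu]_x f x.
Proof. by move=> h; rewrite /Rintegral integral_outside // => x /h ->. Qed.

Lemma closed_measurable_rV (K : set V) : closed K -> measurable K.
Proof. by move=> cK; rewrite -(setCK K); apply: measurableC; apply: open_measurable_rV; exact: closed_openC. Qed.

Lemma l2_L1_compact (u : VF) (K : set V) : l2 mu u -> compact K -> mu.-integrable K (EFin \o u).
Proof.
move=> lu cK; have [rho r0 hK] := bounded_normP (compact_bounded cK).
have mK : measurable K by apply: closed_measurable_rV; apply: compact_closed => //; exact: norm_hausdorff.
have lI : l2 mu (\1_[set x : V | `|x| <= rho] : V -> R).
  apply: (bounded_box_l2 (rho := rho) (C := 1)).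
  - by apply: measurable_indic; exact: measurable_norm_le.
  - by move=> x; rewrite indicE; case: (_ \in _); rewrite ?normr1 ?normr0.
  - by move=> x hx; rewrite indicE memNset //= => h; move: hx; rewrite ltNge h.
have := integrableS measurableT mK (@subsetT _ _) (l2M_integrable lI lu).
apply: eq_integrable => // x; rewrite inE => Kx /=.
by rewrite indicE mem_set ?mul1r //; exact: hK.
Qed.

Lemma l2_L1loc D u : measurable D -> l2 mu u -> L1loc D u.
Proof.
move=> mD lu; split; first exact: measurable_funTS (l2_meas lu).
by move=> K cK _; exact: l2_L1_compact.
Qed.

Definition rowg g (x : V) : V := \row_i g i x.

(** U and D are unrelated, because integration by parts holds for all test functions on R^n. *)
Lemma inH_is_wgrad U D u g : open D -> inH U u g -> is_wgrad D u (rowg g).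
Proof.
move=> oD hu; have mD := open_measurable_rV oD; have lu := inH_l2 hu.
split; first exact: l2_L1loc.
move=> i; have E : (fun x => rowg g x ord0 i) = g i by apply/funext => x; rewrite mxE.
split; first by rewrite E; apply: l2_L1loc => //; exact: inH_l2g hu.
move=> psi hpsi.
have -> : (fun x => rowg g x ord0 i * psi x) = (fun x => g i x * psi x) by apply/funext => x; rewrite mxE.
have E1 : \int[mu]_(x in D) (u x * partial i psi x) = \int[mu]_x (u x * partial i psi x).
  by apply: Rintegral_outside => x nDx; rewrite (Cc_out (Cc_partial i hpsi) nDx) mulr0.
have E2 : \int[mu]_(x in D) (g i x * psi x) = \int[mu]_x (g i x * psi x).
  by apply: Rintegral_outside => x nDx; rewrite (Cc_out hpsi nDx) mulr0.
by rewrite E1 E2; exact: (inH_ibp i hu (Cc_mono (@subsetT _ D) hpsi)).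
Qed.

Lemma wgradP D u : has_wgrad D u -> is_wgrad D u (wgrad D u).
Proof. exact: getPex. Qed.

Lemma wgrad_ae D u (G : V -> V) i : open D -> is_wgrad D u G ->
  {ae mu, forall x, D x -> wgrad D u x ord0 i = G x ord0 i}.
Proof. by move=> oD hG; exact: (wgrad_unique oD (wgradP (ex_intro _ G hG)) hG i). Qed.

Lemma sum_ipE h : (forall i, l2 mu (h i)) -> (\int[mu]_x (\sum_i h i x ^+ 2)%:E = (dir h h)%:E)%E.
Proof.
move=> lh; under eq_integral do rewrite -sumEFin.
rewrite integral_sum //; last by move=> i; exact: (lh i).2.
by under eq_bigr do rewrite (ipE (lh _)); rewrite sumEFin.
Qed.

Lemma wgrad_restrict_l2 D u g i : open D -> (forall j, l2 mu (g j)) -> is_wgrad D u (rowg g) -> L2 D (fun x => wgrad D u x ord0 i).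
Proof.
move=> oD lg hg; have mD := open_measurable_rV oD.
apply/Lfun2_l2; have [_ h] := wgradP (ex_intro _ _ hg); have [[mw _] _] := h i.
have lgD : l2 mu (g i \_ D).
  apply: l2_le (lg i); first by apply: (measurable_restrictT _ mD).1; exact: measurable_funTS (l2_meas (lg i)).
  by move=> x; rewrite patchE; case: ifP; rewrite ?normr0.
apply: ae_eq_l2 lgD; first exact: (measurable_restrictT _ mD).1.
apply: filterS (wgrad_ae i oD hg) => x hx; rewrite !patchE.
by case: ifPn => //; rewrite inE => /hx ->; rewrite mxE.
Qed.

(** The chosen [wgrad] is known on D only almost everywhere, so norms are compared through
    integrals. Passing from R^n to D gives an inequality, enough for convergence to 0. *)
Lemma inH_W012 D u g : open D -> inH D u g -> (forall x, ~ D x -> u x = 0) -> W012 D u.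
Proof.
move=> oD hu u0; have mD := open_measurable_rV oD; have [[lu lg] [psi [hp cp]]] := hu.
have hg := inH_is_wgrad oD hu; split => //.
  split; last by move=> i; exact: wgrad_restrict_l2 hg.
    apply/Lfun2_l2; suff -> : u \_ D = u by [].
    apply/funext => x; rewrite patchE; case: ifPn => // /negP hx; rewrite u0 // => Dx; apply: hx; exact: mem_set.
  by exists (rowg g).
exists psi; split => //.
have c0 : (fun k => (Num.sqrt (nrm (fun x => psi k x - u x) (fun i x => partial i (psi k) x - g i x)))%:E) @ \oo --> 0%E.
  apply/fine_cvgP; split; first exact: nearW.
  by have := cont_cvg_seq (@sqrt_continuous R) ((cvgH_nrm _ _ _ _).1 cp); rewrite sqrtr0.
apply: (squeeze_cvge _ (cvg_cst 0%E) c0); apply: nearW => k.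
rewrite poweR_ge0 /=.
have hd := inH_B hu (Cc_inH (hp k)); have ldd i := inH_l2g i hd.
have hgd := inH_is_wgrad oD hd.
have E1 : (\int[mu]_(x in D) ((u \- psi k) x ^+ 2)%:E = (ip mu (fun x => u x - psi k x) (fun x => u x - psi k x))%:E)%E.
  rewrite integral_outside; first exact: (ipE (inH_l2 hd)).
  by move=> x nDx; rewrite /= u0 // (Cc_out (hp k) nDx) subr0 expr0n.
have E2 : (\int[mu]_(x in D) (enorm (wgrad D (u \- psi k) x) ^+ 2)%:E <= (dir (fun i x => g i x - partial i (psi k) x) (fun i x => g i x - partial i (psi k) x))%:E)%E.
  rewrite -sum_ipE //.
  have mS : measurable_fun setT (fun x => (\sum_i (g i x - partial i (psi k) x) ^+ 2)%:E).
    by apply/measurable_EFinP; apply: measurable_sum => i; apply: measurable_funX; exact: l2_meas (ldd i).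
  have enormE (x : V) : enorm x ^+ 2 = \sum_i x ord0 i ^+ 2 by rewrite sqr_sqrtr // sumr_ge0 // => i _; exact: sqr_ge0.
  have [_ hw] := wgradP (ex_intro _ _ hgd).
  rewrite (@ae_eq_integral _ _ _ mu D (fun x => (\sum_i (g i x - partial i (psi k) x) ^+ 2)%:E)) //.
  - apply: ge0_subset_integral => //; move=> x _; rewrite lee_fin; apply: sumr_ge0 => i _; exact: sqr_ge0.
  - apply/measurable_EFinP; under eq_fun do rewrite enormE.
    by apply: measurable_sum => i; apply: measurable_funX; have [[]] := hw i.
  - exact: measurable_funTS.
  have hall : {ae mu, forall x, forall i, D x -> wgrad D (u \- psi k) x ord0 i = g i x - partial i (psi k) x}.
    apply: filter_forall => i; apply: filterS (wgrad_ae i oD hgd) => x hx Dx; by rewrite hx // mxE.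
  by apply: filterS hall => x hx Dx; rewrite enormE; congr EFin; apply: eq_bigr => i _; rewrite hx.
rewrite /W12norm E1; set T := (\int[mu]_(x in D) _)%E in E2 *.
have T0 : (0 <= T)%E by apply: integral_ge0 => x _; rewrite lee_fin sqr_ge0.
have sym : nrm (fun x => psi k x - u x) (fun i x => partial i (psi k) x - g i x) =
   nrm (fun x => u x - psi k x) (fun i x => g i x - partial i (psi k) x).
  have E (a b : VF) : ip mu (fun x => a x - b x) (fun x => a x - b x) = ip mu (fun x => b x - a x) (fun x => b x - a x).
    by apply: eq_Rintegral => x _; rewrite -(opprB (b x)) mulrNN.
  by rewrite /nrm E; congr (_ + _); apply: eq_bigr => i _; exact: E.
rewrite sym -powR12_sqrt ?nrm_ge0 // -poweR_EFin.
apply: gt0_ler_poweR; rewrite ?in_itv /= ?leey ?andbT //.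
- by rewrite adde_ge0 // lee_fin ip_ge0.
- by rewrite lee_fin nrm_ge0.
by rewrite /nrm EFinD leeD2l.
Qed.

Lemma is_wgradB D u (G : V -> V) psi : open D -> is_wgrad D u G -> Cc_smooth D psi ->
  is_wgrad D (u \- psi) (fun x => G x - rowg (fun i => partial i psi) x).
Proof.
move=> oD [hu hG] hpsi; have mD := open_measurable_rV oD.
have hps := inH_is_wgrad oD (Cc_inH hpsi); have [lp hP] := hps.
have L1B (a b : VF) : L1loc D a -> L1loc D b -> L1loc D (fun x => a x - b x).
  move=> [ma ha] [mb hb]; split; first exact: measurable_funB.
  move=> K cK KD; have mK : measurable K by apply: closed_measurable_rV; apply: compact_closed => //; exact: norm_hausdorff.
  have := integrableB mK (ha K cK KD) (hb K cK KD).
  by apply: eq_integrable => // x _ /=; rewrite EFinB.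
split; first exact: L1B.
move=> i; have [lG iG] := hG i; have [lP iP] := hP i.
have E : (fun x => (G x - rowg (fun i => partial i psi) x) ord0 i) = (fun x => G x ord0 i - rowg (fun i => partial i psi) x ord0 i).
  by apply/funext => x; rewrite !mxE.
split; first by rewrite E; exact: L1B.
move=> chi hchi; have hchii := Cc_partial i hchi.
have key (f : VF) (t : VF) : L1loc D f -> Cc_smooth D t -> mu.-integrable D (EFin \o (fun x => f x * t x)).
  move=> lf ht; have := integrableS measurableT mD (@subsetT _ _) (L1loc_mul oD lf ht).
  by apply: eq_integrable => // x xD /=; rewrite patchE xD.
have -> : \int[mu]_(x in D) ((u \- psi) x * partial i chi x) = \int[mu]_(x in D) (u x * partial i chi x) - \int[mu]_(x in D) (psi x * partial i chi x).
  rewrite -RintegralB //; [|exact: key|exact: key].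
  by apply: eq_Rintegral => x _; rewrite /= mulrBl.
have -> : \int[mu]_(x in D) ((G x - rowg (fun i => partial i psi) x) ord0 i * chi x) =
    \int[mu]_(x in D) (G x ord0 i * chi x) - \int[mu]_(x in D) (rowg (fun i => partial i psi) x ord0 i * chi x).
  rewrite -RintegralB //; [|exact: key|exact: key].
  by apply: eq_Rintegral => x _; rewrite !mxE mulrBl.
by rewrite iG // iP //; lra.
Qed.

(** The converse passage: the gradient is [wgrad], set to 0 off w, and the given approximation is
    kept. *)
Lemma W012_inH w phi : open w -> W012 w phi -> exists g, inH w phi g.
Proof.
move=> ow [phi0 [l2phi hw l2g] [psi [hp cW]]]; have mw := open_measurable_rV ow.
pose g : GF := fun i => (fun x => wgrad w phi x ord0 i) \_ w.
have lg i : l2 mu (g i) by apply/Lfun2_l2; exact: l2g.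
have lphi : l2 mu phi.
  have /Lfun2_l2 := l2phi; suff -> : phi \_ w = phi by [].
  apply/funext => x; rewrite patchE; case: ifPn => // /negP hx; rewrite phi0 // => Dx; apply: hx; exact: mem_set.
exists g; split => //; exists psi; split => //.
have /fine_cvgP[cfin c0] := cW.
pose b k : R := fine (W12norm w (phi \- psi k)).
have c2 : (fun k => b k * b k) @ \oo --> (0 : R).
  by rewrite -[X in _ --> X](mulr0 0); exact: (cvgM c0 c0).
have wp := wgradP hw.
(* Convergence in the extended reals makes the norm finite only from some index on, hence the
   condition. *)
have main k : W12norm w (phi \- psi k) \is a fin_num ->
    ip mu (fun x => psi k x - phi x) (fun x => psi k x - phi x) <= b k * b k /\
    forall i, ip mu (fun x => partial i (psi k) x - g i x) (fun x => partial i (psi k) x - g i x) <= b k * b k.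
  move=> fk; have lpsi := Cc_l2 (hp k).
  have ld := l2B lpsi lphi; have ldg i := l2B (Cc_partial_l2 i (hp k)) (lg i).
  have hB := is_wgradB ow wp (hp k).
  have [_ hBw] := wgradP (ex_intro _ _ hB).
  have enormE (x : V) : enorm x ^+ 2 = \sum_i x ord0 i ^+ 2 by rewrite sqr_sqrtr // sumr_ge0 // => i _; exact: sqr_ge0.
  pose S := (\int[mu]_(x in w) ((phi \- psi k) x ^+ 2)%:E)%E.
  pose T := (\int[mu]_(x in w) (enorm (wgrad w (phi \- psi k) x) ^+ 2)%:E)%E.
  have S0 : (0 <= S)%E by apply: integral_ge0 => x _; rewrite lee_fin sqr_ge0.
  have T0 : (0 <= T)%E by apply: integral_ge0 => x _; rewrite lee_fin sqr_ge0.
  have ST : (S + T = (b k * b k)%:E)%E.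
    have E : (S + T = (W12norm w (phi \- psi k)%R) `^ 2)%E.
      by rewrite /W12norm -/S -/T -poweRrM mulVf ?pnatr_eq0 // poweRe1 // adde_ge0.
    rewrite E -(fineK fk) poweR_EFin powR_mulrn ?expr2 //.
    by rewrite fine_ge0 // poweR_ge0.
  have ES : S = (ip mu (fun x => psi k x - phi x) (fun x => psi k x - phi x))%:E.
    rewrite /S integral_outside; last by move=> x nx; rewrite /= phi0 // (Cc_out (hp k) nx) subr0 expr0n.
    rewrite -ipE //; apply: eq_integral => x _; congr EFin; rewrite /= !expr2; lra.
  split; first by rewrite -lee_fin -ST ES leeDl.
  move=> i; rewrite -lee_fin -ST -ipE //.
  apply: (@le_trans _ _ T); last by rewrite leeDr.
  rewrite -(@integral_outside w); last first.
    move=> x nx; rewrite (Cc_out (Cc_partial i (hp k)) nx) /g patchE memNset //= subr0 expr0n //.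
  have mi j : measurable_fun w (fun x => wgrad w (phi \- psi k) x ord0 j) by have [[]] := hBw j.
  rewrite (@ae_eq_integral _ _ _ mu w (fun x => (wgrad w (phi \- psi k) x ord0 i ^+ 2)%:E)) //.
  - apply: ge0_le_integral => //.
    + by move=> x _; rewrite lee_fin sqr_ge0.
    + by apply/measurable_EFinP; apply: measurable_funX.
    + apply/measurable_EFinP; under eq_fun do rewrite enormE.
      by apply: measurable_sum => j; apply: measurable_funX.
    move=> x _; rewrite lee_fin enormE (bigD1 i) //= lerDl; apply: sumr_ge0 => j _; exact: sqr_ge0.
  - by apply: measurable_funTS; apply/measurable_EFinP; apply: measurable_funX; exact: l2_meas (ldg i).
  - by apply/measurable_EFinP; apply: measurable_funX.
  apply: filterS (wgrad_ae i ow hB) => x hx wx; rewrite hx // !mxE /g patchE mem_set //.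
  by congr EFin; rewrite !expr2; lra.
split.
  apply: squeeze_cvgr (cvg_cst 0) c2; apply: filterS cfin => k /main[h _]; by rewrite ip_ge0.
move=> i; apply: squeeze_cvgr (cvg_cst 0) c2; apply: filterS cfin => k /main[_ h]; by rewrite ip_ge0 h.
Qed.

End conversions.

(** * Local convergence *)

Lemma dominated_Rint0 d (T : measurableType d) (R : realType) (m : {measure set T -> \bar R}) (f : nat -> T -> R) (D : T -> R) :
  (forall k, measurable_fun setT (f k)) -> (forall x, (fun k => f k x) @ \oo --> (0 : R)) ->
  m.-integrable setT (EFin \o D) -> (forall k x, `|f k x| <= D x) -> (fun k => \int[m]_x f k x) @ \oo --> (0 : R).
Proof.
move=> mf f0 ID fD.
have ae0 : {ae m, forall x, (fun k => f k x) @ \oo --> (fun=> 0 : R) x} by apply: nearW => x; exact: (@f0 x).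
have [_] := dominated_Rint mf (measurable_cst (0:R)) ae0 ID fD.
by rewrite [X in _ --> X -> _](_ : _ = 0) // /Rintegral integral0_eq.
Qed.

Lemma cvg_sum_seq (R : realType) (I : Type) (r : seq I) (f : nat -> I -> R) (l : I -> R) :
  (forall i, (fun k => f k i) @ \oo --> l i) -> (fun k => \sum_(i <- r) f k i) @ \oo --> \sum_(i <- r) l i.
Proof.
move=> h; elim: r => [|a r IH].
  by rewrite big_nil; under eq_fun do rewrite big_nil; exact: cvg_cst.
by rewrite big_cons; under eq_fun do rewrite big_cons; exact: cvgD (@h a) IH.
Qed.

(** A near covering makes the index uniform: half the radius of a ball inside U is spent on moving
    the point, half on the collar that [exhaust] asks for. *)
Lemma compact_sub_exhaust (R : realType) (n : nat) (K U : set 'rV[R]_n) : compact K -> open U -> K `<=` U ->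
  \forall k \near \oo, K `<=` exhaust U k.
Proof.
move=> /compact_near_coveringP cK oU KU.
apply: (cK nat \oo (fun k x => exhaust U k x)) => x Kx.
have /nbhs_ballP[e /= e0 he] : nbhs x U by apply: open_nbhs_nbhs; split => //; exact: KU.
have e2 : 0 < e / 2 by rewrite divr_gt0.
exists (ball x (e / 2), [set k : nat | `|x| + e / 2 <= k%:R /\ k.+1%:R^-1 <= e / 2]) => /=.
  split; first exact: nbhsx_ballx.
  near=> k; split; first by near: k; exact: nbhs_infty_ger.
  by apply: ltW; near: k; exact: (near_infty_natSinv_lt (PosNum e2)).
move=> [y k] /= [xy [h1 h2]]; rewrite mx_norm_ball /ball_ /= in xy; split.
  apply: le_trans h1; rewrite -(subrK x y) addrC -(opprB x y); apply: le_trans (ler_normB _ _) _.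
  by rewrite lerD2l ltW.
move=> z yz; apply: he; rewrite mx_norm_ball /ball_ /=.
have -> : x - z = (x - y) + (y - z) by rewrite addrA subrK.
apply: le_lt_trans (ler_normD _ _) _; have := lt_le_trans yz h2; lra.
Unshelve. all: by end_near.
Qed.

Section limit.
Context {R : realType} {n : nat}.
Local Notation V := 'rV[R]_n.
Local Notation mu := (@lebesgue_rV R n).
Local Notation m2 := (@product_measure1 _ _ V V R mu mu).
Local Notation VF := (V -> R).
Local Notation GF := ('I_n -> V -> R).
Implicit Types (v d chi phi : VF) (h G : GF) (D w : set V).
Variables (s : R) (s_gt0 : 0 < s) (s_lt1 : s < 1).
Local Notation nl := (nl s).

(** The gradient of chi d when G is that of d. *)
Definition mulg chi d G : GF := fun i x => chi x * G i x + d x * partial i chi x.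

(* [chi^2 d] as test function: the mixed terms are exactly those on the right. *)
Lemma caccioppoli D d G chi : inH D d G -> Cc_smooth setT chi ->
  let P := (fun z : V * V => d z.1 * d z.2 * ndiff s chi z ^+ 2) in
  m2.-integrable setT (EFin \o P) /\
  dir (mulg chi d G) (mulg chi d G) + nl (fun x => chi x * d x) (fun x => chi x * d x) =
    dir G (mulg chi (fun x => chi x * d x) (mulg chi d G)) + nl d (fun x => chi x * (chi x * d x)) +
    \sum_i ip mu (fun x => d x * partial i chi x) (fun x => d x * partial i chi x) + \int[m2]_z P z.
Proof.
move=> hd hc P; have hcd := inH_mul hc hd; have hccd := inH_mul hc hcd.
have ln0 := inH_l2n s_gt0 s_lt1 hd; have ln1 := inH_l2n s_gt0 s_lt1 hcd; have ln2 := inH_l2n s_gt0 s_lt1 hccd.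
have I1 := l2M_integrable ln1 ln1; have I2 := l2M_integrable ln0 ln2.
have PE z : P z = ndiff s (fun x => chi x * d x) z * ndiff s (fun x => chi x * d x) z - ndiff s d z * ndiff s (fun x => chi x * (chi x * d x)) z.
  by rewrite /P /ndiff; lra.
have IP : m2.-integrable setT (EFin \o P).
  by apply: eq_integrable (integrableB measurableT I1 I2) => // z _ /=; rewrite PE EFinB.
split => //.
have EP : \int[m2]_z P z = nl (fun x => chi x * d x) (fun x => chi x * d x) - nl d (fun x => chi x * (chi x * d x)).
  rewrite /nl /ip -RintegralB //; by apply: eq_Rintegral => z _; exact: PE.
have Ed : dir (mulg chi d G) (mulg chi d G) = dir G (mulg chi (fun x => chi x * d x) (mulg chi d G)) +
    \sum_i ip mu (fun x => d x * partial i chi x) (fun x => d x * partial i chi x).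
  rewrite /dir -big_split /=; apply: eq_bigr => i _.
  have [C _ hC] := Cc_bounded hc; have [C' _ hC'] := Cc_bounded (Cc_partial i hc).
  have la : l2 mu (fun x => chi x * G i x) := l2_bdM (Cc_meas hc) hC (inH_l2g i hd).
  have lc : l2 mu (fun x => d x * partial i chi x).
    have -> : (fun x => d x * partial i chi x) = (fun x => partial i chi x * d x) by apply/funext => x; exact: mulrC.
    exact: l2_bdM (Cc_meas (Cc_partial i hc)) hC' (inH_l2 hd).
  have lac := l2D la lc; have l2c := l2Z 2 lc.
  have -> : ip mu (G i) (mulg chi (fun x => chi x * d x) (mulg chi d G) i) = ip mu (fun x => chi x * G i x) (fun x => chi x * G i x + 2 * (d x * partial i chi x)).
    by apply: eq_Rintegral => x _; rewrite /mulg; lra.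
  rewrite (ipDr la l2c la) (ipZr 2 lc la) /mulg (ipDl la lc lac) (ipDr la lc la) (ipDr la lc lc) (ipC mu (fun x => d x * _) (fun x => chi x * _)); lra.
rewrite EP Ed; lra.
Qed.

Variables (Omega : set V) (rho : R) (i0 : 'I_n).
Hypotheses (rho_gt0 : 0 < rho) (Omega_rho : forall x, Omega x -> `|x| <= rho) (mOmega : measurable Omega).
Variables (M : R) (u : nat -> VF) (g : nat -> GF) (F : nat -> VF) (ul Flim : VF).
Hypotheses (u_solves : forall k, solves s Omega (u k) (g k) (F k))
  (u_bd : forall k x, 0 <= u k x <= M) (u_out : forall k x, ~ Omega x -> u k x = 0)
  (u_mono : forall k x, u k x <= u k.+1 x) (u_cvg : forall x, (fun k => u k x) @ \oo --> ul x)
  (F_bd : forall chi, Cc_smooth Omega chi -> exists2 B : R, 0 <= B & forall k x, chi x != 0 -> `|F k x| <= B)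
  (F_cvg : forall x, Omega x -> (fun k => F k x) @ \oo --> Flim x).

Let u_inH k : inH Omega (u k) (g k). Proof. by case: (u_solves k). Qed.
Let u_meas k : measurable_fun setT (u k). Proof. exact: l2_meas (inH_l2 (u_inH k)). Qed.

Lemma limit_meas : measurable_fun setT ul.
Proof. by apply: (@measurable_fun_cvg _ _ _ _ u ul) => // x _; exact: (@u_cvg x). Qed.

Lemma u_nd j k x : (j <= k)%N -> u j x <= u k x.
Proof. by elim: k => [|k IH]; [rewrite leqn0 => /eqP ->|rewrite leq_eqVlt ltnS => /orP[/eqP -> //|/IH h]; exact: le_trans (u_mono k x)]. Qed.

Lemma u_le_limit k x : u k x <= ul x.
Proof.
apply: (ler_cvg_to (cvg_cst (u k x)) (@u_cvg x)); exists k => // j /= kj; exact: u_nd.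
Qed.

Lemma limit_bd x : 0 <= ul x <= M.
Proof.
apply/andP; split; first by apply: le_trans (u_le_limit 0 x); case/andP: (u_bd 0 x).
by apply: (ler_cvg_to (@u_cvg x) (cvg_cst M)); apply: nearW => k; case/andP: (u_bd k x).
Qed.

Lemma limit_out x : ~ Omega x -> ul x = 0.
Proof.
move=> nOx; have E : (fun k => u k x) = (fun=> 0) by apply/funext => k; exact: u_out.
have h : (fun k => u k x) @ \oo --> (0 : R) by rewrite E; exact: cvg_cst.
exact: cvg_unique (@u_cvg x) h.
Qed.

(** The tail of the monotone sequence, bounded and decreasing to 0, dominates |u_j - u_k| for all j,
    k >= N; Cauchy estimates thereby become limits in N. *)
Let e (N : nat) x := ul x - u N x.

Let e_bd N x : 0 <= e N x <= M.
Proof.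
have := u_le_limit N x; have := limit_bd x; have := u_bd N x; rewrite /e => /andP[? ?] /andP[? ?] ?.
by apply/andP; split; lra.
Qed.

Let e_cvg x : (fun N => e N x) @ \oo --> (0 : R).
Proof. by rewrite -(subrr (ul x)); exact: (cvgB (cvg_cst _) (@u_cvg x)). Qed.

Let e_meas N : measurable_fun setT (e N).
Proof. by apply: measurable_funB => //; exact: limit_meas. Qed.

Let d_le_e N j k x : (N <= j)%N -> (N <= k)%N -> `|u j x - u k x| <= e N x.
Proof.
move=> Nj Nk; have h1 := u_nd x Nj; have h2 := u_nd x Nk; have h3 := u_le_limit j x; have h4 := u_le_limit k x.
by rewrite ler_norml /e; apply/andP; split; lra.
Qed.

(** Majorants of the right-hand terms of [caccioppoli]: the source, the gradient of the cut-off and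
    the nonlocal difference of the cut-off. *)
Let R1 (B : R) chi N := \int[mu]_x (2 * B * chi x ^+ 2 * e N x).
Let R2 chi N i := \int[mu]_x ((e N x * partial i chi x) ^+ 2).
Let R3 chi N := \int[m2]_z (e N z.1 * e N z.2 * ndiff s chi z ^+ 2).

Let R1_cvg B chi : 0 <= B -> Cc_smooth setT chi -> (fun N => R1 B chi N) @ \oo --> (0 : R) /\
  forall N, mu.-integrable setT (EFin \o (fun x => 2 * B * chi x ^+ 2 * e N x)).
Proof.
move=> B0 hc; have [mc Ic] := Cc_l2 hc.
have ID : mu.-integrable setT (EFin \o (fun x => (2 * B * M) * chi x ^+ 2)) := integrableZl measurableT _ Ic.
have mk N : measurable_fun setT (fun x => 2 * B * chi x ^+ 2 * e N x).
  by apply: measurable_funM => //; apply: measurable_funM => //; exact: measurable_funX.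
have bd N x : `|2 * B * chi x ^+ 2 * e N x| <= (2 * B * M) * chi x ^+ 2.
  have /andP[e0 eM] := e_bd N x; have c0 := sqr_ge0 (chi x).
  rewrite ger0_norm; last by rewrite mulr_ge0 // mulr_ge0 // mulr_ge0.
  have -> : 2 * B * M * chi x ^+ 2 = 2 * B * chi x ^+ 2 * M by lra.
  by rewrite ler_wpM2l // mulr_ge0 // mulr_ge0.
split; last by move=> N; exact: integrable_le (mk N) (bd N) ID.
apply: (dominated_Rint0 mk _ ID bd) => x; exact: cvg0Z _ (@e_cvg x).
Qed.

Let R2_cvg chi i : Cc_smooth setT chi -> (fun N => R2 chi N i) @ \oo --> (0 : R) /\
  forall N, l2 mu (fun x => e N x * partial i chi x).
Proof.
move=> hc; have lp := Cc_partial_l2 i hc; have [mc Ic] := lp.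
have lN N : l2 mu (fun x => e N x * partial i chi x).
  by apply: (l2_bdM (e_meas N) _ lp (C := M)) => x; have /andP[e0 eM] := e_bd N x; rewrite ger0_norm.
split => //; have ID : mu.-integrable setT (EFin \o (fun x => M ^+ 2 * partial i chi x ^+ 2)) := integrableZl measurableT _ Ic.
apply: (dominated_Rint0 _ _ ID).
- by move=> N; apply: measurable_funX; exact: l2_meas (lN N).
- move=> x; have h : (fun N => partial i chi x ^+ 2 * e N x) @ \oo --> (0 : R) := cvg0Z _ (@e_cvg x).
  have h2 : (fun N => M * (partial i chi x ^+ 2 * e N x)) @ \oo --> (0 : R) := cvg0Z _ h.
  apply: squeeze0 h2 => N; rewrite sqr_ge0 /=; have /andP[e0 eM] := e_bd N x.
  have -> : (e N x * partial i chi x) ^+ 2 = (e N x * e N x) * partial i chi x ^+ 2 by rewrite exprMn expr2.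
  have -> : M * (partial i chi x ^+ 2 * e N x) = (M * e N x) * partial i chi x ^+ 2 by lra.
  by rewrite ler_wpM2r ?sqr_ge0 // ler_wpM2r.
move=> N x; have /andP[e0 eM] := e_bd N x.
rewrite ger0_norm ?sqr_ge0 // exprMn ler_wpM2r ?sqr_ge0 //.
by rewrite lerXn2r ?nnegrE //; exact: le_trans eM.
Qed.

Let R3_cvg chi : Cc_smooth setT chi -> (fun N => R3 chi N) @ \oo --> (0 : R) /\
  forall N, m2.-integrable setT (EFin \o (fun z => e N z.1 * e N z.2 * ndiff s chi z ^+ 2)).
Proof.
move=> hc; have [mc Ic] := inH_l2n s_gt0 s_lt1 (Cc_inH hc).
have ID : m2.-integrable setT (EFin \o (fun z => M ^+ 2 * ndiff s chi z ^+ 2)) := integrableZl measurableT _ Ic.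
have mk N : measurable_fun setT (fun z : V * V => e N z.1 * e N z.2 * ndiff s chi z ^+ 2).
  apply: measurable_funM; last exact: measurable_funX.
  by apply: measurable_funM; [exact: measurableT_comp (e_meas N) measurable_fst|exact: measurableT_comp (e_meas N) measurable_snd].
have bd N z : `|e N z.1 * e N z.2 * ndiff s chi z ^+ 2| <= M ^+ 2 * ndiff s chi z ^+ 2.
  have /andP[e0 eM] := e_bd N z.1; have /andP[e0' eM'] := e_bd N z.2; have c0 := sqr_ge0 (ndiff s chi z).
  rewrite ger0_norm; last by rewrite mulr_ge0 // mulr_ge0.
  by rewrite ler_wpM2r // expr2; exact: ler_pM.
split; last by move=> N; exact: integrable_le (mk N) (bd N) ID.
apply: (dominated_Rint0 mk _ ID bd) => z.
have h : (fun N => M * ndiff s chi z ^+ 2 * e N z.1) @ \oo --> (0 : R) := cvg0Z _ (@e_cvg z.1).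
apply: squeeze0 h => N; have /andP[e0 eM] := e_bd N z.1; have /andP[e0' eM'] := e_bd N z.2; have c0 := sqr_ge0 (ndiff s chi z).
rewrite (mulr_ge0 (mulr_ge0 e0 e0') c0) /=.
have -> : M * ndiff s chi z ^+ 2 * e N z.1 = e N z.1 * M * ndiff s chi z ^+ 2 by lra.
by rewrite ler_wpM2r // ler_wpM2l.
Qed.

(** In the Caccioppoli identity for u_j - u_k no gradient is left on the right once the equations
    are inserted, so every term is controlled by the tail [e]. The bound on F is needed only where
    chi differs from 0, since the test function carries chi^2; the Poincaré inequality recovers the
    full norm. *)
Lemma local_limit chi : Cc_smooth Omega chi -> exists G, inH Omega (fun x => chi x * ul x) G /\
  cvgH (fun k x => chi x * u k x) (fun k => mulg chi (u k) (g k)) (fun x => chi x * ul x) G.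
Proof.
move=> hcO; have hc := Cc_mono (@subsetT _ Omega) hcO; have [B B0 hB] := F_bd hcO.
have [c1 I1] := R1_cvg B0 hc; have [c3 I3] := R3_cvg hc.
have hk k : inH Omega (fun x => chi x * u k x) (mulg chi (u k) (g k)) := inH_mul hc (u_inH k).
have dir_small N j k : (N <= j)%N -> (N <= k)%N ->
    dir (fun i x => mulg chi (u j) (g j) i x - mulg chi (u k) (g k) i x) (fun i x => mulg chi (u j) (g j) i x - mulg chi (u k) (g k) i x) <=
    R1 B chi N + \sum_i R2 chi N i + R3 chi N.
  move=> Nj Nk; have hd := inH_B (u_inH j) (u_inH k); have [IP E] := caccioppoli hd hc.
  have hccd := inH_mul hc (inH_mul hc hd); have hcd := inH_mul hc hd.
  have -> : (fun i x => mulg chi (u j) (g j) i x - mulg chi (u k) (g k) i x) = mulg chi (fun x => u j x - u k x) (fun i x => g j i x - g k i x).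
    by apply/funext => i; apply/funext => x; rewrite /mulg; lra.
  have N0 : 0 <= nl (fun x => chi x * (u j x - u k x)) (fun x => chi x * (u j x - u k x)) by exact: ip_ge0.
  have [_ lFj sj] := u_solves j; have [_ lFk sk] := u_solves k; have lccd := inH_l2 hccd.
  have EF : dir (fun i x => g j i x - g k i x) (mulg chi (fun x => chi x * (u j x - u k x)) (mulg chi (fun x => u j x - u k x) (fun i x => g j i x - g k i x)))
      + nl (fun x => u j x - u k x) (fun x => chi x * (chi x * (u j x - u k x))) =
      ip mu (fun x => F j x - F k x) (fun x => chi x * (chi x * (u j x - u k x))).
    rewrite (ipBl lFj lFk lccd) -(sj _ _ hccd) -(sk _ _ hccd).
    rewrite dirB; [|by move=> i; exact: (inH_l2g i (u_inH j))|by move=> i; exact: (inH_l2g i (u_inH k))|by move=> i; exact: (inH_l2g i hccd)].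
    rewrite (nlB s_gt0 s_lt1 (u_inH j) (u_inH k) hccd); lra.
  have b1 : ip mu (fun x => F j x - F k x) (fun x => chi x * (chi x * (u j x - u k x))) <= R1 B chi N.
    apply: le_Rintegral => //; first exact: (l2M_integrable (l2B lFj lFk) lccd).
    move=> x _; have [->|cx] := eqVneq (chi x) 0; first by rewrite !mul0r !mulr0 expr0n /= mulr0 mul0r.
    have dx := d_le_e x Nj Nk; have /andP[e0 _] := e_bd N x.
    apply: le_trans (ler_norm _) _.
    have -> : (F j x - F k x) * (chi x * (chi x * (u j x - u k x))) = (F j x - F k x) * chi x ^+ 2 * (u j x - u k x) by lra.
    rewrite normrM; apply: ler_pM => //; rewrite normrM normrX real_normK ?num_real // ler_wpM2r ?sqr_ge0 //.
    have := ler_normB (F j x) (F k x); have := hB j x cx; have := hB k x cx; lra.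
  have b2 i : ip mu (fun x => (u j x - u k x) * partial i chi x) (fun x => (u j x - u k x) * partial i chi x) <= R2 chi N i.
    have [_ lN] := R2_cvg i hc; have -> : R2 chi N i = ip mu (fun x => e N x * partial i chi x) (fun x => e N x * partial i chi x).
      by apply: eq_Rintegral => x _; rewrite expr2.
    apply: ip_le => //.
      apply: measurable_funM; [exact: measurable_funB|exact: Cc_meas (Cc_partial i hc)].
    move=> x; rewrite !normrM ler_wpM2r //; have /andP[e0 _] := e_bd N x; by rewrite (ger0_norm e0) d_le_e.
  have b3 : \int[m2]_z ((u j z.1 - u k z.1) * (u j z.2 - u k z.2) * ndiff s chi z ^+ 2) <= R3 chi N.
    apply: le_Rintegral => // z _; rewrite ler_wpM2r ?sqr_ge0 //; apply: le_trans (ler_norm _) _.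
    by rewrite normrM; apply: ler_pM => //; exact: d_le_e.
  have b2' := ler_sum (index_enum 'I_n) (fun i (_ : xpredT i) => b2 i).
  move: E EF N0 b1 b2' b3; lra.
have cR : (fun N => R1 B chi N + \sum_i R2 chi N i + R3 chi N) @ \oo --> (0 : R).
  have c2 : (fun N => \sum_i R2 chi N i) @ \oo --> (0 : R) by have := @cvg_sum_seq R _ (index_enum 'I_n) (R2 chi) (fun=> 0) (fun i => proj1 (R2_cvg i hc)); rewrite big1.
  have c12 := cvg0_lin 1 1 c1 c2; have := cvg0_lin 1 1 c12 c3.
  by under eq_fun do rewrite !mul1r.
have [|u0 [G0 [h0 [c01 c02]]]] := inH_cauchy hk.
  move=> eps eps0; have P0 : 0 < (2 * rho + 1) ^+ 2 + 1 by rewrite ltr_wpDl ?sqr_ge0.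
  have /cvgrPdist_le/(_ _ (divr_gt0 eps0 P0))[N _ hN] := cR.
  exists N => j k Nj Nk; apply: le_trans (nrm_poincare i0 Omega_rho rho_gt0 (inH_B (hk j) (hk k))) _.
  have := hN N (leqnn N); rewrite sub0r normrN => /(le_trans (ler_norm _)).
  rewrite ler_pdivlMr // mulrC; apply: le_trans; rewrite ler_wpM2l ?(ltW P0) //; exact: dir_small.
have [C _ hC] := Cc_bounded hc; have mc := Cc_meas hc; have mul := limit_meas.
have mcu : measurable_fun setT (fun x => chi x * ul x) by exact: measurable_funM.
have lD : l2 mu (fun x => M * chi x) by apply: l2Z; exact: Cc_l2 hc.
have lDa : l2 mu (fun x => `|M * chi x|).
  by apply: l2_le lD; [apply: measurableT_comp => //; exact: measurable_funM|move=> x; rewrite normr_id].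
have M0 : 0 <= M by case/andP: (u_bd 0 0) => h1 h2; exact: le_trans h2.
have c2 : l2cvg mu (fun k x => chi x * u k x) (fun x => chi x * ul x).
  apply: (l2cvg_dominated lDa) => //.
  - by move=> k; exact: measurable_funM.
  - by apply: nearW => x; apply: cvgMr; exact: (@u_cvg x).
  - move=> k x; rewrite mulrC normrM [X in _ <= X]normrM (ger0_norm M0) ler_wpM2r //.
    by have /andP[a1 a2] := u_bd k x; rewrite ger0_norm.
  - move=> x; rewrite mulrC normrM [X in _ <= X]normrM (ger0_norm M0) ler_wpM2r //.
    by have /andP[a1 a2] := limit_bd x; rewrite ger0_norm.
have lcu : l2 mu (fun x => chi x * ul x).
  apply: l2_le lDa => // x; rewrite normr_id mulrC normrM [X in _ <= X]normrM (ger0_norm M0) ler_wpM2r //.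
  by have /andP[a1 a2] := limit_bd x; rewrite ger0_norm.
have E := l2cvg_unique (fun k => inH_l2 (hk k)) (inH_l2 h0) lcu c01 c2.
exists G0; split; last by split.
apply: (inH_ae h0 mcu (fun i => l2_meas (inH_l2g i h0)) E) => i; exact: (filterS (fun x _ => erefl) E).
Qed.

(** Away from the diagonal the kernel is traded for the integrable [kmin]. *)
Lemma kern_far (delta : R) (z : V) : 0 < delta -> delta <= `|z| -> kern s z <= (Num.min 1 (delta ^+ 2))^-1 * kmin s z.
Proof.
move=> d0 dz; have m0 : 0 < Num.min 1 (delta ^+ 2) by rewrite lt_min ltr01 exprn_gt0.
rewrite mulrC ler_pdivlMr // /kmin ler_wpM2l ?kern_ge0 //.
rewrite le_min !ge_min lexx /=; apply/orP; right.
by rewrite lerXn2r ?nnegrE // ltW.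
Qed.

Lemma integrable_sum_kmin (f : VF) : mu.-integrable setT (EFin \o f) -> (forall x, 0 <= f x) ->
  m2.-integrable setT (EFin \o (fun z : V * V => (f z.1 + f z.2) * kmin s (z.1 - z.2))).
Proof.
move=> If f0; have mf : measurable_fun setT f by apply/measurable_EFinP; case/integrableP: If.
have S0 z : 0 <= (f z.1 + f z.2) * kmin s (z.1 - z.2) by rewrite mulr_ge0 ?kmin_ge0 // addr_ge0.
have mG : measurable_fun setT (fun z : V * V => ((f z.1 + f z.2) * kmin s (z.1 - z.2))%:E).
  apply/measurable_EFinP; apply: measurable_funM.
    by apply: measurable_funD; [exact: measurableT_comp mf measurable_fst|exact: measurableT_comp mf measurable_snd].
  exact: measurableT_comp (measurable_kmin s) (@measurable_sub_rV R n).
apply/integrableP; split => //.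
have -> : (\int[m2]_z `|(EFin \o (fun z : V * V => ((f z.1 + f z.2) * kmin s (z.1 - z.2))%R)) z| = \int[m2]_z ((f z.1 + f z.2) * kmin s (z.1 - z.2))%:E)%E.
  by apply: eq_integral => z _; rewrite /= ger0_norm.
rewrite ge0_integral_shear //.
have Ef (z : V) : (\int[mu]_x (f x + f (x + z)%R)%:E = (2 * \int[mu]_x f x)%:E)%E.
  have Iz := integrable_shift z If.
  have -> : 2 * \int[mu]_x f x = \int[mu]_x (f x + f (x + z)).
    by rewrite RintegralD // Rintegral_shift //; lra.
  rewrite /Rintegral fineK //.
  by have := integrable_fin_num measurableT (integrableD measurableT If Iz).
have E (z : V) : (\int[mu]_x ((f x + f (x + z)%R) * kmin s (x - (x + z)))%:E = (kmin s z * (2 * \int[mu]_x f x))%:E)%E.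
  transitivity (\int[mu]_x ((kmin s z)%:E * (f x + f (x + z)%R)%:E))%E.
    by apply: eq_integral => x _; rewrite opprD addrA subrr sub0r /kmin kernN normrN -EFinM; congr EFin; lra.
  have -> : ((kmin s z * (2 * \int[mu]_x f x))%:E = (kmin s z)%:E * \int[mu]_x (f x + f (x + z)%R)%:E)%E by rewrite Ef.
  apply: ge0_integralZl => //.
  - by apply/measurable_EFinP; apply: measurable_funD => //; exact: measurable_shift.
  - by move=> x _; rewrite lee_fin addr_ge0.
  - by rewrite lee_fin kmin_ge0.
under eq_integral do rewrite E.
have := integrableZr measurableT (2 * \int[mu]_x f x) (integrable_kmin (n := n) s_gt0 s_lt1).
case/integrableP => _; apply: le_lt_trans.
rewrite le_eqVlt; apply/orP; left; apply/eqP; apply: eq_integral => z _ /=.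
by rewrite ger0_norm // mulr_ge0 ?kmin_ge0 // mulr_ge0 // Rintegral_ge0.
Qed.

(** The limit need not have finite energy, so its gradient is read off chi ul for a cut-off equal to
    1 on w, while the nonlocal term involves ul itself. *)
Lemma limit_equation w phi h : open w -> cpt_inside w Omega -> open Omega -> inH w phi h -> (forall x, ~ w x -> phi x = 0) ->
  exists chi G, [/\ Cc_smooth Omega chi, forall x, w x -> chi x = 1, inH Omega (fun x => chi x * ul x) G,
    m2.-integrable setT (EFin \o (fun z => ndiff s ul z * ndiff s phi z)) &
    mu.-integrable setT (EFin \o (fun x => Flim x * phi x)) /\
    dir G h + \int[m2]_z (ndiff s ul z * ndiff s phi z) = \int[mu]_x (Flim x * phi x)].
Proof.
move=> ow [cK KO] oO hphi phi0; have wO : w `<=` Omega by move=> x wx; apply: KO; exact: subset_closure.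
have hphiO := inH_mono wO hphi; have lphi := inH_l2 hphi; have mphi := l2_meas lphi.
have [chi [hcO c01 [W [oW KW cW]]]] := urysohn_Cc cK oO KO.
have hc := Cc_mono (@subsetT _ Omega) hcO; have wW x : w x -> W x by move=> wx; apply: KW; exact: subset_closure.
have [G [hG [cG1 cG2]]] := local_limit hcO.
have hk k : inH Omega (fun x => chi x * u k x) (mulg chi (u k) (g k)) := inH_mul hc (u_inH k).
have M0 : 0 <= M by case/andP: (u_bd 0 0) => h1 h2; exact: le_trans h2.
have [N0 _ hN0] := compact_sub_exhaust cK oW KW.
pose delta : R := N0.+1%:R^-1; have d0 : 0 < delta by rewrite invr_gt0.
(* The compact closure of w lies in one member of the exhaustion of W, which gives w a collar of
   uniform width delta inside W. *)
have far x y : w x -> `|x - y| < delta -> W y.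
  by move=> wx; have /hN0 : (N0 <= N0)%N by []; move=> H; have [_] := H x (subset_closure wx); apply.
pose Cd := (Num.min 1 (delta ^+ 2))^-1; have Cd0 : 0 <= Cd by rewrite invr_ge0 le_min ler01 sqr_ge0.
pose v (f : VF) : VF := fun x => (1 - chi x) * f x.
have vW f x : W x -> v f x = 0 by move=> /cW cx; rewrite /v cx subrr mul0r.
have vM f x : 0 <= f x <= M -> `|v f x| <= M.
  move=> /andP[f0 fM]; have /andP[c0 c1] := c01 x; rewrite /v ger0_norm; last by rewrite mulr_ge0 // subr_ge0.
  by rewrite -[M]mul1r; apply: ler_pM => //; lra.
pose T (f : VF) z := ndiff s (v f) z * ndiff s phi z.
pose Dz (z : V * V) := M * Cd * ((`|phi z.1| + `|phi z.2|) * kmin s (z.1 - z.2)).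
have Iphi := inH_integrable Omega_rho hphiO.
have ID : m2.-integrable setT (EFin \o Dz).
  have Ia : mu.-integrable setT (EFin \o (fun x => `|phi x|)) by exact: integrable_norm Iphi.
  have I0 := integrable_sum_kmin Ia (fun x => normr_ge0 (phi x)).
  have := integrableZl measurableT (M * Cd) I0; by apply: eq_integrable.
(* One majorant for all functions with values in [0, M], hence for every u_k and for the limit. [T]
   vanishes unless one point lies in w and the other outside W, at distance at least delta. *)
have TD f z : (forall x, 0 <= f x <= M) -> `|T f z| <= Dz z.
  move=> fM; have Dz0 : 0 <= Dz z by apply: mulr_ge0; apply: mulr_ge0; rewrite ?kmin_ge0 ?addr_ge0.
  have TE : T f z = (v f z.1 - v f z.2) * (phi z.1 - phi z.2) * kern s (z.1 - z.2) by rewrite /T -nonlocalE /nonlocal_integrand /kern.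
  have key : `|v f z.1 - v f z.2| <= M -> delta <= `|z.1 - z.2| -> `|T f z| <= Dz z.
    move=> h1 h2; have h3 := kern_far d0 h2; rewrite TE !normrM (ger0_norm (kern_ge0 _ _)).
    have -> : Dz z = M * (`|phi z.1| + `|phi z.2|) * (Cd * kmin s (z.1 - z.2)) by rewrite /Dz; lra.
    by apply: ler_pM; rewrite ?mulr_ge0 ?kern_ge0 //; apply: ler_pM => //; exact: ler_normB.
  have zero : T f z = 0 -> `|T f z| <= Dz z by move=> ->; rewrite normr0.
  have [w1|w1] := pselect (w z.1); have [w2|w2] := pselect (w z.2).
  - by apply: zero; rewrite TE (vW f _ (wW _ w1)) (vW f _ (wW _ w2)) subrr !mul0r.
  - have [W2|W2] := pselect (W z.2).
      by apply: zero; rewrite TE (vW f _ (wW _ w1)) (vW f _ W2) subrr !mul0r.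
    apply: key; first by rewrite (vW f _ (wW _ w1)) sub0r normrN; exact: vM.
    by rewrite leNgt; apply/negP => /(far _ _ w1).
  - have [W1|W1] := pselect (W z.1).
      by apply: zero; rewrite TE (vW f _ W1) (vW f _ (wW _ w2)) subrr !mul0r.
    apply: key; first by rewrite (vW f _ (wW _ w2)) subr0; exact: vM.
    by rewrite leNgt; apply/negP; rewrite distrC => /(far _ _ w2).
  - by apply: zero; rewrite TE (phi0 _ w1) (phi0 _ w2) subrr mulr0 mul0r.
have mT f : measurable_fun setT f -> measurable_fun setT (T f).
  move=> mf; apply: measurable_funM; apply: measurable_ndiff => //; apply: measurable_funM => //.
  by apply: measurable_funB => //; exact: Cc_meas hc.
have mul := limit_meas.
have cT z : (fun k => T (u k) z) @ \oo --> T ul z.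
  rewrite /T; apply: cvgMl; rewrite /ndiff; apply: cvgMl; apply: cvgB; rewrite /v; apply: cvgMr; [exact: (@u_cvg z.1)|exact: (@u_cvg z.2)].
have aeT : {ae m2, forall z, (fun k => T (u k) z) @ \oo --> T ul z} by apply: nearW => z; exact: (@cT z).
have [IT cIT] := dominated_Rint (fun k => mT _ (u_meas k)) (mT _ mul) aeT ID (fun k z => TD _ z (u_bd k)).
have lnphi := inH_l2n s_gt0 s_lt1 hphi; have lnG := inH_l2n s_gt0 s_lt1 hG.
(* The part (1 - chi) u of u vanishes near w, so it meets phi only away from the diagonal, where
   the kernel is integrable. *)
have split_nd (f : VF) z : ndiff s f z * ndiff s phi z = ndiff s (fun x => chi x * f x) z * ndiff s phi z + T f z.
  by rewrite /T /v /ndiff; lra.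
have I1 := l2M_integrable lnG lnphi.
have Iul : m2.-integrable setT (EFin \o (fun z => ndiff s ul z * ndiff s phi z)).
  have -> : (EFin \o (fun z => ndiff s ul z * ndiff s phi z)) = (fun z => (ndiff s (fun x => chi x * ul x) z * ndiff s phi z)%:E + (T ul z)%:E)%E.
    by apply/funext => z; rewrite -EFinD -split_nd.
  exact: (integrableD measurableT I1 IT).
have Eul : \int[m2]_z (ndiff s ul z * ndiff s phi z) = nl (fun x => chi x * ul x) phi + \int[m2]_z T ul z.
  by rewrite /nl /ip -RintegralD //; apply: eq_Rintegral => z _; exact: split_nd.
have ITk k : m2.-integrable setT (EFin \o T (u k)) := integrable_le (mT _ (u_meas k)) (fun z => TD _ z (u_bd k)) ID.
have Ek k : nl (u k) phi = nl (fun x => chi x * u k x) phi + \int[m2]_z T (u k) z.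
  rewrite /nl /ip -RintegralD //; first by apply: eq_Rintegral => z _; exact: split_nd.
  exact: l2M_integrable (inH_l2n s_gt0 s_lt1 (hk k)) lnphi.
(* On w, inside the open set W where chi = 1, the gradient of chi vanishes; off w the gradient of
   phi does, almost everywhere. *)
have Dk k : dir (g k) h = dir (mulg chi (u k) (g k)) h.
  apply: eq_bigr => i _; have lh := inH_l2g i hphi.
  apply: ae_eq_Rint; try by apply: measurable_funM; [exact: l2_meas (inH_l2g i (u_inH k))|exact: l2_meas lh].
    by apply: measurable_funM; [exact: l2_meas (inH_l2g i (hk k))|exact: l2_meas lh].
  apply: filterS (inH_out hphi) => x hx; have [wx|nwx] := pselect (w x); last first.
    by have [_ h0] := hx nwx; rewrite h0 !mulr0.
  rewrite /mulg cW ?mul1r; last exact: wW.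
  rewrite (_ : partial i chi x = 0) ?mulr0 ?addr0 //.
  by rewrite -(partial_cst (n := n) 1 i x); apply: (partial_near (W := W)) => //; exact: wW.
have lh i := inH_l2g i hphi.
have cD : (fun k => dir (mulg chi (u k) (g k)) h) @ \oo --> dir G h.
  apply: cvg_sum_seq => i.
  exact: l2cvg_ip (fun k => inH_l2g i (hk k)) (fun=> lh i) (inH_l2g i hG) (lh i) (cG2 i) (@l2cvg_cst _ _ _ mu _).
have cN : (fun k => nl (fun x => chi x * u k x) phi) @ \oo --> nl (fun x => chi x * ul x) phi.
  have lk k := inH_l2n s_gt0 s_lt1 (hk k).
  exact: l2cvg_ip lk (fun=> lnphi) lnG lnphi (cvgH_ndiff s_gt0 s_lt1 hk hG (conj cG1 cG2)) (@l2cvg_cst _ _ _ m2 _).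
have [B B0 hB] := F_bd hcO.
have lF k : l2 mu (F k) by case: (u_solves k).
have wchi x : w x -> chi x = 1 by move=> wx; apply: cW; exact: wW.
have bF k x : `|F k x * phi x| <= B * `|phi x|.
  have [wx|nwx] := pselect (w x); last by rewrite phi0 // mulr0 !normr0 mulr0.
  by rewrite normrM ler_wpM2r // hB // wchi // oner_eq0.
have cF x : (fun k => F k x * phi x) @ \oo --> Flim x * phi x.
  have [wx|nwx] := pselect (w x); first by apply: cvgMl; exact: (F_cvg (wO _ wx)).
  by rewrite phi0 // mulr0; under eq_fun do rewrite mulr0; exact: cvg_cst.
have mFk k : measurable_fun setT (fun x => F k x * phi x) by apply: measurable_funM => //; exact: l2_meas (lF k).
have mFl : measurable_fun setT (fun x => Flim x * phi x).
  by apply: (@measurable_fun_cvg _ _ _ _ (fun k x => F k x * phi x)) => // x _; exact: (@cF x).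
have aeF : {ae mu, forall x, (fun k => F k x * phi x) @ \oo --> (fun x => Flim x * phi x) x} by apply: nearW => x; exact: (@cF x).
have IB : mu.-integrable setT (EFin \o (fun x => B * `|phi x|)) := integrableZl measurableT B (integrable_norm Iphi).
have [IF cIF] := dominated_Rint mFk mFl aeF IB bF.
exists chi, G; split => //; split => //; rewrite Eul.
have eqk : (fun k => dir (mulg chi (u k) (g k)) h + (nl (fun x => chi x * u k x) phi + \int[m2]_z T (u k) z)) = (fun k => \int[mu]_x (F k x * phi x)).
  by apply/funext => k; rewrite -Dk -Ek; case: (u_solves k) => _ _; apply.
have cL : (fun k => dir (mulg chi (u k) (g k)) h + (nl (fun x => chi x * u k x) phi + \int[m2]_z T (u k) z)) @ \oo -->
    dir G h + (nl (fun x => chi x * ul x) phi + \int[m2]_z T ul z).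
  by apply: cvgD cD _; exact: cvgD cN cIT.
rewrite eqk in cL; exact: cvg_unique cL cIF.
Qed.

End limit.

(** * Gluing local gradients *)

Section glue.
Context {R : realType} {n : nat}.
Local Notation V := 'rV[R]_n.
Local Notation mu := (@lebesgue_rV R n).
Local Notation VF := (V -> R).
Local Notation GF := ('I_n -> V -> R).
Implicit Types (u v chi psi : VF) (g h G : GF) (D w : set V).

Lemma exhaust_mono (U : set V) j k : (j <= k)%N -> exhaust U j `<=` exhaust U k.
Proof.
move=> jk x [h1 h2]; split; first by apply: le_trans h1 _; rewrite ler_nat.
by move=> y hy; apply: h2; apply: lt_le_trans hy _; rewrite lef_pV2 ?posrE // ler_nat.
Qed.

Lemma is_wgrad_congr D u v (g : V -> V) : (forall x, D x -> u x = v x) -> is_wgrad D u g -> is_wgrad D v g.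
Proof.
move=> uv [[mu_ Iu] hg]; split.
  split; first by apply: eq_measurable_fun mu_ => x; rewrite inE => /uv.
  move=> K cK KD; have := Iu K cK KD; apply: eq_integrable.
    by apply: closed_measurable_rV; apply: compact_closed => //; exact: norm_hausdorff.
  by move=> x; rewrite inE => /KD /uv /= ->.
move=> i; have [h1 h2] := hg i; split => // psi hpsi; rewrite -h2 //.
by apply: eq_Rintegral => x; rewrite inE => /uv ->.
Qed.

Lemma local_wgrad_unique D u w chi1 G1 chi2 G2 : open w ->
  inH D (fun x => chi1 x * u x) G1 -> inH D (fun x => chi2 x * u x) G2 ->
  (forall x, w x -> chi1 x = 1) -> (forall x, w x -> chi2 x = 1) ->
  forall i, {ae mu, forall x, w x -> G1 i x = G2 i x}.
Proof.
move=> ow h1 h2 c1 c2 i.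
have W1 : is_wgrad w u (rowg G1).
  by apply: is_wgrad_congr (inH_is_wgrad ow h1) => x /c1 ->; rewrite mul1r.
have W2 : is_wgrad w u (rowg G2).
  by apply: is_wgrad_congr (inH_is_wgrad ow h2) => x /c2 ->; rewrite mul1r.
by apply: filterS (wgrad_unique ow W1 W2 i) => x hx wx; have := hx wx; rewrite !mxE.
Qed.

(** Gradients of chi u for different cut-offs agree almost everywhere where both cut-offs equal 1.
    Pasted along the exhaustion they form one measurable weak gradient, to which uniqueness ties
    [wgrad]. *)
Lemma glue_wgrad D u : open D -> measurable_fun setT u ->
  (forall chi, Cc_smooth D chi -> exists G, inH D (fun x => chi x * u x) G) ->
  W12loc D u /\ forall w chi G i, open w -> cpt_inside w D -> inH D (fun x => chi x * u x) G ->
    (forall x, w x -> chi x = 1) -> {ae mu, forall x, w x -> wgrad D u x ord0 i = G i x}.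
Proof.
move=> oD mu_ hloc; have mD := open_measurable_rV oD.
have mE k : measurable (exhaust D k).
  by apply: closed_measurable_rV; apply: compact_closed; [exact: norm_hausdorff|exact: compact_exhaust].
have exk k : exists p : VF * GF * set V, [/\ Cc_smooth D p.1.1, inH D (fun x => p.1.1 x * u x) p.1.2, open p.2, exhaust D k `<=` p.2 &
    forall x, p.2 x -> p.1.1 x = 1].
  have [eta [he _ [W [oW KW eW]]]] := urysohn_Cc (compact_exhaust (U := D) (k := k)) oD (@exhaust_sub _ _ D k).
  by have [G hG] := hloc _ he; exists (eta, G, W).
have [p hp] := choice exk; pose eta k := (p k).1.1; pose G k := (p k).1.2; pose W k := (p k).2.
have eta_Cc k : Cc_smooth D (eta k) by case: (hp k).
have hG k : inH D (fun x => eta k x * u x) (G k) by case: (hp k).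
have oW k : open (W k) by case: (hp k).
have EW k : exhaust D k `<=` W k by case: (hp k).
have eta1 k x : W k x -> eta k x = 1 by case: (hp k) => _ _ _ _; apply.
have good i : {ae mu, forall x, forall j k, exhaust D j x -> exhaust D k x -> G j i x = G k i x}.
  apply: ae_foralln => j; apply: ae_foralln => k.
  have := local_wgrad_unique (openI (oW j) (oW k)) (hG j) (hG k) (fun x wx => eta1 _ _ wx.1) (fun x wx => eta1 _ _ wx.2) i.
  by apply: filterS => x hx hj hk; apply: hx; split; exact: EW.
pose I k x : R := \1_(exhaust D k) x.
(* On exhaust D k the partial sums h N, N >= k, all equal h k; hence they converge everywhere
   and the limit is measurable. *)
pose J (k : nat) x : R := if k is k'.+1 then I k' x else 0.
(* [I k - J k] is the indicator of the k-th shell, so each point takes its value from a single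
   [G k]. *)
pose h N : GF := fun i x => \sum_(k < N.+1) (I k x - J k x) * G k i x.
have hS N i x : h N.+1 i x = h N i x + (I N.+1 x - I N x) * G N.+1 i x by rewrite /h big_ord_recr.
have I1 k x : exhaust D k x -> I k x = 1 by move=> hx; rewrite /I indicE mem_set.
have I0 k x : ~ exhaust D k x -> I k x = 0 by move=> hx; rewrite /I indicE memNset.
have h_const k N i x : exhaust D k x -> (k <= N)%N -> h N i x = h k i x.
  move=> hx; elim: N => [|N IH]; first by rewrite leqn0 => /eqP ->.
  rewrite leq_eqVlt => /orP[/eqP -> //|]; rewrite ltnS => kN; rewrite hS IH //.
  rewrite (I1 _ _ (exhaust_mono kN hx)) (I1 _ _ (exhaust_mono (leqW kN) hx)) subrr mul0r addr0 //.
have h_out i x N : ~ D x -> h N i x = 0.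
  move=> nDx; apply: big1 => -[[|k] kN] _ /=.
    by rewrite I0 ?subrr ?mul0r ?subr0 // => /exhaust_sub.
  by rewrite !I0 ?subrr ?mul0r // => /exhaust_sub.
have h_lim i x : exists l : R, (fun N => h N i x) @ \oo --> l.
  have [Dx|nDx] := pselect (D x); last by exists 0; under eq_fun do rewrite h_out //; exact: cvg_cst.
  have [k _ hk] := exhaust_near oD Dx; exists (h k i x); apply: cvg_near_cst.
  exists k => // N /= kN; exact: h_const (hk k (leqnn k)) kN.
have [gl hgl] : exists gl : GF, forall i x, (fun N => h N i x) @ \oo --> gl i x.
  have := choice (fun q : 'I_n * V => h_lim q.1 q.2) => -[f hf].
  by exists (fun i x => f (i, x)) => i x; exact: (hf (i, x)).
have mG k i : measurable_fun setT (G k i) := l2_meas (inH_l2g i (hG k)).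
have mI k : measurable_fun setT (I k) by exact: measurable_indic.
have mh N i : measurable_fun setT (h N i).
  apply: measurable_sum => k; apply: measurable_funM => //; apply: measurable_funB => //.
  by case: (nat_of_ord k) => [|k'] /=; [exact: measurable_cst|exact: mI].
have mgl i : measurable_fun setT (gl i).
  by apply: (@measurable_fun_cvg _ _ _ _ (fun N => h N i)) => // x _; exact: hgl.
have gl_good k i : {ae mu, forall x, exhaust D k x -> gl i x = G k i x}.
  apply: filterS (good i) => x hx hk.
  (* At a point where all local gradients agree the sum over shells telescopes. *)
  have hN N : h N i x = I N x * G N i x.
    elim: N => [|N IH]; first by rewrite /h big_ord1 /= subr0.
    rewrite hS IH; have [hN|hN] := pselect (exhaust D N x); last by rewrite (I0 _ _ hN); lra.
    by rewrite (hx N.+1 N) //; [lra|exact: exhaust_mono hN].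
  have E : h k i x = G k i x by rewrite hN I1 // mul1r.
  have c : (fun N => h N i x) @ \oo --> h k i x.
    by apply: cvg_near_cst; exists k => // N /= kN; exact: h_const.
  by rewrite -E; exact: cvg_unique (hgl i x) c.
have Kex K : compact K -> K `<=` D -> exists k, K `<=` exhaust D k.
  by move=> cK KD; have [k _ hk] := compact_sub_exhaust cK oD KD; exists k; exact: (hk k (leqnn k)).
have uE k x : exhaust D k x -> eta k x * u x = u x by move=> /EW /eta1 ->; rewrite mul1r.
have mK (K : set V) : compact K -> measurable K.
  by move=> cK; apply: closed_measurable_rV; apply: compact_closed => //; exact: norm_hausdorff.
have hgrad : is_wgrad D u (rowg gl).
  split.
    split; first exact: measurable_funTS.
    move=> K cK KD; have [k Kk] := Kex K cK KD.
    have := l2_L1_compact (inH_l2 (hG k)) cK; apply: eq_integrable; first exact: mK.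
    by move=> x; rewrite inE => /Kk /uE /= ->.
  move=> i; have -> : (fun x => rowg gl x ord0 i) = gl i by apply/funext => x; rewrite mxE.
  split.
    split; first exact: measurable_funTS.
    move=> K cK KD; have [k Kk] := Kex K cK KD.
    have lK := l2_L1_compact (inH_l2g i (hG k)) cK.
    apply: (integrable_mkcond _ (mK _ cK)).2.
    have -> : (EFin \o gl i) \_ K = EFin \o (gl i \_ K).
      by apply/funext => x; rewrite /= !patchE; case: ifP.
    have := (integrable_mkcond _ (mK _ cK)).1 lK.
    have -> : (EFin \o G k i) \_ K = EFin \o (G k i \_ K).
      by apply/funext => x; rewrite /= !patchE; case: ifP.
    apply: ae_eq_integrable.
      by apply: (measurable_restrictT _ (mK _ cK)).1; exact: measurable_funTS.
    apply: filterS (gl_good k i) => x hx; rewrite !patchE; case: ifPn => //; rewrite inE => /Kk /hx //.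
  move=> psi hpsi; have [_ [cS SD]] := hpsi; have [k Sk] := Kex _ cS SD.
  have hpT := Cc_mono (@subsetT _ D) hpsi.
  have psi0 x : ~ exhaust D k x -> psi x = 0.
    move=> nx; apply/eqP; apply: contrapT => /negP hx; apply: nx; apply: Sk; exact: subset_closure.
  have dpsi0 x : ~ exhaust D k x -> partial i psi x = 0 by move=> nx; apply: partial_out => /Sk.
  have -> : \int[mu]_(x in D) (u x * partial i psi x) = \int[mu]_x (eta k x * u x * partial i psi x).
    rewrite Rintegral_outside; last by move=> x nDx; rewrite dpsi0 ?mulr0 // => /exhaust_sub.
    apply: eq_Rintegral => x _; have [hx|hx] := pselect (exhaust D k x); first by rewrite uE.
    by rewrite dpsi0 // !mulr0.
  rewrite (inH_ibp i (hG k) hpT) (@Rintegral_outside _ _ D); last first.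
    by move=> x nDx; rewrite psi0 ?mulr0 // => /exhaust_sub.
  have -> : (fun x => rowg gl x ord0 i * psi x) = (fun x => gl i x * psi x) by apply/funext => x; rewrite mxE.
  congr (- _); have mpsi := Cc_meas hpsi; apply: ae_eq_Rint; try exact: measurable_funM.
  apply: filterS (gl_good k i) => x hx; have [Ex|Ex] := pselect (exhaust D k x); first by rewrite hx.
  by rewrite psi0 // !mulr0.
have wae i := wgrad_ae i oD hgrad.
have [_ hW] := wgradP (ex_intro _ _ hgrad).
have wG w chi G0 i : open w -> cpt_inside w D -> inH D (fun x => chi x * u x) G0 ->
    (forall x, w x -> chi x = 1) -> {ae mu, forall x, w x -> wgrad D u x ord0 i = G0 i x}.
  move=> ow [cw wD] h0 c1; have [k wk] := Kex _ cw wD.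
  have w_k x : w x -> exhaust D k x by move=> wx; apply: wk; exact: subset_closure.
  have := local_wgrad_unique ow h0 (hG k) c1 (fun x wx => eta1 _ _ (EW _ _ (w_k _ wx))) i.
  apply: filterS3 (gl_good k i) (wae i) => x h1 h2 h3 wx; rewrite h2; last exact: exhaust_sub (w_k _ wx).
  by rewrite mxE h1 ?h3 //; exact: w_k.
split; last exact: wG.
split; first by exists (rowg gl).
move=> w ow [cw wD]; have [k wk] := Kex _ cw wD; have mw := open_measurable_rV ow.
have w_k x : w x -> exhaust D k x by move=> wx; apply: wk; exact: subset_closure.
split.
  apply/Lfun2_l2; apply: l2_le (inH_l2 (hG k)).
    by apply: (measurable_restrictT _ mw).1; exact: measurable_funTS.
  move=> x; rewrite patchE; case: ifPn => [|_]; last by rewrite normr0.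
  by rewrite inE => /w_k /uE ->.
move=> i; apply/Lfun2_l2.
have lG : l2 mu (G k i \_ w).
  apply: l2_le (inH_l2g i (hG k)); first by apply: (measurable_restrictT _ mw).1; exact: measurable_funTS.
  by move=> x; rewrite patchE; case: ifP; rewrite ?normr0.
have [[mW _] _] := hW i; have wsubD : w `<=` D by move=> x /w_k /exhaust_sub.
apply: ae_eq_l2 lG; first by apply: (measurable_restrictT _ mw).1; apply: measurable_funS mW.
apply: filterS (wG w (eta k) (G k) i ow (conj cw wD) (hG k) (fun x wx => eta1 _ _ (EW _ _ (w_k _ wx)))) => x hx.
by rewrite !patchE; case: ifPn => //; rewrite inE => /hx ->.
Qed.

End glue.

(** * Powers of the limit *)

Section powers.
Context {R : realType}.
Implicit Types a d t M : R.

(* With d = eps^2 > 0, smooth substitutes for t^p and, since (regV')^2 <= p^2 regT', for the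
   test function t^(2p-1) that controls its gradient. *)
Definition regV p d t : R := (t ^+ 2 + d) `^ (p / 2) - d `^ (p / 2).

Definition regT p d t : R := t * (t ^+ 2 + d) `^ (p - 1).

Lemma smooth_regV p d : 0 < d -> smooth1 (regV p d).
Proof. by move=> d0 k; apply: Ck1D; [exact: Ck1_powR|exact: Ck1_cst]. Qed.

Lemma smooth_regT p d : 0 < d -> smooth1 (regT p d).
Proof. by move=> d0 k; apply: Ck1M; [exact: Ck1_id|exact: Ck1_powR]. Qed.

Lemma regV_derive p d t : 0 < d -> derive1 (regV p d) t = p * t * (t ^+ 2 + d) `^ (p / 2 - 1).
Proof.
move=> d0; have := @is_deriveB _ _ _ _ _ t (1:R) _ _ (is_derive_sqpowR (p / 2) t d0) (is_derive_cst (d `^ (p / 2)) t 1).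
by move=> h; rewrite derive1E (derive_val (is_derive := h)) subr0; lra.
Qed.

Lemma regT_derive p d t : 0 < d ->
  derive1 (regT p d) t = (t ^+ 2 + d) `^ (p - 1) + 2 * (p - 1) * t ^+ 2 * (t ^+ 2 + d) `^ (p - 2).
Proof.
move=> d0; have := @is_deriveM _ _ _ _ t (1:R) _ _ (is_derive_id t 1) (is_derive_sqpowR (p - 1) t d0).
move=> h; rewrite derive1E (derive_val (is_derive := h)) /GRing.scale /=.
have -> : p - 1 - 1 = p - 2 by lra.
lra.
Qed.

(** With w = t^2 + d, the term w^(p-1) of the right-hand derivative already exceeds t^2 w^(p-2), and
    its other term is nonnegative for p >= 1. *)
Lemma regV_regT p d t : 0 < d -> 1 <= p -> derive1 (regV p d) t ^+ 2 <= p ^+ 2 * derive1 (regT p d) t.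
Proof.
move=> d0 p1; rewrite regV_derive // regT_derive //; set w := t ^+ 2 + d.
have w0 : 0 < w by rewrite ltr_wpDl ?sqr_ge0.
have E1 : (w `^ (p / 2 - 1)) ^+ 2 = w `^ (p - 2).
  by rewrite -powR_mulrn ?powR_ge0 // -powRrM; congr powR; lra.
have E2 : w `^ (p - 1) = w * w `^ (p - 2).
  rewrite -{2}(powRr1 (ltW w0)) -powRD; first by congr powR; lra.
  by apply/implyP => _; rewrite gt_eqF.
rewrite !exprMn E1 -mulrA ler_wpM2l ?sqr_ge0 //.
have P0 : 0 <= w `^ (p - 2) by exact: powR_ge0.
have T0 : 0 <= t ^+ 2 * w `^ (p - 2) by rewrite mulr_ge0 ?sqr_ge0.
have D0 : 0 <= d * w `^ (p - 2) by rewrite mulr_ge0 // ltW.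
rewrite E2 {2}/w mulrDl.
have := mulr_ge0 T0 (_ : 0 <= p - 1); rewrite subr_ge0 => /(_ p1); lra.
Qed.

Lemma regT_mono p d a b : 1 <= p -> 0 < d -> 0 <= a -> a <= b -> regT p d a <= regT p d b.
Proof.
move=> p1 d0 a0 ab; have b0 := le_trans a0 ab; apply: ler_pM => //; first exact: powR_ge0.
by apply: ge0_ler_powR; rewrite ?subr_ge0 ?nnegrE ?addr_ge0 ?sqr_ge0 ?(ltW d0) // lerD2r lerXn2r.
Qed.

(** For 2 p - 1 = gamma the right-hand side is exactly the factor that cancels the regularized
    singularity (t + e)^(-gamma); this is why d is taken as e^2. *)
Lemma regT_le p e t : 1 <= p -> 0 < e -> 0 <= t -> regT p (e ^+ 2) t <= (t + e) `^ (2 * p - 1).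
Proof.
move=> p1 e0 t0; have te : 0 < t + e by rewrite ltr_wpDl.
have -> : (t + e) `^ (2 * p - 1) = (t + e) * ((t + e) ^+ 2) `^ (p - 1).
  rewrite -powR_mulrn ?(ltW te) // -powRrM -{2}(powRr1 (ltW te)) -powRD; first by congr powR; lra.
  by apply/implyP => _; rewrite gt_eqF.
apply: ler_pM => //; [exact: powR_ge0|by rewrite lerDl ltW|].
apply: ge0_ler_powR; rewrite ?subr_ge0 ?nnegrE ?addr_ge0 ?sqr_ge0 //.
have := mulr_ge0 t0 (ltW e0); lra.
Qed.

Lemma regV_ge0 p d t : 0 <= p -> 0 < d -> 0 <= regV p d t.
Proof.
move=> p0 d0; rewrite subr_ge0; apply: ge0_ler_powR; rewrite ?divr_ge0 ?nnegrE ?addr_ge0 ?sqr_ge0 ?(ltW d0) //.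
by rewrite lerDr sqr_ge0.
Qed.

Lemma regV_le p d t M : 0 <= p -> 0 < d -> d <= 1 -> 0 <= t -> t <= M -> regV p d t <= (M ^+ 2 + 1) `^ (p / 2).
Proof.
move=> p0 d0 d1 t0 tM; have M0 := le_trans t0 tM; apply: le_trans (_ : (t ^+ 2 + d) `^ (p / 2) <= _).
  by rewrite gerBl powR_ge0.
apply: ge0_ler_powR; rewrite ?divr_ge0 ?nnegrE ?addr_ge0 ?sqr_ge0 ?(ltW d0) //.
by apply: lerD => //; rewrite lerXn2r.
Qed.

Lemma powR_cvg (f : nat -> R) (l p : R) : 0 < l -> f @ \oo --> l -> (fun k => f k `^ p) @ \oo --> l `^ p.
Proof.
move=> l0 fl; have c : {for l, continuous (fun x => x `^ p)}.
  by apply: differentiable_continuous; apply/derivable1_diffP; apply: derivable_powR; rewrite in_itv /= l0.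
exact: cvg_comp fl c.
Qed.

(** Restricted to l > 0, where the power is differentiable; off the domain the sequence is
    constantly 0 and needs no limit theorem. *)
Lemma regV_cvg p (e f : nat -> R) (l : R) : 1 <= p -> 0 < l -> (forall k, 0 < e k <= 1) -> e @ \oo --> (0 : R) -> f @ \oo --> l ->
  (fun k => regV p (e k ^+ 2) (f k)) @ \oo --> l `^ p.
Proof.
move=> p1 l0 e01 ce cf.
have c1 : (fun k => (f k ^+ 2 + e k ^+ 2) `^ (p / 2)) @ \oo --> (l ^+ 2) `^ (p / 2).
  apply: powR_cvg; first by rewrite exprn_gt0.
  under eq_fun do rewrite !expr2; rewrite expr2 -[l * l]addr0 -[X in _ + X](mulr0 0).
  exact: cvgD (cvgM cf cf) (cvgM ce ce).
have c2 : (fun k => (e k ^+ 2) `^ (p / 2)) @ \oo --> (0 : R).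
  apply: (squeeze_cvgr _ (cvg_cst 0) ce); apply: nearW => k; have /andP[h0 h1] := e01 k.
  rewrite powR_ge0 /= -powR_mulrn ?(ltW h0) // -powRrM.
  have -> : 2%:R * (p / 2) = p by lra.
  by apply: ge1r_powR => //; rewrite h0.
have <- : (l ^+ 2) `^ (p / 2) = l `^ p.
  rewrite -powR_mulrn ?(ltW l0) // -powRrM; congr powR; lra.
rewrite -[X in _ --> X]subr0; exact: cvgB c1 c2.
Qed.

(** Bounded u sees F on [0, M] only, so F may be altered beyond to have the bounded derivative
    required by [inH_comp]. Clamping at M + 1 leaves F unchanged near the end points, so the
    derivatives agree there too. *)
Lemma smooth1_trunc (F : R -> R) M : smooth1 F -> F 0 = 0 -> 0 <= M -> exists (H : R -> R) (C : R),
  [/\ smooth1 H, forall t, `|derive1 H t| <= C, H 0 = 0 &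
    forall t, 0 <= t <= M -> H t = F t /\ derive1 H t = derive1 F t].
Proof.
move=> sF F0 M0; pose H t := F (sclamp (M + 1) t).
have sH : smooth1 H by move=> k; apply: Ck1_comp => //; exact: smooth_sclamp.
have [C _ hC] : exists2 C, 0 <= C & forall t, `|derive1 H t| <= C.
  by apply: (smooth_derive_bounded (a := M + 1 + 1)) => // t ht; rewrite /H sclamp_out.
exists H, C; split => //; first by rewrite /H sclamp_id //; lra.
move=> t /andP[t0 tM]; split; first by rewrite /H sclamp_id //; lra.
rewrite !derive1E; apply: near_eq_derive.
near=> y; rewrite /H sclamp_id //; have : `|t - y| < 1 by near: y; exact: (nbhsx_ballx t (1 : R) ltr01).
by rewrite ltr_norml; lra.
Unshelve. all: by end_near.
Qed.

End powers.

(** * Global energy bounds and the boundary condition *)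

Section power_bounds.
Context {R : realType} {n : nat}.
Local Notation V := 'rV[R]_n.
Local Notation mu := (@lebesgue_rV R n).
Local Notation m2 := (@product_measure1 _ _ V V R mu mu).
Local Notation VF := (V -> R).
Local Notation GF := ('I_n -> V -> R).
Implicit Types (u v F : VF) (g h : GF) (D : set V).
Variables (s : R) (s_gt0 : 0 < s) (s_lt1 : s < 1).
Local Notation nl := (nl s).

Lemma inH_comp_bounded D u g (F : R -> R) (M : R) : inH D u g -> smooth1 F -> F 0 = 0 -> (forall x, 0 <= u x <= M) ->
  inH D (fun x => F (u x)) (fun i x => derive1 F (u x) * g i x).
Proof.
move=> hu sF F0 u_bd; have M0 : 0 <= M by case/andP: (u_bd 0) => h1 h2; exact: le_trans h2.
have [H [C [sH hC H0 HF]]] := smooth1_trunc sF F0 M0.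
have q0 (x : V) : H (- (fun=> 0 : R) x) = 0 by rewrite oppr0.
have := inH_comp hu (Cc0 setT) sH hC q0.
have -> : (fun x => H (u x - (fun=> 0 : R) x)) = (fun x => F (u x)).
  by apply/funext => x; rewrite subr0; case: (HF _ (u_bd x)).
suff -> : (fun i x => derive1 H (u x - (fun=> 0 : R) x) * (g i x - partial i (fun=> 0 : R) x)) = (fun i x => derive1 F (u x) * g i x) by [].
by apply/funext => i; apply/funext => x; rewrite partial_cst !subr0; case: (HF _ (u_bd x)) => _ ->.
Qed.

Lemma Rintegral_box_le (f : VF) (rho C : R) : mu.-integrable setT (EFin \o f) ->
  (forall x, f x <= C * \1_[set x : V | `|x| <= rho] x) ->
  \int[mu]_x f x <= C * \int[mu]_x \1_[set x : V | `|x| <= rho] x.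
Proof.
move=> If h; have mI : measurable_fun setT (\1_[set x : V | `|x| <= rho] : V -> R).
  by apply: measurable_indic; exact: measurable_norm_le.
have II : mu.-integrable setT (EFin \o (\1_[set x : V | `|x| <= rho] : V -> R)).
  apply: (bounded_box_integrable (rho := rho) (C := 1)) => //.
  - by move=> x; rewrite indicE; case: (_ \in _); rewrite ?normr1 ?normr0.
  - by move=> x hx; rewrite indicE memNset //= => h'; move: hx; rewrite ltNge h'.
rewrite -RintegralZl //; apply: le_Rintegral => //.
by have := integrableZl measurableT C II; apply: eq_integrable.
Qed.

Variables (Omega : set V) (rho : R) (rho_gt0 : 0 < rho) (Omega_rho : forall x, Omega x -> `|x| <= rho).
Variables (i0 : 'I_n) (gamma r lambda M : R).
Variables (e : nat -> R) (u : nat -> VF) (g : nat -> GF) (F : nat -> VF) (ul : VF).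
Hypothesis gamma_gt0 : 0 < gamma.
Hypothesis r_gt1 : 1 < r.
Hypothesis lambda_gt0 : 0 < lambda.
Hypothesis e_01 : forall k, 0 < e k <= 1.
Hypothesis u_solves : forall k, solves s Omega (u k) (g k) (F k).
Hypothesis u_bd : forall k x, 0 <= u k x <= M.
Hypothesis u_out : forall k x, ~ Omega x -> u k x = 0.
Hypothesis F_le : forall k x, Omega x -> F k x <= rhs gamma r lambda (e k) (u k x).
Hypothesis u_cvg : forall x, (fun k => u k x) @ \oo --> ul x.
Hypothesis ul_gt0 : forall x, Omega x -> 0 < ul x.
Hypothesis ul_bd : forall x, 0 <= ul x <= M.
Hypothesis ul_out : forall x, ~ Omega x -> ul x = 0.
Hypothesis ul_meas : measurable_fun setT ul.

Let M_ge0 : 0 <= M.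
Proof. by case/andP: (ul_bd 0) => h1 h2; exact: le_trans h2. Qed.

Let r_ge0 : 0 <= r.
Proof. by apply: le_trans (ltW r_gt1); exact: ler01. Qed.

Let boxI : R := \int[mu]_x \1_[set x : V | `|x| <= rho] x.

Lemma test_bound k v h C : inH Omega v h -> (forall x, ~ Omega x -> v x = 0) -> 0 <= C ->
  (forall x y, 0 <= (u k x - u k y) * (v x - v y)) ->
  (forall x, Omega x -> F k x * v x <= C) -> dir (g k) h <= C * boxI.
Proof.
move=> hv v0 C0 hm hC; have [hu lF hw] := u_solves k.
have N0 : 0 <= nl (u k) v.
  apply: Rintegral_ge0 => // z _; rewrite /ndiff.
  set a := Num.sqrt _; have -> : (u k z.1 - u k z.2) * a * ((v z.1 - v z.2) * a) = (u k z.1 - u k z.2) * (v z.1 - v z.2) * a ^+ 2 by rewrite expr2; lra.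
  by rewrite mulr_ge0 ?sqr_ge0.
have := hw _ _ hv; suff : ip mu (F k) v <= C * boxI by move: N0; lra.
apply: Rintegral_box_le; first exact: l2M_integrable lF (inH_l2 hv).
move=> x; have [Ox|nOx] := pselect (Omega x).
  by rewrite indicE mem_set ?mulr1; [exact: hC|exact: Omega_rho].
by rewrite v0 // mulr0 mulr_ge0 // indicE.
Qed.

Lemma box_l2 (C : R) : l2 mu (fun x => C * \1_[set x : V | `|x| <= rho] x).
Proof.
apply: l2Z; apply: (bounded_box_l2 (rho := rho) (C := 1)).
- by apply: measurable_indic; exact: measurable_norm_le.
- by move=> x; rewrite indicE; case: (_ \in _); rewrite ?normr1 ?normr0.
- by move=> x hx; rewrite indicE memNset //= => h'; move: hx; rewrite ltNge h'.
Qed.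

Lemma box_dom (C : R) (f : VF) : (forall x, ~ Omega x -> f x = 0) -> 0 <= C -> (forall x, Omega x -> `|f x| <= C) ->
  forall x, `|f x| <= C * \1_[set x : V | `|x| <= rho] x.
Proof.
move=> f0 C0 hC x; have [Ox|nOx] := pselect (Omega x).
  by rewrite indicE mem_set ?mulr1; [exact: hC|exact: Omega_rho].
by rewrite f0 // normr0 mulr_ge0 // indicE.
Qed.

(** Tested with u_k, the singular source is at most lambda (u_k + e_k)^(1 - gamma), bounded
    uniformly in k because gamma <= 1. *)
Lemma limit_inH : gamma <= 1 -> exists G, inH Omega ul G.
Proof.
move=> g1; pose C := lambda * (M + 1) `^ (1 - gamma) + M `^ r * M.
have C0 : 0 <= C by rewrite addr_ge0 // mulr_ge0 ?powR_ge0 // ltW.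
have hC k x : Omega x -> F k x * u k x <= C.
  move=> Ox; have /andP[u0 uM] := u_bd k x; have /andP[e0 e1] := e_01 k.
  apply: le_trans (ler_wpM2r u0 (F_le k Ox)) _; rewrite /rhs mulrDl; apply: lerD.
    rewrite -mulrA ler_wpM2l ?(ltW lambda_gt0) //.
    have ue : 0 < u k x + e k by rewrite ltr_wpDl.
    apply: le_trans (_ : (u k x + e k) `^ (1 - gamma) <= _).
      have -> : (u k x + e k) `^ (1 - gamma) = (u k x + e k) `^ (- gamma) * (u k x + e k).
        rewrite mulrC -{2}(powRr1 (ltW ue)) -powRD //; by apply/implyP => _; rewrite gt_eqF.
      by rewrite ler_wpM2l ?powR_ge0 // lerDl ltW.
    by apply: ge0_ler_powR; rewrite ?subr_ge0 ?nnegrE ?(ltW ue) ?addr_ge0 ?lerD.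
  by apply: ler_pM; rewrite ?powR_ge0 //; apply: ge0_ler_powR; rewrite ?nnegrE.
have hdir k : dir (g k) (g k) <= C * boxI.
  have [hu _ _] := u_solves k; apply: (test_bound hu (u_out k) C0) => // [x y|]; [by rewrite -expr2 sqr_ge0|exact: hC].
have ldom := box_l2 M.
have mdom x : `|ul x| <= M * \1_[set x : V | `|x| <= rho] x.
  by apply: box_dom => // y _; case/andP: (ul_bd y) => h1 h2; rewrite ger0_norm.
have lul : l2 mu ul.
  by apply: l2_le ldom => // x; apply: le_trans (mdom x) (ler_norm _).
have hk k : inH Omega (u k) (g k) by case: (u_solves k).
apply: (inH_weak_closed i0 Omega_rho rho_gt0 hk hdir lul).
apply: l2cvg_dominated ldom _ ul_meas _ _ mdom.
- by move=> k; exact: l2_meas (inH_l2 (hk k)).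
- by apply: nearW => x; exact: (@u_cvg x).
- move=> k; apply: box_dom => //; [exact: u_out|].
  by move=> y _; case/andP: (u_bd k y) => h1 h2; rewrite ger0_norm.
Qed.

Hypothesis e_cvg : e @ \oo --> (0 : R).

(** The test function [T k] is at most (u_k + e_k)^gamma, so the singular source contributes no more
    than lambda, uniformly in k. *)
Lemma limit_powR_inH : 1 < gamma -> exists G, inH Omega (fun x => ul x `^ ((gamma + 1) / 2)) G.
Proof.
move=> g1; pose p := (gamma + 1) / 2; have p1 : 1 <= p by rewrite /p; lra.
have p0 : 0 <= p by lra.
have d0 k : 0 < e k ^+ 2 by rewrite exprn_gt0 //; case/andP: (e_01 k).
have d1 k : e k ^+ 2 <= 1 by case/andP: (e_01 k) => h0 h1; rewrite exprn_ile1 // ltW.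
have T0 k : regT p (e k ^+ 2) 0 = 0 by rewrite /regT mul0r.
have V0 k : regV p (e k ^+ 2) 0 = 0 by rewrite /regV expr0n add0r subrr.
have hk k : inH Omega (u k) (g k) by case: (u_solves k).
pose T k x := regT p (e k ^+ 2) (u k x); pose W k x := regV p (e k ^+ 2) (u k x).
pose gT k : GF := fun i x => derive1 (regT p (e k ^+ 2)) (u k x) * g k i x.
pose gW k : GF := fun i x => derive1 (regV p (e k ^+ 2)) (u k x) * g k i x.
have hT k : inH Omega (T k) (gT k) := inH_comp_bounded (hk k) (smooth_regT p (d0 k)) (T0 k) (u_bd k).
have hW k : inH Omega (W k) (gW k) := inH_comp_bounded (hk k) (smooth_regV p (d0 k)) (V0 k) (u_bd k).
pose C := lambda + M `^ r * (M + 1) `^ gamma.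
have C0 : 0 <= C by rewrite addr_ge0 ?(ltW lambda_gt0) // mulr_ge0 ?powR_ge0.
have hC k x : Omega x -> F k x * T k x <= C.
  move=> Ox; have /andP[u0 uM] := u_bd k x; have /andP[e0 e1] := e_01 k.
  have Tpos : 0 <= T k x by rewrite mulr_ge0 ?powR_ge0.
  have Tle : T k x <= (u k x + e k) `^ gamma.
    have -> : gamma = 2 * p - 1 by rewrite /p; lra.
    exact: regT_le.
  have ue : 0 < u k x + e k by rewrite ltr_wpDl.
  apply: le_trans (ler_wpM2r Tpos (F_le k Ox)) _; rewrite /rhs mulrDl; apply: lerD.
    rewrite -mulrA -[leRHS]mulr1 ler_wpM2l ?(ltW lambda_gt0) //.
    apply: le_trans (ler_wpM2l (powR_ge0 _ _) Tle) _.
    by rewrite powRN mulVf // gt_eqF // powR_gt0.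
  apply: ler_pM; rewrite ?powR_ge0 //; first by apply: ge0_ler_powR; rewrite ?nnegrE.
  apply: le_trans Tle _; apply: ge0_ler_powR; rewrite ?nnegrE ?(ltW ue) ?(ltW gamma_gt0) ?addr_ge0 ?lerD //.
have hdirT k : dir (g k) (gT k) <= C * boxI.
  apply: (test_bound (hT k)) => //; last exact: hC.
    by move=> x /u_out ux; rewrite /T ux T0.
  move=> x y; have /andP[x0 _] := u_bd k x; have /andP[y0 _] := u_bd k y.
  have [xy|/ltW yx] := leP (u k x) (u k y).
    by apply: mulr_le0; rewrite subr_le0 //; exact: regT_mono.
  by apply: mulr_ge0; rewrite subr_ge0 //; exact: regT_mono.
(* [regV_regT], multiplied by the squared derivative of u_k, transfers the bound from the mixed
   product to the gradient of [W k]. *)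
have hdirW k : dir (gW k) (gW k) <= p ^+ 2 * (C * boxI).
  apply: le_trans (_ : p ^+ 2 * dir (g k) (gT k) <= _); last by rewrite ler_wpM2l ?sqr_ge0.
  rewrite /dir mulr_sumr; apply: ler_sum => i _.
  have li := inH_l2g i (hk k); have lT := inH_l2g i (hT k); have lW := inH_l2g i (hW k).
  have I1 := l2M_integrable li lT; have I2 := l2M_integrable lW lW.
  rewrite /ip -RintegralZl //; apply: le_Rintegral => //.
    by have := integrableZl measurableT (p ^+ 2) I1; apply: eq_integrable.
  move=> x _; rewrite /gW /gT; have := regV_regT (u k x) (d0 k) p1.
  move=> /(ler_wpM2r (sqr_ge0 (g k i x))); rewrite !expr2; lra.
pose D := (M ^+ 2 + 1) `^ (p / 2) + M `^ p.
have D0 : 0 <= D by rewrite addr_ge0 ?powR_ge0.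
have ldom := box_l2 D.
have lp x : ul x `^ p <= D.
  have /andP[h0 h1] := ul_bd x; apply: ler_wpDl; first exact: powR_ge0.
  by apply: ge0_ler_powR; rewrite ?nnegrE.
have mdom x : `|ul x `^ p| <= D * \1_[set x : V | `|x| <= rho] x.
  apply: (box_dom (f := fun x => ul x `^ p)) => //.
    by move=> y /ul_out ->; rewrite powR0 // gt_eqF //; lra.
  by move=> y _; rewrite ger0_norm ?powR_ge0.
have mp : measurable_fun setT (fun x => ul x `^ p) by exact: (measurableT_comp (measurable_powR p)).
have lul : l2 mu (fun x => ul x `^ p).
  by apply: l2_le ldom => // x; apply: le_trans (mdom x) (ler_norm _).
apply: (inH_weak_closed i0 Omega_rho rho_gt0 hW hdirW lul).
apply: l2cvg_dominated ldom _ mp _ _ mdom.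
- by move=> k; exact: l2_meas (inH_l2 (hW k)).
- apply: nearW => x; have [Ox|nOx] := pselect (Omega x).
    exact: (regV_cvg p1 (ul_gt0 Ox) e_01 e_cvg (@u_cvg x)).
  rewrite ul_out // powR0; last by rewrite gt_eqF //; lra.
  by under eq_fun do rewrite /W u_out // V0; exact: cvg_cst.
- move=> k; apply: box_dom => //; first by move=> x /u_out ux; rewrite /W ux V0.
  move=> x _; have /andP[u0 uM] := u_bd k x; rewrite ger0_norm; last exact: regV_ge0.
  by rewrite /D; apply: ler_wpDr; [exact: powR_ge0|exact: regV_le].
Qed.

End power_bounds.

(** * Existence *)

Section existence.
Context {R : realType} {n : nat}.
Local Notation V := 'rV[R]_n.
Local Notation mu := (@lebesgue_rV R n).
Local Notation m2 := (@product_measure1 _ _ V V R mu mu).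
Local Notation VF := (V -> R).
Local Notation GF := ('I_n -> V -> R).
Implicit Types (u v F : VF) (g h : GF) (D : set V).
Variables (s : R) (s_gt0 : 0 < s) (s_lt1 : s < 1).
Local Notation nl := (nl s).

Lemma ae_eq_restrict D (f k : VF) : measurable D -> measurable_fun D f -> mu.-integrable setT (EFin \o k) ->
  {ae mu, forall x, D x -> f x = k x} -> (forall x, ~ D x -> k x = 0) -> L1 D f /\ \int[mu]_(x in D) f x = \int[mu]_x k x.
Proof.
move=> mD mf Ik fk k0; have mfD : measurable_fun setT (f \_ D) by exact: (measurable_restrictT _ mD).1.
have E : {ae mu, forall x, k x = (f \_ D) x}.
  apply: filterS fk => x hx; rewrite patchE; case: ifPn => [|/negP hn].
    by rewrite inE => /hx ->.
  by apply: k0 => Dx; apply: hn; rewrite inE.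
have PE : (EFin \o f) \_ D = EFin \o (f \_ D) by apply/funext => x; rewrite /= !patchE; case: ifP.
have IfD := ae_eq_integrable mfD E Ik.
split; first by apply: (integrable_mkcond _ mD).2; rewrite PE.
have mk : measurable_fun setT k by apply/measurable_EFinP; case/integrableP: Ik.
by rewrite (ae_eq_Rint mk mfD E) /Rintegral integral_mkcond PE.
Qed.

Lemma dir_Rintegral g h : (forall i, l2 mu (g i)) -> (forall i, l2 mu (h i)) ->
  mu.-integrable setT (EFin \o (fun x => \sum_i g i x * h i x)) /\ dir g h = \int[mu]_x \sum_i g i x * h i x.
Proof.
move=> lg lh; have I i := l2M_integrable (lg i) (lh i).
have E : EFin \o (fun x => \sum_i g i x * h i x) = (fun x => \sum_i (g i x * h i x)%:E)%E.
  by apply/funext => x; rewrite /= sumEFin.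
split; first by rewrite E; apply: integrable_sum => // i _; exact: I.
have E' : (\int[mu]_x (\sum_i g i x * h i x)%R%:E = \sum_i \int[mu]_x (g i x * h i x)%:E)%E.
  by rewrite -integral_sum //; apply: eq_integral => x _; rewrite sumEFin.
rewrite /dir /Rintegral E'.
have Ei i : (\int[mu]_x (g i x * h i x)%:E)%E = (ip mu (g i) (h i))%:E.
  by rewrite /ip /Rintegral fineK //; exact: (integrable_fin_num measurableT (I i)).
by rewrite [X in fine X](eq_bigr (fun i => (ip mu (g i) (h i))%:E)) => [|i _]; [rewrite sumEFin|exact: Ei].
Qed.

(** [weak_equation] is stated with the chosen gradients on [Omega], known almost everywhere only; on
    w they are identified with G and h, and off w the gradient of phi vanishes. *)
Lemma limit_weak_equation Omega rho (i0 : 'I_n) gamma r lambda M (u : nat -> VF) (g : nat -> GF) (F : nat -> VF) ul :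
  open Omega -> 0 < rho -> (forall x, Omega x -> `|x| <= rho) -> 0 < lambda -> 1 < r ->
  (forall k, solves s Omega (u k) (g k) (F k)) -> (forall k x, 0 <= u k x <= M) ->
  (forall k x, u k x <= u k.+1 x) -> (forall x, (fun k => u k x) @ \oo --> ul x) ->
  (forall chi, Cc_smooth Omega chi -> exists2 B : R, 0 <= B & forall k x, chi x != 0 -> `|F k x| <= B) ->
  (forall x, Omega x -> (fun k => F k x) @ \oo --> lambda * ul x `^ (- gamma) + ul x `^ r) ->
  W12loc Omega ul /\ forall w phi, open w -> cpt_inside w Omega -> W012 w phi -> weak_equation Omega s gamma r lambda ul phi.
Proof.
move=> oO rho0 Orho l0 r1 hs ubd umono ucvg Fbd Fcvg; have mO := open_measurable_rV oO.
have mul : measurable_fun setT ul := limit_meas hs ucvg.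
have ulbd := limit_bd ubd umono ucvg.
have loc chi : Cc_smooth Omega chi -> exists G, inH Omega (fun x => chi x * ul x) G.
  by move=> hc; have [G [hG _]] := local_limit s_gt0 s_lt1 i0 rho0 Orho hs ubd umono ucvg Fbd hc; exists G.
have [W12l hglue] := glue_wgrad oO mul loc; split => // w phi ow cw hphi.
have wO : w `<=` Omega by move=> x wx; case: cw => _; apply; exact: subset_closure.
have [phi0 _ _] := hphi; have [h hh] := W012_inH ow hphi.
have [chi [G [hc chi1 hG Ind [IF Eq]]]] := limit_equation s_gt0 s_lt1 i0 rho0 Orho hs ubd umono ucvg Fbd Fcvg ow cw oO hh phi0.
have hhO := inH_mono wO hh; have lphi := inH_l2 hh; have mphi := l2_meas lphi.
have Iphi := inH_integrable Orho hhO.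
have Ir : mu.-integrable setT (EFin \o (fun x => ul x `^ r * phi x)).
  apply: (integrable_le (g := fun x => M `^ r * `|phi x|)).
  - by apply: measurable_funM => //; exact: (measurableT_comp (measurable_powR r)).
  - move=> x; have /andP[h0 h1] := ulbd x; rewrite normrM (ger0_norm (powR_ge0 _ _)) ler_wpM2r //.
    by apply: powR_mono => //; lra.
  - by have := integrableZl measurableT (M `^ r) (integrable_norm Iphi); apply: eq_integrable.
(* Obtained by difference: the full right-hand side and the power term are integrable against phi,
   and lambda is nonzero. *)
have Ig : mu.-integrable setT (EFin \o (fun x => phi x / ul x `^ gamma)).
  have := integrableZl measurableT lambda^-1 (integrableB measurableT IF Ir); apply: eq_integrable => // x _ /=.
  rewrite -EFinB -EFinM powRN; congr EFin; rewrite mulrDl addrK mulrA mulrA mulVf ?mul1r 1?mulrC //.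
  by rewrite gt_eqF.
have outO f x : ~ Omega x -> f x * phi x = 0 by move=> nO; rewrite phi0 ?mulr0 // => /wO.
have EG : {ae mu, forall x, forall i, Omega x -> wgrad Omega ul x ord0 i * wgrad Omega phi x ord0 i = G i x * h i x}.
  apply: filter_forall => i.
  apply: filterS3 (hglue w chi G i ow cw hG chi1) (wgrad_ae i oO (inH_is_wgrad oO hh)) (inH_out hh) => x h1 h2 h3 Ox.
  have [wx|nwx] := pselect (w x); first by rewrite h1 // h2 // mxE.
  by have [_ h0] := h3 nwx; rewrite h2 // mxE h0 !mulr0.
have [Id Ed] := dir_Rintegral (fun i => inH_l2g i hG) (fun i => inH_l2g i hh).
pose D := fun x => dotr (wgrad Omega ul x) (wgrad Omega phi x).
have mD : measurable_fun Omega D.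
  have [W1 _] := W12l; have [_ P1] := wgradP W1.
  have [_ P2] := wgradP (ex_intro _ _ (inH_is_wgrad oO hh)).
  apply: measurable_sum => i; apply: measurable_funM; [by have [[]] := P1 i|by have [[]] := P2 i].
(* h vanishes off w only almost everywhere; the restriction makes the integrand vanish off [Omega]
   at every point, as [ae_eq_restrict] demands. *)
pose k := (fun x => \sum_i G i x * h i x) \_ w.
have mw := open_measurable_rV ow.
have Ik : mu.-integrable setT (EFin \o k).
  have -> : EFin \o k = (EFin \o (fun x => \sum_i G i x * h i x)) \_ w by apply/funext => x; rewrite /= /k !patchE; case: ifP.
  by apply: (integrable_mkcond _ mw).1; exact: integrableS measurableT mw (@subsetT _ _) Id.
have kE : {ae mu, forall x, \sum_i G i x * h i x = k x}.
  apply: filterS (inH_out hh) => x hx; rewrite /k patchE; case: ifPn => // /negP hn.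
  by apply: big1 => i _; have [|_ ->] := hx; [move=> wx; apply: hn; rewrite inE|rewrite mulr0].
have mk : measurable_fun setT k by apply/measurable_EFinP; case/integrableP: Ik.
have mId : measurable_fun setT (fun x => \sum_i G i x * h i x) by apply/measurable_EFinP; case/integrableP: Id.
have DE : {ae mu, forall x, Omega x -> D x = k x}.
  by apply: filterS2 EG kE => x h1 h2 Ox; rewrite -h2; apply: eq_bigr => i _; exact: h1.
have k0 x : ~ Omega x -> k x = 0 by move=> nO; rewrite /k patchE memNset // => /wO.
have [LD ED] := ae_eq_restrict mO mD Ik DE k0.
have restr (f : VF) : mu.-integrable setT (EFin \o f) -> L1 Omega f by move=> If; exact: integrableS measurableT mO (@subsetT _ _) If.
split.
- exact: restr Ig.
- exact: LD.
- by have := Ind; apply: eq_integrable => // z _; rewrite /= nonlocalE.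
- exact: restr Ir.
have -> : \int[m2]_z nonlocal_integrand s ul phi z = \int[m2]_z (ndiff s ul z * ndiff s phi z).
  by apply: eq_Rintegral => z _; rewrite nonlocalE.
have E1 : \int[mu]_(x in Omega) (phi x / ul x `^ gamma) = \int[mu]_x (phi x / ul x `^ gamma).
  by apply: Rintegral_outside => x nO; rewrite phi0 ?mul0r // => /wO.
have E2 : \int[mu]_(x in Omega) (ul x `^ r * phi x) = \int[mu]_x (ul x `^ r * phi x).
  by apply: Rintegral_outside => x nO; rewrite phi0 ?mulr0 // => /wO.
have Ek := ae_eq_Rint mId mk kE.
rewrite E1 E2 [X in X + _]ED -Ek -Ed Eq -RintegralZl // -RintegralD //; last first.
  by have := integrableZl measurableT lambda Ig; apply: eq_integrable.
by apply: eq_Rintegral => x _; rewrite mulrDl powRN; congr (_ + _); rewrite -mulrA; congr (_ * _); rewrite mulrC.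
Qed.

End existence.

(** * Bounds and limits of the Newton right-hand sides *)

Section rhs_limits.
Context {R : realType}.

Lemma newton_eps_01 k : 0 < (newton_eps k : R) <= 1.
Proof. by rewrite invr_gt0 ltr0Sn /= invf_le1 // ler1n. Qed.

Lemma newton_eps_cvg : (newton_eps : nat -> R) @ \oo --> (0 : R).
Proof. exact: cvg_harmonic. Qed.

(** The bound does not depend on e: all negative powers are controlled by the lower bound b of the
    iterates. *)
Lemma newton_rhs_bound (gamma r lambda M b e t t' : R) : 0 < gamma -> 0 <= r -> 0 < lambda -> 0 < b -> 0 < e ->
  b <= t -> t <= t' -> t' <= M ->
  `|rhs gamma r lambda e t - slope gamma lambda e t * (t' - t)| <=
    lambda * b `^ (- gamma) + M `^ r + lambda * (gamma * b `^ (- (gamma + 1))) * M.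
Proof.
move=> g0 r0 l0 b0 e0 bt tt' t'M.
have h1 : (t + e) `^ (- gamma) <= b `^ (- gamma) by apply: powRN_anti; lra.
have h2 : (t + e) `^ (- gamma - 1) <= b `^ (- (gamma + 1)).
  by rewrite -opprD; apply: powRN_anti; lra.
have h3 : t `^ r <= M `^ r by apply: powR_mono; lra.
have p1 : 0 <= (t + e) `^ (- gamma) by exact: powR_ge0.
have p2 : 0 <= (t + e) `^ (- gamma - 1) by exact: powR_ge0.
have p3 : 0 <= t `^ r by exact: powR_ge0.
rewrite /rhs /slope; apply: le_trans (ler_normB _ _) _; apply: lerD.
  rewrite ger0_norm; last by rewrite addr_ge0 // mulr_ge0 // ltW.
  by apply: lerD => //; rewrite ler_wpM2l // ltW.
rewrite ger0_norm; last by rewrite !mulr_ge0 ?(ltW l0) ?(ltW g0) // subr_ge0.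
apply: ler_pM; rewrite ?mulr_ge0 ?(ltW l0) ?(ltW g0) ?subr_ge0 //; last by lra.
by rewrite ler_wpM2l ?(ltW l0) // ler_wpM2l // ltW.
Qed.

(** The Newton correction disappears because consecutive iterates have the same limit while the
    slopes converge, l being positive. *)
Lemma newton_rhs_cvg (gamma r lambda l : R) (e t : nat -> R) : 0 < l -> e @ \oo --> (0 : R) -> t @ \oo --> l ->
  (fun k => rhs gamma r lambda (e k) (t k) - slope gamma lambda (e k) (t k) * (t k.+1 - t k)) @ \oo -->
    lambda * l `^ (- gamma) + l `^ r.
Proof.
move=> l0 ce ct.
have cte : (fun k => t k + e k) @ \oo --> l by rewrite -[X in _ --> X]addr0; exact: cvgD ct ce.
have ct' : (fun k => t k.+1) @ \oo --> l by rewrite cvg_shiftS.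
have c1 := powR_cvg (p := - gamma) l0 cte; have c2 := powR_cvg (p := - gamma - 1) l0 cte.
have c3 := powR_cvg (p := r) l0 ct.
have cd : (fun k => t k.+1 - t k) @ \oo --> (0 : R) by rewrite -(subrr l); exact: cvgB ct' ct.
rewrite -[X in _ --> X]subr0 -[X in _ - X](mulr0 (lambda * (gamma * l `^ (- gamma - 1)))).
apply: cvgB; first by apply: cvgD c3; exact: cvgMr.
by apply: cvgM cd; apply: cvgMr; exact: cvgMr.
Qed.

End rhs_limits.

Theorem theorem2p14 (R : realType) (n : nat) (n_gt0 : (0 < n)%N)
    (Omega : set 'rV[R]_n) (Omega_bounded : bounded_set Omega)
    (Omega_open : open Omega) (Omega_C1 : C1_boundary Omega)
    (s gamma r : R) (s_gt0 : 0 < s) (s_lt1 : s < 1)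
    (gamma_gt0 : 0 < gamma) (r_gt1 : 1 < r) :
  exists2 Lambda : R, 0 < Lambda &
    forall lambda : R, 0 < lambda -> lambda < Lambda ->
      exists u : 'rV[R]_n -> R,
        [/\ weak_solution Omega s gamma r lambda u,
            (gamma <= 1 -> W012 Omega u) &
            (1 < gamma -> W012 Omega (fun x => u x `^ ((gamma + 1) / 2)))].
Proof.
have i0 : 'I_n := Ordinal n_gt0.
have [rho rho0 Orho] := bounded_normP Omega_bounded; have mO := open_measurable_rV Omega_open.
have r0 : 0 <= r by lra.
have [q [c [hq c0 q0 qb hsup]]] := supersolution s_gt0 s_lt1 i0 rho0.
(* M^r = (c/2) M: half of the supersolution constant c M pays for u^r, the other half for the
   singular term. *)
pose M := (c / 2) `^ (r - 1)^-1.
have M0 : 0 < M by rewrite powR_gt0 // divr_gt0.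
have EM : M `^ r = c / 2 * M.
  have -> : r = 1 + (r - 1) by lra.
  rewrite powRD; last by apply/implyP => _; rewrite gt_eqF.
  rewrite powRr1 ?(ltW M0) // mulrC /M -powRrM mulVf ?powRr1 //; first by rewrite ltW // divr_gt0.
  by rewrite gt_eqF // subr_gt0.
have M2 : 0 < M / 2 by rewrite divr_gt0.
have Mg : 0 < (M / 2) `^ (- gamma) by exact: powR_gt0.
(* The threshold below which the singular term, at most lambda (M/2)^(-gamma) on the barrier, costs
   less than (c/2) M. *)
exists (c / 2 * M / (M / 2) `^ (- gamma)); first by rewrite !mulr_gt0 ?invr_gt0.
move=> lambda l0; rewrite ltr_pdivlMr // => lL.
pose Q x := M * q x; have hQ : Cc_smooth setT Q := CcZ M hq.
have Q0 x : 0 <= Q x by rewrite mulr_ge0 ?(ltW M0).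
have QM x : Omega x -> M / 2 <= Q x <= M.
  move=> /Orho /qb /andP[h1 h2]; apply/andP; split; first by rewrite ler_wpM2l ?(ltW M0).
  by rewrite -[leRHS]mulr1 ler_wpM2l ?(ltW M0).
have Qsup phi h : inH Omega phi h -> (forall x, 0 <= phi x) -> (lebesgue_rV n).-integrable setT (EFin \o phi) ->
    c * M * \int[lebesgue_rV n]_x phi x <= dir (fun i => partial i Q) h + nl s Q phi.
  move=> hp p0 Ip; have := hsup Omega phi h Orho hp p0 Ip.
  move=> /(ler_wpM2l (ltW M0)); rewrite mulrDr mulrA (mulrC M c).
  suff -> : dir (fun i => partial i Q) h + nl s Q phi = M * dir (fun i => partial i q) h + M * nl s q phi by [].
  congr (_ + _).
    rewrite /dir mulr_sumr; apply: eq_bigr => i _.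
    have -> : partial i Q = (fun x => M * partial i q x).
      by apply/funext => x; apply: partialZ; exact: Cc_smoothE hq.
    by rewrite ipZl //; [exact: Cc_partial_l2 hq|exact: inH_l2g hp].
  have hqH := Cc_inH hq; rewrite /nl.
  have -> : ndiff s Q = (fun z => M * ndiff s q z) by apply/funext => z; exact: ndiffZ.
  by rewrite ipZl //; [exact: (inH_l2n s_gt0 s_lt1 hqH)|exact: (inH_l2n s_gt0 s_lt1 hp)].
have cL : lambda * (M / 2) `^ (- gamma) + M `^ r <= c * M by rewrite EM; lra.
have [eta [heta eta01 eta1 _]] := open_approx Omega_open.
have [b [u [g [F [b0 hadm umono hF hlow]]]]] :=
  newton_sequence s_gt0 s_lt1 i0 rho0 Orho mO gamma_gt0 r_gt1 l0 M0 hQ Q0 QM Qsup cL heta eta01.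
have usol k : solves s Omega (u k) (g k) (F k) by case: (hadm k).
have uout k x : ~ Omega x -> u k x = 0 by case: (hadm k) => _ h _ _; exact: h.
have ubd k x : 0 <= u k x <= M.
  have [Ox|nOx] := pselect (Omega x); last by rewrite uout // lexx ltW.
  have [_ _ h _] := hadm k; have /andP[h1 h2] := h x Ox; rewrite h1 /=; apply: le_trans h2 _.
  by case/andP: (QM x Ox).
have Fle k x : Omega x -> F k x <= rhs gamma r lambda (newton_eps k) (u k x) by case: (hadm k) => _ _ _; apply.
have [ul ucvg] : exists ul : 'rV[R]_n -> R, forall x, (fun k => u k x) @ \oo --> ul x.
  exists (fun x => limn (fun k => u k x)) => x; apply: nondecreasing_is_cvgn.
    exact: (fun j k jk => u_nd umono x jk).
  by exists M => _ [k _ <-]; case/andP: (ubd k x).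
have ulbd := limit_bd ubd umono ucvg; have ulout := limit_out uout ucvg.
have mul := limit_meas usol ucvg.
(* Some cut-off [eta j] equals 1 at x, so the barrier from below already makes the initial iterate
   at least [b j] there. *)
have ulpos x : Omega x -> 0 < ul x.
  move=> Ox; have [j _ hj] := exhaust_near Omega_open Ox.
  have := hlow j 0%N x Ox; rewrite eta1 ?mulr1; last exact: (hj j (leqnn j)).
  by move=> h; apply: lt_le_trans (b0 j) (le_trans h _); exact: u_le_limit umono ucvg 0%N x.
(* The formula for the source holds from the second iterate on, so the limit is taken along the
   sequence shifted by one. *)
have umonoS k x : u k.+1 x <= u k.+2 x by exact: umono.
have ucvgS x : (fun k => u k.+1 x) @ \oo --> ul x by rewrite (cvg_shiftS (fun k => u k x)); exact: ucvg.
have FbdS chi : Cc_smooth Omega chi -> exists2 B : R, 0 <= B & forall k x, chi x != 0 -> `|F k.+1 x| <= B.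
  move=> [_ [cS SO]]; have [j _ hj] := compact_sub_exhaust cS Omega_open SO.
  exists (lambda * (b j) `^ (- gamma) + M `^ r + lambda * (gamma * (b j) `^ (- (gamma + 1))) * M).
    by rewrite !addr_ge0 ?mulr_ge0 ?powR_ge0 // ?(ltW l0) ?(ltW gamma_gt0) ?(ltW M0).
  move=> k x cx; have Ex : exhaust Omega j x by apply: (hj j (leqnn j)); exact: subset_closure.
  have Ox := exhaust_sub Ex; rewrite hF //.
  have := hlow j k x Ox; rewrite eta1 // mulr1 => bu.
  have /andP[e0 _] := newton_eps_01 (R := R) k.
  by apply: newton_rhs_bound => //; case/andP: (ubd k.+1 x).
have FcvgS x : Omega x -> (fun k => F k.+1 x) @ \oo --> lambda * ul x `^ (- gamma) + ul x `^ r.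
  move=> Ox; have cx : (fun k => u k x) @ \oo --> ul x by exact: (@ucvg x).
  have -> : (fun k => F k.+1 x) = (fun k => rhs gamma r lambda (newton_eps k) (u k x) - slope gamma lambda (newton_eps k) (u k x) * (u k.+1 x - u k x)).
    by apply/funext => k; exact: hF.
  by apply: newton_rhs_cvg; [exact: ulpos|exact: newton_eps_cvg|exact: cx].
have [W12l weq] := limit_weak_equation s_gt0 s_lt1 i0 Omega_open rho0 Orho l0 r_gt1 (fun k => usol k.+1) (fun k => ubd k.+1) umonoS ucvgS FbdS FcvgS.
have W1 : gamma <= 1 -> W012 Omega ul.
  move=> g1; have [G hG] := limit_inH rho0 Orho i0 r_gt1 l0 newton_eps_01 usol ubd uout Fle ucvg ulbd ulout mul g1.
  exact: inH_W012 hG ulout.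
have W2 : 1 < gamma -> W012 Omega (fun x => ul x `^ ((gamma + 1) / 2)).
  move=> g1; have [G hG] := limit_powR_inH rho0 Orho i0 gamma_gt0 r_gt1 l0 newton_eps_01 usol ubd uout Fle ucvg ulpos ulbd ulout mul newton_eps_cvg g1.
  apply: inH_W012 hG _ => // x /ulout ->; rewrite powR0 // gt_eqF //; lra.
exists ul; split => //; split => //.
- apply: (Loo_bounded (C := M)) => // x; have /andP[h1 h2] := ulbd x; by rewrite ger0_norm.
- have [g1|g1] := leP gamma 1.
    exists 1 => //; have -> : (fun x => ul x `^ 1) = ul; last exact: W1.
    by apply/funext => x; rewrite powRr1 //; case/andP: (ulbd x).
  by exists ((gamma + 1) / 2); [lra|exact: W2].
Qed.
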